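(* Let $(\mathbb S^2,g_0)$ be the standard sphere, let $p_1,p_2,p_3\in\mathbb S^2$ be distinct points with $p_1,p_2$ antipodal, let $\alpha_{im}>-1$ ($i=1,2$, $m=1,2,3$) be the weights, with $\alpha_{13}=0$, and set $$\overline\rho_i:=4\pi\min\Big\{1,\min_{m\neq m'}(2+\alpha_{im}+\alpha_{im'})\Big\},\qquad i=1,2.$$ Let $\rho_1>0$ and $\alpha_{11},\alpha_{12},\alpha_{21},\alpha_{22}$ be fixed so that $$4\pi(1+\alpha_{1m})<\rho_1<\min\{\overline\rho_1,4\pi(2+\alpha_{1m}+\alpha_{2m})\}\qquad\text{for }m=1,2.$$ Then there exists $\alpha_*\in(-1,0)$ such that, if $\alpha_{23}\in(-1,\alpha_*]$ and $\rho_2$ satisfies $$4\pi(1+\alpha_{2m})<\rho_2<\min\{\overline\rho_2,4\pi(2+\alpha_{1m}+\alpha_{2m})\}\qquad\text{for }m=1,2,3,$$ then the system $$\begin{cases}-\Delta u_1=2\rho_1\left(\dfrac{\widetilde h_1e^{u_1}}{\int_{\mathbb S^2}\widetilde h_1e^{u_1}\,dV_{g_0}}-\dfrac1{4\pi}\right)-\rho_2\left(\dfrac{\widetilde h_2e^{u_2}}{\int_{\mathbb S^2}\widetilde h_2e^{u_2}\,dV_{g_0}}-\dfrac1{4\pi}\right)\\[2mm]-\Delta u_2=2\rho_2\left(\dfrac{\widetilde h_2e^{u_2}}{\int_{\mathbb S^2}\widetilde h_2e^{u_2}\,dV_{g_0}}-\dfrac1{4\pi}\right)-\rho_1\left(\dfrac{\widetilde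 h_1e^{u_1}}{\int_{\mathbb S^2}\widetilde h_1e^{u_1}\,dV_{g_0}}-\dfrac1{4\pi}\right)\end{cases}\quad\text{on }\mathbb S^2$$ has no solution $u=(u_1,u_2)\in H^1(\mathbb S^2)^2$.
   Context: $\Delta=\Delta_{g_0}$ is the Laplace-Beltrami operator of the round unit sphere, which has area $4\pi$. Here $\widetilde h_i:=e^{-4\pi\sum_{m=1}^3\alpha_{im}G_{p_m}}$ for $i=1,2$ (i.e. $h_1,h_2\equiv1$), where $G_p$ is the Green function: $-\Delta G_p=\delta_p-\frac1{4\pi}$ on $\mathbb S^2$, $\int_{\mathbb S^2}G_p\,dV_{g_0}=0$. Solutions are understood in the weak sense. Note that $\overline\rho_2$ depends on $\alpha_{23}$. *)

(* Defs.v *)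
From HB Require Import structures.
From mathcomp Require Import all_boot all_order all_algebra.
From mathcomp Require Import all_classical all_reals all_analysis.
From mathcomp Require Import measurable_realfun.
Set Implicit Arguments.
Unset Strict Implicit.
Unset Printing Implicit Defensive.
Import Order.TTheory GRing.Theory Num.Theory numFieldNormedType.Exports.
Local Open Scope classical_set_scope.
Local Open Scope ring_scope.

Definition dot (R : realType) (a b : 'rV[R]_3) : R :=
  \sum_(i < 3) a 0 i * b 0 i.

Record sphere (R : realType) := Sphere {
  pt : 'rV[R]_3 ;
  pt_unit : dot pt pt == 1 }.

HB.instance Definition _ (R : realType) := [isSub for @pt R].
HB.instance Definition _ (R : realType) := [Choice of sphere R by <:].

Lemma north_unit (R : realType) :
  dot (delta_mx 0 ord_max : 'rV[R]_3) (delta_mx 0 ord_max) == 1.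
Proof.
by rewrite /dot !big_ord_recr big_ord0 /= !mxE /= !mul0r !add0r mulr1.
Qed.

Definition north (R : realType) : sphere R := Sphere (north_unit R).

HB.instance Definition _ (R : realType) := isPointed.Build (sphere R) (north R).

(* Borel sigma-algebra, generated by the three ambient coordinates. *)
Definition sphere_coord (R : realType) (i : 'I_3) (x : sphere R) : R := pt x 0 i.

Definition sphere_display : measure_display.
Proof. exact. Qed.

Section sphere_measurable.
Variable R : realType.
Local Notation SB := (g_sigma_preimage (@sphere_coord R)).

Let SB0 : SB set0. Proof. exact: sigma_algebra0. Qed.

Let SBC A : SB A -> SB (~` A). Proof. exact: sigma_algebraC. Qed.

Let SBU (F : _^nat) : (forall i, SB (F i)) -> SB (\bigcup_i F i).
Proof. exact: sigma_algebra_bigcup. Qed.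

HB.instance Definition _ := @isMeasurable.Build sphere_display
  (sphere R) SB SB0 SBC SBU.
End sphere_measurable.

(* Spherical coordinates (theta, t); there
   g0 = dtheta^2 + sin(theta)^2 dt^2, with volume form sin(theta) dtheta dt. *)
Definition spherical_vec (R : realType) (w : R * R) : 'rV[R]_3 :=
  \row_(i < 3) [:: sin w.1 * cos w.2; sin w.1 * sin w.2; cos w.1]`_i.

Lemma spherical_unit (R : realType) (w : R * R) :
  dot (spherical_vec w) (spherical_vec w) == 1.
Proof.
rewrite /dot !big_ord_recr big_ord0 /= !mxE /= add0r -!expr2 !exprMn -mulrDr.
by rewrite cos2Dsin2 mulr1 addrC cos2Dsin2.
Qed.

Definition spherical (R : realType) (w : R * R) : sphere R :=
  Sphere (spherical_unit w).

Lemma measurable_spherical (R : realType) :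
  measurable_fun [set: R * R] (@spherical R).
Proof.
have msin : measurable_fun setT (@sin R).
  by apply: continuous_measurable_fun; exact: continuous_sin.
have mcos : measurable_fun setT (@cos R).
  by apply: continuous_measurable_fun; exact: continuous_cos.
have ms1 : measurable_fun setT (fun w : R * R => sin w.1).
  exact: measurableT_comp.
have mc1 : measurable_fun setT (fun w : R * R => cos w.1).
  exact: measurableT_comp.
have ms2 : measurable_fun setT (fun w : R * R => sin w.2).
  exact: measurableT_comp.
have mc2 : measurable_fun setT (fun w : R * R => cos w.2).
  exact: measurableT_comp.
apply: (@measurability _ _ _ _ setT (@spherical R)
  (\big[setU/set0]_(i < 3)
     preimage_set_system setT (@sphere_coord R i) measurable)) => //.
move=> _ [B + <-]; rewrite -bigcup_mkord_ord => -[i Ii [C mC <-]].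
rewrite !setTI -comp_preimage -[X in measurable X]setTI.
have mi : measurable_fun setT (@sphere_coord R (inord i) \o @spherical R).
  rewrite (_ : _ \o _ = fun w : R * R =>
    [:: sin w.1 * cos w.2; sin w.1 * sin w.2; cos w.1]`_i); last first.
    by apply/funext => w; rewrite /sphere_coord /= mxE inordK.
  case: i Ii => [|[|[|//]]] _ /=; [exact: measurable_funM..|exact: mc1].
exact: mi.
Qed.

Definition spherical_box (R : realType) : set (R * R) :=
  `[0, pi]%classic `*` `[0, 2 * pi]%classic.

Definition area (R : realType) (A : set (sphere R)) : \bar R :=
  (\int[lebesgue_measure \x lebesgue_measure]_
     (w in @spherical R @^-1` A `&` @spherical_box R) (sin w.1)%:E)%E.

Section area_measure.
Variable R : realType.
Local Notation leb2 := (@lebesgue_measure R \x @lebesgue_measure R)%E.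

Let dens : R * R -> \bar R :=
  (fun w => (sin w.1)%:E) \_ (@spherical_box R).

Let areaE (A : set (sphere R)) :
  area A = (\int[leb2]_(w in @spherical R @^-1` A) dens w)%E.
Proof. by rewrite /area integral_mkcondr. Qed.

Let dens_ge0 w : (0 <= dens w)%E.
Proof.
rewrite /dens patchE; case: ifPn => // /[!inE] -[/=].
by rewrite in_itv /= => tpi _; rewrite lee_fin sin_ge0_pi.
Qed.

Let mdens : measurable_fun setT dens.
Proof.
apply/(measurable_restrictT _ _).1; first exact: measurableX.
apply/measurable_EFinP; apply: measurable_funTS.
apply: measurableT_comp => //.
by apply: continuous_measurable_fun; exact: continuous_sin.
Qed.

Let area0 : @area R set0 = 0%E.
Proof. by rewrite areaE preimage_set0 integral_set0. Qed.

Let area_ge0 A : (0 <= @area R A)%E.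
Proof. by rewrite areaE; apply: integral_ge0 => w _; exact: dens_ge0. Qed.

Let area_sigma_additive : semi_sigma_additive (@area R).
Proof.
move=> F mF tF mUF.
have mS (A : set (sphere R)) : measurable A ->
    measurable (@spherical R @^-1` A).
  by move=> mA; rewrite -[X in measurable X]setTI; exact: measurable_spherical.
under eq_fun do under eq_bigr do rewrite areaE.
rewrite areaE preimage_bigcup.
apply: (@semi_sigma_additive_nng_induced _ _ _ leb2 _ mdens dens_ge0
  (fun n => @spherical R @^-1` F n)).
- by move=> n; exact: mS.
- apply/trivIsetP => i j _ _ ij; rewrite -preimage_setI.
  by move/trivIsetP : tF => /(_ _ _ _ _ ij) ->//; rewrite preimage_set0.
- by rewrite -preimage_bigcup; exact: mS.
Qed.

HB.instance Definition _ := isMeasure.Build _ _ _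
  (@area R) area0 area_ge0 area_sigma_additive.
End area_measure.

Definition dV (R : realType) : {measure set (sphere R) -> \bar R} := @area R.

(* x |-> x / |x|; the value at the origin is irrelevant. *)
Definition radial (R : realType) (x : 'rV[R]_3) : sphere R :=
  insubd (north R) ((Num.sqrt (dot x x))^-1 *: x).

(* The ambient gradient of the degree-0 homogeneous extension of f is, at a
   point of the sphere, the Riemannian gradient of f for the induced metric;
   tderiv i f is its i-th component. *)
Definition extend (R : realType) (f : sphere R -> R) : 'rV[R]_3 -> R^o :=
  f \o @radial R.

Definition tderiv (R : realType) (i : 'I_3) (f : sphere R -> R) :
    sphere R -> R :=
  fun x => 'D_(delta_mx 0 i) (extend f) (pt x).

Definition smooth (R : realType) (f : sphere R -> R) : Prop :=
  forall (s : seq 'I_3) (x : sphere R),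
    differentiable (extend (foldr (@tderiv R) f s)) (pt x).

Definition grad (R : realType) (f : sphere R -> R) : sphere R -> 'rV[R]_3 :=
  fun x => \row_(i < 3) tderiv i f x.

Definition component (R : realType) (X : sphere R -> 'rV[R]_3) (i : 'I_3) :
    sphere R -> R :=
  fun x => X x 0 i.

Definition tangent (R : realType) (X : sphere R -> 'rV[R]_3) : Prop :=
  forall x, dot (X x) (pt x) = 0.

(* For tangent X this is the trace of the Levi-Civita covariant derivative. *)
Definition divergence (R : realType) (X : sphere R -> 'rV[R]_3) :
    sphere R -> R :=
  fun x => \sum_(i < 3) tderiv i (component X i) x.

Definition laplace (R : realType) (f : sphere R -> R) : sphere R -> R :=
  divergence (grad f).

Definition weak_grad (R : realType) (u : sphere R -> R)
    (V : sphere R -> 'rV[R]_3) : Prop :=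
  [/\ tangent V,
      forall i, component V i \in Lfun (dV R) 2%:E &
      forall X, (forall i, smooth (component X i)) -> tangent X ->
        \int[dV R]_x (u x * divergence X x) =
        - \int[dV R]_x dot (V x) (X x)].

Definition H1 (R : realType) (u : sphere R -> R) : Prop :=
  u \in Lfun (dV R) 2%:E /\ exists V, weak_grad u V.

(* - Delta u = f in the weak sense *)
Definition weak_poisson (R : realType) (u f : sphere R -> R) : Prop :=
  exists2 V, weak_grad u V &
    forall phi, smooth phi ->
      \int[dV R]_x dot (V x) (grad phi x) = \int[dV R]_x (f x * phi x).

(* g is the Green function G_p, the equation being meant as distributions *)
Definition is_green (R : realType) (p : sphere R) (g : sphere R -> R) : Prop :=
  [/\ (dV R).-integrable [set: sphere R] (EFin \o g),
      forall phi, smooth phi ->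
        \int[dV R]_x (g x * - laplace phi x) =
        phi p - (4 * pi)^-1 * \int[dV R]_x phi x &
      \int[dV R]_x g x = 0].

Definition h_tilde (R : realType) (G : sphere R -> sphere R -> R)
    (p : 'I_3 -> sphere R) (a : 'I_3 -> R) : sphere R -> R :=
  fun x => expR (- (4 * pi) * \sum_(m < 3) a m * G (p m) x).

(* For u in H^1 and weights > -1 the integral is finite and positive
   (Moser-Trudinger inequality). *)
Definition mean_field (R : realType) (rho : R) (h u : sphere R -> R) :
    sphere R -> R :=
  fun x => rho * (h x * expR (u x) / (\int[dV R]_y (h y * expR (u y)))
                  - (4 * pi)^-1).

Definition toda_solution (R : realType) (h1 h2 : sphere R -> R) (rho1 rho2 : R)
    (u1 u2 : sphere R -> R) : Prop :=
  [/\ H1 u1, H1 u2,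
      weak_poisson u1
        (fun x => 2 * mean_field rho1 h1 u1 x - mean_field rho2 h2 u2 x) &
      weak_poisson u2
        (fun x => 2 * mean_field rho2 h2 u2 x - mean_field rho1 h1 u1 x)].

Definition triple (T : Type) (a b c : T) : 'I_3 -> T :=
  fun m => nth a [:: a; b; c] m.

Definition rho_bar (R : realType) (a : 'I_3 -> R) : R :=
  4 * pi * \big[Num.min/1]_(q : 'I_3 * 'I_3 | q.1 != q.2) (2 + a q.1 + a q.2).

(* Main.v *)
From HB Require Import structures.
From mathcomp Require Import all_boot all_order all_algebra.
From mathcomp Require Import all_classical all_reals all_analysis.
From mathcomp Require Import measurable_realfun ring lra.
Require Import Defs.
Set Implicit Arguments.
Unset Strict Implicit.
Unset Printing Implicit Defensive.
Import Order.TTheory GRing.Theory Num.Theory numFieldNormedType.Exports.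
Local Open Scope classical_set_scope.
Local Open Scope ring_scope.

(** Write [D x y = 1 - x . y], half the squared chordal distance, for which
[- ln D / (4 pi)] is, up to a constant, the Green function; [r_i] for
[rho_i / (4 pi)]; and [A = 1 + a11], [B = 1 + a12], [be = 1 + a21],
[eps = 1 + a23]. The hypotheses on [rho_2] give [1 + a2m < r_2] for [m = 1, 2]
and [r_2 < 2 + a2m + a23], that is [r_2 < 1 + a2m + eps]. When [eps] is small
this forces [a21 = a22] and [a21 < 0] -- otherwise no [rho_2] satisfies them --
and then [be < r_2 < be + eps]. The hypotheses on [rho_1] give
[A, B < r_1 < A + B, A + be, B + be].

A solution is replaced by the pair of densities proportional to
[h_i e^(u_i)], of integrals [r_i]. As [u_i] is a logarithmic potential, they
solve the integral equations

  [f_i = exp (C_i + sum_m a_im ln D(., p_m) - 2 pot f_i + pot f_j)]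

([toda_densities]), where [pot f y] is the integral of [ln (D y x) * f x]. The
conformal vector field pointing away from a point [v] yields, for every radial weight, a virial identity for each
[f_i] ([virial]); it is proved for regularised logarithms, by integrating along
the meridians from [v], and passes to the limit.

With [v] and the centre of the weight at a same point [q], the interaction of
two points depends, up to a bounded error, on the outer one only. The layer-cake
formula then turns the identity into a statement on the masses [n_i(t)] of the
[f_i] in [D(., q) <= t]: the form

  [pohozaev_form = b_1 n_1 + b_2 n_2 - n_1^2 - n_2^2 + n_1 n_2],

where [b_i] is one plus the weight of [f_i] at [q], has an integral against
[dt / t] that is bounded by an absolute constant, on any interval of scales
([local_pohozaev]). On the other hand Jensen's inequality compares the masses of
[f_i] in annuli with the values of an explicit function of the scale
([annulus_mass_ge], [region_mass_le]).

At the third vortex [b_1 = 1] and [b_2 = eps]. The form controls the excess of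
[f_1] over [f_2], which gives a decay of the mass of [f_1] towards [p_3] that
does not depend on [eps] ([inner_mass]). Hence [f_2] behaves there like
[D^(eps - 1)] times a function bounded below, and about [1 / eps] dyadic annuli
carry comparable masses, so that each mass, and the whole mass of [f_2] away
from the vortices, is of order [eps] ([top_small], [far_mass_small]). The form
also prevents [f_2] from concentrating at [p_3] ([third_mass_small]). All of
[f_2] is therefore near [p_1] and [p_2]. Near each of them the form is almost
nonpositive at some scale, and [r_1 < A + B] prevents both from carrying mass:
nearly all of [f_2], a mass close to [be], is near a single one, say [p_1]
([concentration]).

Finally, the virial identity for the axis from [p_1] to the antipodal [p_2],
with a weight that cuts off a neighbourhood of [p_3], reads in the limit

  [(A + be - r_1) (r_1 + M) + (r_1 - B) (r_1 - M) = 0],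

where [M], with [|M| <= r_1], is the integral of the height [p_1 . x] against
[f_1]. Both coefficients are positive: this is a contradiction
([no_concentration]). *)

(** * Integrals of real-valued functions *)

Definition itg d (T : measurableType d) (R : realType)
    (mu : {measure set T -> \bar R}) (f : T -> R) : Prop :=
  mu.-integrable setT (EFin \o f).

Section almost_everywhere_real.
Context d (T : measurableType d) (R : realType).
Variable mu : {measure set T -> \bar R}.
Implicit Types P Q : T -> Prop.

Lemma ae_mono P Q : (forall x, P x -> Q x) -> {ae mu, forall x, P x} -> {ae mu, forall x, Q x}.
Proof. by move=> PQ; apply: filterS. Qed.

Lemma ae_mono2 P1 P2 Q : (forall x, P1 x -> P2 x -> Q x) ->
  {ae mu, forall x, P1 x} -> {ae mu, forall x, P2 x} -> {ae mu, forall x, Q x}.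
Proof. by move=> PQ; apply: filterS2. Qed.

Lemma ae_all P : (forall x, P x) -> {ae mu, forall x, P x}.
Proof. exact: aeW. Qed.

End almost_everywhere_real.

Section real_integral.
Context d (T : measurableType d) (R : realType).
Variable mu : {measure set T -> \bar R}.
Implicit Types f g : T -> R.

Lemma itg_measurable f : itg mu f -> measurable_fun setT f.
Proof. by move=> /measurable_int /measurable_EFinP. Qed.

Lemma itgD f g : itg mu f -> itg mu g -> itg mu (fun x => f x + g x).
Proof.
by move=> mf mg; rewrite /itg (_ : _ \o _ = (EFin \o f) \+ (EFin \o g))%E//; exact: integrableD.
Qed.

Lemma itgZ c f : itg mu f -> itg mu (fun x => c * f x).
Proof.
by move=> mf; rewrite /itg (_ : _ \o _ = (fun x => c%:E * (EFin \o f) x))%E//; exact: integrableZl.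
Qed.

Lemma itgN f : itg mu f -> itg mu (fun x => - f x).
Proof. by move=> /(itgZ (-1)); under eq_fun do rewrite mulN1r. Qed.

Lemma itgB f g : itg mu f -> itg mu g -> itg mu (fun x => f x - g x).
Proof. by move=> mf mg; apply: itgD => //; exact: itgN. Qed.

Lemma itg_le g f : measurable_fun setT f -> (forall x, `|f x| <= g x) ->
  itg mu g -> itg mu f.
Proof.
move=> mf fg ig; apply: (le_integrable _ _ _ ig) => //.
  exact/measurable_EFinP.
by move=> x _ /=; rewrite lee_fin (le_trans (fg x))// ler_norm.
Qed.

Lemma itg_le_ae g f : measurable_fun setT f -> {ae mu, forall x, `|f x| <= g x} ->
  itg mu g -> itg mu f.
Proof.
move=> mf fg ig; apply/integrableP; split; first exact/measurable_EFinP.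
have /integrableP[mg] := ig; apply: le_lt_trans.
apply: ae_ge0_le_integral => //.
- by apply: measurableT_comp => //; exact/measurable_EFinP.
- exact: measurableT_comp.
- by apply: filterS fg => x fx _ /=; rewrite lee_fin (le_trans fx)// ler_norm.
Qed.

Lemma itg_norm f : itg mu f -> itg mu (fun x => `|f x|).
Proof.
move=> mf; have m := itg_measurable mf; apply/integrableP; split.
  by apply/measurable_EFinP; exact: measurableT_comp.
have /integrableP[_] := mf; apply: le_lt_trans.
by rewrite (eq_integral (fun x => `|(EFin \o f) x|)%E)// => x _ /=; rewrite normr_id.
Qed.

Lemma itgMb f g C : itg mu f -> measurable_fun setT g ->
  (forall x, `|g x| <= C) -> itg mu (fun x => g x * f x).
Proof.
move=> mf mg gC; apply: (@itg_le (fun x => C * `|f x|)).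
- by apply: measurable_funM => //; exact: itg_measurable.
- by move=> x; rewrite normrM ler_wpM2r.
- by apply: itgZ; exact: itg_norm.
Qed.

Lemma ae_eq_Rint f g : measurable_fun setT f -> measurable_fun setT g ->
  {ae mu, forall x, f x = g x} -> \int[mu]_x f x = \int[mu]_x g x.
Proof.
move=> mf mg fg; congr fine; apply: ae_eq_integral => //; try exact/measurable_EFinP.
by apply: filterS fg => x /= -> _.
Qed.

Lemma itg_ae f g : measurable_fun setT g ->
  {ae mu, forall x, f x = g x} -> itg mu f -> itg mu g.
Proof.
move=> mg fg mf; apply: (@itg_le_ae (fun x => `|f x|)) => //; last exact: itg_norm.
by apply: filterS fg => x ->.
Qed.

Lemma eq_Rint f g : (forall x, f x = g x) -> \int[mu]_x f x = \int[mu]_x g x.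
Proof. by move=> fg; apply: eq_Rintegral => x _; exact: fg. Qed.

Lemma Rint_eq0 f : (forall x, f x = 0) -> \int[mu]_x f x = 0.
Proof. by move=> /eq_Rint ->; rewrite Rintegral_cst// mul0r. Qed.

Lemma le_Rint f g : itg mu f -> itg mu g -> (forall x, f x <= g x) ->
  \int[mu]_x f x <= \int[mu]_x g x.
Proof. by move=> mf mg fg; apply: le_Rintegral => // x _; exact: fg. Qed.

Lemma le_Rint_ae f g : itg mu f -> itg mu g -> {ae mu, forall x, f x <= g x} ->
  \int[mu]_x f x <= \int[mu]_x g x.
Proof.
move=> mf mg fg; have mm : measurable_fun setT (f \max g).
  by apply: measurable_maxr; exact: itg_measurable.
have Hm : {ae mu, forall x, g x = (f \max g) x}.
  by apply: filterS fg => x; rewrite /=; case: ltgtP => //.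
rewrite (ae_eq_Rint (itg_measurable mg) mm Hm); apply: le_Rint => //.
  exact: (itg_ae mm Hm).
by move=> x /=; rewrite le_max lexx.
Qed.

Lemma Rint_ge0 f : (forall x, 0 <= f x) -> 0 <= \int[mu]_x f x.
Proof. by move=> f0; apply: Rintegral_ge0 => x _. Qed.

Lemma RintD f g : itg mu f -> itg mu g ->
  \int[mu]_x (f x + g x) = \int[mu]_x f x + \int[mu]_x g x.
Proof. by move=> *; exact: RintegralD. Qed.

Lemma RintB f g : itg mu f -> itg mu g ->
  \int[mu]_x (f x - g x) = \int[mu]_x f x - \int[mu]_x g x.
Proof. by move=> *; exact: RintegralB. Qed.

Lemma RintZ c f : itg mu f -> \int[mu]_x (c * f x) = c * \int[mu]_x f x.
Proof. by move=> *; exact: RintegralZl. Qed.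

Lemma RintN f : itg mu f -> \int[mu]_x (- f x) = - \int[mu]_x f x.
Proof. by move=> mf; rewrite -mulN1r -RintZ//; apply: eq_Rintegral => x _; rewrite mulN1r. Qed.

Lemma normr_Rint f : itg mu f -> `|\int[mu]_x f x| <= \int[mu]_x `|f x|.
Proof. by move=> *; exact: le_normr_Rintegral. Qed.

Lemma EFin_Rint f : itg mu f -> (\int[mu]_x f x)%:E = (\int[mu]_x (f x)%:E)%E.
Proof. by move=> mf; rewrite /Rintegral fineK//; exact: integrable_fin_num. Qed.

Lemma itg_ge0_bound f C : measurable_fun setT f -> (forall x, 0 <= f x) ->
  (\int[mu]_x (f x)%:E <= C%:E)%E -> itg mu f /\ \int[mu]_x f x <= C.
Proof.
move=> mf f0 fC; have H : itg mu f.
  apply/integrableP; split; first exact/measurable_EFinP.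
  rewrite (eq_integral (fun x => (f x)%:E)); last by move=> x _ /=; rewrite ger0_norm.
  by rewrite (le_lt_trans fC)// ltry.
by split => //; rewrite -lee_fin EFin_Rint.
Qed.

Lemma Rint_dct (F : nat -> T -> R) f g :
  (forall n, measurable_fun setT (F n)) -> measurable_fun setT f ->
  {ae mu, forall x, F ^~ x @ \oo --> f x} ->
  itg mu g -> {ae mu, forall x, forall n, `|F n x| <= g x} ->
  itg mu f /\ \int[mu]_x F n x @[n --> \oo] --> \int[mu]_x f x.
Proof.
move=> mF mf Ff ig Fg.
have fc : {ae mu, forall x, setT x -> (EFin \o F n) x @[n --> \oo] --> (EFin \o f) x}.
  apply: filterS Ff => x Fx _; apply/fine_cvgP; split => //=.
  by apply: nearW.
have fd : {ae mu, forall x (n : nat), setT x -> `|(EFin \o F n) x| <= (EFin \o g) x}%E.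
  by apply: filterS Fg => x Fx n _ /=; rewrite lee_fin.
have [i1 _ i3] := @dominated_convergence _ T R mu setT measurableT
  (fun n => EFin \o F n) (EFin \o f) (EFin \o g)
  (fun n => (measurable_EFinP _ _).2 (mF n)) ((measurable_EFinP _ _).2 mf) fc ig fd.
split=> //.
by move: i3; rewrite /= -EFin_Rint// => /fine_cvgP[_]; exact.
Qed.

Lemma Rint_dct1 (F : nat -> T -> R) f g :
  (forall n, measurable_fun setT (F n)) -> measurable_fun setT f ->
  (forall x, F ^~ x @ \oo --> f x) ->
  itg mu g -> (forall n x, `|F n x| <= g x) ->
  \int[mu]_x F n x @[n --> \oo] --> \int[mu]_x f x.
Proof.
move=> mF mf Ff ig Fg; apply: (Rint_dct mF mf (aeW _ Ff) ig _).2.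
by apply: aeW => x n; exact: Fg.
Qed.

End real_integral.

Section finite_integral.
Context d (T : measurableType d) (R : realType).
Variable mu : {finite_measure set T -> \bar R}.
Implicit Types f g : T -> R.

Lemma itg_cst c : itg mu (cst c).
Proof. exact: finite_measure_integrable_cst. Qed.

Lemma itg_bounded f C : measurable_fun setT f -> (forall x, `|f x| <= C) -> itg mu f.
Proof. by move=> mf fC; apply: (itg_le mf fC); exact: itg_cst. Qed.

Lemma Rint_cst c : \int[mu]_x c = c * fine (mu setT).
Proof. by rewrite Rintegral_cst. Qed.

End finite_integral.

(** The image under [phi] of a measure of density [dens]: for polar coordinates
    this is the area, and for a rotation it expresses an invariance. *)
Section pushed_density.
Import HBNNSimple.
Context d1 d2 (X : measurableType d1) (Y : measurableType d2) (R : realType).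
Variables (m : {measure set X -> \bar R}) (nu : {measure set Y -> \bar R}).
Variables (phi : X -> Y) (dens : X -> R).
Hypothesis mphi : measurable_fun setT phi.
Hypothesis mdens : measurable_fun setT dens.
Hypothesis dens0 : forall x, 0 <= dens x.
Hypothesis nuE : forall A, measurable A ->
  nu A = (\int[m]_x (\1_A (phi x) * dens x)%:E)%E.

Lemma ge0_integral_pushed (F : Y -> R) : measurable_fun setT F -> (forall y, 0 <= F y) ->
  (\int[nu]_y (F y)%:E = \int[m]_x (F (phi x) * dens x)%:E)%E.
Proof.
move=> mF F0.
have mF' : measurable_fun setT (EFin \o F) by exact/measurable_EFinP.
pose h := nnsfun_approx measurableT mF'.
have hF (y : Y) : (h n y)%:E @[n --> \oo] --> (F y)%:E.
  by apply: (cvg_nnsfun_approx measurableT mF') => // z _; rewrite lee_fin.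
have -> : (\int[nu]_y (F y)%:E)%E = limn (fun n => \int[nu]_y (h n y)%:E)%E.
  rewrite -monotone_convergence//.
  - by apply: eq_integral => y _; apply/esym/cvg_lim => //; exact: hF.
  - by move=> n; exact/measurable_EFinP.
  - by move=> n y _; rewrite lee_fin.
  - by move=> y _ a b ab; rewrite lee_fin; exact/lefP/nd_nnsfun_approx.
have mhd n : measurable_fun setT (fun x => h n (phi x) * dens x).
  by apply: measurable_funM => //; exact: measurableT_comp.
have -> : (\int[m]_x (F (phi x) * dens x)%:E)%E =
    limn (fun n => \int[m]_x (h n (phi x) * dens x)%:E)%E.
  rewrite -monotone_convergence//.
  - apply: eq_integral => x _; apply/esym/cvg_lim => //.
    under eq_cvg do rewrite EFinM.
    have := cvgeZr (isT : (dens x)%:E \is a fin_num) (hF (phi x)); rewrite -EFinM; exact.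
  - by move=> n; exact/measurable_EFinP.
  - by move=> n x _; rewrite lee_fin mulr_ge0.
  - move=> x _ a b ab; rewrite lee_fin ler_wpM2r//.
    exact/lefP/nd_nnsfun_approx.
congr (limn _); apply/funext => n.
rewrite integralT_nnsfun sintegralE.
have -> : (\int[m]_x (h n (phi x) * dens x)%:E =
  \int[m]_x (\sum_(r \in range (h n)) (r * (\1_(h n @^-1` [set r]) (phi x) * dens x))%:E))%E.
  apply: eq_integral => x _; rewrite fsumEFin//; congr EFin.
  rewrite {1}fimfunE /= mulrC mulr_fsumr; apply: eq_fsbigr => r _.
  by rewrite mulrC mulrA.
rewrite ge0_integral_fsum//; last 2 first.
- move=> r; apply/measurable_EFinP/measurable_funM => //.
  apply: measurable_funM => //; apply: measurableT_comp => //; exact: measurable_indic.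
- move=> r x _; have [rn|rn] := leP 0 r; first by rewrite lee_fin !mulr_ge0.
  by rewrite preimage_nnfun0// indic0 mul0r mulr0.
apply: eq_fsbigr => r _.
under [RHS]eq_integral do rewrite EFinM.
rewrite nuE//.
have [rn|rn] := leP 0 r.
  rewrite ge0_integralZl//.
  - apply/measurable_EFinP/measurable_funM => //; apply: measurableT_comp => //; exact: measurable_indic.
  - by move=> x _; rewrite lee_fin mulr_ge0.
rewrite preimage_nnfun0//.
by rewrite !integral0_eq ?mule0// => x _; rewrite indic0 mul0r ?mule0.
Qed.

Lemma itg_pushed (F : Y -> R) : itg nu F ->
  itg m (fun x => F (phi x) * dens x) /\
  \int[nu]_y F y = \int[m]_x (F (phi x) * dens x).
Proof.
move=> iF; have mF := itg_measurable iF.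
have mh : measurable_fun setT (fun x => F (phi x) * dens x).
  by apply: measurable_funM => //; exact: measurableT_comp.
have key (G : Y -> R) : measurable_fun setT G -> (forall y, 0 <= G y) -> itg nu G ->
    itg m (fun x => G (phi x) * dens x) /\
    \int[nu]_y G y = \int[m]_x (G (phi x) * dens x).
  move=> mG G0 iG; have E := ge0_integral_pushed mG G0.
  split; last by rewrite /Rintegral E.
  have [] // := @itg_ge0_bound _ _ _ m (fun x => G (phi x) * dens x) (\int[nu]_y G y).
  - by apply: measurable_funM => //; exact: measurableT_comp.
  - by move=> x; rewrite mulr_ge0.
  - by rewrite EFin_Rint// E.
have mp : measurable_fun setT (fun y => (`|F y| + F y) / 2).
  by apply: measurable_funM => //; apply: measurable_funD => //; exact: measurableT_comp.
have mn : measurable_fun setT (fun y => (`|F y| - F y) / 2).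
  by apply: measurable_funM => //; apply: measurable_funB => //; exact: measurableT_comp.
have ip : itg nu (fun y => (`|F y| + F y) / 2).
  by under eq_fun do rewrite mulrC; apply: itgZ; apply: itgD => //; exact: itg_norm.
have in_ : itg nu (fun y => (`|F y| - F y) / 2).
  by under eq_fun do rewrite mulrC; apply: itgZ; apply: itgB => //; exact: itg_norm.
have p0 y : 0 <= (`|F y| + F y) / 2.
  by rewrite divr_ge0// -lerBlDr sub0r -normrN ler_norm.
have n0 y : 0 <= (`|F y| - F y) / 2 by rewrite divr_ge0// subr_ge0 ler_norm.
have [ip' Ep] := key _ mp p0 ip; have [in' En] := key _ mn n0 in_.
have FE y : F y = (`|F y| + F y) / 2 - (`|F y| - F y) / 2 by field.
have hE : (fun x => F (phi x) * dens x) = (fun x => (`|F (phi x)| + F (phi x)) / 2 * dens x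
    - (`|F (phi x)| - F (phi x)) / 2 * dens x).
  by apply/funext => x; rewrite -mulrBl -FE.
split; first by rewrite hE; exact: itgB.
rewrite hE RintB// -Ep -En -RintB//.
by apply: eq_Rintegral => y _; exact: FE.
Qed.

End pushed_density.

Section real_fubini.
Context d1 d2 (T1 : measurableType d1) (T2 : measurableType d2) (R : realType).
Variables (m1 : {sigma_finite_measure set T1 -> \bar R})
  (m2 : {sigma_finite_measure set T2 -> \bar R}).
Variable h : T1 * T2 -> R.
Hypothesis ih : itg (m1 \x m2)%E h.

Lemma Rint_prod12 : itg m1 (fun x => \int[m2]_y h (x, y)) /\
  \int[(m1 \x m2)%E]_z h z = \int[m1]_x \int[m2]_y h (x, y).
Proof.
have iF := integrable_fubini_F ih.
have aeE : {ae m1, forall x, (\int[m2]_y (h (x, y))%:E)%E = (\int[m2]_y h (x, y))%:E}.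
  have := ae_integrable1 ih; apply: filterS => x ix.
  by rewrite EFin_Rint.
have mF : measurable_fun setT (fun x => \int[m2]_y h (x, y)).
  by apply: measurableT_comp => //; exact: measurable_int iF.
have iG : itg m1 (fun x => \int[m2]_y h (x, y)).
  apply/integrableP; split; first exact/measurable_EFinP.
  have /integrableP[mm] := iF; apply: le_lt_trans; apply: ae_ge0_le_integral => //.
  - by apply: measurableT_comp => //; exact/measurable_EFinP.
  - exact: measurableT_comp.
  - by apply: filterS aeE => x /= xE _; rewrite /fubini_F /= xE.
split => //; apply: EFin_inj; rewrite EFin_Rint// EFin_Rint//.
rewrite -[LHS](@integral12_prod_meas1 _ _ _ _ _ m1 m2 _ ih).
apply: ae_eq_integral => //.
- exact: measurable_int iF.
- exact/measurable_EFinP.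
- by apply: filterS aeE => x /= xE _.
Qed.

Lemma Rint_prod21 : itg m2 (fun y => \int[m1]_x h (x, y)) /\
  \int[(m1 \x m2)%E]_z h z = \int[m2]_y \int[m1]_x h (x, y).
Proof.
have iF : m2.-integrable setT (fubini_G m1 (EFin \o h)).
  apply/integrableP; split; first exact: measurable_fubini_G ih.
  have mh := measurable_int _ ih.
  apply: le_lt_trans ((integrable21ltyP m1 m2 mh).1 ih); apply: ge0_le_integral => //.
  - by apply: measurableT_comp => //; exact: measurable_fubini_G ih.
  - by apply: (measurable_fun_fubini_tonelli_G (fun z => `|(EFin \o h) z|%E)) => //; exact: measurableT_comp.
  - move=> y _; apply: le_abse_integral => //.
    by apply: measurableT_comp => //; exact: measurable_pair2.
have aeE : {ae m2, forall y, (\int[m1]_x (h (x, y))%:E)%E = (\int[m1]_x h (x, y))%:E}.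
  have := ae_integrable2 ih; apply: filterS => x ix.
  by rewrite EFin_Rint.
have mF : measurable_fun setT (fun y => \int[m1]_x h (x, y)).
  by apply: measurableT_comp => //; exact: measurable_int iF.
have iG : itg m2 (fun y => \int[m1]_x h (x, y)).
  apply/integrableP; split; first exact/measurable_EFinP.
  have /integrableP[mm] := iF; apply: le_lt_trans; apply: ae_ge0_le_integral => //.
  - by apply: measurableT_comp => //; exact/measurable_EFinP.
  - exact: measurableT_comp.
  - by apply: filterS aeE => x /= xE _; rewrite /fubini_G /= xE.
split => //; apply: EFin_inj; rewrite EFin_Rint// EFin_Rint//.
rewrite -[LHS](@integral21_prod_meas1 _ _ _ _ _ m1 m2 _ ih).
apply: ae_eq_integral => //.
- exact: measurable_int iF.
- exact/measurable_EFinP.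
- by apply: filterS aeE => x /= xE _.
Qed.

Lemma Rint_swap :
  \int[m1]_x \int[m2]_y h (x, y) = \int[m2]_y \int[m1]_x h (x, y).
Proof. by rewrite -Rint_prod12.2 Rint_prod21.2. Qed.

End real_fubini.

(** By Tonelli; the slices are controlled in one variable only, which is the
    form in which kernels of the distance are estimated. *)
Lemma itg_prod_bound d1 d2 (T1 : measurableType d1) (T2 : measurableType d2) (R : realType)
    (m1 : {finite_measure set T1 -> \bar R}) (m2 : {finite_measure set T2 -> \bar R})
    (h : T1 * T2 -> R) (b : T2 -> R) :
  measurable_fun setT h -> itg m2 b ->
  (forall y, (\int[m1]_x `|h (x, y)|%:E <= (b y)%:E)%E) ->
  itg (m1 \x m2)%E h.
Proof.
move=> mh ib hb; apply/integrable21ltyP; first exact/measurable_EFinP.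
have /integrableP[mb] := ib; apply: le_lt_trans; apply: ge0_le_integral => //.
- by move=> y _; apply: integral_ge0.
- apply: (measurable_fun_fubini_tonelli_G (fun z => `|(EFin \o h) z|%E)) => //.
  by apply: measurableT_comp => //; exact/measurable_EFinP.
- exact: measurableT_comp.
- move=> y _; apply: (le_trans (hb y)).
  by rewrite lee_fin ler_norm.
Qed.


(** * Geometry of the sphere *)

Section geometry.
Variable R : realType.
Implicit Types a b c : 'rV[R]_3.
Implicit Types v x y z : sphere R.

Lemma dotE a b : dot a b = a 0 ord0 * b 0 ord0 + a 0 (inord 1) * b 0 (inord 1)
  + a 0 ord_max * b 0 ord_max.
Proof.
rewrite /dot !big_ord_recr big_ord0 /= add0r; congr (_ * _ + _ * _ + _ * _);
  congr (_ 0 _); apply: val_inj => //=; by rewrite inordK.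
Qed.

Lemma dotC a b : dot a b = dot b a.
Proof. by apply: eq_bigr => i _; rewrite mulrC. Qed.

Definition sdot x y : R := dot (pt x) (pt y).

(** Half the squared chordal distance, so that its logarithm is a multiple of
    the Green function and its square root satisfies the triangle inequality. *)
Definition D x y : R := 1 - sdot x y.

(** The derivative of [- sdot x y] is [- Bk v x y] along the conformal field [v
    - (v . x) x]: hence [Bk v x y / D x y] is the derivative of [ln D], in its
    first variable, along the opposite field, which points away from [v]. *)
Definition Bk v x y : R := sdot v y - sdot v x * sdot x y.

Lemma sdotC x y : sdot x y = sdot y x. Proof. exact: dotC. Qed.

Lemma DC x y : D x y = D y x. Proof. by rewrite /D sdotC. Qed.

Lemma sdot1 x : sdot x x = 1. Proof. exact/eqP/pt_unit. Qed.

Lemma sphere_eq x y : pt x = pt y -> x = y.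
Proof. by move=> h; apply: val_inj. Qed.

(** The difference of the two sides is the Gram determinant of the three unit
    vectors, a square by Lagrange's identity. *)
Lemma gram_ge0 v x y :
  Bk v x y ^+ 2 <= (1 - sdot v x ^+ 2) * (1 - sdot x y ^+ 2).
Proof.
have hv := sdot1 v; have hx := sdot1 x; have hy := sdot1 y.
rewrite /Bk -subr_ge0.
rewrite (_ : _ - _ = sdot v v * sdot x x * sdot y y + 2 * sdot v x * sdot x y * sdot v y
   - sdot v v * sdot x y ^+ 2 - sdot x x * sdot v y ^+ 2 - sdot y y * sdot v x ^+ 2); last first.
  by rewrite hv hx hy; ring.
move: hv hx hy => _ _ _; rewrite /sdot !dotE.
set v0 := pt v 0 _; set v1 := pt v 0 _; set v2 := pt v 0 _.
set x0 := pt x 0 _; set x1 := pt x 0 _; set x2 := pt x 0 _.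
set y0 := pt y 0 _; set y1 := pt y 0 _; set y2 := pt y 0 _.
rewrite (_ : _ - _ = (v0 * (x1 * y2 - x2 * y1) - v1 * (x0 * y2 - x2 * y0)
  + v2 * (x0 * y1 - x1 * y0)) ^+ 2) ?sqr_ge0//.
by ring.
Qed.

Lemma sdot_sqr_le1 x y : sdot x y ^+ 2 <= 1.
Proof.
have hx := sdot1 x; have hy := sdot1 y.
rewrite -subr_ge0 (_ : _ - _ = sdot x x * sdot y y - sdot x y ^+ 2); last by rewrite hx hy mul1r.
move: hx hy => _ _; rewrite /sdot !dotE.
set x0 := pt x 0 _; set x1 := pt x 0 _; set x2 := pt x 0 _.
set y0 := pt y 0 _; set y1 := pt y 0 _; set y2 := pt y 0 _.
rewrite (_ : _ - _ = (x1 * y2 - x2 * y1) ^+ 2 + (x0 * y2 - x2 * y0)^+2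
  + (x0 * y1 - x1 * y0) ^+ 2); last by ring.
by rewrite !addr_ge0 ?sqr_ge0.
Qed.

Lemma sdot_le1 x y : sdot x y <= 1.
Proof. by have := sdot_sqr_le1 x y; have := sqr_ge0 (sdot x y - 1); nra. Qed.

Lemma sdot_geN1 x y : -1 <= sdot x y.
Proof. by have := sdot_sqr_le1 x y; have := sqr_ge0 (sdot x y + 1); nra. Qed.

Lemma norm_sdot x y : `|sdot x y| <= 1.
Proof. by rewrite ler_norml sdot_geN1 sdot_le1. Qed.

Lemma D_ge0 x y : 0 <= D x y.
Proof. by rewrite subr_ge0 sdot_le1. Qed.

Lemma D_le2 x y : D x y <= 2.
Proof. by rewrite /D; have := sdot_geN1 x y; lra. Qed.

Lemma Dxx x : D x x = 0. Proof. by rewrite /D sdot1 subrr. Qed.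

Lemma D_eq0 x y : D x y = 0 -> x = y.
Proof.
move=> /eqP; rewrite subr_eq0 => /eqP h.
have hx := sdot1 x; have hy := sdot1 y; apply: sphere_eq.
have : sdot x x + sdot y y - 2 * sdot x y = 0 by rewrite hx hy -h; ring.
move: hx hy h => _ _ _; rewrite /sdot !dotE.
set x0 := pt x 0 ord0; set x1 := pt x 0 (inord 1); set x2 := pt x 0 ord_max.
set y0 := pt y 0 ord0; set y1 := pt y 0 (inord 1); set y2 := pt y 0 ord_max => h.
have {}h : (x0 - y0) ^+ 2 + (x1 - y1) ^+ 2 + (x2 - y2) ^+ 2 = 0 by rewrite -h; ring.
have a0 := sqr_ge0 (x0 - y0); have a1 := sqr_ge0 (x1 - y1); have a2 := sqr_ge0 (x2 - y2).
have sq0 (r s : R) : (r - s) ^+ 2 = 0 -> r = s.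
  by move/eqP; rewrite sqrf_eq0 subr_eq0 => /eqP.
have h0 : x0 = y0 by apply: sq0; lra.
have h1 : x1 = y1 by apply: sq0; lra.
have h2 : x2 = y2 by apply: sq0; lra.
apply/matrixP => i j; rewrite ord1.
case: j => -[|[|[|//]]] jlt.
- by rewrite (_ : Ordinal jlt = ord0) //; apply: val_inj.
- by rewrite (_ : Ordinal jlt = inord 1) //; apply: val_inj => /=; rewrite inordK.
- by rewrite (_ : Ordinal jlt = ord_max) //; apply: val_inj.
Qed.

Lemma D_gt0 x y : x <> y -> 0 < D x y.
Proof.
by move=> xy; rewrite lt_neqAle D_ge0 andbT; apply/eqP => h; apply/xy/D_eq0.
Qed.

(** A quasi-triangle inequality without square roots, sufficient wherever
    constants do not matter. *)
Lemma D_quasi x y z : D x z <= 2 * (D x y + D y z).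
Proof.
have hx := sdot1 x; have hy := sdot1 y; have hz := sdot1 z.
have : 0 <= sdot x x + 4 * sdot y y + sdot z z + 2 * sdot x z - 4 * sdot x y - 4 * sdot y z.
  move: hx hy hz => _ _ _; rewrite /sdot !dotE.
  set x0 := pt x 0 _; set x1 := pt x 0 _; set x2 := pt x 0 _.
  set y0 := pt y 0 _; set y1 := pt y 0 _; set y2 := pt y 0 _.
  set z0 := pt z 0 _; set z1 := pt z 0 _; set z2 := pt z 0 _.
  rewrite (_ : _ - _ = (x0 - 2 * y0 + z0)^+2 + (x1 - 2 * y1 + z1)^+2 + (x2 - 2 * y2 + z2)^+2); last by ring.
  by rewrite !addr_ge0 ?sqr_ge0.
by rewrite hx hy hz /D; lra.
Qed.

(** Cauchy-Schwarz for the chords [x - y] and [y - z]. *)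
Lemma D_cross x y z : (D x z - D x y - D y z) ^+ 2 <= 4 * D x y * D y z.
Proof.
have := gram_ge0 x y z; rewrite /Bk /D.
set a := sdot x y; set b := sdot y z; set c := sdot x z => h.
have ha : 0 <= 1 - a by rewrite subr_ge0 sdot_le1.
have hb : 0 <= 1 - b by rewrite subr_ge0 sdot_le1.
have : (c - a * b) ^+ 2 <= (1 - a ^+ 2) * (1 - b ^+ 2) by [].
have : 0 <= (1 - a) * (1 - b) by exact: mulr_ge0.
have hx := sdot1 x; have hy := sdot1 y; have hz := sdot1 z => _ _.
rewrite -subr_ge0.
(* Lagrange's identity for the vectors x - y and y - z *)
rewrite (_ : _ - _ = (sdot x x - 2 * a + sdot y y) * (sdot y y - 2 * b + sdot z z)
  - (a - c - sdot y y + b) ^+ 2); last by rewrite hx hy hz; ring.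
rewrite /a /b /c; move: hx hy hz h ha hb => _ _ _ _ _ _; rewrite /sdot !dotE.
set x0 := pt x 0 _; set x1 := pt x 0 _; set x2 := pt x 0 _.
set y0 := pt y 0 _; set y1 := pt y 0 _; set y2 := pt y 0 _.
set z0 := pt z 0 _; set z1 := pt z 0 _; set z2 := pt z 0 _.
rewrite (_ : _ - _ = ((x1-y1) * (y2-z2) - (x2-y2) * (y1-z1)) ^+ 2
 + ((x0-y0) * (y2-z2) - (x2-y2) * (y0-z0))^+2
  + ((x0-y0) * (y1-z1) - (x1-y1) * (y0-z0)) ^+ 2); last by ring.
by rewrite !addr_ge0 ?sqr_ge0.
Qed.

Lemma D_triangle x y z :
  Num.sqrt (D x z) <= Num.sqrt (D x y) + Num.sqrt (D y z).
Proof.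
have p0 := D_ge0 x y; have q0 := D_ge0 y z; have r0 := D_ge0 x z.
rewrite -(@ler_pXn2r _ 2) ?nnegrE ?addr_ge0 ?sqrtr_ge0// sqrrD !sqr_sqrtr//.
have := D_cross x y z.
set p := D x y in p0 *; set q := D y z in q0 *; set r := D x z in r0 *.
move=> h; rewrite -sqrtrM//.
have hs : 0 <= Num.sqrt (p * q) by rewrite sqrtr_ge0.
have hs2 : Num.sqrt (p * q) ^+ 2 = p * q by rewrite sqr_sqrtr// mulr_ge0.
rewrite mulr2n; set s := Num.sqrt _ in hs hs2 *.
have : (r - p - q) ^+ 2 <= (2 * s) ^+ 2 by rewrite exprMn hs2; nra.
rewrite -ler_sqrt ?sqr_ge0// !sqrtr_sqr (ger0_norm (_ : 0 <= 2 * s)) ?mulr_ge0//.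
by have := ler_norm (r - p - q); lra.
Qed.

Lemma sdot2E v x : 1 - sdot v x ^+ 2 = D v x * (2 - D v x).
Proof. by rewrite /D; ring. Qed.

Lemma sdot2_ge0 v x : 0 <= 1 - sdot v x ^+ 2.
Proof. by rewrite subr_ge0 sdot_sqr_le1. Qed.

(** The first factor is the length of the conformal field at [x]: the field
    vanishes at [v] and at its antipode. *)
Lemma Bk_bound v x y :
  `|Bk v x y| <= Num.sqrt (1 - sdot v x ^+ 2) * (Num.sqrt 2 * Num.sqrt (D x y)).
Proof.
have h1 := sdot2_ge0 v x; have h2 := sdot2_ge0 x y.
rewrite -sqrtr_sqr -!sqrtrM// ?ler0n//.
rewrite ler_wsqrtr//; apply: (le_trans (gram_ge0 v x y)).
rewrite ler_wpM2l// sdot2E; have := D_ge0 x y; have := D_le2 x y; nra.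
Qed.

Lemma sqrt_sdot2_le v x : Num.sqrt (1 - sdot v x ^+ 2) <= Num.sqrt 2 * Num.sqrt (D v x).
Proof.
rewrite -sqrtrM// ler_wsqrtr// sdot2E; have := D_ge0 v x; have := D_le2 v x; nra.
Qed.

Lemma sqrt_sdot2_le1 v x : Num.sqrt (1 - sdot v x ^+ 2) <= 1.
Proof.
rewrite -[leRHS]sqrtr1 ler_wsqrtr//; have := sqr_ge0 (sdot v x); lra.
Qed.

Lemma Bk_bound2 v x y : `|Bk v x y| <= 2 * Num.sqrt (D v x) * Num.sqrt (D x y).
Proof.
apply: (le_trans (Bk_bound v x y)).
rewrite mulrA ler_wpM2r ?sqrtr_ge0//.
have h2 : (2 : R) = Num.sqrt 2 * Num.sqrt 2 by rewrite -expr2 sqr_sqrtr.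
rewrite [X in _ <= X * _]h2 -mulrA [leLHS]mulrC ler_wpM2l// ?sqrtr_ge0//.
exact: sqrt_sdot2_le.
Qed.

Lemma Bk_le2 v x y : `|Bk v x y| <= 2.
Proof.
have -> : (2 : R) = 1 + 1 * 1 by lra.
rewrite (le_trans (ler_normB _ _))// lerD ?norm_sdot// normrM ler_pM ?normr_ge0 ?norm_sdot//.
Qed.

(** The singularity of the kernel [Bk v x y / D x y] is odd: symmetrised, it is
    the height along [v]. *)
Lemma Bk_sym v x y : Bk v x y + Bk v y x = (sdot v x + sdot v y) * D x y.
Proof. by rewrite /Bk /D (sdotC y x); ring. Qed.

Lemma Bk_self v x : Bk v x v = D v x * (2 - D v x).
Proof. by rewrite /Bk sdot1 (sdotC x v) /D; ring. Qed.

End geometry.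

(** * Compact intervals as finite measures *)

Section segments.
Variable R : realType.
Implicit Types (a b : R) (f F : R -> R).

Definition seg a b := mrestr (@lebesgue_measure R) (measurable_itv `[a, b]).

HB.instance Definition _ a b := Measure.on (seg a b).

Let seg_fin a b : fin_num_fun (seg a b).
Proof.
move=> A mA; rewrite ge0_fin_numE ?measure_ge0//.
rewrite /seg /mrestr (@le_lt_trans _ _ (lebesgue_measure `[a, b]%classic))//.
  by apply: le_measure => //; rewrite inE//; exact: measurableI.
by rewrite /= lebesgue_measure_itv/=; case: ifPn => // _; rewrite -EFinB ltry.
Qed.

HB.instance Definition _ a b := Measure_isFinite.Build _ _ _ (seg a b) (@seg_fin a b).

Lemma ae_seg a b : {ae seg a b, forall x, a <= x <= b}.
Proof.
exists (~` `[a, b]%classic); split; first exact: measurableC.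
  by rewrite /seg /= /mrestr setICl measure0.
by move=> x /= + xab; apply; move: xab; rewrite in_itv.
Qed.

Lemma seg_pushed a b (A : set R) : measurable A ->
  seg a b A = (\int[@lebesgue_measure R]_x (\1_A x * \1_`[a, b]%classic x)%:E)%E.
Proof.
move=> mA; under eq_integral do rewrite -[(_ * _)]/((\1_A \* \1_`[a, b]%classic) _) -indicI.
by rewrite integral_indic ?setIT//; exact: measurableI.
Qed.

Lemma Rint_seg a b f : itg (seg a b) f ->
  \int[seg a b]_x f x = \int[@lebesgue_measure R]_(x in `[a, b]) f x.
Proof.
move=> fi.
have [_ ->] := itg_pushed (m := @lebesgue_measure R) (phi := idfun)
   (@measurable_id _ _ setT)
   (@measurable_indic _ _ _ setT `[a, b]%classic (measurable_itv _))
   (fun x => ler0n R _) (@seg_pushed a b) fi.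
rewrite [RHS]Rintegral_mkcond; apply: eq_Rintegral => x _.
by rewrite patchE /= indicE; case: ifPn; rewrite ?mulr1 ?mulr0.
Qed.

Lemma eq_Rint_seg a b f g : measurable_fun setT f -> measurable_fun setT g ->
  (forall x, a <= x <= b -> f x = g x) -> \int[seg a b]_x f x = \int[seg a b]_x g x.
Proof.
by move=> mf mg fg; apply: ae_eq_Rint => //; apply: ae_mono (ae_seg a b) => x /fg.
Qed.

Lemma itg_seg_cont a b f : continuous f -> itg (seg a b) f.
Proof.
move=> cf; have mf := continuous_measurable_fun cf.
have [M [_ HM]] : bounded_set [set f x | x in `[a, b]%classic].
  apply: compact_bounded; apply: continuous_compact; last exact: segment_compact.
  exact: continuous_subspaceT.
apply: (@itg_le_ae _ _ _ _ (cst (M + 1))) => //; last exact: itg_cst.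
apply: ae_mono (ae_seg a b) => x xab; apply: (HM (M + 1)); first by rewrite ltrDl.
by exists x => //=; rewrite in_itv.
Qed.

Lemma FTC_seg a b f F : a <= b -> (forall x, is_derive x (1 : R) F (f x)) -> continuous f ->
  \int[seg a b]_x f x = F b - F a.
Proof.
move=> ab dF cf; have itf := itg_seg_cont a b cf; rewrite Rint_seg//.
move: ab; rewrite le_eqVlt => /orP[/eqP <-|ab].
  by rewrite set_itv1 Rintegral_set1 subrr.
have cF : continuous F.
  by move=> x; apply/differentiable_continuous/derivable1_diffP; case: (dF x).
apply: EFin_inj; rewrite EFinB -(continuous_FTC2 ab (f := f)).
- rewrite /Rintegral fineK//.
  have : (@lebesgue_measure R).-integrable `[a, b] (EFin \o f).
    apply: continuous_compact_integrable; first exact: segment_compact.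
    exact: continuous_subspaceT.
  by move=> fi; exact: (integrable_fin_num _ fi).
- exact: continuous_subspaceT.
- split; first by move=> x _; case: (dF x).
  + exact/cvg_at_right_filter/cF.
  + exact/cvg_at_left_filter/cF.
- by move=> x _; rewrite derive1E; case: (dF x).
Qed.

Lemma seg_set1 a b x : seg a b [set x] = 0%E.
Proof.
apply/eqP; rewrite eq_le measure_ge0 andbT -(@lebesgue_measure_set1 _ x).
rewrite /seg /mrestr; apply: le_measure => //; rewrite inE//; exact: measurableI.
Qed.

Lemma seg_setT a b : a <= b -> seg a b setT = (b - a)%:E.
Proof.
move=> ab; rewrite /seg /= /mrestr setTI lebesgue_measure_itv /= lte_fin.
by move: ab; rewrite le_eqVlt => /orP[/eqP ->|->]; rewrite ?ltxx ?subrr -?EFinB.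
Qed.

End segments.

(** * The surface measure in polar coordinates *)

Section area_finite.
Variable R : realType.

Notation boxm := (seg 0 (@pi R) \x seg 0 (2 * pi))%E.

Lemma measurable_coord (i : 'I_3) : measurable_fun setT (@sphere_coord R i).
Proof.
move=> _ B mB; rewrite setTI; apply: sub_sigma_algebra.
rewrite -bigcup_mkord_ord; exists i; first exact: ltn_ord.
by exists B => //; rewrite setTI inord_val.
Qed.

Lemma measurable_sdot d (T : measurableType d) (f g : T -> sphere R) :
  measurable_fun setT f -> measurable_fun setT g ->
  measurable_fun setT (fun t => sdot (f t) (g t)).
Proof.
move=> mf mg; rewrite /sdot; under eq_fun do rewrite dotE.
have mc i : measurable_fun setT (fun t => pt (f t) 0 i).
  exact: measurableT_comp (measurable_coord i) mf.
have mc' i : measurable_fun setT (fun t => pt (g t) 0 i).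
  exact: measurableT_comp (measurable_coord i) mg.
by apply: measurable_funD; [apply: measurable_funD|]; apply: measurable_funM.
Qed.

Lemma measurable_D d (T : measurableType d) (f g : T -> sphere R) :
  measurable_fun setT f -> measurable_fun setT g ->
  measurable_fun setT (fun t => D (f t) (g t)).
Proof. by move=> mf mg; apply: measurable_funB => //; exact: measurable_sdot. Qed.

Lemma measurable_Bk d (T : measurableType d) (f g h : T -> sphere R) :
  measurable_fun setT f -> measurable_fun setT g -> measurable_fun setT h ->
  measurable_fun setT (fun t => Bk (f t) (g t) (h t)).
Proof.
by move=> mf mg mh; apply: measurable_funB; [|apply: measurable_funM]; exact: measurable_sdot.
Qed.

Lemma measurable_invr : measurable_fun setT (@GRing.inv R).
Proof.
have -> : @GRing.inv R = fun u => u * (u ^+ 2) `^ (-1).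
  apply/funext => u; rewrite powR_inv1 ?sqr_ge0//.
  by have [->|u0] := eqVneq u 0; [rewrite invr0 mul0r|field].
apply: measurable_funM => //.
by apply: (measurableT_comp (@measurable_powR R (-1))); exact: measurable_funX.
Qed.

Lemma measurable_sin : measurable_fun setT (@sin R).
Proof. by apply: continuous_measurable_fun; exact: continuous_sin. Qed.

Lemma measurable_cos : measurable_fun setT (@cos R).
Proof. by apply: continuous_measurable_fun; exact: continuous_cos. Qed.

Let mbox : measurable (@spherical_box R).
Proof. exact: measurableX. Qed.

Let boxmE (X : set (R * R)) : measurable X ->
  boxm X = mrestr (@lebesgue_measure R \x @lebesgue_measure R)%E mbox X.
Proof.
move=> mX; apply: (@product_measure_unique _ _ _ _ _ (seg 0 pi) (seg 0 (2 * pi))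
  (mrestr (@lebesgue_measure R \x @lebesgue_measure R)%E mbox)) => // A B mA mB.
rewrite /mrestr /= /mrestr /spherical_box -setXI product_measure1E//; exact: measurableI.
Qed.

(** The definition of the area restricts the integral to a box and has density
    [sin]; here the restriction is moved to a finite product measure, to which
    Fubini applies, and the absolute value makes the density nonnegative
    everywhere. *)
Lemma area_pushed (A : set (sphere R)) : measurable A ->
  area A = (\int[boxm]_w (\1_A (spherical w) * `|sin w.1|)%:E)%E.
Proof.
move=> mA.
have mS : measurable (@spherical R @^-1` A).
  by rewrite -[X in measurable X]setTI; exact: measurable_spherical.
have ms : measurable_fun setT (fun w : R * R => sin w.1).
  exact: measurableT_comp measurable_sin measurable_fst.
have mi : measurable_fun setT (fun w : R * R => \1_A (spherical w) * `|sin w.1|).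
  apply: measurable_funM; last exact: measurableT_comp.
  by apply: measurableT_comp; [exact: measurable_indic|exact: measurable_spherical].
rewrite (@eq_measure_integral _ _ _ _ (mrestr (@lebesgue_measure R \x @lebesgue_measure R)%E mbox)); last first.
  by move=> X mX _; exact: boxmE.
rewrite (ge0_integral_pushed (m := (@lebesgue_measure R \x @lebesgue_measure R)%E)
   (phi := idfun) (dens := \1_(@spherical_box R))) //.
- rewrite /area [LHS]integral_mkcond; apply: eq_integral => w _ /=.
  rewrite patchE !indicE in_setI /=.
  have -> : (w \in @spherical R @^-1` A) = (spherical w \in A) by apply/idP/idP; rewrite !inE.
  case: (spherical w \in A) => /=; rewrite ?mul0r// mul1r.
  have [|_] := boolP (w \in _); rewrite ?mulr0// mulr1 inE => -[/=].
  by rewrite in_itv /= => t0 _; rewrite ger0_norm// sin_ge0_pi.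
- exact: measurable_id.
- move=> X mX; under eq_integral do rewrite -[(_ * _)]/((\1_X \* \1_(@spherical_box R)) _) -indicI.
  by rewrite integral_indic ?setIT//; exact: measurableI.
Qed.

Let mabs_sin : measurable_fun setT (fun w : R * R => `|sin w.1|).
Proof.
exact: measurableT_comp (measurableT_comp measurable_sin measurable_fst).
Qed.

Lemma area_fin_num : fin_num_fun (@area R).
Proof.
move=> A mA; rewrite ge0_fin_numE ?measure_ge0// area_pushed//.
rewrite (@le_lt_trans _ _ (\int[boxm]_w (cst 1%:E w))%E)//.
  apply: ge0_le_integral.
  - exact: measurableT.
  - by move=> w _; rewrite lee_fin mulr_ge0.
  - apply/measurable_EFinP/measurable_funM; last exact: mabs_sin.
    by apply: measurableT_comp; [exact: measurable_indic|exact: measurable_spherical].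
  - by [].
  - move=> w _; rewrite lee_fin -[leRHS]mul1r ler_pM// ?indic_le1// ler_norml.
    by rewrite sin_geN1 sin_le1.
have p0 := pi_ge0 R.
rewrite integral_cst// mul1e [X in (X < _)%E](_ : _ = (pi * (2 * pi))%:E) ?ltry//.
rewrite -setXTT; apply: (etrans (product_measure1E _ _ _ _)) => //.
by rewrite /= !seg_setT// ?mulr_ge0// !subr0 -EFinM.
Qed.

HB.instance Definition _ := Measure_isFinite.Build _ _ _ (@area R) area_fin_num.

End area_finite.

(** * Elementary calculus on the real line *)

Section calculus.
Variable R : realType.
Implicit Types (f g : R -> R) (x a b : R).

Definition drv f x a := is_derive (x : R) (1 : R) f a.

Lemma drv_eq f x a b : drv f x a -> a = b -> drv f x b.
Proof. by move=> h <-. Qed.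

Lemma drv_cst c x : drv (fun=> c) x 0. Proof. exact: is_derive_cst. Qed.

Lemma drv_id x : drv (fun y => y) x 1. Proof. exact: is_derive_id. Qed.

Lemma drvD f g x a b : drv f x a -> drv g x b -> drv (fun y => f y + g y) x (a + b).
Proof. by move=> hf hg; exact: is_deriveD. Qed.

Lemma drvN f x a : drv f x a -> drv (fun y => - f y) x (- a).
Proof. by move=> hf; exact: is_deriveN. Qed.

Lemma drvM f g x a b : drv f x a -> drv g x b ->
  drv (fun y => f y * g y) x (f x * b + g x * a).
Proof. by move=> hf hg; exact: is_deriveM. Qed.

Lemma drv_comp f g x a b : drv f (g x) a -> drv g x b -> drv (fun y => f (g y)) x (a * b).
Proof. by move=> hf hg; exact: (is_derive1_comp hf hg). Qed.

Lemma drv_sin f x a : drv f x a -> drv (fun y => sin (f y)) x (cos (f x) * a).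
Proof. by move=> hf; apply: (drv_comp (f := sin)) => //; exact: is_derive_sin. Qed.

Lemma drv_cos f x a : drv f x a -> drv (fun y => cos (f y)) x (- sin (f x) * a).
Proof. by move=> hf; apply: (drv_comp (f := cos)) => //; exact: is_derive_cos. Qed.

Lemma drv_expR f x a : drv f x a -> drv (fun y => expR (f y)) x (expR (f x) * a).
Proof. by move=> hf; apply: (drv_comp (f := expR)) => //; exact: is_derive_expR. Qed.

Lemma drv_ln f x a : 0 < f x -> drv f x a -> drv (fun y => ln (f y)) x ((f x)^-1 * a).
Proof. by move=> f0 hf; apply: (drv_comp (f := @ln R)) => //; exact: is_derive1_ln. Qed.

Lemma drvV f x a : f x != 0 -> drv f x a -> drv (fun y => (f y)^-1) x (- (f x) ^- 2 * a).
Proof. by move=> f0 hf; exact: is_deriveV. Qed.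

Lemma drv_continuous f x a : drv f x a -> {for x, continuous f}.
Proof. by case=> h _; exact/differentiable_continuous/derivable1_diffP. Qed.

Lemma FTC_drv a b f g : a <= b -> (forall x, drv g x (f x)) -> continuous f ->
  \int[seg a b]_x f x = g b - g a.
Proof. by move=> ab dg cf; exact: FTC_seg. Qed.

Lemma ctsD f g : continuous f -> continuous g -> continuous (fun x => f x + g x).
Proof. by move=> cf cg x; apply: cvgD; [exact: cf|exact: cg]. Qed.

Lemma ctsN f : continuous f -> continuous (fun x => - f x).
Proof. by move=> cf x; apply: cvgN; exact: cf. Qed.

Lemma ctsM f g : continuous f -> continuous g -> continuous (fun x => f x * g x).
Proof. by move=> cf cg x; apply: cvgM; [exact: cf|exact: cg]. Qed.

Lemma ctsX f n : continuous f -> continuous (fun x => f x ^+ n).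
Proof.
move=> cf; elim: n => [|n IH]; first by move=> x; exact: cvg_cst.
by under eq_fun do rewrite exprS; exact: ctsM.
Qed.

Lemma cts_cst (c : R) : continuous (fun _ : R => c).
Proof. by move=> x; exact: cvg_cst. Qed.

Lemma cts_id : continuous (fun x : R => x). Proof. by move=> x; exact: cvg_id. Qed.

Lemma cts_comp f g : continuous f -> continuous g -> continuous (fun x => f (g x)).
Proof. by move=> cf cg x; apply: (continuous_comp (cg x)); exact: cf. Qed.

Lemma cts_sin f : continuous f -> continuous (fun x => sin (f x)).
Proof. by apply: cts_comp; exact: continuous_sin. Qed.

Lemma cts_cos f : continuous f -> continuous (fun x => cos (f x)).
Proof. by apply: cts_comp; exact: continuous_cos. Qed.

Lemma cts_expR f : continuous f -> continuous (fun x => expR (f x)).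
Proof. by apply: cts_comp; exact: continuous_expR. Qed.

Lemma ctsV f : (forall x, f x != 0) -> continuous f -> continuous (fun x => (f x)^-1).
Proof. by move=> f0 cf x; apply: cvgV => //; exact: cf. Qed.

Lemma cts_ln f : (forall x, 0 < f x) -> continuous f -> continuous (fun x => ln (f x)).
Proof. by move=> f0 cf x; apply: (continuous_comp (cf x)); exact: continuous_ln. Qed.

Lemma cts_max f g : continuous f -> continuous g -> continuous (fun x => Num.max (f x) (g x)).
Proof. by move=> cf cg x; apply: continuous_max; [exact: cf|exact: cg]. Qed.

Lemma cts_min f g : continuous f -> continuous g -> continuous (fun x => Num.min (f x) (g x)).
Proof. by move=> cf cg x; apply: continuous_min; [exact: cf|exact: cg]. Qed.

End calculus.

Ltac cts := lazymatch goal with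
  | |- continuous (fun x => @?f x + @?g x) => apply: (@ctsD _ f g); cts
  | |- continuous (fun x => @?f x * @?g x) => apply: (@ctsM _ f g); cts
  | |- continuous (fun x => - @?f x) => apply: (@ctsN _ f); cts
  | |- continuous (fun x => @?f x ^+ ?n) => apply: (@ctsX _ f n); cts
  | |- continuous (fun x => sin (@?f x)) => apply: (@cts_sin _ f); cts
  | |- continuous (fun x => cos (@?f x)) => apply: (@cts_cos _ f); cts
  | |- continuous (fun x => expR (@?f x)) => apply: (@cts_expR _ f); cts
  | |- continuous (fun x => Num.max (@?f x) (@?g x)) => apply: (@cts_max _ f g); cts
  | |- continuous (fun x => Num.min (@?f x) (@?g x)) => apply: (@cts_min _ f g); cts
  | |- continuous (@sin _) => exact: continuous_sin
  | |- continuous (@cos _) => exact: continuous_cos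
  | |- continuous (@expR _) => exact: continuous_expR
  | |- continuous (fun x => x) => exact: cts_id
  | |- continuous (fun x => ?c) => first [exact: cts_cst | assumption | idtac]
  | |- _ => try assumption
  end.

Ltac meas := lazymatch goal with
  | |- measurable_fun _ (fun x => @?f x + @?g x) => apply: (@measurable_funD _ _ _ _ f g); meas
  | |- measurable_fun _ (fun x => @?f x * @?g x) => apply: (@measurable_funM _ _ _ _ f g); meas
  | |- measurable_fun _ (fun x => - @?f x) => apply: measurableT_comp; [by []|meas]
  | |- measurable_fun _ (fun x => `|@?f x|) => apply: measurableT_comp; [by []|meas]
  | |- measurable_fun _ (fun x => (@?f x) ^+ ?n) => apply: (@measurable_funX _ _ _ _ f n); meas
  | |- measurable_fun _ (fun x => sin (@?f x)) => apply: (measurableT_comp (@measurable_sin _)); meas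
  | |- measurable_fun _ (fun x => cos (@?f x)) => apply: (measurableT_comp (@measurable_cos _)); meas
  | |- measurable_fun _ (fun x => expR (@?f x)) => apply: (measurableT_comp (@measurable_expR _)); meas
  | |- measurable_fun _ (fun x => ln (@?f x)) => apply: (measurableT_comp (@measurable_ln _)); meas
  | |- measurable_fun _ (fun x => sdot (@?f x) (@?g x)) => apply: (@measurable_sdot _ _ _ f g); meas
  | |- measurable_fun _ (fun x => D (@?f x) (@?g x)) => apply: (@measurable_D _ _ _ f g); meas
  | |- measurable_fun _ (fun x => Bk (@?f x) (@?g x) (@?h x)) => apply: (@measurable_Bk _ _ _ f g h); meas
  | |- measurable_fun _ (D ?v) => apply: (@measurable_D _ _ _ (fun _ => v) (fun x => x)); meas
  | |- measurable_fun _ (sdot ?v) => apply: (@measurable_sdot _ _ _ (fun _ => v) (fun x => x)); meas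
  | |- measurable_fun _ (Bk ?v ?y) => apply: (@measurable_Bk _ _ _ (fun _ => v) (fun _ => y) (fun x => x)); meas
  | |- measurable_fun _ (fun x => (@?f x)^-1) => apply: (measurableT_comp (@measurable_invr _)); meas
  | |- measurable_fun _ (fun x => (@?f x) `^ ?a) => apply: (measurableT_comp (@measurable_powR _ a)); meas
  | |- measurable_fun _ (@sin _) => exact: measurable_sin
  | |- measurable_fun _ (@cos _) => exact: measurable_cos
  | |- measurable_fun _ (@expR _) => exact: measurable_expR
  | |- measurable_fun _ (@ln _) => exact: measurable_ln
  | |- measurable_fun _ (fun x => x.1) => exact: measurable_fst
  | |- measurable_fun _ (fun x => x.2) => exact: measurable_snd
  | |- measurable_fun _ (fun x => x) => exact: measurable_id
  | |- measurable_fun _ (fun x => ?c) => first [exact: measurable_cst | assumption | idtac]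
  | |- _ => try assumption
  end.

(* [dv] proves [drv f x ?a], leaving the side conditions of inverses and
   logarithms. *)
Ltac dv := lazymatch goal with
  | |- drv (fun x => @?f x + @?g x) _ _ => eapply (@drvD _ f g); dv
  | |- drv (fun x => @?f x * @?g x) _ _ => eapply (@drvM _ f g); dv
  | |- drv (fun x => - @?f x) _ _ => eapply (@drvN _ f); dv
  | |- drv (fun x => sin (@?f x)) _ _ => eapply (@drv_sin _ f); dv
  | |- drv (fun x => cos (@?f x)) _ _ => eapply (@drv_cos _ f); dv
  | |- drv (fun x => expR (@?f x)) _ _ => eapply (@drv_expR _ f); dv
  | |- drv (fun x => ln (@?f x)) _ _ => eapply (@drv_ln _ f); [|dv]
  | |- drv (fun x => (@?f x)^-1) _ _ => first [exact: drv_cst | eapply (@drvV _ f); [|dv]]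
  | |- drv (@sin _) _ _ => eapply (drv_sin (drv_id _))
  | |- drv (@cos _) _ _ => eapply (drv_cos (drv_id _))
  | |- drv (@expR _) _ _ => eapply (drv_expR (drv_id _))
  | |- drv (fun x => x) _ _ => exact: drv_id
  | |- drv (fun x => ?c) _ _ => first [exact: drv_cst | eassumption | idtac]
  | |- _ => try eassumption
  end.

Section norm_bounds.
Variable R : realType.
Implicit Types x y a b : R.

Lemma nbM x y a b : `|x| <= a -> `|y| <= b -> `|x * y| <= a * b.
Proof. by move=> hx hy; rewrite normrM ler_pM. Qed.

Lemma nbD x y a b : `|x| <= a -> `|y| <= b -> `|x + y| <= a + b.
Proof. by move=> hx hy; rewrite (le_trans (ler_normD _ _))// lerD. Qed.

Lemma nbN x a : `|x| <= a -> `|- x| <= a. Proof. by rewrite normrN. Qed.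

Lemma nb_sin x : `|sin x| <= 1. Proof. by rewrite ler_norml sin_geN1 sin_le1. Qed.

Lemma nb_cos x : `|cos x| <= 1. Proof. by rewrite ler_norml cos_geN1 cos_le1. Qed.

End norm_bounds.

(* [nb] proves [`|e| <= ?B], leaving the atoms. *)
Ltac nb := first [eassumption | lazymatch goal with
  | |- is_true (`|?f + ?g| <= _) => eapply (@nbD _ f g); nb
  | |- is_true (`|?f * ?g| <= _) => eapply (@nbM _ f g); nb
  | |- is_true (`|- ?f| <= _) => eapply (@nbN _ f); nb
  | |- is_true (`|sin _| <= _) => eapply nb_sin
  | |- is_true (`|cos _| <= _) => eapply nb_cos
  | |- _ => idtac
  end].

(** * Rotation invariance *)

Section logistic.
Variable R : realType.

(** The logistic function, whose derivative is a polynomial in itself. *)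
Definition sg (u : R) : R := (1 + expR (- u))^-1.

Lemma sg_den (u : R) : 1 + expR (- u) != 0.
Proof. by rewrite gt_eqF// addr_gt0// expR_gt0. Qed.

Lemma sg_ge0 u : 0 <= sg u.
Proof. by rewrite invr_ge0 addr_ge0// expR_ge0. Qed.

Lemma sg_le1 u : sg u <= 1.
Proof. by rewrite invf_le1 ?addr_gt0 ?expR_gt0// lerDl expR_ge0. Qed.

Lemma norm_sg u : `|sg u| <= 1.
Proof. by rewrite ger0_norm ?sg_le1// sg_ge0. Qed.

Lemma is_derive_sg (u : R) : is_derive u (1 : R) sg (sg u * (1 - sg u)).
Proof.
have -> : sg u * (1 - sg u) = - (1 + expR (- u)) ^- 2 *: (0 + (- 1) * expR (- u)).
  by rewrite /sg /GRing.scale /=; have := sg_den u => h; field.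
apply: is_deriveV; first exact: sg_den.
apply: is_deriveD; rewrite mulrC; apply: (is_derive1_comp (f := expR) (g := -%R)).
Qed.

Lemma sg_le_exp u : sg u <= expR u.
Proof.
rewrite /sg -[leRHS]invrK -expRN lef_pV2 ?posrE ?addr_gt0 ?expR_gt0//.
by rewrite lerDr.
Qed.

Lemma sg_ge_exp u : 1 - expR (- u) <= sg u.
Proof.
rewrite /sg -[leRHS]div1r ler_pdivlMr ?addr_gt0 ?expR_gt0//.
by have := sqr_ge0 (expR (- u)); lra.
Qed.

Lemma expRN_nat_le (n : nat) : expR (- n%:R : R) <= n.+1%:R^-1.
Proof.
rewrite expRN lef_pV2 ?posrE ?expR_gt0// -natr1 addrC; exact: expR_ge1Dx.
Qed.

(** The shift by [n] makes the limit vanish at [c = 0], so that the limit is the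
    indicator of an open half line. *)
Lemma cvg_sg (c : R) : sg (n%:R ^+ 2 * c - n%:R) @[n --> \oo] --> ((0 < c)%R%:R : R).
Proof.
have h0 : (n.+1%:R^-1 : R) @[n --> \oo] --> (0 : R).
  have := @cvg_harmonic R; exact.
have [c0|c0] := ltP 0 c; last first.
  apply: (@squeeze_cvgr _ _ _ _ (cst 0) (fun n => n.+1%:R^-1)) => //; last exact: cvg_cst.
  apply: nearW => n; rewrite sg_ge0 /=.
  apply: (le_trans (sg_le_exp _)); apply: le_trans (expRN_nat_le n).
  by rewrite ler_expR gerDr mulr_ge0_le0// exprn_ge0.
have h1 : (1 - n.+1%:R^-1 : R) @[n --> \oo] --> (1 : R).
  by rewrite -[X in _ --> X]subr0; apply: cvgB => //; exact: cvg_cst.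
apply: (@squeeze_cvgr _ _ _ _ (fun n => 1 - n.+1%:R^-1) (cst 1)) => //; last exact: cvg_cst.
near=> n; rewrite sg_le1 andbT.
apply: le_trans (sg_ge_exp _); rewrite lerD2l lerN2.
apply: le_trans (expRN_nat_le n); rewrite ler_expR lerN2.
have hn : 2 / c <= n%:R.
  by near: n; exact: nbhs_infty_ger.
have : 2 <= n%:R * c by move: hn; rewrite ler_pdivrMr.
have : 0 <= (n%:R : R) by [].
by rewrite expr2; nra.
Unshelve. all: by end_near. Qed.

End logistic.

Section octants.
Variable R : realType.
Implicit Types x : sphere R.

Definition c0 x : R := pt x 0 ord0.
Definition c1 x : R := pt x 0 (inord 1).
Definition c2 x : R := pt x 0 ord_max.

Lemma measurable_c0 : measurable_fun setT c0. Proof. exact: measurable_coord. Qed.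
Lemma measurable_c1 : measurable_fun setT c1. Proof. exact: measurable_coord. Qed.
Lemma measurable_c2 : measurable_fun setT c2. Proof. exact: measurable_coord. Qed.

Lemma sdotE x y : sdot x y = c0 x * c0 y + c1 x * c1 y + c2 x * c2 y.
Proof. by rewrite /sdot dotE. Qed.

Lemma unitE x : c0 x ^+ 2 + c1 x ^+ 2 + c2 x ^+ 2 = 1.
Proof. by rewrite -(sdot1 x) sdotE; ring. Qed.

Lemma c_lt2 x : [/\ c0 x < 2, c1 x < 2 & c2 x < 2].
Proof.
have h := unitE x; have a := sqr_ge0 (c0 x); have b := sqr_ge0 (c1 x); have c := sqr_ge0 (c2 x).
by split; rewrite ltNge; apply/negP => h2; nra.
Qed.

Definition octant (r s t : R) : set (sphere R) := [set x | [/\ c0 x < r, c1 x < s & c2 x < t]].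

Definition octants : set (set (sphere R)) := [set A | exists r s t, A = octant r s t].

Lemma measurable_octants : @measurable _ (sphere R) = <<s octants >>.
Proof.
apply/seteqP; split; last first.
  apply: smallest_sub; first exact: sigma_algebra_measurable.
  move=> _ [r [s [t ->]]].
  have -> : octant r s t = (c0 @^-1` `]-oo, r[%classic `&` c1 @^-1` `]-oo, s[%classic)
     `&` c2 @^-1` `]-oo, t[%classic.
    apply/seteqP; split => x /=; rewrite /octant /= !in_itv /=; first by move=> [].
    by move=> [[]].
  apply: measurableI; [apply: measurableI|]; rewrite -[X in measurable X]setTI.
  - exact: measurable_c0.
  - exact: measurable_c1.
  - exact: measurable_c2.
have key (f : sphere R -> R) : (forall r, <<s octants >> (f @^-1` `]-oo, r[%classic)) ->
    forall B, measurable B -> <<s octants >> (f @^-1` B).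
  move=> fo B mB; rewrite -[X in <<s _ >> X]setTI.
  have : measurable_fun (setT : set (g_sigma_algebraType octants)) (f : g_sigma_algebraType octants -> R).
    apply: (@measurability _ _ _ _ _ _ (@RGenInftyO.G R)); first exact: RGenInftyO.measurableE.
    by move=> _ [_ [r ->] <-]; rewrite setTI; exact: fo.
  by apply.
apply: smallest_sub; first exact: smallest_sigma_algebra.
rewrite -bigcup_mkord_ord => A [i /= i3 [B mB <-]]; rewrite setTI.
have octE r s t : <<s octants >> (octant r s t).
  by apply: sub_sigma_algebra; exists r, s, t.
case: i i3 => [|[|[|//]]] _.
- apply: key mB => r; have -> : @sphere_coord R (inord 0) @^-1` `]-oo, r[%classic = octant r 2 2.
    have -> : inord 0 = ord0 :> 'I_3 by apply: val_inj; rewrite /= inordK.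
    apply/seteqP; split => x; rewrite /octant /= in_itv /= -/(c0 x); last by move=> [].
    by move=> ?; have [] := c_lt2 x; split.
  exact: octE.
- apply: key mB => r; have -> : @sphere_coord R (inord 1) @^-1` `]-oo, r[%classic = octant 2 r 2.
    apply/seteqP; split => x; rewrite /octant /= in_itv /= -/(c1 x); last by move=> [].
    by move=> ?; have [] := c_lt2 x; split.
  exact: octE.
- apply: key mB => r; have -> : @sphere_coord R (inord 2) @^-1` `]-oo, r[%classic = octant 2 2 r.
    have -> : inord 2 = ord_max :> 'I_3 by apply: val_inj; rewrite /= inordK.
    apply/seteqP; split => x; rewrite /octant /= in_itv /= -/(c2 x); last by move=> [].
    by move=> ?; have [] := c_lt2 x; split.
  exact: octE.
Qed.

Definition psi (n : nat) (r s t : R) (x : sphere R) : R :=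
  sg (n%:R ^+ 2 * (r - c0 x) - n%:R) * sg (n%:R ^+ 2 * (s - c1 x) - n%:R)
  * sg (n%:R ^+ 2 * (t - c2 x) - n%:R).

Lemma measurable_sg : measurable_fun setT (@sg R).
Proof.
apply: continuous_measurable_fun => u; apply/differentiable_continuous/derivable1_diffP.
by case: (is_derive_sg u).
Qed.

Lemma measurable_psi n r s t : measurable_fun setT (psi n r s t).
Proof.
have h (a : R) (f : sphere R -> R) : measurable_fun setT f ->
    measurable_fun setT (fun x => sg (n%:R ^+ 2 * (a - f x) - n%:R)).
  move=> mf; apply: measurableT_comp; first exact: measurable_sg.
  by apply: measurable_funB => //; apply: measurable_funM => //; exact: measurable_funB.
apply: measurable_funM; [apply: measurable_funM|]; apply: h.
- exact: measurable_c0.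
- exact: measurable_c1.
- exact: measurable_c2.
Qed.

Lemma norm_psi n r s t x : `|psi n r s t x| <= 1.
Proof.
rewrite /psi 2!normrM -[leRHS]mul1r ler_pM ?norm_sg ?mulr_ge0//.
by rewrite -[leRHS]mul1r ler_pM ?norm_sg.
Qed.

Lemma cvg_psi r s t x : psi n r s t x @[n --> \oo] --> (\1_(octant r s t) x : R).
Proof.
have -> : \1_(octant r s t) x = (0 < r - c0 x)%R%:R * (0 < s - c1 x)%R%:R * (0 < t - c2 x)%R%:R :> R.
  rewrite !subr_gt0 -!natrM !mulnb indicE; congr (_%:R); congr nat_of_bool.
  apply/idP/idP; rewrite inE /octant /=; first by move=> [-> -> ->].
  by move=> /andP[/andP[-> ->] ->].
by apply: cvgM; [apply: cvgM|]; exact: cvg_sg.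
Qed.

(** The [psi n r s t] converge to the indicators of the open octants, a
    generating family stable under intersections. *)
Lemma psi_measure_unique (m1 m2 : {finite_measure set (sphere R) -> \bar R}) :
  (forall n r s t, \int[m1]_x psi n r s t x = \int[m2]_x psi n r s t x) ->
  forall A, measurable A -> m1 A = m2 A.
Proof.
move=> E A mA.
apply: (measure_unique octants (fun=> octant 2 2 2)) => //.
- exact: measurable_octants.
- move=> _ _ [r [s [t ->]]] [r' [s' [t' ->]]].
  exists (Num.min r r'), (Num.min s s'), (Num.min t t').
  apply/seteqP; split => x; rewrite /octant /= !lt_min.
    by move=> [[-> -> ->] [-> -> ->]].
  by move=> [/andP[-> ->] /andP[-> ->] /andP[-> ->]].
- by move=> _; exists 2, 2, 2.
- apply/seteqP; split => // x _; exists 0%N => //; exact: c_lt2.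
- move=> _ [r [s [t ->]]].
  have mo : measurable (octant r s t).
    by rewrite measurable_octants; apply: sub_sigma_algebra; exists r, s, t.
  have key (m : {finite_measure set (sphere R) -> \bar R}) :
      \int[m]_x psi n r s t x @[n --> \oo] --> \int[m]_x \1_(octant r s t) x.
    apply: (Rint_dct1 (g := cst 1)) => //.
    - by move=> n; exact: measurable_psi.
    - by move=> x; exact: cvg_psi.
    - exact: itg_cst.
    - by move=> n x; exact: norm_psi.
  have : \int[m1]_x \1_(octant r s t) x = \int[m2]_x \1_(octant r s t) x :> R.
    rewrite -(cvg_lim (@Rhausdorff R) (key m1)) -(cvg_lim (@Rhausdorff R) (key m2)).
    by congr (limn _); apply/funext => n; exact: E.
  rewrite /Rintegral !integral_indic// !setIT => h.
  by rewrite -[LHS]fineK ?fin_num_measure// h fineK// fin_num_measure.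
- move=> _; rewrite ltey_eq fin_num_measure//.
  by rewrite measurable_octants; apply: sub_sigma_algebra; exists 2, 2, 2.
Qed.

End octants.

(** * Rotations *)

Section rotation.
Variable R : realType.
Variables (f s : R).
Implicit Types x : sphere R.

(** Rotation of angle [s] about the horizontal axis [(cos f, sin f, 0)]. *)
Let p x := cos f * c0 x + sin f * c1 x.
Let q x := cos f * c1 x - sin f * c0 x.
Let q' x := cos s * q x - sin s * c2 x.

Definition rotv x : 'rV[R]_3 :=
  \row_(i < 3) [:: cos f * p x - sin f * q' x; sin f * p x + cos f * q' x;
                   sin s * q x + cos s * c2 x]`_i.

Let cs2 (a : R) : cos a ^+ 2 + sin a ^+ 2 = 1. Proof. exact: cos2Dsin2. Qed.

Lemma rot_unit x : dot (rotv x) (rotv x) == 1.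
Proof.
rewrite dotE !mxE /= inordK// -(unitE x).
have hf := cs2 f; have hs := cs2 s; rewrite /= /q' /q /p.
set a := c0 x; set b := c1 x; set c := c2 x.
set cf := cos f in hf *; set sf := sin f in hf *; set c' := cos s in hs *; set s' := sin s in hs *.
apply/eqP; transitivity ((cf ^+ 2 + sf ^+ 2) * ((cf * a + sf * b) ^+ 2) +
   (cf ^+ 2 + sf ^+ 2) * (c' * (cf * b - sf * a) - s' * c) ^+ 2 + (s' * (cf * b - sf * a) + c' * c) ^+ 2).
  by ring.
rewrite hf !mul1r.
transitivity ((cf * a + sf * b) ^+ 2 + (c' ^+ 2 + s' ^+ 2) * ((cf * b - sf * a) ^+ 2 + c ^+ 2)); first by ring.
rewrite hs mul1r.
transitivity ((cf ^+ 2 + sf ^+ 2) * (a ^+ 2 + b ^+ 2) + c ^+ 2); first by ring.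
by rewrite hf mul1r.
Qed.

Definition rot x : sphere R := Sphere (rot_unit x).

Lemma c0_rot x : c0 (rot x) = cos f * p x - sin f * q' x.
Proof. by rewrite /c0 /= mxE. Qed.

Lemma c1_rot x : c1 (rot x) = sin f * p x + cos f * q' x.
Proof. by rewrite /c1 /= mxE /= inordK. Qed.

Lemma c2_rot x : c2 (rot x) = sin s * q x + cos s * c2 x.
Proof. by rewrite {1}/c2 /= mxE. Qed.

Lemma sdot_rot x y : sdot (rot x) (rot y) = sdot x y.
Proof.
rewrite !sdotE !c0_rot !c1_rot !c2_rot /q' /q /p.
have hf := cs2 f; have hs := cs2 s.
set a := c0 x; set b := c1 x; set c := c2 x; set d := c0 y; set e := c1 y; set g := c2 y.
set cf := cos f in hf *; set sf := sin f in hf *; set c' := cos s in hs *; set s' := sin s in hs *.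
transitivity ((cf ^+ 2 + sf ^+ 2) * ((cf * a + sf * b) * (cf * d + sf * e)) +
   (cf ^+ 2 + sf ^+ 2) * ((c' * (cf * b - sf * a) - s' * c) * (c' * (cf * e - sf * d) - s' * g)) +
   (s' * (cf * b - sf * a) + c' * c) * (s' * (cf * e - sf * d) + c' * g)); first by ring.
rewrite hf !mul1r.
transitivity ((cf * a + sf * b) * (cf * d + sf * e)
  + (c' ^+ 2 + s' ^+ 2) * ((cf * b - sf * a) * (cf * e - sf * d) + c * g)); first by ring.
rewrite hs mul1r.
transitivity ((cf ^+ 2 + sf ^+ 2) * (a * d + b * e) + c * g); first by ring.
by rewrite hf mul1r.
Qed.

Lemma measurable_from_coords d (T : measurableType d) (h : T -> sphere R) :
  measurable_fun setT (fun t => c0 (h t)) -> measurable_fun setT (fun t => c1 (h t)) ->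
  measurable_fun setT (fun t => c2 (h t)) -> measurable_fun setT h.
Proof.
move=> h0 h1 h2. apply: (@measurability _ _ T (sphere R) setT h (@octants R)).
  exact: measurable_octants.
move=> _ [_ [r [u [v ->]]] <-]; rewrite setTI.
have -> : h @^-1` octant r u v = ((fun t => c0 (h t)) @^-1` `]-oo, r[%classic
   `&` (fun t => c1 (h t)) @^-1` `]-oo, u[%classic)
     `&` (fun t => c2 (h t)) @^-1` `]-oo, v[%classic.
  apply/seteqP; split => x /=; rewrite /octant /= !in_itv /=; first by move=> [].
  by move=> [[]].
by apply: measurableI; [apply: measurableI|]; rewrite -[X in measurable X]setTI;
  [exact: h0|exact: h1|exact: h2].
Qed.

Lemma measurable_rot : measurable_fun setT rot.
Proof.
have m0 := @measurable_c0 R; have m1 := @measurable_c1 R; have m2 := @measurable_c2 R.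
apply: measurable_from_coords.
- by rewrite (funext c0_rot : (fun x => c0 (rot x)) = _) /q' /q /p; meas.
- by rewrite (funext c1_rot : (fun x => c1 (rot x)) = _) /q' /q /p; meas.
- by rewrite (funext c2_rot : (fun x => c2 (rot x)) = _) /q; meas.
Qed.

End rotation.

Lemma cts_flow (R : realType) (K : R) (d e h k0 k1 k2 a b c : R -> R) :
  continuous d -> continuous e -> continuous h -> continuous k0 -> continuous k1 -> continuous k2 ->
  continuous a -> continuous b -> continuous c ->
  continuous (fun x => d x * h x + e x * (- K * h x * ((1 - k0 x) * a x + (1 - k1 x) * b x + (1 - k2 x) * c x))).
Proof. by move=> h1 h2 h3 h4 h5 h6 h7 h8 h9; cts. Qed.

Section rotation_flow.
Variable R : realType.
Notation boxm := (seg 0 (@pi R) \x seg 0 (2 * pi))%E.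

Lemma itg_boxm C (h : R * R -> R) : measurable_fun setT h -> (forall w, `|h w| <= C) ->
  itg boxm h.
Proof.
move=> mh hC; apply: (@itg_prod_bound _ _ _ _ _ (seg 0 pi) (seg 0 (2 * pi)) _ (cst (C * pi))) => //.
  exact: itg_cst.
move=> y; apply: (@le_trans _ _ (\int[seg 0 pi]_x (cst C%:E) x)%E).
  apply: ge0_le_integral => //.
  - apply/measurable_EFinP; apply: measurableT_comp => //.
    exact: measurableT_comp mh (measurable_pair2 y).
  - by move=> x _; rewrite lee_fin.
by rewrite integral_cst// [X in (_ * X)%E](seg_setT (pi_ge0 R)) subr0 -EFinM.
Qed.

Lemma ae_box (P : R * R -> Prop) : (forall w, 0 <= w.1 <= pi -> P w) -> {ae boxm, forall w, P w}.
Proof.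
move=> hP; exists ((~` `[0, pi]%classic) `*` setT); split.
- apply: measurableX => //; exact: measurableC.
- rewrite [LHS]product_measure1E//; last exact: measurableC.
  by rewrite [X in (X * _)%E](_ : _ = 0%E) ?mul0e// /= /seg /mrestr setICl measure0.
- by move=> w /= nP; split => // h; apply/nP/hP; move: h; rewrite /= in_itv.
Qed.

Lemma Rint_area (F : sphere R -> R) : itg (@area R) F ->
  itg boxm (fun w => F (spherical w) * `|sin w.1|) /\
  \int[@area R]_x F x = \int[boxm]_w (F (spherical w) * `|sin w.1|).
Proof.
move=> iF; have mabs : measurable_fun setT (fun w : R * R => `|sin w.1|) by meas.
exact: (@itg_pushed _ _ _ _ R boxm (@area R) (@spherical R) (fun w => `|sin w.1|)
  (@measurable_spherical R) mabs (fun w => normr_ge0 _) (@area_pushed R) F iF).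
Qed.

Variables (f r u v : R) (n : nat).

Let K : R := n%:R ^+ 2.
Let S (a b : R) := sg (K * (a - b) - n%:R).

(* The three coordinates of the rotated point and their partial derivatives,
   in polar coordinates about the vertical axis. *)
Let P (th t : R) := sin th * cos (t - f).
Let Q (th t : R) := sin th * sin (t - f).
Let Q' (s th t : R) := cos s * Q th t - sin s * cos th.
Let X0 s th t := cos f * P th t - sin f * Q' s th t.
Let X1 s th t := sin f * P th t + cos f * Q' s th t.
Let X2 s th t := sin s * Q th t + cos s * cos th.

Let H s th t := S r (X0 s th t) * S u (X1 s th t) * S v (X2 s th t).

Let HE s th t : H s th t = psi n r u v (rot f s (spherical (th, t))).
Proof.
have h0 : c0 (spherical (th, t)) = sin th * cos t by rewrite /c0 /= mxE.
have h1 : c1 (spherical (th, t)) = sin th * sin t by rewrite /c1 /= mxE /= inordK.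
have h2 : c2 (spherical (th, t)) = cos th by rewrite /c2 /= mxE.
rewrite /H /psi c0_rot c1_rot c2_rot h0 h1 h2.
rewrite /X0 /X1 /X2 /Q' /Q /P cosB sinB.
by congr (S _ _ * S _ _ * S _ _); ring.
Qed.

(* The derivative of [H] when the coordinates have derivatives [a], [b], [c]. *)
Let dH s th t a b c := - K * H s th t *
  ((1 - S r (X0 s th t)) * a + (1 - S u (X1 s th t)) * b + (1 - S v (X2 s th t)) * c).

Let drvS (g : R -> R) y a b : drv g y a ->
  drv (fun z => S b (g z)) y (- K * S b (g y) * (1 - S b (g y)) * a).
Proof.
move=> hg; have hu : drv (fun z => K * (b - g z) - n%:R) y (- K * a).
  by apply: drv_eq; [dv|ring].
apply: drv_eq; first exact: (drv_comp (is_derive_sg _) hu).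
by rewrite /S; ring.
Qed.

Let drvH (g0 g1 g2 : R -> R) (s th t : R -> R) y a b c :
  drv (fun z => X0 (s z) (th z) (t z)) y a -> drv (fun z => X1 (s z) (th z) (t z)) y b ->
  drv (fun z => X2 (s z) (th z) (t z)) y c ->
  drv (fun z => H (s z) (th z) (t z)) y (dH (s y) (th y) (t y) a b c).
Proof.
move=> h0 h1 h2; apply: drv_eq.
  by apply: drvM; [apply: drvM|]; apply: drvS; eassumption.
by rewrite /dH /H; ring.
Qed.

Let Q1 s th t := - sin s * Q th t - cos s * cos th.
Let dsH s th t := dH s th t (- sin f * Q1 s th t) (cos f * Q1 s th t)
   (cos s * Q th t - sin s * cos th).

Let drvHs th t s : drv (fun z => H z th t) s (dsH s th t).
Proof.
apply: (drvH (fun=> 0) (fun=> 0) (fun=> 0) (s := fun z => z) (th := fun=> th) (t := fun=> t)).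
- by rewrite /X0 /Q'; apply: drv_eq; [dv|rewrite /Q1; ring].
- by rewrite /X1 /Q'; apply: drv_eq; [dv|rewrite /Q1; ring].
- by rewrite /X2; apply: drv_eq; [dv|ring].
Qed.

Let P2 th t := cos th * cos (t - f).
Let Q2 s th t := cos s * (cos th * sin (t - f)) + sin s * sin th.
Let dthH s th t := dH s th t (cos f * P2 th t - sin f * Q2 s th t)
   (sin f * P2 th t + cos f * Q2 s th t) (sin s * (cos th * sin (t - f)) - cos s * sin th).

Let drvHth s t th : drv (fun z => H s z t) th (dthH s th t).
Proof.
apply: (drvH (fun=> 0) (fun=> 0) (fun=> 0) (s := fun=> s) (th := fun z => z) (t := fun=> t)).
- by rewrite /X0 /Q' /P /Q; apply: drv_eq; [dv|rewrite /P2 /Q2; ring].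
- by rewrite /X1 /Q' /P /Q; apply: drv_eq; [dv|rewrite /P2 /Q2; ring].
- by rewrite /X2 /Q; apply: drv_eq; [dv|ring].
Qed.

Let Q3 s th t := cos s * P th t.
Let dtH s th t := dH s th t (- cos f * Q th t - sin f * Q3 s th t)
   (- sin f * Q th t + cos f * Q3 s th t) (sin s * P th t).

Let drvHt s th t : drv (fun z => H s th z) t (dtH s th t).
Proof.
apply: (drvH (fun=> 0) (fun=> 0) (fun=> 0) (s := fun=> s) (th := fun=> th) (t := fun z => z)).
- by rewrite /X0 /Q' /P /Q; apply: drv_eq; [dv|rewrite /Q3 /P /Q; ring].
- by rewrite /X1 /Q' /P /Q; apply: drv_eq; [dv|rewrite /Q3 /P /Q; ring].
- by rewrite /X2 /Q; apply: drv_eq; [dv|rewrite /P; ring].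
Qed.

(* The rotation flow is divergence free. *)
Let flow_div s th t : sin th * dsH s th t =
  - ((cos th * sin (t - f) * H s th t + sin th * sin (t - f) * dthH s th t)
     + (- cos th * sin (t - f) * H s th t + cos th * cos (t - f) * dtH s th t)).
Proof.
have h2 := cos2Dsin2 (t - f); have h3 : cos (t - f) ^+ 2 = 1 - sin (t - f) ^+ 2 by lra.
rewrite /dsH /dthH /dtH /dH /Q1 /P2 /Q2 /Q3 /P /Q; ring: h3.
Qed.

Let mS d (T : measurableType d) (g : T -> R) a : measurable_fun setT g ->
  measurable_fun setT (fun x => S a (g x)).
Proof. by move=> mg; apply: (measurableT_comp (@measurable_sg R)); meas. Qed.

Let ctS (g : R -> R) a : continuous g -> continuous (fun x => S a (g x)).
Proof.
move=> cg; apply: (@cts_comp _ (@sg R)); last by cts.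
by move=> y; exact: drv_continuous (is_derive_sg y).
Qed.

Let mX0 s : measurable_fun setT (fun w : R * R => X0 s w.1 w.2).
Proof. by rewrite /X0 /Q' /P /Q; meas. Qed.
Let mX1 s : measurable_fun setT (fun w : R * R => X1 s w.1 w.2).
Proof. by rewrite /X1 /Q' /P /Q; meas. Qed.
Let mX2 s : measurable_fun setT (fun w : R * R => X2 s w.1 w.2).
Proof. by rewrite /X2 /Q' /P /Q; meas. Qed.

Let mH s : measurable_fun setT (fun w : R * R => H s w.1 w.2).
Proof. by rewrite /H; meas; apply: mS. Qed.

Let mdH s (a b c : R * R -> R) : measurable_fun setT a -> measurable_fun setT b ->
  measurable_fun setT c -> measurable_fun setT (fun w : R * R => dH s w.1 w.2 (a w) (b w) (c w)).
Proof.
move=> ma mb mc; have mh := mH s.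
by rewrite /dH; meas; apply: mS.
Qed.

Let nS a x : `|S a x| <= 1. Proof. exact: norm_sg. Qed.
Let nS1 a x : `|1 - S a x| <= 1.
Proof. by rewrite /S ger0_norm ?subr_ge0 ?sg_le1// gerBl sg_ge0. Qed.

Let nH s th t : `|H s th t| <= 1.
Proof. by rewrite HE norm_psi. Qed.

Let ndH s th t a b c A B C : `|a| <= A -> `|b| <= B -> `|c| <= C ->
  `|dH s th t a b c| <= K * (A + B + C).
Proof.
move=> ha hb hc; have K0 : 0 <= K by rewrite /K sqr_ge0.
have hK : `|K| <= K by rewrite ger0_norm.
have h := nH s th t; have h0 := nS1 r (X0 s th t); have h1 := nS1 u (X1 s th t).
have h2 := nS1 v (X2 s th t).
rewrite /dH; apply: le_trans; first by nb.
by rewrite !mul1r mulr1.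
Qed.

(** The boundary terms vanish because [sin th] does at the poles. *)
Let int_th s t : \int[seg 0 pi]_th (cos th * sin (t - f) * H s th t
  + sin th * sin (t - f) * dthH s th t) = 0.
Proof.
apply: (etrans (FTC_drv (g := fun th => sin th * sin (t - f) * H s th t) (pi_ge0 R) _ _)); last first.
- by rewrite sinpi sin0 !mul0r subrr.
- have cH : continuous (fun th => H s th t) by move=> th; exact: drv_continuous (drvHth s t th).
  have k0 : continuous (fun th => S r (X0 s th t)) by apply: ctS; rewrite /X0 /Q' /P /Q; cts.
  have k1 : continuous (fun th => S u (X1 s th t)) by apply: ctS; rewrite /X1 /Q' /P /Q; cts.
  have k2 : continuous (fun th => S v (X2 s th t)) by apply: ctS; rewrite /X2 /Q' /P /Q; cts.
  by rewrite /dthH /dH /P2 /Q2; apply: cts_flow => //; cts.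
- move=> th; have h := drvHth s t th; apply: drv_eq; first by dv.
  by rewrite /=; ring.
Qed.

(** The boundary terms cancel by periodicity. *)
Let int_t s th : \int[seg 0 (2 * pi)]_t (- cos th * sin (t - f) * H s th t
  + cos th * cos (t - f) * dtH s th t) = 0.
Proof.
have pi2 : 0 <= 2 * pi :> R by rewrite mulr_ge0 ?pi_ge0.
apply: (etrans (FTC_drv (g := fun t => cos th * cos (t - f) * H s th t) pi2 _ _)); last first.
- have per (g : R) : cos (g + 2 * pi) = cos g /\ sin (g + 2 * pi) = sin g.
    by rewrite mulrC -[2]/(2%:R) mulr_natr cosD sinD cos2pi sin2pi; split; ring.
  have pc : cos (2 * pi - f) = cos (0 - f) by rewrite (_ : 2 * pi - f = (0 - f) + 2 * pi) ?(per _).1//; ring.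
  have ps : sin (2 * pi - f) = sin (0 - f) by rewrite (_ : 2 * pi - f = (0 - f) + 2 * pi) ?(per _).2//; ring.
  by rewrite /H /X0 /X1 /X2 /Q' /P /Q pc ps subrr.
- have cH : continuous (fun t => H s th t) by move=> t; exact: drv_continuous (drvHt s th t).
  have k0 : continuous (fun t => S r (X0 s th t)) by apply: ctS; rewrite /X0 /Q' /P /Q; cts.
  have k1 : continuous (fun t => S u (X1 s th t)) by apply: ctS; rewrite /X1 /Q' /P /Q; cts.
  have k2 : continuous (fun t => S v (X2 s th t)) by apply: ctS; rewrite /X2 /Q' /P /Q; cts.
  by rewrite /dtH /dH /Q3 /P /Q; apply: cts_flow => //; cts.
- move=> t; have h := drvHt s th t; apply: drv_eq; first by dv.
  by rewrite /=; ring.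
Qed.

Let mdth s : measurable_fun setT (fun w : R * R => dthH s w.1 w.2).
Proof. by rewrite /dthH /P2 /Q2; apply: mdH; meas. Qed.
Let mdt s : measurable_fun setT (fun w : R * R => dtH s w.1 w.2).
Proof. by rewrite /dtH /Q3 /P /Q; apply: mdH; meas. Qed.
Let mds s : measurable_fun setT (fun w : R * R => dsH s w.1 w.2).
Proof. by rewrite /dsH /Q1 /Q; apply: mdH; meas. Qed.

Let ndth s th t : `|dthH s th t| <= K * 8.
Proof.
rewrite (_ : 8 = 3 + 3 + 2); last by lra.
apply: ndH; (apply: le_trans; first by rewrite /P2 /Q2; nb); lra.
Qed.
Let ndt s th t : `|dtH s th t| <= K * 8.
Proof.
rewrite (_ : 8 = 3 + 3 + 2); last by lra.
apply: ndH; (apply: le_trans; first by rewrite /Q3 /P /Q; nb); lra.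
Qed.
Let nds s th t : `|dsH s th t| <= K * 8.
Proof.
rewrite (_ : 8 = 3 + 3 + 2); last by lra.
apply: ndH; (apply: le_trans; first by rewrite /Q1 /Q; nb); lra.
Qed.

Let int_ds s : \int[boxm]_w (dsH s w.1 w.2 * `|sin w.1|) = 0.
Proof.
pose A (w : R * R) := cos w.1 * sin (w.2 - f) * H s w.1 w.2 + sin w.1 * sin (w.2 - f) * dthH s w.1 w.2.
pose B (w : R * R) := - cos w.1 * sin (w.2 - f) * H s w.1 w.2 + cos w.1 * cos (w.2 - f) * dtH s w.1 w.2.
have mA : measurable_fun setT A by rewrite /A; have := mH s; have := mdth s; move=> *; meas.
have mB : measurable_fun setT B by rewrite /B; have := mH s; have := mdt s; move=> *; meas.
have iA : itg boxm A.
  apply: itg_boxm => // w; have := nH s w.1 w.2; have := ndth s w.1 w.2 => h1 h2.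
  by rewrite /A; nb.
have iB : itg boxm B.
  apply: itg_boxm => // w; have := nH s w.1 w.2; have := ndt s w.1 w.2 => h1 h2.
  by rewrite /B; nb.
transitivity (\int[boxm]_w (- (A w + B w))).
  apply: ae_eq_Rint.
  - by have := mds s => *; meas.
  - by meas.
  - apply: ae_box => w wpi; rewrite ger0_norm ?sin_ge0_pi// mulrC flow_div//.
rewrite RintN; last exact: itgD.
rewrite RintD// (Rint_prod21 iA).2 (Rint_prod12 iB).2.
rewrite Rint_eq0; last by move=> t; exact: int_th.
rewrite Rint_eq0; last by move=> t; exact: int_t.
by rewrite addr0 oppr0.
Qed.

Let I s := \int[boxm]_w (H s w.1 w.2 * `|sin w.1|).

Let drvI s : drv I s 0.
Proof.
have itgH z : itg boxm (fun w => H z w.1 w.2 * `|sin w.1|).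
  apply: (@itg_boxm 1); first by have := mH z => *; meas.
  move=> w; apply: le_trans; first by apply: nbM; [exact: nH|rewrite normr_id; exact: nb_sin].
  by rewrite mulr1.
have dE z w : derive1 (fun s => H s w.1 w.2 * `|sin w.1|) z = dsH z w.1 w.2 * `|sin w.1|.
  have h : drv (fun s => H s w.1 w.2 * `|sin w.1|) z (dsH z w.1 w.2 * `|sin w.1|).
    have h := drvHs w.1 w.2 z.
    by apply: drv_eq; [dv|rewrite /=; ring].
  by rewrite derive1E; case: h.
have hd z w : derivable (fun s => H s w.1 w.2 * `|sin w.1|) z 1.
  have h : drv (fun s => H s w.1 w.2 * `|sin w.1|) z (dsH z w.1 w.2 * `|sin w.1|).
    have h := drvHs w.1 w.2 z.
    by apply: drv_eq; [dv|rewrite /=; ring].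
  by case: h.
have K0 : 0 <= K by rewrite /K sqr_ge0.
pose ff z (w : R * R) := H z w.1 w.2 * `|sin w.1|.
have zI : `]s - 1, s + 1[%classic s by rewrite /= in_itv /= ltrDl ltrBlDr ltrDl ltr01.
have hG z w : `]s - 1, s + 1[%classic z -> setT w -> `|partial1of2 ff z w| <= cst (K * 8) w.
  move=> _ _; rewrite /partial1of2 dE.
  apply: le_trans; first by apply: nbM; [exact: nds|rewrite normr_id; exact: nb_sin].
  by rewrite mulr1.
have iG : boxm.-integrable setT (EFin \o cst (K * 8)).
  by apply: (@itg_boxm (K * 8)) => // w; rewrite /= ger0_norm// mulr_ge0.
have G0 (w : R * R) : 0 <= cst (K * 8) w by rewrite mulr_ge0.
have E := @differentiation_under_integral R _ _ boxm ff setT measurableT s (s - 1) (s + 1) zI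
  (fun z _ => itgH z) (fun z w _ _ => hd z w) _ G0 iG hG.
have E' := @derivable_under_integral R _ _ boxm ff setT measurableT s (s - 1) (s + 1) zI
  (fun z _ => itgH z) (fun z w _ _ => hd z w) _ G0 iG hG.
apply: DeriveDef; first exact: E'.
rewrite -derive1E E -[RHS](int_ds s); apply: eq_Rintegral => w _; exact: dE.
Qed.

(** The derivative in the angle vanishes: the rotation flow is divergence free,
    and in polar coordinates its divergence is a sum of two exact derivatives,
    each integrated in its own variable. *)
Lemma Rint_psi_rot s :
  \int[@area R]_x psi n r u v (rot f s x) = \int[@area R]_x psi n r u v x.
Proof.
have sE z : I z = \int[@area R]_x psi n r u v (rot f z x).
  have ip : itg (@area R) (fun x => psi n r u v (rot f z x)).
    apply: (@itg_bounded _ _ _ _ _ 1); last by move=> x; exact: norm_psi.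
    by apply: measurableT_comp; [exact: measurable_psi|exact: measurable_rot].
  rewrite (Rint_area ip).2.
  by apply: eq_Rintegral => -[th t] _; rewrite HE.
have rot0 x : rot f 0 x = x.
  have h := cos2Dsin2 f.
  apply: sphere_eq; apply/matrixP => i j; rewrite ord1 !mxE sin0 cos0 !mul1r !mul0r subr0 add0r.
  case: j => -[|[|[|//]]] jlt /=.
  - rewrite (_ : Ordinal jlt = ord0); last exact: val_inj.
    rewrite -/(c0 x); transitivity ((cos f ^+ 2 + sin f ^+ 2) * c0 x); first by ring.
    by rewrite h mul1r.
  - rewrite (_ : Ordinal jlt = inord 1); last by apply: val_inj; rewrite /= inordK.
    rewrite -/(c1 x); transitivity ((cos f ^+ 2 + sin f ^+ 2) * c1 x); first by ring.
    by rewrite h mul1r.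
  - by rewrite (_ : Ordinal jlt = ord_max); last exact: val_inj.
rewrite -sE (is_derive_0_is_cst s 0 drvI) sE.
by apply: eq_Rintegral => x _; rewrite rot0.
Qed.

End rotation_flow.

(** * Polar coordinates about an arbitrary point *)

Section rotated_area.
Variable R : realType.
Notation boxm := (seg 0 (@pi R) \x seg 0 (2 * pi))%E.

Definition area_rot (f s : R) := pushforward (@area R) (rot f s).

HB.instance Definition _ f s := Measure.copy (area_rot f s)
  (measure_function_pushforward__canonical__measure_function_Measure (@area R)
     (@measurable_rot R f s)).

Let area_rot_fin f s : fin_num_fun (area_rot f s).
Proof.
move=> A mA; rewrite /area_rot /pushforward fin_num_measure//.
by rewrite -[X in measurable X]setTI; exact: measurable_rot.
Qed.

HB.instance Definition _ f s := Measure_isFinite.Build _ _ _ (area_rot f s) (@area_rot_fin f s).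

(** The two measures integrate each [psi] alike. *)
Lemma area_rotE f s A : measurable A -> @area R A = @area R (rot f s @^-1` A).
Proof.
apply: (psi_measure_unique (m1 := @area R) (m2 := area_rot f s)) => n r u v.
rewrite -(Rint_psi_rot f r u v n s) /Rintegral.
by rewrite integral_pushforward//; [exact: measurable_rot|apply/measurable_EFinP; exact: measurable_psi
 |apply: (@itg_bounded _ _ _ _ _ 1); [apply: measurableT_comp; [exact: measurable_psi|exact: measurable_rot]
 |move=> x; exact: norm_psi]].
Qed.

Lemma unit_circle (a b : R) : a ^+ 2 + b ^+ 2 = 1 -> exists f, cos f = a /\ sin f = b.
Proof.
move=> ab.
have a1 : -1 <= a <= 1 by apply/andP; split; have := sqr_ge0 b; have := sqr_ge0 a; nra.
have sE : sin (acos a) = `|b|.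
  by rewrite sin_acos// -sqrtr_sqr; congr Num.sqrt; rewrite -ab; ring.
have [b0|b0] := leP 0 b.
  by exists (acos a); rewrite acosK// sE ger0_norm.
by exists (- acos a); rewrite cosN sinN acosK// sE ltr0_norm// opprK.
Qed.

Lemma sphere_ext (x y : sphere R) : c0 x = c0 y -> c1 x = c1 y -> c2 x = c2 y -> x = y.
Proof.
move=> e0 e1 e2; apply: sphere_eq; apply/matrixP => i j; rewrite ord1.
case: j => -[|[|[|//]]] jlt.
- by rewrite (_ : Ordinal jlt = ord0) //; apply: val_inj.
- by rewrite (_ : Ordinal jlt = inord 1) //; apply: val_inj => /=; rewrite inordK.
- by rewrite (_ : Ordinal jlt = ord_max) //; apply: val_inj.
Qed.

Lemma rot_north v : exists f s, rot f s (north R) = v.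
Proof.
have [h0 [h1 h2]] : c0 (north R) = 0 /\ c1 (north R) = 0 /\ c2 (north R) = 1.
  rewrite /c0 /c1 /c2 /= !mxE /=; split => //; split => //.
  by rewrite -val_eqE /= inordK.
have nv := unitE v.
have c21 : -1 <= c2 v <= 1.
  by apply/andP; split; have := sqr_ge0 (c0 v); have := sqr_ge0 (c1 v); nra.
pose s := acos (c2 v); have cs : cos s = c2 v by rewrite acosK.
have ss : sin s ^+ 2 = c0 v ^+ 2 + c1 v ^+ 2.
  by have := cos2Dsin2 s; rewrite cs -nv => h; lra.
have [s0|s0] := eqVneq (sin s) 0.
  exists 0, s; apply: sphere_ext.
  - rewrite c0_rot h0 h1 h2 s0 sin0 cos0; move: ss; rewrite s0 expr0n /= => ss.
    by have := sqr_ge0 (c0 v); have := sqr_ge0 (c1 v); nra.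
  - rewrite c1_rot h0 h1 h2 s0 sin0 cos0; move: ss; rewrite s0 expr0n /= => ss.
    by have := sqr_ge0 (c0 v); have := sqr_ge0 (c1 v); nra.
  - by rewrite c2_rot h0 h1 h2 cs; ring.
have [f [cf sf]] : exists f, cos f = - c1 v / sin s /\ sin f = c0 v / sin s.
  apply: unit_circle; rewrite !expr_div_n sqrrN -mulrDl addrC -ss divff//.
  by rewrite sqrf_eq0.
exists f, s; apply: sphere_ext.
- by rewrite c0_rot h0 h1 h2 sf; field.
- by rewrite c1_rot h0 h1 h2 cf; field.
- by rewrite c2_rot h0 h1 h2 cs; ring.
Qed.

(** The spherical coordinates are rotated so that their pole is [v]. The last
    property says that each meridian is a great circle leaving [v], with [P (pi
    / 2, t)] as its direction. *)
Lemma polar_exists v : exists P : R * R -> sphere R, [/\ measurable_fun setT P,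
  (forall A, measurable A -> @area R A = (\int[boxm]_w (\1_A (P w) * `|sin w.1|)%:E)%E),
  (forall w, sdot v (P w) = cos w.1) &
  (forall th t y, sdot (P (th, t)) y = sin th * sdot (P (pi / 2, t)) y + cos th * sdot v y)].
Proof.
have [f [s <-]] := rot_north v.
exists (fun w => rot f s (spherical w)); split.
- by apply: measurableT_comp; [exact: measurable_rot|exact: measurable_spherical].
- move=> A mA; rewrite (area_rotE f s mA) area_pushed//.
  by rewrite -[X in measurable X]setTI; exact: measurable_rot.
- move=> -[th t]; rewrite sdot_rot sdotE /c0 /c1 /c2 /= !mxE /= inordK//.
  rewrite -val_eqE /= inordK//=; ring.
- have lin u th t : sdot (spherical (th, t)) u =
     sin th * sdot (spherical (pi / 2, t)) u + cos th * sdot (north R) u.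
    rewrite !sdotE /c0 /c1 /c2 /= !mxE /= inordK// -val_eqE /= inordK//= sin_pihalf cos_pihalf.
    ring.
  move=> th t y.
  have rotS z : exists z', rot f s z' = z.
    have hf := cos2Dsin2 f; have hs := cos2Dsin2 s.
    exists (rot f (- s) z).
    have hf' : cos f ^+ 2 = 1 - sin f ^+ 2 by lra.
    have hs' : cos s ^+ 2 = 1 - sin s ^+ 2 by lra.
    apply: sphere_ext.
    + rewrite c0_rot !c0_rot !c1_rot !c2_rot cosN sinN; ring: hf' hs'.
    + rewrite c1_rot !c0_rot !c1_rot !c2_rot cosN sinN; ring: hf' hs'.
    + rewrite c2_rot !c0_rot !c1_rot !c2_rot cosN sinN; ring: hf' hs'.
  have [y' <-] := rotS y; rewrite !sdot_rot; exact: lin.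
Qed.

Lemma ge0_polar (P : R * R -> sphere R) (F : sphere R -> R) :
  measurable_fun setT P ->
  (forall A, measurable A -> @area R A = (\int[boxm]_w (\1_A (P w) * `|sin w.1|)%:E)%E) ->
  measurable_fun setT F -> (forall x, 0 <= F x) ->
  (\int[@area R]_x (F x)%:E = \int[boxm]_w (F (P w) * `|sin w.1|)%:E)%E.
Proof.
move=> mP hP mF F0; have mabs : measurable_fun setT (fun w : R * R => `|sin w.1|) by meas.
exact: (@ge0_integral_pushed _ _ _ _ R boxm (@area R) P (fun w => `|sin w.1|)
  mP mabs (fun w => normr_ge0 _) hP F mF F0).
Qed.

Lemma Rint_polar (P : R * R -> sphere R) (F : sphere R -> R) :
  measurable_fun setT P ->
  (forall A, measurable A -> @area R A = (\int[boxm]_w (\1_A (P w) * `|sin w.1|)%:E)%E) ->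
  itg (@area R) F ->
  itg boxm (fun w => F (P w) * `|sin w.1|) /\
  \int[@area R]_x F x = \int[boxm]_w (F (P w) * `|sin w.1|).
Proof.
move=> mP hP iF; have mabs : measurable_fun setT (fun w : R * R => `|sin w.1|) by meas.
exact: (@itg_pushed _ _ _ _ R boxm (@area R) P (fun w => `|sin w.1|)
  mP mabs (fun w => normr_ge0 _) hP F iF).
Qed.

(** Archimedes: the height is uniformly distributed. *)
Lemma ge0_area_D v (g : R -> R) : measurable_fun setT g -> (forall u, 0 <= g u) ->
  (\int[@area R]_x (g (D v x))%:E =
   (2 * pi)%:E * \int[seg 0 pi]_th (g (1 - cos th) * `|sin th|)%:E)%E.
Proof.
move=> mg g0; have [P [mP hP Pv _]] := polar_exists v.
have mF : measurable_fun setT (fun x : sphere R => g (D v x)).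
  by apply: (measurableT_comp mg); meas.
rewrite (ge0_polar mP hP mF)//.
have mh : measurable_fun setT (fun th : R => g (1 - cos th) * `|sin th|).
  have mc : measurable_fun setT (fun th : R => 1 - cos th) by meas.
  by have := measurableT_comp mg mc => ?; meas.
have mh2 : measurable_fun setT (fun w : R * R => g (1 - cos w.1) * `|sin w.1|).
  exact: (measurableT_comp mh measurable_fst).
transitivity (\int[boxm]_w (g (1 - cos w.1) * `|sin w.1|)%:E)%E.
  by apply: eq_integral => w _; rewrite /D Pv.
rewrite (@fubini_tonelli1 _ _ _ _ _ (seg 0 pi) (seg 0 (2 * pi))); last 2 first.
- exact/measurable_EFinP.
- by move=> w; rewrite lee_fin mulr_ge0.
rewrite /fubini_F /=.
under eq_integral do rewrite integral_cst// [X in (_ * X)%E](seg_setT _) ?subr0 ?mulr_ge0 ?pi_ge0// muleC.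
rewrite ge0_integralZl//.
- exact/measurable_EFinP.
- by move=> th _; rewrite lee_fin mulr_ge0.
- by rewrite lee_fin mulr_ge0 ?pi_ge0.
Qed.

(** Substituting [u = 1 - cos th], whose derivative is the density [sin th]. *)
Lemma Rint_D v (g G : R -> R) : continuous g -> (forall u, 0 <= u <= 2 -> drv G u (g u)) ->
  \int[@area R]_x g (D v x) = 2 * pi * (G 2 - G 0).
Proof.
move=> cg dG; have mg := continuous_measurable_fun cg.
have [P [mP hP Pv _]] := polar_exists v.
have [M HM] : exists M, forall u, 0 <= u <= 2 -> `|g u| <= M.
  have [M [_ HM]] : bounded_set [set g x | x in `[0, 2]%classic].
    apply: compact_bounded; apply: continuous_compact; last exact: segment_compact.
    exact: continuous_subspaceT.
  exists (M + 1) => u u02; apply: (HM (M + 1)); first by rewrite ltrDl.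
  by exists u => //=; rewrite in_itv.
have mgD : measurable_fun setT (fun x : sphere R => g (D v x)).
  by apply: (measurableT_comp mg); meas.
have iF : itg (@area R) (fun x : sphere R => g (D v x)).
  by apply: (@itg_bounded _ _ _ _ _ M) => // x; apply: HM; rewrite D_ge0 D_le2.
have [iF' ->] := Rint_polar mP hP iF.
rewrite (Rint_prod21 iF').2.
have cs : continuous (fun th : R => g (1 - cos th) * sin th).
  by apply: ctsM; [apply: (@cts_comp _ g (fun th => 1 - cos th)) => //; cts|cts].
have mcos1 : measurable_fun setT (fun th : R => g (1 - cos th)).
  by apply: continuous_measurable_fun; apply: (@cts_comp _ g (fun th => 1 - cos th)) => //; cts.
under eq_Rint => t.
  rewrite (_ : \int[_]_x _ = G 2 - G 0); first over.
  transitivity (\int[seg 0 pi]_th (g (1 - cos th) * `|sin th|)).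
    by apply: eq_Rint => th /=; rewrite /D Pv.
  transitivity (\int[seg 0 pi]_th (g (1 - cos th) * sin th)).
    apply: eq_Rint_seg.
    - by meas.
    - by meas.
    - by move=> th thpi; rewrite ger0_norm// sin_ge0_pi.
  rewrite (FTC_drv (g := fun th => G (1 - cos th)) (pi_ge0 R) _ cs).
    by rewrite cospi cos0; congr (G _ - G _); lra.
  move=> th; apply: drv_eq.
    apply: (@drv_comp _ G (fun th => 1 - cos th)); [apply: dG|dv].
    by rewrite subr_ge0 cos_le1 lerBlDr -lerBlDl (_ : 1 - 2 = -1) ?cos_geN1//; lra.
  by rewrite /=; ring.
rewrite Rintegral_cst// [X in fine X](seg_setT _) ?mulr_ge0 ?pi_ge0//= subr0; ring.
Qed.

Lemma ae_cos (c : R) : {ae seg 0 pi, forall th, cos th <> c}.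
Proof.
exists ([set acos c] `|` ~` `[0, pi]%classic); split.
- by apply: measurableU => //; exact: measurableC.
- apply/eqP; rewrite eq_le measure_ge0 andbT; apply: (le_trans (measureU2 _ _ _)) => //; first exact: measurableC.
  rewrite [X in (X + _)%E](_ : _ = 0%E); last exact: seg_set1.
  by rewrite add0e [X in (X <= _)%E](_ : _ = 0%E)// /= /seg /mrestr setICl measure0.
- move=> th /= h; have [thpi|/negP thpi] := boolP (th \in `[0, pi]); last by right.
  left; apply: contrapT => h2; apply: h => h3; apply: h2.
  by rewrite -h3 cosK// -in_itv.
Qed.

(** Circles are negligible; in particular points are, so that the singularities
    of the kernels do not matter. *)
Lemma ae_D_neq v (c : R) : {ae @area R, forall x, D v x <> c}.
Proof.
exists [set x | D v x = c]; split => //.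
- have mD : measurable_fun setT (fun x : sphere R => D v x) by meas.
  by rewrite -[X in measurable X]setTI; exact: (mD measurableT [set c]).
- pose g := \1_[set c] : R -> R.
  have mg : measurable_fun setT g by exact: measurable_indic.
  have -> : @area R [set x | D v x = c] = (\int[@area R]_x (g (D v x))%:E)%E.
    have mD : measurable_fun setT (fun x : sphere R => D v x) by meas.
    have mA : measurable [set x : sphere R | D v x = c].
      by rewrite -[X in measurable X]setTI; exact: (mD measurableT [set c]).
    rewrite -[LHS](_ : \int[@area R]_x (\1_[set x | D v x = c] x)%:E = _)%E; last first.
      by rewrite integral_indic// setIT.
    apply: eq_integral => x _; congr EFin; rewrite /g !indicE.
  rewrite ge0_area_D// (ae_eq_integral (cst 0%E))//.
  + by rewrite integral0 mule0.
  + apply/measurable_EFinP.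
    have mc : measurable_fun setT (fun th : R => 1 - cos th) by meas.
    by have := measurableT_comp mg mc => ?; meas.
  + apply: ae_mono (ae_cos (1 - c)) => th h _ /=.
    rewrite /g indicE memNset ?mul0r// => /= h2; apply: h; rewrite -h2; ring.
- by move=> x /= /contrapT.
Qed.

Lemma ae_neq v : {ae @area R, forall x, x <> v}.
Proof. by apply: ae_mono (ae_D_neq v 0) => x + xv; rewrite xv Dxx. Qed.

End rotated_area.

(** * Integrals of functions of the distance to a point *)

Section distance_integrals.
Variable R : realType.

Lemma seg_sub (a b : R) (h : R -> R) : 0 <= a -> measurable_fun setT h -> (forall x, 0 <= h x) ->
  (\int[seg a b]_x (h x)%:E = \int[seg 0 b]_x (h x * \1_`[a, +oo[%classic x)%:E)%E.
Proof.
move=> a0 mh h0.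
apply: (@ge0_integral_pushed _ _ _ _ R (seg 0 b) (seg a b) idfun (\1_`[a, +oo[%classic)) => //; first exact: measurable_id.
move=> A mA; under eq_integral do rewrite -[(_ * _)]/((\1_A \* \1_`[a, +oo[%classic) _) -indicI.
have mI : measurable (A `&` `[a, +oo[%classic : set R) by exact: measurableI.
have -> : (\int[seg 0 b]_x (\1_(A `&` `[a, +oo[%classic) (idfun x))%:E)%E = seg 0 b (A `&` `[a, +oo[%classic).
  by rewrite integral_indic// setIT.
transitivity (@lebesgue_measure R (A `&` `[a, +oo[%classic `&` `[0, b]%classic)); last by [].
rewrite -setIA; congr (lebesgue_measure (_ `&` _)); apply/seteqP; split => x /=; rewrite !in_itv /=.
  by move=> /andP[ax ->]; rewrite ax (le_trans a0 ax).
by move=> [/andP[-> _] /andP[_ ->]].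
Qed.

(** The integrand is only required to be continuous on the segment, as
    primitives of powers and logarithms are only available away from the origin.
    *)
Lemma FTC_loc (a b : R) (f F : R -> R) : a <= b -> measurable_fun setT f ->
  (forall x, a <= x <= b -> drv F x (f x)) ->
  (forall x, a <= x <= b -> {for x, continuous f}) ->
  itg (seg a b) f /\ \int[seg a b]_x f x = F b - F a.
Proof.
move=> ab mf dF cf.
have wcf : {within `[a, b], continuous f}.
  by apply: continuous_in_subspaceT => x /[!inE] /= /[!in_itv]; exact: cf.
have [M [_ HM]] : bounded_set [set f x | x in `[a, b]%classic].
  apply: compact_bounded; apply: continuous_compact; last exact: segment_compact.
  exact: wcf.
have itf : itg (seg a b) f.
  apply: (@itg_le_ae _ _ _ _ (cst (M + 1))) => //; last exact: itg_cst.
  apply: ae_mono (ae_seg a b) => x xab; apply: (HM (M + 1)); first by rewrite ltrDl.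
  by exists x => //=; rewrite in_itv.
split => //; rewrite Rint_seg//.
move: ab; rewrite le_eqVlt => /orP[/eqP e|ab].
  by rewrite e set_itv1 Rintegral_set1 subrr.
have cF x : a <= x <= b -> {for x, continuous F}.
  by move=> /dF /drv_continuous.
apply: EFin_inj; rewrite EFinB -(continuous_FTC2 ab (f := f)) //.
- rewrite /Rintegral fineK//.
  have fi : (@lebesgue_measure R).-integrable `[a, b] (EFin \o f).
    by apply: continuous_compact_integrable; first exact: segment_compact.
  exact: (integrable_fin_num _ fi).
- split.
  + by move=> x /[!in_itv] /= /andP[ax xb]; case: (dF x _) => //; rewrite !ltW.
  + by apply/cvg_at_right_filter/cF; rewrite lexx ltW.
  + by apply/cvg_at_left_filter/cF; rewrite lexx ltW.
- move=> x /[!in_itv] /= /andP[ax xb]; rewrite derive1E.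
  by case: (dF x _) => //; rewrite !ltW.
Qed.

(** A singular function of the distance, by exhaustion: the primitive [G] need
    not extend to the origin, near which only its sign is used. *)
Lemma area_D_le v (g G : R -> R) C : measurable_fun setT g -> (forall u, 0 <= g u) ->
  (forall u, 0 < u -> drv G u (g u)) -> (forall u, 0 < u -> {for u, continuous g}) ->
  (forall u, 0 < u -> 0 <= G u) -> G 2 <= C ->
  (\int[@area R]_x (g (D v x))%:E <= (2 * pi * C)%:E)%E.
Proof.
move=> mg g0 dG cg G0 GC.
rewrite ge0_area_D// (EFinM (2 * pi) C) lee_wpmul2l// ?lee_fin ?mulr_ge0 ?pi_ge0//.
have pi1 : 1 <= pi :> R by have := pi_ge2 R; lra.
pose h th := g (1 - cos th) * `|sin th|.
have mcos1 : measurable_fun setT (fun th : R => g (1 - cos th)).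
  have mc : measurable_fun setT (fun th : R => 1 - cos th) by meas.
  exact: (measurableT_comp mg mc).
have mh : measurable_fun setT h by rewrite /h; meas.
have h0 th : 0 <= h th by rewrite mulr_ge0.
pose a (n : nat) : R := n.+1%:R^-1.
have a0 n : 0 < a n by rewrite invr_gt0.
have a1 n : a n <= pi by rewrite (le_trans _ pi1)// invf_le1// ler1n.
have ha n : (\int[seg 0 pi]_x (h x * \1_`[a n, +oo[%classic x)%:E <= C%:E)%E.
  rewrite -seg_sub//; last exact: ltW.
  have c1 x : a n <= x <= pi -> 0 < 1 - cos x.
    move=> /andP[ax xpi]; rewrite subr_gt0 -cos0.
    have x0 := lt_le_trans (a0 n) ax.
    by rewrite ltr_cos// in_itv /= ?lexx ?pi_ge0// xpi ltW.
  have [|||itf E] := @FTC_loc (a n) pi (fun x => g (1 - cos x) * sin x) (fun x => G (1 - cos x)) (a1 n).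
  - by meas.
  - move=> x /c1 cx; apply: drv_eq.
      by apply: (@drv_comp _ G (fun th => 1 - cos th)); [exact: dG|dv].
    by rewrite /=; ring.
  - move=> x /c1 cx; apply: cvgM; last exact: continuous_sin.
    have c2 : {for x, continuous (fun th : R => 1 - cos th)} by have : continuous (fun th : R => 1 - cos th); [cts|exact].
    by apply: (continuous_comp c2); exact: cg.
  have -> : (\int[seg (a n) pi]_x (h x)%:E = (\int[seg (a n) pi]_x (g (1 - cos x) * sin x))%:E)%E.
    rewrite EFin_Rint//; apply: ae_eq_integral => //; try exact/measurable_EFinP.
      by apply/measurable_EFinP; meas.
    apply: ae_mono (ae_seg (a n) pi) => x /andP[ax xpi] _; congr EFin.
    by rewrite /h ger0_norm// sin_ge0_pi// xpi andbT (le_trans _ ax)// ltW.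
  rewrite E lee_fin cospi (_ : 1 - -1 = 2); last by lra.
  by have := G0 _ (c1 (a n) _); rewrite lexx a1 => /(_ isT); lra.
have nd : forall x, {homo (fun n => (h x * \1_`[a n, +oo[%classic x)%:E) : n m / (n <= m)%N >-> (n <= m)%E}.
  move=> x n m nm; rewrite lee_fin ler_wpM2l// !indicE ler_nat.
  have [|//] := boolP (x \in `[a n, +oo[%classic).
  rewrite inE /= in_itv /= andbT => ax; rewrite mem_set//= in_itv /= andbT (le_trans _ ax)//.
  by rewrite lef_pV2 ?posrE// ler_nat.
have mha n : measurable_fun setT (fun x => (h x * \1_`[a n, +oo[%classic x)%:E).
  by apply/measurable_EFinP; apply: measurable_funM.
have E := @cvg_monotone_convergence _ _ R (seg 0 pi) setT measurableT
  (fun n x => (h x * \1_`[a n, +oo[%classic x)%:E) mha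
  (fun n x _ => mulr_ge0 (h0 x) (ler0n R _)) (fun x _ => nd x).
have -> : (\int[seg 0 pi]_x (g (1 - cos x) * `|sin x|)%:E =
    \int[seg 0 pi]_x limn (fun n => (h x * \1_`[a n, +oo[%classic x)%:E))%E.
  apply: ae_eq_integral => //.
  - exact/measurable_EFinP.
  - apply: (emeasurable_fun_cvg (fun n x => (h x * \1_`[a n, +oo[%classic x)%:E)) => // x _.
    have /cvgP : (fun n => (h x * \1_`[a n, +oo[%classic x)%:E) @ \oo --> ereal_sup (range (fun n => (h x * \1_`[a n, +oo[%classic x)%:E)).
      by apply: ereal_nondecreasing_cvgn; exact: nd.
    by [].
  - apply: ae_mono2 (ae_cos 1) (ae_seg 0 pi) => x cx /andP[x0 _] _; apply/esym/cvg_lim => //.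
    have xp : 0 < x by rewrite lt_neqAle x0 andbT; apply/eqP => e; apply: cx; rewrite -e cos0.
    apply: cvg_near_cst; near=> n; rewrite indicE mem_set ?mulr1//= in_itv /= andbT.
    rewrite /a -[leRHS]invrK lef_pV2 ?posrE ?invr_gt0//.
    apply: (@le_trans _ _ n%:R); last by rewrite ler_nat.
    by near: n; exact: nbhs_infty_ger.
rewrite -(cvg_lim _ E)//; apply: lime_le; first by apply/cvg_ex; eexists; exact: E.
  by apply: nearW => n; exact: ha.
Unshelve. all: by end_near. Qed.

Lemma drv_powR (a x : R) : 0 < x -> drv (fun y => y `^ a) x (a * x `^ (a - 1)).
Proof. exact: is_derive1_powR. Qed.

Lemma powR_mull (a x : R) : 0 < x -> x * x `^ a = x `^ (1 + a).
Proof. by move=> x0; rewrite powRD ?powRr1 ?(ltW x0)// (gt_eqF x0) implybT. Qed.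

Lemma continuous_powRp (a x : R) : 0 < x -> {for x, continuous (fun y => y `^ a)}.
Proof. by move=> x0; exact: drv_continuous (drv_powR a x0). Qed.

Lemma area_D_pow v (q : R) : 0 < q < 1 ->
  itg (@area R) (fun x => D v x `^ (- q)) /\
  \int[@area R]_x D v x `^ (- q) <= 4 * pi / (1 - q).
Proof.
move=> /andP[q0 q1]; have q2 : 0 < 1 - q by rewrite subr_gt0.
apply: itg_ge0_bound.
- apply: (measurableT_comp (@measurable_powR R (- q))); meas.
- by move=> x; exact: powR_ge0.
rewrite (_ : 4 * pi / (1 - q) = 2 * pi * (2 / (1 - q))); last by ring.
apply: (@area_D_le v (fun u => u `^ (- q)) (fun u => u `^ (1 - q) / (1 - q))).
- exact: measurable_powR.
- by move=> u; exact: powR_ge0.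
- move=> u u0; have h := drv_powR (1 - q) u0.
  apply: drv_eq; first by dv.
  by rewrite (_ : 1 - q - 1 = - q); [field; rewrite gt_eqF|ring].
- by move=> u u0; exact: continuous_powRp.
- by move=> u u0; rewrite divr_ge0 ?powR_ge0// ltW.
- rewrite ler_pM2r ?invr_gt0// -[leRHS]powRr1// ler_powR ?ler1n// gerBl ltW//.
Qed.

(** The exponential of half the logarithmic singularity, within the distance
    [rho]; its integral over the sphere is of order [rho], whence its use in
    averaging over a region of size [rho]. *)
Definition lk (rho u : R) : R := (u < rho)%R%:R * (rho `^ 2^-1 * u `^ (- 2^-1)).

Lemma lk_ge0 rho u : 0 <= lk rho u. Proof. by rewrite !mulr_ge0 ?powR_ge0. Qed.

Lemma measurable_lk rho : measurable_fun setT (lk rho).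
Proof.
have -> : lk rho = fun u => \1_(`]-oo, rho[%classic) u * (rho `^ 2^-1 * u `^ (- 2^-1)).
  apply/funext => u; rewrite /lk indicE; congr (_%:R * _); congr nat_of_bool.
  by apply/idP/idP; rewrite inE /= in_itv.
apply: measurable_funM; first exact: measurable_indic.
by apply: measurable_funM => //; exact: measurable_powR.
Qed.

Lemma area_D_lk v rho : 0 < rho ->
  itg (@area R) (fun x => lk rho (D v x)) /\ \int[@area R]_x lk rho (D v x) <= 32 * pi * rho.
Proof.
move=> r0; have ml : measurable_fun setT (fun x : sphere R => lk rho (D v x)).
  by apply: (measurableT_comp (measurable_lk rho)); meas.
apply: itg_ge0_bound => //; first by move=> x; exact: lk_ge0.
pose g u : R := 8 * rho ^+ 2 * u `^ (- 2^-1) * (u + rho) `^ (- (3 / 2)).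
have mg : measurable_fun setT g.
  by rewrite /g; meas.
have hg0 u : 0 <= g u by rewrite /g mulr_ge0 ?powR_ge0// mulr_ge0 ?powR_ge0// mulr_ge0 ?sqr_ge0.
apply: (@le_trans _ _ (\int[@area R]_x (g (D v x))%:E)%E).
  apply: ge0_le_integral => //.
  - by move=> x _; rewrite lee_fin lk_ge0.
  - exact/measurable_EFinP.
  - by apply/measurable_EFinP; apply: (measurableT_comp mg); meas.
  - move=> x _; rewrite lee_fin /lk; set u := D v x.
    have [ur|_] := ltP u rho; last by rewrite mul0r.
    rewrite mul1r; have u0 := D_ge0 v x; rewrite -/u in u0; rewrite /g.
    have -> : rho `^ 2^-1 = rho ^+ 2 * rho `^ (- (3 / 2)).
      rewrite -[in RHS]powR_mulrn ?ltW// -powRD; first by congr powR; lra.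
      by rewrite (gt_eqF r0) implybT.
    rewrite [X in _ <= X](_ : _ = (rho ^+ 2 * (8 * (u + rho) `^ (- (3 / 2)))) * u `^ (- 2^-1)); last by ring.
    rewrite ler_wpM2r ?powR_ge0// ler_wpM2l ?sqr_ge0//.
    have -> : rho `^ (- (3 / 2)) = (2 * rho) `^ (- (3 / 2)) * 2 `^ (3 / 2).
      rewrite powRM ?ltW// mulrAC -powRD ?pnatr_eq0 ?implybT// (_ : - (3 / 2) + 3 / 2 = 0 :> R); last by lra.
      by rewrite powRr0 mul1r.
    rewrite mulrC ler_pM ?powR_ge0//.
      apply: (@le_trans _ _ (2 `^ 3%:R)); first by rewrite ler_powR ?ler1n//; lra.
      by rewrite powR_mulrn//; lra.
    have h1 : 0 < u + rho by rewrite ltr_wpDl.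
    rewrite !powRN lef_pV2 ?posrE ?powR_gt0 ?mulr_gt0//.
    have ur2 : u + rho <= 2 * rho by rewrite mulrDl mul1r lerD2r ltW.
    have h2 : 0 <= 2 * rho by rewrite mulr_ge0// ltW.
    have h3 : 0 <= u + rho by rewrite addr_ge0// ltW.
    by apply: ge0_ler_powR => //; lra.
rewrite (_ : 32 * pi * rho = 2 * pi * (16 * rho)); last by ring.
apply: (@area_D_le v g (fun u => 16 * rho * (u `^ 2^-1 * (u + rho) `^ (- 2^-1))) _ mg hg0).
- move=> u u0; have ur : 0 < u + rho by rewrite addr_gt0.
  have h1 := drv_powR 2^-1 u0.
  have h2 : drv (fun y => (y + rho) `^ (- 2^-1)) u (- 2^-1 * (u + rho) `^ (- 2^-1 - 1) * 1).
    by apply: (@drv_comp _ (fun y => y `^ (- 2^-1)) (fun y => y + rho)); [exact: drv_powR|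
      apply: drv_eq; [dv|rewrite addr0]].
  apply: drv_eq; first by dv.
  rewrite /g (_ : 2^-1 - 1 = - 2^-1 :> R); last by lra.
  rewrite (_ : - 2^-1 - 1 = - (3 / 2) :> R); last by lra.
  have -> : u `^ 2^-1 = u * u `^ (- 2^-1).
    by rewrite powR_mull//; congr powR; lra.
  have -> : (u + rho) `^ (- 2^-1) = (u + rho) * (u + rho) `^ (- (3 / 2)).
    by rewrite powR_mull//; congr powR; lra.
  by field.
- move=> u u0; have ur : 0 < u + rho by rewrite addr_gt0.
  have h1 := drv_powR (- 2^-1) u0.
  have h2 : drv (fun y => (y + rho) `^ (- (3 / 2))) u (- (3 / 2) * (u + rho) `^ (- (3 / 2) - 1) * 1).
    by apply: (@drv_comp _ (fun y => y `^ (- (3 / 2))) (fun y => y + rho)); [exact: drv_powR|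
      apply: drv_eq; [dv|rewrite addr0]].
  exact: drv_continuous (drvM (drvM (drv_cst (8 * rho ^+ 2) u) h1) h2).
- by move=> u u0; rewrite !mulr_ge0 ?powR_ge0 ?ltW.
- apply: ler_piMr; first by rewrite mulr_ge0// ltW.
  rewrite powRN ler_pdivrMr ?powR_gt0 ?addr_gt0// mul1r.
  by apply: ge0_ler_powR; rewrite ?nnegrE ?invr_ge0 ?addr_ge0// ?lerDl ltW.
Qed.

Lemma Rint_D_centre v w (g : R -> R) : measurable_fun setT g -> (forall u, 0 <= g u) ->
  \int[@area R]_x g (D v x) = \int[@area R]_x g (D w x).
Proof. by move=> mg g0; rewrite /Rintegral !ge0_area_D. Qed.

Lemma area_setT : @area R setT = (4 * pi)%:E.
Proof.
have := @Rint_D R (north R) (cst 1) id (@cts_cst R 1) (fun u _ => @drv_id R u).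
rewrite Rintegral_cst// mul1r subr0 (_ : 2 * pi * 2 = 4 * pi); last by ring.
by move=> <-; rewrite fineK// fin_num_measure.
Qed.

Lemma itg_bker_prod (k : sphere R * sphere R -> R) C (F : sphere R -> R) :
  measurable_fun setT k -> (forall z, `|k z| <= C) -> itg (@area R) F ->
  itg (@area R \x @area R)%E (fun z => k z * F z.2).
Proof.
move=> mk kC iF; have mF := itg_measurable iF.
have mh : measurable_fun setT (fun z : sphere R * sphere R => k z * F z.2).
  by apply: measurable_funM => //; exact: (measurableT_comp mF measurable_snd).
apply: (@itg_prod_bound _ _ _ _ _ _ _ _ (fun x => C * (4 * pi) * `|F x|)) => //.
  by apply: itgZ; exact: itg_norm.
move=> x; rewrite mulrAC EFinM -area_setT -integral_cst//; apply: ge0_le_integral => //.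
  apply/measurable_EFinP; apply: measurableT_comp => //.
  exact: (measurableT_comp mh (@measurable_pair2 _ _ _ _ x)).
by move=> y _; rewrite lee_fin normrM ler_wpM2r.
Qed.

(** By Fubini the convolution then converges at almost every point; it may
    diverge where the singularity of the kernel meets that of the density. *)
Lemma itg_ker_prod (k : R -> R) C (F : sphere R -> R) :
  measurable_fun setT k -> (forall u, 0 <= k u) ->
  (forall x, itg (@area R) (fun y => k (D x y)) /\ \int[@area R]_y k (D x y) <= C) ->
  itg (@area R) F -> itg (@area R \x @area R)%E (fun z => k (D z.1 z.2) * F z.2).
Proof.
move=> mk k0 kC iF; have mF := itg_measurable iF.
have mh : measurable_fun setT (fun z : sphere R * sphere R => k (D z.1 z.2) * F z.2).
  apply: measurable_funM; last exact: (measurableT_comp mF measurable_snd).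
  by apply: (measurableT_comp mk); meas.
apply: (@itg_prod_bound _ _ _ _ _ _ _ _ (fun x => C * `|F x|)) => //.
  by apply: itgZ; exact: itg_norm.
move=> x; have [ik Ik] := kC x.
have ix : itg (@area R) (fun y => `|F x| * k (D x y)) by exact: itgZ.
apply: (@le_trans _ _ (\int[@area R]_y (`|F x| * k (D x y))%:E)%E).
  apply: ge0_le_integral => //.
  - apply/measurable_EFinP; apply: measurableT_comp => //.
    exact: (measurableT_comp mh (@measurable_pair2 _ _ _ _ x)).
  - by apply/measurable_EFinP; exact: itg_measurable ix.
  - by move=> y _; rewrite lee_fin normrM (ger0_norm (k0 _)) mulrC DC.
rewrite -(EFin_Rint ix) lee_fin (RintZ _ ik) mulrC.
by apply: ler_wpM2r.
Qed.

End distance_integrals.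

(** * Smooth kernels and their Laplacians *)

Section gradients.
Variable R : realType.
Implicit Types (F : 'rV[R]_3 -> R^o) (z : 'rV[R]_3).

(** Differentiability together with the value of the gradient, so that both
    propagate through the rules below. *)
Definition hg F z (a : 'I_3 -> R) :=
  differentiable F z /\ forall i, 'd F z (delta_mx 0 i) = a i.

Lemma hg_eq F z a b : hg F z a -> a =1 b -> hg F z b.
Proof. by move=> [dF E] ab; split => // i; rewrite E ab. Qed.

Lemma hg_cst (c : R) z : hg (fun=> c) z (fun=> 0).
Proof. by split => [//|i]; have -> := @diff_cst _ _ _ (c : R^o) z. Qed.

Lemma hg_coord j z : hg (fun w => w 0 j) z (fun i => (i == j)%:R).
Proof.
split=> [|i]; first exact: differentiable_coord.
have @f : {linear 'rV[R]_3 -> R^o}.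
  by exists (fun N : 'rV[R]_3 => N 0 j); do 2![eexists]; do ?[constructor];
     rewrite ?mxE// => ? *; rewrite ?mxE//; move=> ?; rewrite !mxE.
have -> : (fun w : 'rV[R]_3 => w 0 j : R^o) = f by [].
by rewrite diff_lin; [rewrite /= mxE eqxx eq_sym|exact: coord_continuous].
Qed.

Lemma hgD F1 F2 z a b : hg F1 z a -> hg F2 z b ->
  hg (fun w => F1 w + F2 w) z (fun i => a i + b i).
Proof.
move=> [d1 E1] [d2 E2]; split=> [|i]; first exact: differentiableD.
by have -> := diffD d1 d2; rewrite /= E1 E2.
Qed.

Lemma hgM F1 F2 z a b : hg F1 z a -> hg F2 z b ->
  hg (fun w => F1 w * F2 w) z (fun i => F1 z * b i + F2 z * a i).
Proof.
move=> [d1 E1] [d2 E2]; split=> [|i]; first exact: differentiableM.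
by rewrite (diffM d1 d2) /= -E1 -E2.
Qed.

Lemma hg_comp (k : R -> R) F z a b : drv k (F z) b -> hg F z a ->
  hg (fun w => k (F w)) z (fun i => b * a i).
Proof.
move=> [dk Ek] [dF E].
have dk' : differentiable (k : R^o -> R^o) (F z) by apply/derivable1_diffP.
split=> [|i]; first exact: (@differentiable_comp _ _ _ _ F (k : R^o -> R^o)).
have -> := @diff_comp _ _ _ _ F (k : R^o -> R^o) z dF dk'.
by rewrite /= deriv1E// E derive1E Ek mulrC.
Qed.

Lemma hg_sum (F : 'I_3 -> 'rV[R]_3 -> R^o) (a : 'I_3 -> 'I_3 -> R) z :
  (forall j, hg (F j) z (a j)) ->
  hg (fun w => \sum_(j < 3) F j w) z (fun i => \sum_(j < 3) a j i).
Proof.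
move=> h; elim: (index_enum 'I_3) => [|j s IH].
  under eq_fun do rewrite big_nil.
  by apply: hg_eq; first exact: hg_cst; move=> i; rewrite big_nil.
under eq_fun do rewrite big_cons.
by apply: hg_eq; first exact: (hgD (h j) IH); move=> i; rewrite big_cons.
Qed.

Lemma hg_dot z : hg (fun w => dot w w) z (fun i => 2 * z 0 i).
Proof.
apply: hg_eq; first by apply: hg_sum => j; apply: hgM; apply: hg_coord.
move=> i /=; rewrite (bigD1 i)//= eqxx big1 ?addr0; first by rewrite mulr1 mulrDl mul1r.
by move=> j ji; rewrite eq_sym (negPf ji) !mulr0 addr0.
Qed.

Lemma radial_pt (x : sphere R) : radial (pt x) = x.
Proof.
apply/val_inj; rewrite /= /radial val_insubd.
by rewrite (eqP (pt_unit x)) sqrtr1 invr1 scale1r (pt_unit x).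
Qed.

Definition hgs (f : sphere R -> R) x a := hg (extend f) (pt x) a.

Lemma hgs_tderiv f x a : hgs f x a -> forall i, tderiv i f x = a i.
Proof. by move=> [d E] i; rewrite /tderiv deriveE. Qed.

Lemma hgs_comp (k : R -> R) f x a b : drv k (f x) b -> hgs f x a ->
  hgs (fun y => k (f y)) x (fun i => b * a i).
Proof. by move=> dk; apply: hg_comp; rewrite /extend /= radial_pt. Qed.

Lemma hgsM f g x a b : hgs f x a -> hgs g x b ->
  hgs (fun w => f w * g w) x (fun i => f x * b i + g x * a i).
Proof.
by move=> ha hb; apply: hg_eq (hgM ha hb) _ => i; rewrite /extend /= radial_pt.
Qed.

(** The homogeneous extension projects the ambient gradient onto the tangent
    plane. *)
Lemma hgs_coord j x :
  hgs (fun y => pt y 0 j) x (fun i => (i == j)%:R - pt x 0 i * pt x 0 j).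
Proof.
pose K (s : R) : R := (s == 0)%:R.
pose H (s : R) : R := (Num.sqrt s)^-1.
have E : extend (fun y : sphere R => pt y 0 j) = fun z : 'rV[R]_3 =>
    z 0 j * H (dot z z) + pt (north R) 0 j * K (dot z z) :> R^o.
  apply/funext => z; rewrite /extend /= /radial val_insubd /H /K.
  have dE : dot (H (dot z z) *: z) (H (dot z z) *: z) = H (dot z z) ^+ 2 * dot z z.
    by rewrite /dot big_distrr /=; apply: eq_bigr => i _; rewrite !mxE; ring.
  rewrite -/(H _) dE /H exprVn sqr_sqrtr; last first.
    by apply: sumr_ge0 => i _; rewrite -expr2 sqr_ge0.
  have [z0|z0] := eqVneq (dot z z) 0.
    rewrite z0 invr0 mul0r eq_sym oner_eq0 mulr1 sqrtr0 invr0 mulr0 add0r//.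
  by rewrite mulVf// eqxx mulr0 addr0 mxE mulrC.
have p1 : dot (pt x) (pt x) = 1 by apply/eqP; exact: pt_unit.
have dH : drv H (dot (pt x) (pt x)) (- 2^-1).
  rewrite p1 /H; have h := @is_derive1_sqrt R 1 ltr01.
  apply: drv_eq; first by apply: drvV; [rewrite sqrtr1 oner_eq0|exact: h].
  by rewrite sqrtr1 expr1n invr1 mulr1 mulN1r.
have dK : drv K (dot (pt x) (pt x)) 0.
  rewrite p1 /K; apply: (@near_eq_is_derive R R^o R^o (fun=> 0)).
  exists 1 => //= y /= h1; rewrite (_ : y == 0 = false)//; apply/eqP => y0.
  by move: h1; rewrite y0 subr0 normr1 ltxx.
rewrite /hgs E; apply: hg_eq.
  apply: hgD.
    apply: hgM; first exact: hg_coord.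
    by apply: (@hg_comp H (fun w => dot w w) _ _ _ dH); exact: hg_dot.
  apply: hgM; first exact: hg_cst.
  by apply: (@hg_comp K (fun w => dot w w) _ _ _ dK); exact: hg_dot.
by move=> i /=; rewrite p1 /H sqrtr1 invr1; lra.
Qed.


Lemma hgsD f g x a b : hgs f x a -> hgs g x b ->
  hgs (fun w => f w + g w) x (fun i => a i + b i).
Proof. exact: hgD. Qed.

Lemma hgs_cst (c : R) x : hgs (fun=> c) x (fun=> 0).
Proof. exact: hg_cst. Qed.

Lemma hgs_sdot y x : hgs (fun w => sdot w y) x (fun i => pt y 0 i - pt x 0 i * sdot x y).
Proof.
rewrite /hgs; apply: hg_eq.
  have -> : extend (fun w => sdot w y) = fun z => \sum_(j < 3) extend (fun w => pt w 0 j * pt y 0 j) z.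
    by [].
  apply: hg_sum => j; apply: (hgsM (f := fun w => pt w 0 j) (g := fun=> pt y 0 j)); first exact: hgs_coord.
  exact: hgs_cst.
move=> i /=; rewrite /sdot /dot mulr_sumr.
rewrite (eq_bigr (fun j : 'I_3 => (i == j)%:R * pt y 0 j - pt x 0 i * (pt x 0 j * pt y 0 j))); last first.
  by move=> j _; ring.
rewrite sumrB (bigD1 i)//= eqxx mul1r big1 ?addr0// => j ji.
by rewrite eq_sym (negPf ji) mul0r.
Qed.

(** Smoothness only constrains iterated derivatives, so it follows from
    membership in a class of differentiable functions stable under [tderiv]. *)
Lemma smooth_class (P : (sphere R -> R) -> Prop) :
  (forall f, P f -> exists2 a : 'I_3 -> sphere R -> R,
     forall x, hgs f x (a^~ x) & forall i, P (a i)) ->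
  forall f, P f -> smooth f.
Proof.
move=> H f Pf s x.
have Ps : P (foldr (@tderiv R) f s).
  elim: s => //= i s /H[a ha Pa]; rewrite (_ : tderiv _ _ = a i)//.
  by apply/funext => z; exact: (hgs_tderiv (ha z)).
by have [a /(_ x)[]] := H _ Ps.
Qed.

Lemma smooth_grad (f : sphere R -> R) i : smooth f -> smooth (component (grad f) i).
Proof.
move=> sf s x; have := sf (rcons s i) x; rewrite foldr_rcons.
by rewrite (_ : component _ _ = tderiv i f)//; apply/funext => z; rewrite /component /grad mxE.
Qed.

(** The extension is homogeneous of degree zero, so its gradient has no radial part. *)
Lemma tangent_grad (f : sphere R -> R) : smooth f -> tangent (grad f).
Proof.
move=> sf x; have df : differentiable (extend f) (pt x) := sf [::] x.
have -> : dot (grad f x) (pt x) = 'd (extend f) (pt x) (pt x).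
  have lin v : 'd (extend f) (pt x) v = \sum_i v 0 i * 'd (extend f) (pt x) (delta_mx 0 i).
    by rewrite {1}[v]row_sum_delta linear_sum; apply: eq_bigr => i _; rewrite linearZ.
  rewrite lin /dot; apply: eq_bigr => i _.
  by rewrite /= mxE /tderiv deriveE// mulrC.
rewrite -deriveE// /derive; apply/cvg_lim => //; apply: cvg_near_cst.
exists 1 => //= h /=; rewrite sub0r normrN => h1 h0.
have hp : 0 < 1 + h by move: h1; rewrite ltr_norml; lra.
rewrite /extend /= (_ : radial _ = x) ?radial_pt ?subrr ?scaler0//.
apply/val_inj; rewrite /= /radial val_insubd -[X in _ + X]scale1r -scalerDl addrC.
have -> : dot ((1 + h) *: pt x) ((1 + h) *: pt x) = (1 + h) ^+ 2.
  rewrite -[RHS]mulr1 -(eqP (pt_unit x)) /dot big_distrr /=.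
  by apply: eq_bigr => i _; rewrite !mxE; ring.
have -> : (Num.sqrt ((1 + h) ^+ 2))^-1 *: ((1 + h) *: pt x) = pt x.
  by rewrite sqrtr_sqr gtr0_norm// scalerA mulVf ?gt_eqF// scale1r.
by rewrite (pt_unit x).
Qed.

(** The identity defining the weak gradient is tested with the gradient of
    [phi], a smooth tangent field. *)
Lemma weak_poisson_laplace (u f phi : sphere R -> R) : weak_poisson u f -> smooth phi ->
  \int[dV R]_x (u x * laplace phi x) = - \int[dV R]_x (f x * phi x).
Proof.
move=> [V [_ _ hV] hf] sp; rewrite -hf// /laplace hV//.
  by move=> i; exact: smooth_grad.
exact: tangent_grad.
Qed.

End gradients.

Section log_kernel.
Variables (R : realType) (eta : R).
Hypothesis eta0 : 0 < eta.
Implicit Types x y : sphere R.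

Definition Lk x y : R := ln (eta + D x y).

(** The Laplacian of [Lk ^~ y] is [-1 + kap], a bump of total mass [4 * pi]
    concentrated where [D x y] is of order [eta], against a constant. *)
Definition kap x y : R := (2 * eta + eta ^+ 2) / (eta + D x y) ^+ 2.

Lemma etaD_gt0 x y : 0 < eta + D x y. Proof. by rewrite ltr_wpDr ?D_ge0. Qed.

Lemma hgs_D y x : hgs (fun w => eta + D w y) x (fun i => pt x 0 i * sdot x y - pt y 0 i).
Proof.
apply: hg_eq.
  apply: (hgsD (hgs_cst eta x)); apply: (hgsD (hgs_cst 1 x)).
  by apply: (hgs_comp (drvN (drv_id _))); exact: hgs_sdot.
by move=> i /=; ring.
Qed.

Lemma hgs_Lk y x : hgs (Lk^~ y) x (fun i => (eta + D x y)^-1 * (pt x 0 i * sdot x y - pt y 0 i)).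
Proof.
apply: hg_eq; first by apply: (hgs_comp _ (hgs_D y x)); apply: drv_ln (drv_id _); exact: etaD_gt0.
by move=> i /=; rewrite mulr1.
Qed.

Lemma hgs_inv y x : hgs (fun w => (eta + D w y)^-1) x
  (fun i => - (eta + D x y) ^- 2 * (pt x 0 i * sdot x y - pt y 0 i)).
Proof.
apply: hg_eq; first by apply: (hgs_comp _ (hgs_D y x)); apply: drvV (drv_id _); rewrite gt_eqF// etaD_gt0.
by move=> i /=; rewrite mulr1.
Qed.

(** An algebra containing [Lk] and stable under tangential derivatives, which
    makes [Lk] a legitimate test function. *)
Inductive kclass y : (sphere R -> R) -> Prop :=
| kc_cst c : kclass y (fun=> c)
| kc_coord i : kclass y (fun x => pt x 0 i)
| kc_Lk : kclass y (Lk^~ y)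
| kc_inv : kclass y (fun x => (eta + D x y)^-1)
| kcD f g : kclass y f -> kclass y g -> kclass y (fun x => f x + g x)
| kcM f g : kclass y f -> kclass y g -> kclass y (fun x => f x * g x).

Lemma kcN y f : kclass y f -> kclass y (fun x => - f x).
Proof.
move=> hf; rewrite (_ : (fun _ => _) = fun x => -1 * f x); first exact: kcM (kc_cst _ _) hf.
by apply/funext => x; rewrite mulN1r.
Qed.

Lemma kc_sdot y : kclass y (fun x => sdot x y).
Proof.
rewrite /sdot; under eq_fun do rewrite dotE.
by do 2?apply: kcD; apply: kcM (kc_coord _ _) (kc_cst _ _).
Qed.

Lemma kclass_smooth y f : kclass y f -> smooth f.
Proof.
apply: (smooth_class (P := kclass y)) => {}f.
have kX i : kclass y (fun x => pt x 0 i * sdot x y - pt y 0 i).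
  by apply: kcD (kcM (kc_coord _ _) (kc_sdot y)) (kc_cst _ _).
elim=> {f} [c|j|||f g kf [a ha ka] kg [b hb kb]|f g kf [a ha ka] kg [b hb kb]].
- by exists (fun _ _ => 0) => [x|i]; [exact: hgs_cst|exact: kc_cst].
- exists (fun i x => (i == j)%:R - pt x 0 i * pt x 0 j) => [x|i]; first exact: hgs_coord.
  exact: kcD (kc_cst _ _) (kcN (kcM (kc_coord _ _) (kc_coord _ _))).
- exists (fun i x => (eta + D x y)^-1 * (pt x 0 i * sdot x y - pt y 0 i)) => [x|i]; first exact: hgs_Lk.
  exact: kcM (kc_inv y) (kX i).
- exists (fun i x => - ((eta + D x y)^-1 * (eta + D x y)^-1) * (pt x 0 i * sdot x y - pt y 0 i)) => [x|i].
    by apply: hg_eq; [exact: hgs_inv|move=> i /=; rewrite expr2 invfM].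
  exact: kcM (kcN (kcM (kc_inv y) (kc_inv y))) (kX i).
- by exists (fun i x => a i x + b i x) => [x|i]; [exact: hgsD|exact: kcD].
- exists (fun i x => f x * b i x + g x * a i x) => [x|i]; first exact: hgsM.
  by apply: kcD; apply: kcM.
Qed.

Lemma smooth_Lk y : smooth (Lk^~ y).
Proof. exact: kclass_smooth (kc_Lk y). Qed.

Lemma laplace_Lk y x : laplace (Lk^~ y) x = -1 + kap x y.
Proof.
have d0 := etaD_gt0 x y.
have E i : component (grad (Lk^~ y)) i = fun x => (eta + D x y)^-1 * (pt x 0 i * sdot x y - pt y 0 i).
  by apply/funext => z; rewrite /component /grad mxE (hgs_tderiv (hgs_Lk y z)).
rewrite /laplace /divergence.
pose s := sdot x y; pose q := (eta + D x y)^-1.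
have Ei i : tderiv i (component (grad (Lk^~ y)) i) x =
    q * (s + pt x 0 i * pt y 0 i - 2 * s * pt x 0 i ^+ 2)
    - q ^+ 2 * (pt x 0 i * s - pt y 0 i) ^+ 2.
  rewrite E (hgs_tderiv (hgsM (hgs_inv y x) (hgsD (hgsM (hgs_coord i x) (hgs_sdot y x)) (hgs_cst (- pt y 0 i) x)))).
  by rewrite eqxx -/s -exprVn -/q /=; ring.
rewrite (eq_bigr _ (fun i _ => Ei i)).
have e1 : \sum_(i < 3) pt x 0 i ^+ 2 = 1.
  by rewrite -(sdot1 x) /sdot /dot; apply: eq_bigr => i _; rewrite expr2.
have e2 : \sum_(i < 3) pt y 0 i ^+ 2 = 1.
  by rewrite -(sdot1 y) /sdot /dot; apply: eq_bigr => i _; rewrite expr2.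
have e3 : \sum_(i < 3) pt x 0 i * pt y 0 i = s by [].
rewrite sumrB -!mulr_sumr sumrB big_split /= -mulr_sumr e1 e3 sumr_const card_ord.
rewrite (eq_bigr (fun i : 'I_3 => s ^+ 2 * pt x 0 i ^+ 2 - (2 * s) * (pt x 0 i * pt y 0 i) + pt y 0 i ^+ 2)); last first.
  by move=> i _; ring.
rewrite big_split sumrB /= -!mulr_sumr e1 e2 e3 /kap /q /D -/s.
by field; rewrite gt_eqF//.
Qed.

End log_kernel.

(** * Approximation of the identity by the regularised Laplacians *)

Section approximation.
Variable R : realType.
Implicit Types x y : sphere R.

Lemma sg_lip (a b : R) : `|sg a - sg b| <= `|a - b|.
Proof.
wlog ab : a b / a <= b.
  by move=> H; case: (leP a b) => [/H //|/ltW /H]; rewrite distrC (distrC b).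
have cS : continuous (@sg R) by move=> y; exact: drv_continuous (is_derive_sg y).
have [c _ E] : exists2 c : R, c \in `[a, b] & sg b - sg a = sg c * (1 - sg c) * (b - a).
  by apply: MVT_segment => // [x _|]; [exact: is_derive_sg|exact: continuous_subspaceT].
rewrite distrC E normrM (distrC a) ler_piMl// ger0_norm; last first.
  by rewrite mulr_ge0 ?sg_ge0// subr_ge0 sg_le1.
by rewrite mulr_ile1 ?sg_ge0 ?sg_le1 ?subr_ge0 ?gerBl ?sg_ge0// sg_le1.
Qed.

Lemma coord_lip x y : [/\ `|c0 x - c0 y| <= Num.sqrt (2 * D x y),
  `|c1 x - c1 y| <= Num.sqrt (2 * D x y) & `|c2 x - c2 y| <= Num.sqrt (2 * D x y)].
Proof.
have e : (c0 x - c0 y) ^+ 2 + (c1 x - c1 y) ^+ 2 + (c2 x - c2 y) ^+ 2 = 2 * D x y.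
  by rewrite /D sdotE; have := unitE x; have := unitE y; lra.
have h0 := sqr_ge0 (c0 x - c0 y); have h1 := sqr_ge0 (c1 x - c1 y).
have h2 := sqr_ge0 (c2 x - c2 y).
have D0 : 0 <= 2 * D x y by rewrite mulr_ge0 ?D_ge0.
by split; rewrite -sqrtr_sqr ler_sqrt//; lra.
Qed.

Lemma norm_sqrtD x y : `|Num.sqrt (D x y)| <= 2.
Proof.
rewrite ger0_norm ?sqrtr_ge0// -[leRHS](@ger0_norm R 2)// -sqrtr_sqr ler_sqrt// ?sqr_ge0//.
by have := D_le2 x y; lra.
Qed.

Lemma psi_lip n r s t x y :
  `|psi n r s t x - psi n r s t y| <= 3 * n%:R ^+ 2 * Num.sqrt (2 * D x y).
Proof.
have [h0 h1 h2] := coord_lip x y; rewrite /psi.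
pose S (a u : R) := sg (n%:R ^+ 2 * (a - u) - n%:R).
have L a u v : `|u - v| <= Num.sqrt (2 * D x y) ->
    `|S a u - S a v| <= n%:R ^+ 2 * Num.sqrt (2 * D x y).
  move=> uv; apply: (le_trans (sg_lip _ _)).
  rewrite (_ : _ - _ = n%:R ^+ 2 * (v - u)); last by ring.
  by rewrite normrM ger0_norm ?sqr_ge0// distrC ler_wpM2l// sqr_ge0.
rewrite -/(S r (c0 x)) -/(S s (c1 x)) -/(S t (c2 x)) -/(S r (c0 y)) -/(S s (c1 y)) -/(S t (c2 y)).
have nS a u : `|S a u| <= 1 by exact: norm_sg.
have {}h0 := L r _ _ h0; have {}h1 := L s _ _ h1; have {}h2 := L t _ _ h2.
set q := n%:R ^+ 2 * _ in h0 h1 h2.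
rewrite (_ : _ - _ = (S r (c0 x) - S r (c0 y)) * S s (c1 x) * S t (c2 x)
  + S r (c0 y) * (S s (c1 x) - S s (c1 y)) * S t (c2 x)
  + S r (c0 y) * S s (c1 y) * (S t (c2 x) - S t (c2 y))); last by ring.
have n1 := nS r (c0 y); have n2 := nS s (c1 x); have n3 := nS t (c2 x); have n4 := nS s (c1 y).
apply: le_trans; first by nb.
by rewrite -[leRHS]mulrA -/q; lra.
Qed.

Section kap.
Variable eta : R.
Hypothesis (eta0 : 0 < eta).

Lemma kap_ge0 x y : 0 <= kap eta x y.
Proof. by rewrite divr_ge0 ?sqr_ge0// addr_ge0 ?sqr_ge0// mulr_ge0// ltW. Qed.

Lemma kap_le x y : kap eta x y <= (2 * eta + eta ^+ 2) / eta ^+ 2.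
Proof.
have e1 := etaD_gt0 eta0 x y.
rewrite ler_wpM2l ?addr_ge0 ?sqr_ge0 ?mulr_ge0 ?(ltW eta0)//.
by rewrite lef_pV2 ?posrE ?exprn_gt0// lerXn2r ?nnegrE ?(ltW eta0) ?(ltW e1)// lerDl D_ge0.
Qed.

Lemma etamax_gt0 (u : R) : 0 < eta + Num.max 0 u.
Proof. by rewrite ltr_wpDr// le_max lexx. Qed.

Lemma Rint_kap x : \int[@area R]_y kap eta x y = 4 * pi.
Proof.
have e0 := etamax_gt0.
rewrite (@eq_Rint _ _ _ _ _ (fun y => (2 * eta + eta ^+ 2) * ((eta + Num.max 0 (D x y))^-1) ^+ 2)); last first.
  by move=> y; rewrite max_r ?D_ge0// /kap exprVn.
rewrite (@Rint_D _ _ (fun u => (2 * eta + eta ^+ 2) * ((eta + Num.max 0 u)^-1) ^+ 2)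
  (fun u => - (2 * eta + eta ^+ 2) * (eta + u)^-1)).
- by rewrite addr0; field; rewrite !gt_eqF// addr_gt0.
- by cts; apply: ctsV; [move=> u; rewrite gt_eqF|cts].
- move=> u /andP[u0 _]; have u1 : eta + u != 0 by rewrite gt_eqF// ltr_wpDr.
  apply: drv_eq; first by dv.
  by rewrite max_r//; field.
Qed.

Lemma measurable_kap x : measurable_fun setT (kap eta x).
Proof. by rewrite /kap; meas. Qed.

Lemma itg_kap_cont x (f : sphere R -> R) C : measurable_fun setT f -> (forall y, `|f y| <= C) ->
  itg (@area R) (fun y => kap eta x y * f y).
Proof.
move=> mf fC; apply: (itgMb (C := (2 * eta + eta ^+ 2) / eta ^+ 2)).
- exact: (itg_bounded _ _ fC).
- exact: measurable_kap.
- by move=> y; rewrite ger0_norm ?kap_ge0// kap_le.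
Qed.

(** The first moment, in the chordal distance, which measures how fast [kap]
    concentrates. *)
Lemma Rint_kap_sqrt x : eta <= 1 ->
  \int[@area R]_y (kap eta x y * Num.sqrt (D x y)) <= 12 * pi * Num.sqrt eta.
Proof.
move=> eta1; have e0 := etamax_gt0.
pose g (u : R) := (eta + Num.max 0 u) `^ (- (3 / 2)).
have pe (u : R) : 0 <= u -> 0 < eta + u by move=> u0; rewrite ltr_wpDr.
have dp (a u : R) : 0 <= u -> drv (fun v => (eta + v) `^ a) u (a * (eta + u) `^ (a - 1)).
  move=> u0; have d1 : drv (fun v => eta + v) u 1 by apply: drv_eq; [dv|rewrite add0r].
  apply: drv_eq; first exact: (@drv_comp _ (fun z => z `^ a) _ _ _ _ (drv_powR a (pe u u0)) d1).
  by rewrite mulr1.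
have cg : continuous g.
  move=> u; have c2 : {for u, continuous (fun v : R => eta + Num.max 0 v)}.
    by have : continuous (fun v : R => eta + Num.max 0 v); [cts|exact].
  exact: (continuous_comp c2 (@continuous_powRp R (- (3 / 2)) _ (e0 u))).
have Ig : \int[@area R]_y g (D x y) <= 4 * pi / Num.sqrt eta.
  rewrite (@Rint_D _ _ g (fun u => - 2 * (eta + u) `^ (- 2^-1)) cg).
    rewrite addr0 (_ : eta `^ (- 2^-1) = (Num.sqrt eta)^-1); last first.
      by rewrite powRN powR12_sqrt// ltW.
    have h2 := powR_ge0 (eta + 2) (- 2^-1); have := pi_gt0 R => pi0.
    by have := mulr_ge0 (ltW pi0) h2; lra.
  move=> u /andP[u0 _]; apply: drv_eq; first by apply: drvM; [dv|exact: dp].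
  rewrite /g max_r// (_ : - 2^-1 - 1 = - (3 / 2)); last by lra.
  by rewrite oppr0 mulr0 addr0; lra.
have itl : itg (@area R) (fun y => kap eta x y * Num.sqrt (D x y)).
  apply: (@itg_kap_cont _ _ 2).
    apply: (measurableT_comp (f := @Num.sqrt R)); last by meas.
    by apply: continuous_measurable_fun; exact: sqrt_continuous.
  exact: norm_sqrtD.
have itr : itg (@area R) (fun y => 3 * eta * g (D x y)).
  apply: itgZ; apply: (@itg_bounded _ _ _ _ _ (eta `^ (- (3 / 2)))).
    by apply: (measurableT_comp (continuous_measurable_fun cg)); meas.
  move=> y; rewrite ger0_norm ?powR_ge0// /g !powRN lef_pV2 ?posrE ?powR_gt0//.
  by apply: ge0_ler_powR; rewrite ?nnegrE ?(ltW (e0 _)) ?(ltW eta0)// ?lerDl ?le_max ?lexx//; lra.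
apply: (@le_trans _ _ (\int[@area R]_y (3 * eta * g (D x y)))).
  apply: le_Rint => // y; rewrite /kap /g max_r ?D_ge0//.
  have h1 := etaD_gt0 eta0 x y; rewrite -mulrA; apply: ler_pM.
  - by rewrite addr_ge0 ?sqr_ge0 ?mulr_ge0 ?ltW.
  - by rewrite mulr_ge0 ?invr_ge0 ?sqr_ge0 ?sqrtr_ge0.
  - by have : eta * eta <= eta; [rewrite ler_piMl// ltW|rewrite expr2; lra].
  - have -> : (eta + D x y) `^ (- (3 / 2)) = ((eta + D x y) ^+ 2)^-1 * Num.sqrt (eta + D x y).
      rewrite -powR12_sqrt ?ltW// -powR_mulrn ?ltW// -powRN -powRD ?(gt_eqF h1) ?implybT//.
      by congr powR; lra.
    by apply: ler_wpM2l; [rewrite invr_ge0 sqr_ge0|rewrite ler_sqrt ?(ltW h1)// lerDr ltW].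
rewrite RintZ; last first.
  by have := itgZ (3 * eta)^-1 itr; congr itg; apply/funext => y; rewrite mulKf// gt_eqF// mulr_gt0.
have s0 : 0 < Num.sqrt eta by rewrite sqrtr_gt0.
have -> : 12 * pi * Num.sqrt eta = 3 * eta * (4 * pi / Num.sqrt eta).
  have es := sqr_sqrtr (ltW eta0); move: s0 es; set q := Num.sqrt eta => q0 es.
  by rewrite -es; field; rewrite gt_eqF.
by rewrite ler_wpM2l// mulr_ge0// ltW.
Qed.

End kap.

End approximation.

Section density_measure.
Variables (R : realType) (f : sphere R -> R).
Hypothesis itf : itg (@area R) f.
Hypothesis f0 : forall x, 0 <= f x.

(** A nonnegative density as a finite measure; the proofs are arguments so that
    the instances depend on terms. *)
Definition densm (h1 : itg (@area R) f) (h2 : forall x, 0 <= f x) (A : set (sphere R)) : \bar R :=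
  (\int[@area R]_(x in A) (f x)%:E)%E.

Let densm0 : densm itf f0 set0 = 0%E. Proof. exact: integral_set0. Qed.
Let densm_ge0 A : (0 <= densm itf f0 A)%E.
Proof. by apply: integral_ge0 => x _; rewrite lee_fin. Qed.
Let densm_sigma : semi_sigma_additive (densm itf f0).
Proof.
apply: semi_sigma_additive_nng_induced; last by move=> x; rewrite lee_fin.
by apply/measurable_EFinP; exact: itg_measurable itf.
Qed.

HB.instance Definition _ := isMeasure.Build _ _ _ (densm itf f0) densm0 densm_ge0 densm_sigma.

Let densm_fin : fin_num_fun (densm itf f0).
Proof.
by move=> A mA; apply: integrable_fin_num => //; apply: integrableS itf.
Qed.

HB.instance Definition _ := Measure_isFinite.Build _ _ _ (densm itf f0) densm_fin.

Lemma Rint_densm (F : sphere R -> R) C : measurable_fun setT F -> (forall x, `|F x| <= C) ->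
  \int[densm itf f0]_x F x = \int[@area R]_x (F x * f x).
Proof.
move=> mF FC; apply: (@itg_pushed _ _ _ _ R (@area R) (densm itf f0) idfun f _ _ f0 _ F _).2.
- exact: measurable_id.
- exact: itg_measurable itf.
- move=> A mA; rewrite /densm [LHS]integral_mkcond; apply: eq_integral => x _.
  by rewrite patchE /= indicE; case: ifP => _; rewrite ?mul1r ?mul0r.
- exact: itg_bounded mF FC.
Qed.

End density_measure.

Section weak_limits.
Variable R : realType.

(** The positive and negative parts of [w] define two finite measures that agree
    on each [psi]. *)
Lemma psi_ae0 (w : sphere R -> R) : itg (@area R) w ->
  (forall n r s t, \int[@area R]_x (psi n r s t x * w x) = 0) ->
  {ae @area R, forall x, w x = 0}.
Proof.
move=> iw E; have inw := itg_norm iw.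
have ip : itg (@area R) (fun x => `|w x| + w x) by exact: itgD.
have im : itg (@area R) (fun x => `|w x| - w x) by exact: itgB.
have p0 x : 0 <= `|w x| + w x by rewrite -lerBlDr sub0r -normrN ler_norm.
have m0 x : 0 <= `|w x| - w x by rewrite subr_ge0 ler_norm.
have mE := psi_measure_unique (m1 := densm ip p0) (m2 := densm im m0).
have {mE}H : forall A, measurable A -> densm ip p0 A = densm im m0 A.
  apply: mE => n r s t; have np := @norm_psi R n r s t; have mp := @measurable_psi R n r s t.
  rewrite !(Rint_densm _ _ mp np).
  have i1 : itg (@area R) (fun x => psi n r s t x * `|w x|) by exact: itgMb inw mp np.
  have i2 : itg (@area R) (fun x => psi n r s t x * w x) by exact: itgMb iw mp np.
  under eq_Rint do rewrite mulrDr; under [RHS]eq_Rint do rewrite mulrBr.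
  by rewrite RintD// RintB// E addr0 subr0.
have h0 := integral_ae_eq measurableT ip (measurable_int _ im) (fun A _ mA => H A mA).
have h : {ae @area R, forall x, setT x -> (`|w x| + w x)%:E = (`|w x| - w x)%:E} := h0.
apply: ae_mono h => x hx; have := EFin_inj (hx I); lra.
Qed.

Definition etan (n : nat) : R := n.+1%:R^-1.

Lemma etan_gt0 n : 0 < etan n. Proof. by rewrite invr_gt0. Qed.
Lemma etan_le1 n : etan n <= 1. Proof. by rewrite invf_le1// ler1n. Qed.
Lemma cvg_etan : etan n @[n --> \oo] --> 0.
Proof. exact: cvg_harmonic. Qed.

Lemma kap_psi n r s t k x :
  `|\int[@area R]_y (kap (etan k) x y * psi n r s t y) - 4 * pi * psi n r s t x| <=
  3 * n%:R ^+ 2 * Num.sqrt 2 * (12 * pi * Num.sqrt (etan k)).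
Proof.
have e0 := etan_gt0 k; set eta := etan k in e0 *.
have mp := @measurable_psi R n r s t; have np := @norm_psi R n r s t.
have i1 : itg (@area R) (fun y => kap eta x y * psi n r s t y) by exact: itg_kap_cont mp np.
have i2 : itg (@area R) (fun y => kap eta x y * psi n r s t x).
  by apply: (@itg_kap_cont _ _ e0 _ _ 1) => //; exact: measurable_cst.
have E : 4 * pi * psi n r s t x = \int[@area R]_y (kap eta x y * psi n r s t x).
  rewrite -(Rint_kap e0 x) mulrC -RintZ; first by apply: eq_Rint => y; rewrite mulrC.
  have h : itg (@area R) (fun y => kap eta x y * 1).
    by apply: (@itg_kap_cont _ _ e0 _ _ 1) => //; rewrite normr1.
  by move: h; under eq_fun do rewrite mulr1.
rewrite E -RintB//; have i3 := itgB i1 i2.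
apply: (le_trans (normr_Rint i3)).
have i4 : itg (@area R) (fun y => kap eta x y * Num.sqrt (D x y)).
  apply: (@itg_kap_cont _ _ e0 _ _ 2).
    apply: (measurableT_comp (f := @Num.sqrt R)); last by meas.
    by apply: continuous_measurable_fun; exact: sqrt_continuous.
  exact: norm_sqrtD.
apply: (@le_trans _ _ (\int[@area R]_y (3 * n%:R ^+ 2 * Num.sqrt 2 * (kap eta x y * Num.sqrt (D x y))))).
  apply: le_Rint; [exact: itg_norm|exact: itgZ|move=> y].
  rewrite -mulrBr normrM ger0_norm ?kap_ge0// mulrCA ler_wpM2l ?kap_ge0//.
  apply: (le_trans (psi_lip _ _ _ _ _ _)).
  by rewrite sqrtrM// DC mulrA.
rewrite RintZ// ler_wpM2l ?mulr_ge0 ?sqrtr_ge0 ?sqr_ge0//.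
by apply: Rint_kap_sqrt => //; exact: etan_le1.
Qed.

(** [kap / (4 pi)] is an approximation of the identity on the functions [psi],
    and these separate integrable functions. *)
Lemma kap_weak_limit (g K b : sphere R -> R) (Kn : nat -> sphere R -> R) :
  itg (@area R) g -> measurable_fun setT K -> (forall n, measurable_fun setT (Kn n)) ->
  itg (@area R) b -> {ae @area R, forall y, Kn ^~ y @ \oo --> K y} ->
  {ae @area R, forall y, forall n, `|Kn n y| <= b y} ->
  (forall n y, \int[@area R]_x (kap (etan n) x y * g x) = Kn n y) ->
  {ae @area R, forall x, 4 * pi * g x = K x}.
Proof.
move=> ig mK mKn ib cK bK E.
have [iK _] := Rint_dct mKn mK cK ib bK.
suff : {ae @area R, forall x, 4 * pi * g x - K x = 0}.
  by apply: ae_mono => x /eqP; rewrite subr_eq0 => /eqP.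
apply: psi_ae0 => [|n r s t]; first by apply: itgB => //; exact: itgZ.
have mp := @measurable_psi R n r s t; have np := @norm_psi R n r s t.
have ig4 := itgMb (itgZ (4 * pi) ig) mp np; have iKp := itgMb iK mp np.
under eq_Rint do rewrite mulrBr; rewrite RintB//; apply/eqP; rewrite subr_eq0; apply/eqP.
have [_ c1] : itg (@area R) (fun y => psi n r s t y * K y) /\
    \int[@area R]_y (psi n r s t y * Kn k y) @[k --> \oo] --> \int[@area R]_y (psi n r s t y * K y).
  apply: (Rint_dct (g := b)) => //.
  - by move=> k; exact: measurable_funM.
  - exact: measurable_funM.
  - by apply: ae_mono cK => y cy; apply: cvgM => //; exact: cvg_cst.
  - by apply: ae_mono bK => y hy k; rewrite normrM (le_trans (ler_wpM2r _ (np y)))// mul1r.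
have swap k : \int[@area R]_y (psi n r s t y * Kn k y) =
    \int[@area R]_x (g x * \int[@area R]_y (kap (etan k) x y * psi n r s t y)).
  have e0 := etan_gt0 k.
  pose h (z : sphere R * sphere R) := psi n r s t z.2 * (kap (etan k) z.1 z.2 * g z.1).
  pose C := (2 * etan k + etan k ^+ 2) / etan k ^+ 2.
  have kC x y : `|kap (etan k) x y| <= C by rewrite ger0_norm ?kap_ge0 ?kap_le.
  have mkap : measurable_fun setT (fun z : sphere R * sphere R => kap (etan k) z.1 z.2).
    by rewrite /kap; meas.
  have mg2 : measurable_fun setT (fun z : sphere R * sphere R => g z.1).
    exact: (measurableT_comp (itg_measurable ig) measurable_fst).
  have mp2 : measurable_fun setT (fun z : sphere R * sphere R => psi n r s t z.2).
    exact: (measurableT_comp mp measurable_snd).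
  have ih : itg (@area R \x @area R)%E h.
    apply: (@itg_prod_bound _ _ _ _ _ _ _ _ (fun _ => C * \int[@area R]_x `|g x|)).
    - by rewrite /h; apply: measurable_funM => //; exact: measurable_funM.
    - exact: itg_cst.
    - move=> y; rewrite -RintZ; last exact: itg_norm.
      rewrite EFin_Rint; last by apply: itgZ; exact: itg_norm.
      apply: ge0_le_integral => //.
      + apply/measurable_EFinP; apply: measurableT_comp => //.
        apply: (@measurable_funM _ _ _ _ (fun=> psi n r s t y)) => //.
        apply: (@measurable_funM _ _ _ _ (fun x => kap (etan k) x y)); last exact: itg_measurable ig.
        by rewrite /kap; meas.
      + apply/measurable_EFinP; apply: measurable_funM => //; apply: measurableT_comp => //.
        exact: itg_measurable ig.
      + move=> x _; rewrite lee_fin -[leRHS]mul1r; apply: (@nbM _ (psi n r s t y) _ 1) => //.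
        by rewrite normrM; apply: ler_wpM2r.
  transitivity (\int[@area R]_y \int[@area R]_x h (x, y)).
    apply: eq_Rint => y; rewrite -E /h /= RintZ//.
    by apply: itgMb ig _ (kC ^~ y); rewrite /kap; meas.
  rewrite -(Rint_swap ih); apply: eq_Rint => x; rewrite -RintZ.
    by apply: eq_Rint => y; rewrite /h /=; ring.
  exact: itg_kap_cont mp np.
have c2 : \int[@area R]_y (psi n r s t y * Kn k y) @[k --> \oo] -->
    \int[@area R]_x (psi n r s t x * (4 * pi * g x)).
  under eq_fun do rewrite swap.
  have mI k : measurable_fun setT (fun x => \int[@area R]_y (kap (etan k) x y * psi n r s t y)).
    have ih : itg (@area R \x @area R)%E (fun z => kap (etan k) z.1 z.2 * psi n r s t z.2).
      apply: (@itg_bker_prod _ (fun z => kap (etan k) z.1 z.2) ((2 * etan k + etan k ^+ 2) / etan k ^+ 2)).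
      - by rewrite /kap; meas.
      - by move=> z; rewrite ger0_norm ?kap_ge0 ?kap_le ?etan_gt0.
      - exact: itg_bounded mp np.
    exact: itg_measurable (Rint_prod12 ih).1.
  have cI x : \int[@area R]_y (kap (etan k) x y * psi n r s t y) @[k --> \oo] --> 4 * pi * psi n r s t x.
    pose M : R := 3 * n%:R ^+ 2 * Num.sqrt 2 * (12 * pi).
    have c0 : M * Num.sqrt (etan k) @[k --> \oo] --> 0.
      rewrite -(mulr0 M) -(@sqrtr0 R); apply: cvgM; first exact: cvg_cst.
      exact: (continuous_cvg _ (@sqrt_continuous R 0) cvg_etan).
    apply/subr_cvg0; apply/norm_cvg0P.
    apply: (@squeeze_cvgr _ _ _ _ (fun=> 0) (fun k => M * Num.sqrt (etan k))) => //; last exact: cvg_cst.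
    by apply: nearW => k; rewrite normr_ge0 /= (le_trans (kap_psi n r s t k x))// /M mulrA.
  have c3 : \int[@area R]_x (g x * \int[@area R]_y (kap (etan k) x y * psi n r s t y)) @[k --> \oo]
      --> \int[@area R]_x (g x * (4 * pi * psi n r s t x)).
    apply: (Rint_dct (g := fun x => 4 * pi * `|g x|) _ _ _ _ _).2.
    - by move=> k; apply: measurable_funM => //; exact: itg_measurable ig.
    - by apply: measurable_funM; [exact: itg_measurable ig|exact: measurable_funM].
    - by apply: ae_all => x; apply: cvgM; [exact: cvg_cst|exact: cI].
    - by apply: itgZ; exact: itg_norm.
    - apply: ae_all => x k; rewrite normrM mulrC ler_wpM2r//.
      have e0 := etan_gt0 k.
      apply: le_trans (normr_Rint (itg_kap_cont e0 x mp np)) _.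
      rewrite -(Rint_kap e0 x); apply: le_Rint.
      + exact: itg_norm (itg_kap_cont e0 x mp np).
      + have h : itg (@area R) (fun y => kap (etan k) x y * 1).
          by apply: (@itg_kap_cont _ _ e0 _ _ 1) => // y; rewrite normr1.
        by move: h; under eq_fun do rewrite mulr1.
      + by move=> y; rewrite normrM ger0_norm ?kap_ge0// ler_piMr ?kap_ge0.
  rewrite (eq_Rint _ (g := fun x => g x * (4 * pi * psi n r s t x)))//.
  by move=> x; ring.
exact: (cvg_unique _ c2 c1).
Qed.

End weak_limits.

(** * Logarithmic potentials *)

Section potentials.
Variable R : realType.
Implicit Types x y p : sphere R.

Lemma Rint_area_cst c : \int[@area R]_x c = c * (4 * pi).
Proof.
by rewrite Rint_cst; congr (_ * _); transitivity (fine (4 * pi)%:E : R); rewrite // -area_setT.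
Qed.

(** A bound of all the regularised logarithms at once, whose convolution with an
    integrable function is integrable. *)
Definition lb (u : R) : R := 4 + 2 * u `^ (- 2^-1).

Lemma lb_ge0 u : 0 <= lb u. Proof. by rewrite addr_ge0 ?mulr_ge0 ?powR_ge0. Qed.

Lemma measurable_lb : measurable_fun setT lb.
Proof. by rewrite /lb; meas. Qed.

Lemma ln_le_pow (u : R) : 0 < u -> - ln u <= 2 * u `^ (- 2^-1).
Proof.
move=> u0; have -> : - ln u = 2 * ln (u `^ (- 2^-1)) by rewrite ln_powR; field.
by rewrite ler_wpM2l// ltW// ln_sublinear// powR_gt0.
Qed.

Lemma norm_ln_lb (u : R) : 0 <= u <= 3 -> `|ln u| <= lb u.
Proof.
move=> /andP[u0 u2]; have h := powR_ge0 u (- 2^-1).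
move: u0; rewrite le_eqVlt => /orP[/eqP <-|u0]; first by rewrite ln0// normr0 lb_ge0.
have h1 := ln_le_pow u0; have h2 := ln_sublinear u0.
by rewrite /lb ler_norml; apply/andP; split; lra.
Qed.

Lemma norm_Lk_lb eta x y : 0 < eta <= 1 -> D x y <> 0 -> `|Lk eta x y| <= lb (D x y).
Proof.
move=> /andP[e0 e1] /eqP D0'; have D0 : 0 < D x y by rewrite lt_neqAle eq_sym D0' D_ge0.
have D2 := D_le2 x y; have h := powR_ge0 (D x y) (- 2^-1).
have h1 := ln_le_pow D0; have h2 := ln_sublinear (etaD_gt0 e0 x y).
have h3 : ln (D x y) <= ln (eta + D x y) by rewrite ler_ln ?posrE ?(addr_gt0 e0 D0)// lerDr ltW.
by rewrite /lb /Lk ler_norml; apply/andP; split; lra.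
Qed.

Lemma norm_Lk_cst eta x y : 0 < eta <= 1 -> `|Lk eta x y| <= `|ln eta| + 4.
Proof.
move=> /andP[e0 e1]; have D2 := D_le2 x y; have D0 := D_ge0 x y.
have h2 := ln_sublinear (etaD_gt0 e0 x y).
have h3 : ln eta <= ln (eta + D x y) by rewrite ler_ln ?posrE ?etaD_gt0// lerDl.
have := ler_norm (ln eta); have := ler_norm (- ln eta); rewrite normrN.
by rewrite /Lk => ? ?; rewrite ler_norml; apply/andP; split; lra.
Qed.

Lemma cvg_Lk x y : D x y <> 0 -> Lk (etan R n) x y @[n --> \oo] --> ln (D x y).
Proof.
move=> /eqP D0'; have D0 : 0 < D x y by rewrite lt_neqAle eq_sym D0' D_ge0.
rewrite -[X in ln X]add0r.
have c : {for 0 + D x y, continuous (@ln R)} by apply: continuous_ln; rewrite add0r.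
apply: (continuous_cvg _ c); apply: cvgD; [exact: cvg_etan|exact: cvg_cst].
Qed.

Lemma itg_lb p : itg (@area R) (fun x => lb (D p x)).
Proof.
apply: itgD; first exact: itg_cst.
by apply: itgZ; apply: (area_D_pow p _).1; apply/andP; split; lra.
Qed.

Lemma Rint_lb p : \int[@area R]_x lb (D p x) <= 32 * pi.
Proof.
have hq : 0 < (2^-1 : R) < 1 by lra.
have [i1 h1] := @area_D_pow R p 2^-1 hq.
rewrite RintD; [|exact: itg_cst|exact: itgZ].
have e8 : 4 * pi / (1 - 2^-1) = 8 * pi :> R.
  by rewrite (_ : 1 - 2^-1 = 2^-1 :> R) ?invrK; [ring|lra].
by rewrite Rint_area_cst RintZ//=; lra.
Qed.

Lemma itg_lb_prod (F : sphere R -> R) : itg (@area R) F ->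
  itg (@area R \x @area R)%E (fun z => lb (D z.1 z.2) * F z.2).
Proof.
apply: (itg_ker_prod (C := 32 * pi) measurable_lb lb_ge0) => x.
by split; [exact: itg_lb|exact: Rint_lb].
Qed.

Lemma itg_lb_ae (F : sphere R -> R) : itg (@area R) F ->
  {ae @area R, forall y, itg (@area R) (fun x => lb (D y x) * F x)}.
Proof. by move=> iF; apply: (ae_integrable1 (itg_lb_prod iF)). Qed.

Definition pot (F : sphere R -> R) y : R := \int[@area R]_x (ln (D y x) * F x).

Lemma itg_pot_prod (F : sphere R -> R) : itg (@area R) F ->
  itg (@area R \x @area R)%E (fun z => ln (D z.1 z.2) * F z.2).
Proof.
move=> iF; have mF := itg_measurable iF.
apply: itg_le (itg_norm (itg_lb_prod iF)).
  apply: measurable_funM; last exact: (measurableT_comp mF measurable_snd).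
  by meas.
move=> z; rewrite !normrM ler_wpM2r// (ger0_norm (lb_ge0 _)); apply: norm_ln_lb.
by rewrite D_ge0 (le_trans (D_le2 _ _))//; lra.
Qed.

Lemma itg_pot F : itg (@area R) F -> itg (@area R) (pot F).
Proof. by move=> iF; exact: (Rint_prod12 (itg_pot_prod iF)).1. Qed.

Lemma measurable_pot F : itg (@area R) F -> measurable_fun setT (pot F).
Proof. by move=> iF; exact: itg_measurable (itg_pot iF). Qed.

Lemma Lk_pot (F : sphere R -> R) y : itg (@area R) (fun x => lb (D y x) * F x) -> measurable_fun setT F ->
  (\int[@area R]_x (Lk (etan R n) y x * F x) @[n --> \oo] --> pot F y) /\
  forall n, `|\int[@area R]_x (Lk (etan R n) y x * F x)| <= \int[@area R]_x (lb (D y x) * `|F x|).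
Proof.
move=> iy mF; have iy' := itg_norm iy.
have B n : {ae @area R, forall x, `|Lk (etan R n) y x * F x| <= `|lb (D y x) * F x|}.
  apply: ae_mono (ae_D_neq y 0) => x D0; rewrite !normrM ler_wpM2r//.
  by rewrite (ger0_norm (lb_ge0 _)) norm_Lk_lb// etan_gt0 etan_le1.
have mL n : measurable_fun setT (fun x => Lk (etan R n) y x * F x).
  by apply: measurable_funM => //; rewrite /Lk; meas.
have iL n := itg_le_ae (mL n) (B n) iy'.
split.
  apply: (Rint_dct mL _ _ iy' _).2.
  - by apply: measurable_funM => //; meas.
  - by apply: ae_mono (ae_D_neq y 0) => x D0; apply: cvgM; [exact: cvg_Lk|exact: cvg_cst].
  - apply: ae_mono (ae_D_neq y 0) => x D0 n; rewrite !normrM ler_wpM2r//.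
    by rewrite (ger0_norm (lb_ge0 _)) norm_Lk_lb// etan_gt0 etan_le1.
move=> n; apply: (le_trans (normr_Rint (iL n))).
have -> : \int[@area R]_x (lb (D y x) * `|F x|) = \int[@area R]_x `|lb (D y x) * F x|.
  by apply: eq_Rint => x; rewrite normrM (ger0_norm (lb_ge0 _)).
by apply: le_Rint_ae => //; exact: itg_norm.
Qed.

Lemma LkC eta x y : Lk eta x y = Lk eta y x. Proof. by rewrite /Lk DC. Qed.

Lemma measurable_Rint_Lk (F : sphere R -> R) n : itg (@area R) F ->
  measurable_fun setT (fun y => \int[@area R]_x (Lk (etan R n) y x * F x)).
Proof.
move=> iF; have ih : itg (@area R \x @area R)%E (fun z => Lk (etan R n) z.1 z.2 * F z.2).
  apply: (@itg_bker_prod _ (fun z => Lk (etan R n) z.1 z.2) (`|ln (etan R n)| + 4)) => //.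
    by rewrite /Lk; meas.
  by move=> z; rewrite norm_Lk_cst// etan_gt0 etan_le1.
exact: itg_measurable (Rint_prod12 ih).1.
Qed.

(** The averages of [u] converge to [u] and the regularised potentials to the
    potential. *)
Lemma potential_rep (u F : sphere R -> R) c : itg (@area R) u -> itg (@area R) F ->
  (forall n y, \int[@area R]_x (kap (etan R n) x y * u x) =
     c - \int[@area R]_x (Lk (etan R n) y x * F x)) ->
  {ae @area R, forall y, 4 * pi * u y = c - pot F y}.
Proof.
move=> iu iF E; have mF := itg_measurable iF.
apply: (kap_weak_limit (Kn := fun n y => c - \int[@area R]_x (Lk (etan R n) y x * F x))
   (b := fun y => `|c| + \int[@area R]_x (lb (D y x) * `|F x|))) => //.
- by apply: measurable_funB => //; exact: measurable_pot.
- by move=> n; apply: measurable_funB => //; exact: measurable_Rint_Lk.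
- apply: itgD; first exact: itg_cst.
  exact: (Rint_prod12 (itg_lb_prod (itg_norm iF))).1.
- apply: ae_mono (itg_lb_ae iF) => y iy; apply: cvgB; first exact: cvg_cst.
  exact: (Lk_pot iy mF).1.
- apply: ae_mono (itg_lb_ae iF) => y iy n; rewrite (le_trans (ler_normB _ _))// lerD2l.
  exact: (Lk_pot iy mF).2.
Qed.

(** The test function is the regularised logarithm with pole [y]. *)
Lemma weak_poisson_rep (u F : sphere R -> R) : itg (@area R) u -> itg (@area R) F ->
  weak_poisson u F ->
  {ae @area R, forall y, 4 * pi * u y = \int[@area R]_x u x - pot F y}.
Proof.
move=> iu iF wp; have mF := itg_measurable iF.
apply: potential_rep => // n y; have e0 := etan_gt0 R n.
have := weak_poisson_laplace wp (smooth_Lk e0 y).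
under [LHS]eq_Rint do rewrite laplace_Lk// mulrDr mulrN1 addrC.
have ik : itg (@area R) (fun x => u x * kap (etan R n) x y).
  under eq_fun do rewrite mulrC.
  apply: (itgMb (C := (2 * etan R n + etan R n ^+ 2) / etan R n ^+ 2) iu).
    by rewrite /kap; meas.
  by move=> x; rewrite ger0_norm ?kap_ge0 ?kap_le.
rewrite RintB// => E; transitivity (\int[@area R]_x (u x * kap (etan R n) x y)).
  by apply: eq_Rint => x; rewrite mulrC.
have -> : \int[@area R]_x (Lk (etan R n) y x * F x) = \int[@area R]_x (F x * Lk (etan R n) x y).
  by apply: eq_Rint => x; rewrite mulrC LkC.
by move: E; lra.
Qed.

Lemma Rint_Lk_centre eta y z : 0 < eta <= 1 ->
  \int[@area R]_x Lk eta y x = \int[@area R]_x Lk eta z x.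
Proof.
move=> /andP[e0 e1].
pose g (u : R) := ln (eta + Num.max 0 u) - ln eta.
have hg0 u : 0 <= g u.
  by rewrite subr_ge0 ler_ln ?posrE ?etamax_gt0// lerDl le_max lexx.
have mg : measurable_fun setT g.
  apply: continuous_measurable_fun; rewrite /g; cts.
  by apply: cts_ln; [move=> u; exact: etamax_gt0|cts].
have E w : \int[@area R]_x Lk eta w x = \int[@area R]_x g (D w x) + ln eta * (4 * pi).
  have il : itg (@area R) (fun x => Lk eta w x).
    apply: (@itg_bounded _ _ _ _ _ (`|ln eta| + 4)); first by rewrite /Lk; meas.
    by move=> x; apply: norm_Lk_cst; rewrite e0 e1.
  rewrite (@eq_Rint _ _ _ _ (fun x => g (D w x)) (fun x => Lk eta w x - ln eta)); last first.
    by move=> x; rewrite /g max_r ?D_ge0.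
  have E1 : \int[@area R]_x cst (ln eta) x = ln eta * (4 * pi) by exact: Rint_area_cst.
  by rewrite (RintB il (itg_cst _ (ln eta))) E1 subrK.
by rewrite !E (Rint_D_centre y z).
Qed.

Definition lncst : R := pot (fun=> 1) (north R).

Lemma pot1 y : pot (fun=> 1) y = lncst.
Proof.
have il w : itg (@area R) (fun x => lb (D w x) * 1).
  by under eq_fun do rewrite mulr1; exact: itg_lb.
have [c1 _] := Lk_pot (il y) (@measurable_cst _ _ _ _ _ _).
have [c2 _] := Lk_pot (il (north R)) (@measurable_cst _ _ _ _ _ _).
have E : (fun n => \int[@area R]_x (Lk (etan R n) (north R) x * 1)) =
    (fun n => \int[@area R]_x (Lk (etan R n) y x * 1)).
  apply/funext => n; under eq_Rint do rewrite mulr1; under [RHS]eq_Rint do rewrite mulr1.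
  by apply: Rint_Lk_centre; rewrite etan_gt0 etan_le1.
by rewrite E in c2; exact: (cvg_unique _ c1 c2).
Qed.

(** The same computation as for [weak_poisson_rep], the source being a point
    mass. *)
Lemma green_rep p (g : sphere R -> R) : is_green p g ->
  {ae @area R, forall y, 4 * pi * g y = (4 * pi)^-1 * lncst - ln (D p y)}.
Proof.
move=> [ig hg hg0].
have il : itg (@area R) (fun x => lb (D p x) * 1).
  by under eq_fun do rewrite mulr1; exact: itg_lb.
have [c1 b1] := Lk_pot il (@measurable_cst _ _ _ _ _ _).
pose cn n := \int[@area R]_x (Lk (etan R n) p x * 1).
have p0 := pi_gt0 R; have p40 : 0 < (4 * pi)^-1 :> R by rewrite invr_gt0 mulr_gt0.
apply: (kap_weak_limit (Kn := fun n y => (4 * pi)^-1 * cn n - Lk (etan R n) p y)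
   (b := fun y => (4 * pi)^-1 * \int[@area R]_x (lb (D p x) * `|1|) + lb (D p y))) => //.
- by apply: measurable_funB => //; meas.
- by move=> n; apply: measurable_funB => //; rewrite /Lk; meas.
- by apply: itgD; [exact: itg_cst|exact: itg_lb].
- apply: ae_mono (ae_D_neq p 0) => y D0; apply: cvgB; last exact: cvg_Lk.
  by apply: cvgM; [exact: cvg_cst|rewrite -(pot1 p); exact: c1].
- apply: ae_mono (ae_D_neq p 0) => y D0 n; rewrite (le_trans (ler_normB _ _))// lerD//.
    by rewrite normrM gtr0_norm// ler_wpM2l ?(ltW p40)//; exact: b1.
  by apply: norm_Lk_lb => //; rewrite etan_gt0 etan_le1.
move=> n y; have e0 := etan_gt0 R n.
have := hg _ (smooth_Lk e0 y).
under [LHS]eq_Rint do rewrite laplace_Lk// opprD opprK mulrDr mulr1 mulrN.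
have ik : itg (@area R) (fun x => g x * kap (etan R n) x y).
  under eq_fun do rewrite mulrC.
  apply: (itgMb (C := (2 * etan R n + etan R n ^+ 2) / etan R n ^+ 2) ig).
    by rewrite /kap; meas.
  by move=> x; rewrite ger0_norm ?kap_ge0 ?kap_le.
rewrite RintB//.
have -> : \int[@area R]_x g x = 0 by exact: hg0.
have -> : \int[dV R]_x Lk (etan R n) x y = cn n.
  transitivity (\int[@area R]_x Lk (etan R n) y x); first by apply: eq_Rint => x; rewrite LkC.
  rewrite (@Rint_Lk_centre _ y p) ?etan_gt0 ?etan_le1//.
  by apply: eq_Rint => x; rewrite mulr1.
move=> E; transitivity (\int[@area R]_x (g x * kap (etan R n) x y)).
  by apply: eq_Rint => x; rewrite mulrC.
by move: E; lra.
Qed.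

End potentials.

(** * From weak solutions to densities *)

Section reduction.
Variable R : realType.
Implicit Types x y : sphere R.

Lemma Lfun2_itg (u : sphere R -> R) : u \in Lfun (dV R) 2%:E -> itg (@area R) u.
Proof.
move=> u2; have iu2 : itg (@area R) (fun x => u x ^+ 2) by exact: Lfun2_integrable_sqr u2.
have mu : measurable_fun setT u by move: u2; rewrite inE => /andP[+ _]; rewrite inE.
apply: (@itg_le _ _ _ _ (fun x => 1 + u x ^+ 2)) => // [x|]; last first.
  by apply: itgD => //; exact: itg_cst.
have h1 := sqr_ge0 (u x - 1); have h2 := sqr_ge0 (u x + 1); have h3 := sqr_ge0 (u x).
by rewrite ler_norml; apply/andP; split; nra.
Qed.

Lemma Rint_not_itg (w : sphere R -> R) : measurable_fun setT w -> (forall x, 0 <= w x) ->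
  ~ itg (@area R) w -> \int[@area R]_x w x = 0.
Proof.
move=> mw w0 niw; rewrite /Rintegral.
case E : (\int[@area R]_x (w x)%:E)%E => [r| |//] //=.
by case: niw; apply: (itg_ge0_bound (C := r) mw w0 _).1; rewrite E.
Qed.

Lemma Rint_gt0 (w : sphere R -> R) : itg (@area R) w -> (forall x, 0 < w x) ->
  0 < \int[@area R]_x w x.
Proof.
move=> iw w0; have w0' x := ltW (w0 x).
rewrite lt_neqAle Rint_ge0// andbT eq_sym; apply/eqP => E.
have I0 : (\int[@area R]_x `|(w x)%:E| = 0)%E.
  by under eq_integral do rewrite gee0_abs ?lee_fin//; rewrite -EFin_Rint// E.
have /ae_eq_integral_abs h : measurable_fun setT (EFin \o w) by exact: (measurable_int _ iw).
have [N [mN N0 subN]] : {ae @area R, forall x, setT x -> (w x)%:E = 0%E} := (h _ measurableT).1 I0.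
have : (@area R setT <= 0)%E.
  rewrite -N0; apply: le_measure; rewrite ?inE// => x _; apply: subN => /= hx; have h0 := EFin_inj (hx Logic.I).
  by have := w0 x; rewrite h0 ltxx.
by rewrite area_setT lee_fin leNgt mulr_gt0// pi_gt0.
Qed.

Lemma ae_forall3 (P : 'I_3 -> sphere R -> Prop) :
  (forall m, {ae @area R, forall x, P m x}) -> {ae @area R, forall x, forall m, P m x}.
Proof.
move=> h; have := ae_foralln (fun n => h (inord n)).
by apply: ae_mono => x hx m; rewrite -(inord_val m); exact: hx.
Qed.

(** When [h e^u] is not integrable its integral is [0] by convention, hence so
    is its inverse, and the mean field is a constant. The total mass tells the
    two cases apart. *)
Lemma mean_field_itg (rho : R) (h u : sphere R -> R) :
  measurable_fun setT (fun x => h x * expR (u x)) -> (forall x, 0 < h x) ->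
  itg (@area R) (mean_field rho h u) /\
  ((itg (@area R) (fun x => h x * expR (u x)) /\ \int[@area R]_x mean_field rho h u x = 0)
   \/ \int[@area R]_x mean_field rho h u x = - rho).
Proof.
move=> mw h0; set w := fun x => h x * expR (u x) in mw *.
have w0 x : 0 < w x by rewrite mulr_gt0// expR_gt0.
have p0 := pi_gt0 R.
have [iw|niw] := pselect (itg (@area R) w).
  have I0 := Rint_gt0 iw w0.
  have E x : mean_field rho h u x = rho / (\int[@area R]_y w y) * w x + - (rho / (4 * pi)).
    rewrite /mean_field -/(w x) -[\int[dV R]_y _]/(\int[@area R]_y w y).
    move: I0; set I := \int[@area R]_y w y => I0.
    by move: p0; generalize (@pi R) => q q0; field; rewrite (gt_eqF I0) (gt_eqF q0).
  have i1 : itg (@area R) (fun x => rho / (\int[@area R]_y w y) * w x) by exact: itgZ.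
  have i2 : itg (@area R) (fun=> - (rho / (4 * pi))) by exact: itg_cst.
  have -> : mean_field rho h u = fun x => rho / (\int[@area R]_y w y) * w x + - (rho / (4 * pi)).
    by apply/funext.
  split; [exact: itgD|left; split => //].
  rewrite RintD// RintZ// Rint_area_cst divfK ?gt_eqF// mulNr divfK ?subrr//.
  by rewrite gt_eqF// mulr_gt0.
have w0' x := ltW (w0 x).
have -> : mean_field rho h u = fun=> - (rho / (4 * pi)).
  apply/funext => x; rewrite /mean_field -/(w x).
  have -> : \int[dV R]_y w y = 0 by exact: Rint_not_itg.
  by rewrite invr0 mulr0 sub0r mulrN.
split; first exact: itg_cst.
by right; rewrite Rint_area_cst mulNr divfK// gt_eqF// mulr_gt0.
Qed.

(** The total masses in the two equations vanish, which excludes the degenerate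
    case: [2 m1 = m2] and [2 m2 = m1] give [m1 = m2 = 0]. *)
Lemma finite_masses (P1 P2 : Prop) (m1 m2 r1 r2 : R) : 0 < r1 -> 0 < r2 ->
  (P1 /\ m1 = 0) \/ m1 = - r1 -> (P2 /\ m2 = 0) \/ m2 = - r2 ->
  2 * m1 - m2 = 0 -> 2 * m2 - m1 = 0 -> P1 /\ P2.
Proof. by move=> ? ? [[? ->]| ->] [[? ->]| ->] ? ?; split => //; exfalso; lra. Qed.

(** Test with a constant. *)
Lemma weak_poisson_mean0 (u F : sphere R -> R) : weak_poisson u F -> \int[@area R]_x F x = 0.
Proof.
move=> wp; have s1 : smooth (fun _ : sphere R => 1 : R).
  by apply: (@kclass_smooth R 1 ltr01 (north R)); exact: kc_cst.
have := weak_poisson_laplace wp s1.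
have -> : laplace (fun _ : sphere R => 1 : R) = fun=> 0.
  apply/funext => x; rewrite /laplace /divergence big1// => i _.
  have -> : component (grad (fun _ : sphere R => 1)) i = fun=> 0.
    by apply/funext => z; rewrite /component /grad mxE (hgs_tderiv (hgs_cst 1 z)).
  by rewrite (hgs_tderiv (hgs_cst 0 x)).
under [LHS]eq_Rint do rewrite mulr0.
rewrite Rint_eq0//; under eq_Rint do rewrite mulr1.
by move/esym/eqP; rewrite oppr_eq0 => /eqP.
Qed.

Lemma ae_itg_pot (F : sphere R -> R) : itg (@area R) F ->
  {ae @area R, forall y, itg (@area R) (fun x => ln (D y x) * F x)}.
Proof. by move=> iF; apply: (ae_integrable1 (itg_pot_prod iF)). Qed.

Definition vort (a : 'I_3 -> R) (p : 'I_3 -> sphere R) (C : R) (f g : sphere R -> R) x : R :=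
  C + \sum_(m < 3) a m * ln (D x (p m)) - 2 * pot f x + pot g x.

Lemma measurable_vort a p C f g : itg (@area R) f -> itg (@area R) g ->
  measurable_fun setT (vort a p C f g).
Proof.
move=> iF ig; have mf := measurable_pot iF; have mg := measurable_pot ig.
apply: measurable_funD => //; apply: measurable_funB; last exact: measurable_funM.
by apply: measurable_funD => //; apply: measurable_sum => m; meas.
Qed.

Lemma pot_affine (F1 F2 : sphere R -> R) (s c : R) y :
  itg (@area R) (fun x => ln (D y x) * F1 x) -> itg (@area R) (fun x => ln (D y x) * F2 x) ->
  pot (fun x => s * (2 * F1 x - F2 x) + c) y = s * (2 * pot F1 y - pot F2 y) + c * lncst R.
Proof.
move=> i1 i2; rewrite -(pot1 y) /pot.
have i3 : itg (@area R) (fun x => ln (D y x) * 1).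
  apply: itg_le (itg_lb y) => [|x]; first by meas.
  by rewrite mulr1 norm_ln_lb// D_ge0 (le_trans (D_le2 _ _))//; lra.
have i4 := itgB (itgZ 2 i1) i2.
transitivity (\int[@area R]_x (s * (2 * (ln (D y x) * F1 x) - ln (D y x) * F2 x) + c * (ln (D y x) * 1))).
  by apply: eq_Rint => x; ring.
by rewrite RintD; [|exact: itgZ|exact: itgZ]; rewrite !RintZ// RintB ?RintZ//; exact: itgZ.
Qed.

Variables (G : sphere R -> sphere R -> R) (p : 'I_3 -> sphere R).
Hypothesis hG : forall q, is_green q (G q).

Lemma h_tilde_gt0 a x : 0 < h_tilde G p a x. Proof. exact: expR_gt0. Qed.

Lemma measurable_h_tilde a : measurable_fun setT (h_tilde G p a).
Proof.
apply: (measurableT_comp (@measurable_expR R)); apply: measurable_funM => //.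
apply: measurable_sum => m; apply: measurable_funM => //.
by have [ig _ _] := hG (p m); exact: itg_measurable (ig : itg (@area R) _).
Qed.

(** The weight is a power of the distances because the Green function is a
    logarithm. *)
Lemma h_tilde_ae a : exists c, {ae @area R, forall x,
  h_tilde G p a x = expR (c + \sum_(m < 3) a m * ln (D x (p m)))}.
Proof.
exists (- \sum_(m < 3) a m * ((4 * pi)^-1 * lncst R)).
have h m := green_rep (hG (p m)).
have hh : {ae @area R, forall x m, 4 * pi * G (p m) x = (4 * pi)^-1 * lncst R - ln (D (p m) x)}.
  exact: ae_forall3.
apply: ae_mono hh => x hx; rewrite /h_tilde; congr expR.
rewrite -sumrN -big_split /= mulNr mulr_sumr -sumrN; apply: eq_bigr => m _.
by rewrite (DC x) mulrCA hx; ring.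
Qed.

Lemma toda_eq_ae a rho1 u F1 F2 c1 c2 : 0 < rho1 -> itg (@area R) u ->
  itg (@area R) F1 -> itg (@area R) F2 ->
  itg (@area R) (fun x => h_tilde G p a x * expR (u x)) ->
  weak_poisson u (fun x => 4 * pi * (2 * F1 x - F2 x) + (c1 + c2)) ->
  F1 = (fun x => rho1 * (h_tilde G p a x * expR (u x) / \int[@area R]_y (h_tilde G p a y * expR (u y)))) ->
  exists C, {ae @area R, forall x, F1 x = expR (vort a p C F1 F2 x)}.
Proof.
move=> r0 iu i1 i2 iw wp F1E; have p0 := pi_gt0 R.
have iF : itg (@area R) (fun x => 4 * pi * (2 * F1 x - F2 x) + (c1 + c2)).
  by apply: itgD; [apply: itgZ; apply: itgB => //; exact: itgZ|exact: itg_cst].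
have hu := weak_poisson_rep iu iF wp; have [c hc] := h_tilde_ae a.
have I0 : 0 < \int[@area R]_y (h_tilde G p a y * expR (u y)).
  by apply: Rint_gt0 => // x; rewrite mulr_gt0 ?expR_gt0 ?h_tilde_gt0.
move: I0 F1E; set I := \int[_]_y _ => I0 F1E.
exists (ln (rho1 / I) + c + (4 * pi)^-1 * (\int[@area R]_x u x - (c1 + c2) * lncst R)).
have hp : {ae @area R, forall y, itg (@area R) (fun x => ln (D y x) * F1 x) /\
    itg (@area R) (fun x => ln (D y x) * F2 x)}.
  by apply: ae_mono2 (ae_itg_pot i1) (ae_itg_pot i2).
have hcp := ae_mono2 (fun x => @conj _ _) hc hp.
apply: ae_mono2 hu hcp => x ux [hx [j1 j2]]; rewrite (pot_affine _ _ j1 j2) in ux.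
have r1I : 0 < rho1 / I by rewrite divr_gt0.
rewrite F1E hx mulrCA mulrC -expRD -{1}(lnK r1I) -expRD; congr expR.
have {}ux : u x = (4 * pi)^-1 * (\int[@area R]_x u x - (c1 + c2) * lncst R) - 2 * pot F1 x + pot F2 x.
  have k0 : 4 * pi != 0 :> R by rewrite mulf_neq0// gt_eqF.
  by apply: (mulfI k0); rewrite ux; move: k0; generalize (4 * @pi R) => k k0; field.
by rewrite ux /vort -F1E; ring.
Qed.

(** The normalised exponentials satisfy the integral equations only almost
    everywhere; the densities [f_i] are redefined as the right-hand sides, so
    that the equations hold at every point. *)
Theorem toda_densities a1 a2 rho1 rho2 u1 u2 : 0 < rho1 -> 0 < rho2 ->
  toda_solution (h_tilde G p a1) (h_tilde G p a2) rho1 rho2 u1 u2 ->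
  exists C1 C2 f1 f2, [/\ itg (@area R) f1, itg (@area R) f2,
    \int[@area R]_x f1 x = rho1 / (4 * pi), \int[@area R]_x f2 x = rho2 / (4 * pi) &
    (forall x, f1 x = expR (vort a1 p C1 f1 f2 x)) /\
    (forall x, f2 x = expR (vort a2 p C2 f2 f1 x))].
Proof.
move=> r1 r2 [[/Lfun2_itg iu1 _] [/Lfun2_itg iu2 _] wp1 wp2]; have p0 := pi_gt0 R.
have mw a u : itg (@area R) u -> measurable_fun setT (fun x => h_tilde G p a x * expR (u x)).
  move=> iu; apply: measurable_funM; first exact: measurable_h_tilde.
  exact: (measurableT_comp (@measurable_expR R) (itg_measurable iu)).
have [im1 E1] := mean_field_itg rho1 (mw a1 u1 iu1) (h_tilde_gt0 a1).
have [im2 E2] := mean_field_itg rho2 (mw a2 u2 iu2) (h_tilde_gt0 a2).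
have EM (m m' : sphere R -> R) : itg (@area R) m -> itg (@area R) m' ->
    \int[@area R]_x (2 * m x - m' x) = 2 * \int[@area R]_x m x - \int[@area R]_x m' x.
  by move=> im im'; rewrite RintB ?RintZ//; exact: itgZ.
have M1 := etrans (esym (EM _ _ im1 im2)) (weak_poisson_mean0 wp1).
have M2 := etrans (esym (EM _ _ im2 im1)) (weak_poisson_mean0 wp2).
have [iw1 iw2] := finite_masses r1 r2 E1 E2 M1 M2.
have w0 a (u : sphere R -> R) x : 0 < h_tilde G p a x * expR (u x) by rewrite mulr_gt0 ?expR_gt0 ?h_tilde_gt0.
have I1 := Rint_gt0 iw1 (w0 a1 u1); have I2 := Rint_gt0 iw2 (w0 a2 u2).
pose F a rho (u : sphere R -> R) x := rho / (4 * pi) *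
  (h_tilde G p a x * expR (u x) / \int[@area R]_y (h_tilde G p a y * expR (u y))).
have mfE a rho u x : mean_field rho (h_tilde G p a) u x = 4 * pi * F a rho u x + - (rho / (4 * pi)).
  rewrite /mean_field /F -[\int[dV R]_y _]/(\int[@area R]_y (h_tilde G p a y * expR (u y))).
  have k0 : 4 * pi != 0 :> R by rewrite mulf_neq0// gt_eqF.
  by move: k0; generalize (4 * @pi R) => k k0; generalize (h_tilde G p a x * expR (u x) / \int[@area R]_y (h_tilde G p a y * expR (u y))) => w; field.
have FE a rho u : F a rho u = fun x => (rho / (4 * pi) / \int[@area R]_y (h_tilde G p a y * expR (u y))) * (h_tilde G p a x * expR (u x)).
  by apply/funext => x; rewrite /F; ring.
have FE' a rho u : F a rho u = fun x => rho / (4 * pi) *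
    (h_tilde G p a x * expR (u x) / \int[@area R]_y (h_tilde G p a y * expR (u y))) by [].
clearbody F.
have wpF a a' rho rho' u u' :
    weak_poisson u (fun x => 2 * mean_field rho (h_tilde G p a) u x - mean_field rho' (h_tilde G p a') u' x) ->
    weak_poisson u (fun x => 4 * pi * (2 * F a rho u x - F a' rho' u' x)
      + (- (2 * (rho / (4 * pi))) + rho' / (4 * pi))).
  have alg (k r s z w : R) : 2 * (k * z + - r) - (k * w + - s) = k * (2 * z - w) + (- (2 * r) + s) by ring.
  by rewrite (_ : (fun x => 2 * _ - _) = fun x => 4 * pi * (2 * F a rho u x - F a' rho' u' x)
      + (- (2 * (rho / (4 * pi))) + rho' / (4 * pi))); last by apply/funext => x; rewrite 2!mfE alg.
have iF1 : itg (@area R) (F a1 rho1 u1) by rewrite FE; exact: itgZ.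
have iF2 : itg (@area R) (F a2 rho2 u2) by rewrite FE; exact: itgZ.
have J1 : \int[@area R]_x F a1 rho1 u1 x = rho1 / (4 * pi) by rewrite FE (RintZ _ iw1) divfK// gt_eqF.
have J2 : \int[@area R]_x F a2 rho2 u2 x = rho2 / (4 * pi) by rewrite FE (RintZ _ iw2) divfK// gt_eqF.
have q1 : 0 < rho1 / (4 * pi) by rewrite divr_gt0 ?mulr_gt0.
have q2 : 0 < rho2 / (4 * pi) by rewrite divr_gt0 ?mulr_gt0.
have [C1 H1] : exists C, {ae @area R, forall x, F a1 rho1 u1 x = expR (vort a1 p C (F a1 rho1 u1) (F a2 rho2 u2) x)}.
  exact: (toda_eq_ae q1 iu1 iF1 iF2 iw1 (wpF _ _ _ _ _ _ wp1) (FE' a1 rho1 u1)).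
have [C2 H2] : exists C, {ae @area R, forall x, F a2 rho2 u2 x = expR (vort a2 p C (F a2 rho2 u2) (F a1 rho1 u1) x)}.
  exact: (toda_eq_ae q2 iu2 iF2 iF1 iw2 (wpF _ _ _ _ _ _ wp2) (FE' a2 rho2 u2)).
move: {F mfE FE FE' wpF} (F a1 rho1 u1) (F a2 rho2 u2) iF1 iF2 J1 J2 H1 H2 => F1 F2 iF1 iF2 J1 J2 H1 H2.
pose f1 x := expR (vort a1 p C1 F1 F2 x); pose f2 x := expR (vort a2 p C2 F2 F1 x).
have mF1 := itg_measurable iF1; have mF2 := itg_measurable iF2.
have mf1 : measurable_fun setT f1 by apply: measurableT_comp => //; exact: measurable_vort.
have mf2 : measurable_fun setT f2 by apply: measurableT_comp => //; exact: measurable_vort.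
have P1 : pot f1 = pot F1.
  apply/funext => y; apply: ae_eq_Rint; [by meas|by meas|].
  by apply: ae_mono H1 => x ->.
have P2 : pot f2 = pot F2.
  apply/funext => y; apply: ae_eq_Rint; [by meas|by meas|].
  by apply: ae_mono H2 => x ->.
exists C1, C2, f1, f2; split.
- exact: itg_ae mf1 H1 iF1.
- exact: itg_ae mf2 H2 iF2.
- by rewrite -J1; apply: ae_eq_Rint => //; apply: ae_mono H1 => x ->.
- by rewrite -J2; apply: ae_eq_Rint => //; apply: ae_mono H2 => x ->.
- by split => x; rewrite /vort P1 P2.
Qed.

End reduction.

(** * The virial identity for regularised densities *)

Section parametric_integrals.
Context d (T : measurableType d) (R : realType) (mu : {measure set T -> \bar R}).

Lemma drv_Rint (F f : R -> T -> R) (G : T -> R) (s : R) :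
  (forall z, itg mu (F z)) -> (forall z w, drv (F ^~ w) z (f z w)) ->
  itg mu G -> (forall z w, `|f z w| <= G w) ->
  drv (fun z => \int[mu]_w F z w) s (\int[mu]_w f s w).
Proof.
move=> iF dF iG fG.
have G0 w : 0 <= G w by rewrite (le_trans _ (fG s w)).
have dE z w : derive1 (F ^~ w) z = f z w by rewrite derive1E; case: (dF z w).
have hd z w : derivable (F ^~ w) z 1 by case: (dF z w).
have sI : `]s - 1, s + 1[%classic s by rewrite /= in_itv /= ltrDl ltrBlDr ltrDl ltr01.
have hG z w : `]s - 1, s + 1[%classic z -> setT w -> `|partial1of2 F z w| <= G w.
  by move=> _ _; rewrite /partial1of2 dE.
have E := @differentiation_under_integral R _ _ mu F setT measurableT s (s - 1) (s + 1) sI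
  (fun z _ => iF z) (fun z w _ _ => hd z w) G G0 iG hG.
have E' := @derivable_under_integral R _ _ mu F setT measurableT s (s - 1) (s + 1) sI
  (fun z _ => iF z) (fun z w _ _ => hd z w) G G0 iG hG.
apply: DeriveDef; first exact: E'.
by rewrite -derive1E E; apply: eq_Rintegral => w _; exact: dE.
Qed.

Lemma cts_Rint (F : R -> T -> R) (G : T -> R) :
  (forall z, measurable_fun setT (F z)) -> (forall w, continuous (F ^~ w)) ->
  itg mu G -> (forall z w, `|F z w| <= G w) -> continuous (fun z => \int[mu]_w F z w).
Proof.
move=> mF cF iG FG s.
have iF z : itg mu (F z) by apply: itg_le (FG z) iG.
have sI : s \in `]s - 1, s + 1[%classic.
  by rewrite inE /= in_itv /= ltrDl ltrBlDr ltrDl ltr01.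
apply: (@continuity_under_integral R _ _ mu F setT measurableT (s - 1) (s + 1)
  (fun z _ => iF z) _ G iG _ s sI).
- by apply: ae_all => w _ z _; exact: cF.
- by move=> z _; apply: ae_all => w _; exact: FG.
Qed.

End parametric_integrals.

Lemma cts_meridian (R : realType) (s c b1 e b2 d k : R -> R) : continuous s -> continuous c -> continuous b1 ->
  continuous e -> continuous b2 -> continuous d -> continuous k ->
  continuous (fun th => s th * (2 * c th * b1 th * e th)
    + s th ^+ 2 * (b2 th * d th * e th + b1 th * (e th * k th))).
Proof. by move=> k1 k2 k3 k4 k5 k6 k7; cts. Qed.

Section regularised_virial.
Variables (R : realType) (n : nat).
Implicit Types x y v w : sphere R.

Let eta := etan R n.
Let e0 : 0 < eta. Proof. exact: etan_gt0. Qed.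
Let e1 : 0 < eta <= 1. Proof. by rewrite e0 etan_le1. Qed.

Definition Uh (f : sphere R -> R) x : R := \int[@area R]_y (Lk eta x y * f y).

(** The derivative of [Uh] along the field pointing away from [v]. *)
Definition DUh v (f : sphere R -> R) x : R :=
  \int[@area R]_y (Bk v x y / (eta + D x y) * f y).

Lemma itg_Lk f x : itg (@area R) f -> itg (@area R) (fun y => Lk eta x y * f y).
Proof.
move=> iF; apply: (itgMb (C := `|ln eta| + 4) iF); first by rewrite /Lk; meas.
by move=> y; exact: norm_Lk_cst.
Qed.

Lemma BkD_bound v x y : `|Bk v x y / (eta + D x y)| <= 2 / eta.
Proof.
have h := etaD_gt0 e0 x y; have D0 := D_ge0 x y.
rewrite normrM; apply: ler_pM => //; first exact: Bk_le2.
by rewrite ger0_norm ?invr_ge0 ?(ltW h)// lef_pV2 ?posrE// lerDl.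
Qed.

Lemma itg_DUh v f x : itg (@area R) f -> itg (@area R) (fun y => Bk v x y / (eta + D x y) * f y).
Proof.
by move=> iF; apply: (itgMb (C := 2 / eta) iF); [meas|move=> y; exact: BkD_bound].
Qed.

Lemma measurable_Uh f : itg (@area R) f -> measurable_fun setT (Uh f).
Proof. by move=> iF; exact: measurable_Rint_Lk. Qed.

Lemma measurable_DUh v f : itg (@area R) f -> measurable_fun setT (DUh v f).
Proof.
move=> iF; have ih : itg (@area R \x @area R)%E (fun z => Bk v z.1 z.2 / (eta + D z.1 z.2) * f z.2).
  apply: (@itg_bker_prod _ (fun z => Bk v z.1 z.2 / (eta + D z.1 z.2)) (2 / eta)) => //; first by meas.
  by move=> z; exact: BkD_bound.
exact: itg_measurable (Rint_prod12 ih).1.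
Qed.

Lemma Uh_bound f x : itg (@area R) f -> `|Uh f x| <= (`|ln eta| + 4) * \int[@area R]_y `|f y|.
Proof.
move=> iF; apply: (le_trans (normr_Rint (itg_Lk x iF))).
rewrite -RintZ; last exact: itg_norm.
apply: le_Rint; [exact: itg_norm (itg_Lk x iF)|by apply: itgZ; exact: itg_norm|].
by move=> y; rewrite normrM ler_wpM2r// norm_Lk_cst.
Qed.

Lemma DUh_bound v f x : itg (@area R) f -> `|DUh v f x| <= 2 / eta * \int[@area R]_y `|f y|.
Proof.
move=> iF; apply: (le_trans (normr_Rint (itg_DUh v x iF))).
rewrite -RintZ; last exact: itg_norm.
apply: le_Rint; [exact: itg_norm (itg_DUh v x iF)|by apply: itgZ; exact: itg_norm|].
by move=> y; rewrite normrM ler_wpM2r// BkD_bound.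
Qed.

Variables (a : 'I_3 -> R) (p : 'I_3 -> sphere R) (C : R) (f g : sphere R -> R).
Hypotheses (itf : itg (@area R) f) (itgg : itg (@area R) g).

Definition Wh x : R := C + \sum_(m < 3) a m * Lk eta x (p m) - 2 * Uh f x + Uh g x.

Definition DWh v x : R := \sum_(m < 3) a m * (Bk v x (p m) / (eta + D x (p m)))
  - 2 * DUh v f x + DUh v g x.

Let mU := measurable_Uh itf.
Let mUg := measurable_Uh itgg.

Lemma measurable_Wh : measurable_fun setT Wh.
Proof.
apply: measurable_funD => //; apply: measurable_funB; last exact: measurable_funM.
apply: measurable_funD => //; apply: measurable_sum => m.
by apply: measurable_funM => //; rewrite /Lk; meas.
Qed.

Lemma measurable_DWh v : measurable_fun setT (DWh v).
Proof.
have mD := measurable_DUh v itf; have mDg := measurable_DUh v itgg.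
apply: measurable_funD => //; apply: measurable_funB; last exact: measurable_funM.
by apply: measurable_sum => m; meas.
Qed.

Lemma Wh_bounded : exists B, forall x, `|Wh x| <= B.
Proof.
eexists => x; rewrite /Wh; apply: nbD; last exact: Uh_bound.
apply: nbD; last by apply: nbN; apply: nbM; [exact: lexx|exact: Uh_bound].
apply: nbD; first exact: lexx.
apply: le_trans (ler_norm_sum _ _ _) _; apply: ler_sum => m _.
by apply: nbM; [exact: lexx|exact: norm_Lk_cst].
Qed.

Lemma DWh_bounded v : exists B, forall x, `|DWh v x| <= B.
Proof.
eexists => x; rewrite /DWh; apply: nbD; last exact: DUh_bound.
apply: nbD; last by apply: nbN; apply: nbM; [exact: lexx|exact: DUh_bound].
apply: le_trans (ler_norm_sum _ _ _) _; apply: ler_sum => m _.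
by apply: nbM; [exact: lexx|exact: BkD_bound].
Qed.

Section meridian.
Variables (v : sphere R) (P : R -> sphere R) (s1 : sphere R -> R).
Hypotheses (ms1 : measurable_fun setT s1) (s11 : forall y, `|s1 y| <= 1).
Hypotheses (Pv : forall th, sdot v (P th) = cos th)
  (Py : forall th y, sdot (P th) y = sin th * s1 y + cos th * sdot v y).

Let dD th y := sin th * sdot v y - cos th * s1 y.

Let sin_dD th y : sin th * dD th y = Bk v (P th) y.
Proof.
rewrite /dD /Bk Pv Py; have h := cos2Dsin2 th.
by rewrite -[X in _ = X - _]mul1r -h; ring.
Qed.

Let drvDm th y : drv (fun z => D (P z) y) th (dD th y).
Proof.
have -> : (fun z => D (P z) y) = fun z => 1 - (sin z * s1 y + cos z * sdot v y).
  by apply/funext => z; rewrite /D Py.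
by apply: drv_eq; [dv|rewrite /dD; ring].
Qed.

Let cD y : continuous (fun z => D (P z) y).
Proof. by move=> th; exact: drv_continuous (drvDm th y). Qed.

Let cdD y : continuous (fun z => dD z y). Proof. by rewrite /dD; cts. Qed.

Let ndD th y : `|dD th y| <= 2.
Proof.
have h1 := norm_sdot v y; have h2 := s11 y.
by rewrite /dD; apply: le_trans; [nb|lra].
Qed.

Let eDP z y : eta + D (P z) y != 0. Proof. by rewrite gt_eqF// etaD_gt0. Qed.

Let drvL th y : drv (fun z => Lk eta (P z) y) th (dD th y / (eta + D (P th) y)).
Proof.
have h := drvDm th y; apply: drv_eq; first by rewrite /Lk; dv; exact: etaD_gt0.
by rewrite add0r mulrC.
Qed.

Let cL y : continuous (fun th => dD th y / (eta + D (P th) y)).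
Proof. have h : continuous (fun th => D (P th) y) := @cD y.
by apply: ctsM; [exact: (@cdD y)|apply: ctsV; [by []|cts]]. Qed.

Let nL th y : `|dD th y / (eta + D (P th) y)| <= 2 / eta.
Proof.
have h := etaD_gt0 e0 (P th) y; have D0 := D_ge0 (P th) y.
rewrite normrM; apply: ler_pM => //.
by rewrite ger0_norm ?invr_ge0 ?(ltW h)// lef_pV2 ?posrE// lerDl.
Qed.

Let dU (h : sphere R -> R) th := \int[@area R]_y (dD th y / (eta + D (P th) y) * h y).

Let mdU (h : sphere R -> R) th : measurable_fun setT h ->
  measurable_fun setT (fun y => dD th y / (eta + D (P th) y) * h y).
Proof. by move=> mh; rewrite /dD; meas. Qed.

Let drvU h th : itg (@area R) h -> drv (fun z => Uh h (P z)) th (dU h th).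
Proof.
move=> ih; apply: (@drv_Rint _ _ _ (@area R) (fun z y => Lk eta (P z) y * h y) (fun z y => dD z y / (eta + D (P z) y) * h y) (fun y => 2 / eta * `|h y|)).
- by move=> z; exact: itg_Lk.
- by move=> z y; have hh := drvL z y; apply: drv_eq; [dv|rewrite mulr0 add0r mulrC].
- by apply: itgZ; exact: itg_norm.
- by move=> z y; rewrite normrM ler_wpM2r.
Qed.

Let cU h : itg (@area R) h -> continuous (dU h).
Proof.
move=> ih; apply: (@cts_Rint _ _ _ (@area R) (fun z y => dD z y / (eta + D (P z) y) * h y) (fun y => 2 / eta * `|h y|)).
- by move=> z; apply: mdU; exact: itg_measurable ih.
- by move=> y; apply: ctsM; [exact: (@cL y)|exact: cts_cst].
- by apply: itgZ; exact: itg_norm.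
- by move=> z y; rewrite normrM ler_wpM2r.
Qed.

Let sin_dU h th : itg (@area R) h -> sin th * dU h th = DUh v h (P th).
Proof.
move=> ih; rewrite /dU -RintZ; first by apply: eq_Rint => y; rewrite -sin_dD; ring.
apply: (itg_le (g := fun y => 2 / eta * `|h y|)).
- by apply: mdU; exact: itg_measurable ih.
- by move=> y; rewrite normrM ler_wpM2r.
- by apply: itgZ; exact: itg_norm.
Qed.

Let dW th := \sum_(m < 3) a m * (dD th (p m) / (eta + D (P th) (p m))) - 2 * dU f th + dU g th.

Let drv_sum (F G : 'I_3 -> R -> R) th : (forall m, drv (F m) th (G m th)) ->
  drv (fun z => \sum_(m < 3) F m z) th (\sum_(m < 3) G m th).
Proof.
move=> h; elim: (index_enum 'I_3) => [|m s IH].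
  by under eq_fun do rewrite big_nil; rewrite big_nil; exact: drv_cst.
by under eq_fun do rewrite big_cons; rewrite big_cons; exact: drvD.
Qed.

Let drvW th : drv (fun z => Wh (P z)) th (dW th).
Proof.
have h1 := drvU th itf; have h2 := drvU th itgg.
have h3 : drv (fun z => \sum_(m < 3) a m * Lk eta (P z) (p m)) th
    (\sum_(m < 3) a m * (dD th (p m) / (eta + D (P th) (p m)))).
  apply: (@drv_sum (fun m z => a m * Lk eta (P z) (p m)) (fun m z => a m * (dD z (p m) / (eta + D (P z) (p m))))) => m; have hh := drvL th (p m).
  by apply: drv_eq; [dv|rewrite mulr0 addr0].
by apply: drv_eq; [rewrite /Wh; dv|rewrite /dW; ring].
Qed.

Let cW : continuous dW.
Proof.
have h1 := @cU _ itf; have h2 := @cU _ itgg.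
have h3 : continuous (fun th => \sum_(m < 3) a m * (dD th (p m) / (eta + D (P th) (p m)))).
  elim: (index_enum 'I_3) => [|m s IH]; first by under eq_fun do rewrite big_nil; exact: cts_cst.
  under eq_fun do rewrite big_cons.
  have h := @cL (p m); apply: ctsD => //.
  by apply: ctsM; [cts|exact: h].
exact: (ctsD (ctsD h3 (ctsN (ctsM (@cts_cst R 2) h1))) h2).
Qed.

Let sin_dW th : sin th * dW th = DWh v (P th).
Proof.
rewrite /dW /DWh mulrDr mulrBr sin_dU// mulrCA sin_dU// mulr_sumr; congr (_ - _ + _).
by apply: eq_bigr => m _; rewrite -sin_dD; ring.
Qed.

(** Along a meridian the integrand is the derivative of [sin th ^ 2 * exp W *
    Phi], which vanishes at both poles. *)
Lemma meridian_virial w (Phi Phi' : R -> R) : (forall u, drv Phi u (Phi' u)) -> continuous Phi' ->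
  \int[seg 0 pi]_th (expR (Wh (P th)) * (2 * sdot v (P th) * Phi (D (P th) w)
    + Phi' (D (P th) w) * Bk v (P th) w + Phi (D (P th) w) * DWh v (P th)) * sin th) = 0.
Proof.
move=> dP cP'; have cP : continuous Phi by move=> u; exact: drv_continuous (dP u).
have cPD : continuous (fun th => Phi (D (P th) w)) by exact: (cts_comp cP (@cD w)).
have cPD' : continuous (fun th => Phi' (D (P th) w)) by exact: (cts_comp cP' (@cD w)).
have cWP : continuous (fun th => Wh (P th)) by move=> th; exact: drv_continuous (drvW th).
pose G th := sin th ^+ 2 * (Phi (D (P th) w) * expR (Wh (P th))).
pose H th := sin th * (2 * cos th * Phi (D (P th) w) * expR (Wh (P th)))
  + sin th ^+ 2 * (Phi' (D (P th) w) * dD th w * expR (Wh (P th))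
     + Phi (D (P th) w) * (expR (Wh (P th)) * dW th)).
have dG th : drv G th (H th).
  have h1 := drvW th.
  have h2 : drv (fun z => Phi (D (P z) w)) th (Phi' (D (P th) w) * dD th w).
    exact: (drv_comp (dP _) (drvDm th w)).
  have -> : G = fun z => sin z * sin z * (Phi (D (P z) w) * expR (Wh (P z))).
    by apply/funext => z; rewrite /G expr2.
  by apply: drv_eq; [dv|rewrite /H; ring].
have cH : continuous H.
  have h1 := cW; have h2 := @cdD w; rewrite /H.
  apply: cts_meridian => //; [exact: continuous_sin|exact: continuous_cos|].
  by apply: cts_expR.
transitivity (\int[seg 0 pi]_th H th).
  apply: eq_Rint => th; rewrite /H -sin_dW -sin_dD Pv; ring.
apply: (etrans (FTC_drv (pi_ge0 R) dG cH)).
have G0 th : sin th = 0 -> G th = 0 by move=> h; rewrite /G h expr0n mul0r.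
by rewrite (G0 _ (sinpi R)) (G0 _ (sin0 R)) subrr.
Qed.

End meridian.

(** Integrate over the meridians from [v]. *)
Lemma reg_virial v w (Phi Phi' : R -> R) : (forall u, drv Phi u (Phi' u)) -> continuous Phi' ->
  \int[@area R]_x (expR (Wh x) * (2 * sdot v x * Phi (D x w)
    + Phi' (D x w) * Bk v x w + Phi (D x w) * DWh v x)) = 0.
Proof.
move=> dP cP'; have cP : continuous Phi by move=> u; exact: drv_continuous (dP u).
have [P [mP hP Pv Py]] := polar_exists v.
pose X x := expR (Wh x) * (2 * sdot v x * Phi (D x w)
    + Phi' (D x w) * Bk v x w + Phi (D x w) * DWh v x).
have mX : measurable_fun setT X.
  have h1 := measurable_Wh; have h2 := measurable_DWh v.
  have h3 : measurable_fun setT (fun x => Phi (D x w)).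
    by apply: (measurableT_comp (continuous_measurable_fun cP)); meas.
  have h4 : measurable_fun setT (fun x => Phi' (D x w)).
    by apply: (measurableT_comp (continuous_measurable_fun cP')); meas.
  by rewrite /X; meas.
have bnd (h : R -> R) : continuous h -> exists B, forall u, 0 <= u <= 2 -> `|h u| <= B.
  move=> ch; have [M [_ HM]] : bounded_set [set h x | x in `[0, 2]%classic].
    apply: compact_bounded; apply: continuous_compact; last exact: segment_compact.
    exact: continuous_subspaceT.
  exists (M + 1) => u u02; apply: (HM (M + 1)); first by rewrite ltrDl.
  by exists u => //=; rewrite in_itv.
have [B hB] := bnd Phi cP; have [B' hB'] := bnd Phi' cP'.
have [K hK] := Wh_bounded; have [L hL] := DWh_bounded v.
have D02 x : 0 <= D x w <= 2 by rewrite D_ge0 D_le2.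
have [Z hZ] : exists Z, forall x, `|X x| <= Z.
  eexists => x; rewrite /X; apply: nbM.
    rewrite ger0_norm ?expR_ge0//; have : expR (Wh x) <= expR K.
      by rewrite ler_expR (le_trans (ler_norm _)).
    by move=> h; exact: h.
  apply: nbD; [apply: nbD|].
  - by apply: nbM; [apply: nbM; [exact: lexx|exact: norm_sdot]|exact: hB].
  - by apply: nbM; [exact: hB'|exact: Bk_le2].
  - by apply: nbM; [exact: hB|exact: hL].
have iX : itg (@area R) X by exact: itg_bounded mX hZ.
have [iX' ->] := Rint_polar mP hP iX.
rewrite (Rint_prod21 iX').2; apply: Rint_eq0 => t.
have mXP : measurable_fun setT (fun th => X (P (th, t))).
  exact: (measurableT_comp mX (measurableT_comp mP (@measurable_pair2 _ _ _ _ t))).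
transitivity (\int[seg 0 pi]_th (X (P (th, t)) * sin th)).
  change (\int[seg 0 pi]_th (X (P (th, t)) * `|sin th|) = \int[seg 0 pi]_th (X (P (th, t)) * sin th)).
  apply: eq_Rint_seg.
  - by apply: measurable_funM => //; meas.
  - by apply: measurable_funM => //; meas.
  by move=> th hth; rewrite ger0_norm// sin_ge0_pi.
apply: (@meridian_virial v (fun th => P (th, t)) (fun y => sdot (P (pi / 2, t)) y)) => //.
- by meas.
- by move=> y; exact: norm_sdot.
Qed.

End regularised_virial.

(** * The virial identity *)

Lemma itg_prod_ae d1 d2 (T1 : measurableType d1) (T2 : measurableType d2) (R : realType)
    (m1 : {finite_measure set T1 -> \bar R}) (m2 : {finite_measure set T2 -> \bar R})
    (h : T1 * T2 -> R) (b : T1 -> R) :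
  measurable_fun setT h -> itg m1 b ->
  {ae m1, forall x, itg m2 (fun y => h (x, y)) /\ \int[m2]_y `|h (x, y)| <= b x} ->
  itg (m1 \x m2)%E h.
Proof.
move=> mh ib hb; apply/integrable12ltyP; first exact/measurable_EFinP.
have /integrableP[mb] := ib; apply: le_lt_trans; apply: ae_ge0_le_integral => //.
- by move=> y _; apply: integral_ge0.
- apply: (measurable_fun_fubini_tonelli_F (fun z => `|(EFin \o h) z|%E)) => //.
  by apply: measurableT_comp => //; exact/measurable_EFinP.
- exact: measurableT_comp.
- apply: ae_mono hb => x [ix hx] _; have ix' := itg_norm ix.
  rewrite (_ : (\int[m2]_y _)%E = (\int[m2]_y `|h (x, y)|)%:E); last by rewrite EFin_Rint.
  by rewrite lee_fin (le_trans hx)// ler_norm.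
Qed.

(** Jensen's inequality for a sub-probability density, the missing mass being
    put where the exponent vanishes. *)
Lemma jensen_exp d (T : measurableType d) (R : realType) (mu : {measure set T -> \bar R})
    (w phi : T -> R) : itg mu w -> (forall x, 0 <= w x) -> \int[mu]_x w x <= 1 ->
  itg mu (fun x => phi x * w x) -> itg mu (fun x => expR (phi x) * w x) ->
  expR (\int[mu]_x (phi x * w x)) <= 1 - \int[mu]_x w x + \int[mu]_x (expR (phi x) * w x).
Proof.
move=> iw w0 w1 ipw iew; set t := \int[mu]_x (phi x * w x); set m := \int[mu]_x w x in w1 *.
have tan (s : R) : expR t * (1 + (s - t)) <= expR s.
  have := expR_ge1Dx (s - t); rewrite -(ler_pM2l (expR_gt0 t)) => /le_trans; apply.
  by rewrite -expRD addrC subrK.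
have h1 : expR t * (m + t - t * m) <= \int[mu]_x (expR (phi x) * w x).
  have i1 : itg mu (fun x => expR t * (w x + phi x * w x - t * w x)).
    by apply: itgZ; apply: itgB; [exact: itgD|exact: itgZ].
  have -> : expR t * (m + t - t * m) = \int[mu]_x (expR t * (w x + phi x * w x - t * w x)).
    rewrite RintZ; last by apply: itgB; [exact: itgD|exact: itgZ].
    by rewrite RintB ?RintD ?RintZ//; [exact: itgD|exact: itgZ].
  apply: le_Rint => // x; apply: le_trans (ler_wpM2r (w0 x) (tan (phi x))).
  by rewrite le_eqVlt; apply/orP; left; apply/eqP; ring.
have := tan 0; rewrite expR0 => h2.
have h3 : (1 - m) * (expR t * (1 + (0 - t))) <= 1 - m by rewrite ler_piMr// subr_ge0.
have e : expR t = (1 - m) * (expR t * (1 + (0 - t))) + expR t * (m + t - t * m) by ring.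
by rewrite e; exact: lerD.
Qed.

Section power_kernels.
Variable R : realType.
Implicit Types (x y p : sphere R) (F : sphere R -> R) (q s t : R).

Definition riesz s F x : R := \int[@area R]_y (D x y `^ (- s) * F y).

Lemma itg_riesz_prod s F : 0 < s < 1 -> itg (@area R) F ->
  itg (@area R \x @area R)%E (fun z => D z.1 z.2 `^ (- s) * F z.2).
Proof.
move=> s01 iF; apply: (itg_ker_prod (k := fun u => u `^ (- s)) (C := 4 * pi / (1 - s))) => //.
by move=> u; exact: powR_ge0.
by move=> x; exact: area_D_pow.
Qed.

Lemma itg_riesz s F : 0 < s < 1 -> itg (@area R) F -> itg (@area R) (riesz s F).
Proof. by move=> s01 iF; exact: (Rint_prod12 (itg_riesz_prod s01 iF)).1. Qed.

Lemma itg_riesz_ae s F : 0 < s < 1 -> itg (@area R) F ->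
  {ae @area R, forall x, itg (@area R) (fun y => D x y `^ (- s) * F y)}.
Proof. by move=> s01 iF; apply: (ae_integrable1 (itg_riesz_prod s01 iF)). Qed.

Lemma riesz_ge0 s F x : (forall y, 0 <= F y) -> 0 <= riesz s F x.
Proof. by move=> F0; apply: Rint_ge0 => y; rewrite mulr_ge0 ?powR_ge0. Qed.

Lemma powRN_le (u w s : R) : 0 < u -> u <= w -> 0 <= s -> w `^ (- s) <= u `^ (- s).
Proof.
move=> u0 uw s0; have w0 := lt_le_trans u0 uw.
by rewrite !powRN lef_pV2 ?posrE ?powR_gt0//; apply: ge0_ler_powR; rewrite ?nnegrE// ltW.
Qed.

(** The larger of the two powers dominates the product. *)
Lemma powR_mix (u w s t : R) : 0 < u -> 0 < w -> 0 <= s -> 0 <= t ->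
  u `^ (- s) * w `^ (- t) <= u `^ (- (s + t)) + w `^ (- (s + t)).
Proof.
move=> u0 w0 s0 t0.
have eD z : 0 < z -> z `^ (- (s + t)) = z `^ (- s) * z `^ (- t).
  by move=> z0; rewrite -powRD ?(gt_eqF z0) ?implybT// opprD.
rewrite !eD//; have [uw|/ltW wu] := leP u w.
  by apply: ler_wpDr; rewrite ?mulr_ge0 ?powR_ge0// ler_wpM2l ?powR_ge0// powRN_le.
by apply: ler_wpDl; rewrite ?mulr_ge0 ?powR_ge0// ler_wpM2r ?powR_ge0// powRN_le.
Qed.

(** Singularities at different places only add up, by [powR_mix]. *)
Lemma riesz_mix (u s t : R) F x : 0 < u -> 0 <= s -> 0 < t -> s + t < 1 -> itg (@area R) F ->
  (forall y, 0 <= F y) -> itg (@area R) (fun y => D x y `^ (- t) * F y) ->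
  itg (@area R) (fun y => D x y `^ (- (s + t)) * F y) ->
  u `^ (- s) * riesz t F x <= u `^ (- (s + t)) * \int[@area R]_y F y + riesz (s + t) F x.
Proof.
move=> u0 s0 t0 st1 iF F0 i1 i2; rewrite /riesz -!RintZ// -RintD//; last exact: itgZ.
apply: le_Rint_ae; [exact: itgZ|by apply: itgD => //; exact: itgZ|].
apply: ae_mono (ae_D_neq x 0) => y D0; rewrite mulrA -mulrDl ler_wpM2r//.
by apply: powR_mix => //; [rewrite lt_neqAle eq_sym D_ge0 andbT; exact/eqP|exact: ltW].
Qed.

Lemma riesz_mix2 s t F H x : 0 < s -> 0 < t -> s + t < 1 -> itg (@area R) F -> itg (@area R) H ->
  (forall y, 0 <= F y) -> (forall y, 0 <= H y) ->
  itg (@area R) (fun y => D x y `^ (- s) * F y) -> itg (@area R) (fun y => D x y `^ (- t) * H y) ->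
  itg (@area R) (fun y => D x y `^ (- (s + t)) * F y) ->
  itg (@area R) (fun y => D x y `^ (- (s + t)) * H y) ->
  riesz s F x * riesz t H x <= riesz (s + t) F x * \int[@area R]_y H y
     + \int[@area R]_y F y * riesz (s + t) H x.
Proof.
move=> s0 t0 st iF iH F0 H0 i1 i2 i3 i4.
have -> : riesz s F x * riesz t H x = \int[@area R]_y (riesz t H x * (D x y `^ (- s) * F y)).
  by rewrite RintZ// mulrC.
have -> : riesz (s + t) F x * \int[@area R]_y H y + \int[@area R]_y F y * riesz (s + t) H x
    = \int[@area R]_y (\int[@area R]_y H y * (D x y `^ (- (s + t)) * F y) + riesz (s + t) H x * F y).
  by rewrite RintD; [rewrite !RintZ// mulrC [X in _ + X]mulrC|exact: itgZ|exact: itgZ].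
apply: le_Rint_ae; [exact: itgZ|by apply: itgD; exact: itgZ|].
apply: ae_mono (ae_D_neq x 0) => y D0; rewrite !mulrA -mulrDl ler_wpM2r//.
rewrite mulrC [X in _ <= X + _]mulrC; apply: riesz_mix => //; last exact: ltW.
by rewrite lt_neqAle eq_sym D_ge0 andbT; exact/eqP.
Qed.

Lemma small_excess F (del : R) : itg (@area R) F -> (forall x, 0 <= F x) -> 0 < del ->
  exists K, 0 <= K /\ \int[@area R]_x Num.max 0 (F x - K) <= del.
Proof.
move=> iF F0 del0; have mF := itg_measurable iF.
have mm n : measurable_fun setT (fun x => Num.max 0 (F x - n%:R)).
  by apply: measurable_maxr => //; exact: measurable_funB.
have c : \int[@area R]_x Num.max 0 (F x - n%:R) @[n --> \oo] --> \int[@area R]_x (cst 0 x : R).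
  apply: (Rint_dct1 (g := F)) => // [x|n x].
    apply: cvg_near_cst; near=> n; rewrite max_l// subr_le0; near: n; exact: nbhs_infty_ger.
  rewrite ger0_norm ?le_max ?lexx// ge_max F0 /= gerBl//.
move: c; rewrite (Rint_eq0 _ (f := cst 0))// => /cvgr0_norm_le /(_ _ del0) [N _ HN].
exists N%:R; split => //; apply: le_trans (HN N (leqnn N)); exact: ler_norm.
Unshelve. all: by end_near. Qed.

(** As [F] is bounded up to a part of mass [del], and the bounded part has a
    bounded potential, Jensen's inequality for the small part gives a Riesz
    potential of an order [2 * del] that is as small as desired. This replaces
    the Moser-Trudinger inequality. *)
Lemma exp_pot_le F (del : R) : itg (@area R) F -> (forall x, 0 <= F x) -> 0 < del -> 2 * del < 1 ->
  exists C0 H, [/\ 0 <= C0, itg (@area R) H, (forall y, 0 <= H y) &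
    {ae @area R, forall x, expR (- 2 * pot F x) <= C0 * riesz (2 * del) H x}].
Proof.
move=> iF F0 d0 d1; have mF := itg_measurable iF.
have [K [K0 hK]] := small_excess iF F0 d0.
pose h x := Num.max 0 (F x - K).
have mh : measurable_fun setT h by apply: measurable_maxr => //; exact: measurable_funB.
have h0 x : 0 <= h x by rewrite le_max lexx.
have hF x : h x <= F x by rewrite ge_max F0 gerBl.
have ih : itg (@area R) h by apply: itg_le iF => // x; rewrite ger0_norm.
have b x : 0 <= F x - h x <= K.
  by rewrite subr_ge0 hF /= lerBlDr -lerBlDl le_max lexx orbT.
have d2 : 0 < 2 * del < 1 by rewrite mulr_gt0.
have iH : itg (@area R) (fun y => h y / del + 1).
  by apply: itgD; [under eq_fun do rewrite mulrC; exact: itgZ|exact: itg_cst].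
exists (expR (64 * pi * K)), (fun y => h y / del + 1); split.
- exact: expR_ge0.
- exact: iH.
- by move=> y; rewrite addr_ge0// divr_ge0// ltW.
have i1ae := itg_riesz_ae d2 ih.
apply: ae_mono2 (itg_lb_ae iF) i1ae => x ix iPh.
have iy : itg (@area R) (fun y => ln (D x y) * F y).
  apply: itg_le (itg_norm ix) => [|y]; first by meas.
  rewrite !normrM ler_wpM2r// (ger0_norm (lb_ge0 _)); apply: norm_ln_lb.
  by rewrite D_ge0 (le_trans (D_le2 _ _))//; lra.
have ihy : itg (@area R) (fun y => ln (D x y) * h y).
  apply: itg_le (itg_norm iy) => [|y]; first by meas.
  by rewrite !normrM ler_wpM2l// !ger0_norm.
have iP : itg (@area R) (fun y => D x y `^ (- (2 * del))) by exact: (area_D_pow x d2).1.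
have i3 : itg (@area R) (fun y => (- (2 * del) * ln (D x y)) * (h y / del)).
  have := itgZ (- 2) ihy; congr itg; apply/funext => y; field; rewrite gt_eqF//.
have E : - 2 * pot F x = - 2 * \int[@area R]_y (ln (D x y) * (F y - h y))
    + \int[@area R]_y ((- (2 * del) * ln (D x y)) * (h y / del)).
  have -> : \int[@area R]_y ((- (2 * del) * ln (D x y)) * (h y / del)) = - 2 * \int[@area R]_y (ln (D x y) * h y).
    by rewrite -RintZ//; apply: eq_Rint => y; field; rewrite gt_eqF.
  rewrite -mulrDr; congr (_ * _); rewrite -RintD//.
    by apply: eq_Rint => y; ring.
  by under eq_fun do rewrite mulrBr; exact: itgB.
rewrite E expRD; apply: ler_pM; rewrite ?expR_ge0//.
  rewrite ler_expR mulNr -mulrN.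
  have -> : 64 * pi * K = 2 * (K * (32 * pi)) by ring.
  apply: ler_wpM2l => //; apply: le_trans (ler_norm _) _; rewrite normrN.
  have i4 : itg (@area R) (fun y => ln (D x y) * (F y - h y)).
    by under eq_fun do rewrite mulrBr; exact: itgB.
  apply: le_trans (normr_Rint i4) _.
  apply: (@le_trans _ _ (\int[@area R]_y (K * lb (D x y)))).
    apply: le_Rint; [exact: itg_norm|by apply: itgZ; exact: itg_lb|move=> y].
    rewrite normrM mulrC; have /andP[b1 b2] := b y; apply: ler_pM => //; first by rewrite ger0_norm.
    by apply: norm_ln_lb; rewrite D_ge0 (le_trans (D_le2 _ _))//; lra.
  by rewrite (RintZ _ (itg_lb x)) ler_wpM2l// Rint_lb.
have iw : itg (@area R) (fun y => h y / del) by under eq_fun do rewrite mulrC; exact: itgZ.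
have w0 y : 0 <= h y / del by rewrite divr_ge0// ltW.
have Iw : \int[@area R]_y (h y / del) <= 1.
  under eq_Rint do rewrite mulrC; rewrite RintZ// mulrC ler_pdivrMr// mul1r; exact: hK.
have eqD : {ae @area R, forall y, expR (- (2 * del) * ln (D x y)) * (h y / del) = D x y `^ (- (2 * del)) * (h y / del)}.
  apply: ae_mono (ae_D_neq x 0) => y /eqP D0; rewrite /powR (negPf D0); congr (expR _ * _); ring.
have i6 : itg (@area R) (fun y => D x y `^ (- (2 * del)) * (h y / del)).
  have := itgZ (del^-1) iPh; congr itg; apply/funext => y; ring.
have m5 : measurable_fun setT (fun y => expR (- (2 * del) * ln (D x y)) * (h y / del)) by meas.
have i5 : itg (@area R) (fun y => expR (- (2 * del) * ln (D x y)) * (h y / del)).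
  by apply: itg_ae m5 _ i6; apply: ae_mono eqD => y ->.
apply: le_trans (jensen_exp iw w0 Iw i3 i5) _.
rewrite (ae_eq_Rint m5 (itg_measurable i6) eqD) /riesz.
have -> : \int[@area R]_y (D x y `^ (- (2 * del)) * (h y / del + 1)) =
    \int[@area R]_y (D x y `^ (- (2 * del)) * (h y / del)) + \int[@area R]_y D x y `^ (- (2 * del)).
  by rewrite -RintD//; apply: eq_Rint => y; ring.
rewrite addrC lerD2l (@le_trans _ _ 1)//; first by rewrite gerBl Rint_ge0.
have : \int[@area R]_y (2 `^ (- (2 * del))) <= \int[@area R]_y D x y `^ (- (2 * del)).
  apply: le_Rint_ae => //; first exact: itg_cst.
  apply: ae_mono (ae_D_neq x 0) => y /eqP D0; apply: powRN_le; rewrite ?D_le2//; last by rewrite ltW// mulr_gt0.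
  by rewrite lt_neqAle eq_sym D0 D_ge0.
apply: le_trans; rewrite Rint_area_cst.
have : 2^-1 <= 2 `^ (- (2 * del)) :> R.
  by rewrite -[leLHS]powR_inv1// ler_powR ?ler1n//; lra.
by have := pi_ge2 R; nra.
Qed.

End power_kernels.

(** * The virial identity for the densities *)

Section virial.
Variables (R : realType) (a : 'I_3 -> R) (p : 'I_3 -> sphere R) (C : R) (f g : sphere R -> R).
Implicit Types (x y v w : sphere R) (F : sphere R -> R).
Hypotheses (a0 : forall m, -1 < a m <= 0) (pp : forall m m', m != m' -> p m <> p m').
Hypotheses (itf : itg (@area R) f) (itgg : itg (@area R) g) (g0 : forall x, 0 <= g x).
Hypothesis fE : forall x, f x = expR (vort a p C f g x).

Let f0 x : 0 <= f x. Proof. by rewrite fE expR_ge0. Qed.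

(** The weights stay away from [-1]; the gap leaves room for the other
    singularities. *)
Lemma exponent_gap : exists q : R, [/\ 2^-1 <= q, q < 1 & forall m, - q <= a m].
Proof.
pose q := \big[Num.max/2^-1]_(m < 3) (- a m).
exists q; split.
- exact: bigmax_ge_id.
- by apply: bigmax_lt => [|m _]; [lra|have := a0 m; lra].
- by move=> m; rewrite lerNl; apply: le_bigmax.
Qed.

Lemma separation : exists t0 : R, [/\ 0 < t0, t0 <= 1 & forall m m', m != m' -> 4 * t0 <= D (p m) (p m')].
Proof.
pose t0 := \big[Num.min/1]_(z : 'I_3 * 'I_3 | z.1 != z.2) (D (p z.1) (p z.2) / 4).
exists t0; split.
- by apply: lt_bigmin => // -[m m'] /= mm'; rewrite divr_gt0// D_gt0//; exact: pp.
- exact: bigmin_le_id.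
- move=> m m' mm'; rewrite mulrC -ler_pdivlMr//.
  exact: (@bigmin_le_cond _ _ _ 1 (m, m') (fun z : 'I_3 * 'I_3 => z.1 != z.2) (fun z => D (p z.1) (p z.2) / 4)).
Qed.

Lemma vortex_factor q : 0 <= q -> q < 1 -> (forall m, - q <= a m) ->
  exists c, 0 <= c /\ forall x, (forall m, D x (p m) <> 0) ->
  exists m0, expR (\sum_(m < 3) a m * ln (D x (p m))) <= c * D x (p m0) `^ (- q).
Proof.
move=> q0 q1 qa; have [t0 [t00 t01 sep]] := separation.
exists (expR (1 - 3 * ln t0)); split; first exact: expR_ge0.
move=> x Dx; have Dp m : 0 < D x (p m) by rewrite lt_neqAle D_ge0 andbT eq_sym; apply/eqP.
have [m0 _ hm0] := @arg_minP _ _ 'I_3 ord0 xpredT (fun m => D x (p m)) isT.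
exists m0; rewrite /powR gt_eqF// -expRD ler_expR.
have lt0 : ln t0 <= 0 by rewrite ln_le0.
have far m : m != m0 -> t0 <= D x (p m).
  move=> mm0; have h1 := sep _ _ mm0; have h2 := D_quasi (p m) x (p m0).
  have h3 : D x (p m0) <= D x (p m) by exact: hm0.
  by rewrite DC in h2; have := DC (p m0) (p m); have := DC x (p m); lra.
have bnd m : a m * ln (D x (p m)) <= - ln t0 + (m == m0)%:R * (1 - q * ln (D x (p m0))).
  have /andP[am1 am0] := a0 m; have qm := qa m.
  have [->|mm0] := eqVneq m m0; rewrite /= ?mul1r ?mul0r ?addr0.
    have l2 : ln (D x (p m0)) <= 1.
      have d0 := Dp m0; have d2 := D_le2 x (p m0).
      have h := @le_ln1Dx R (D x (p m0) - 1); rewrite (_ : 1 + (D x (p m0) - 1) = D x (p m0)) in h; last by ring.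
      have h1 : -1 < D x (p m0) - 1 by lra.
      by have := h h1; lra.
    by have [l0|l0] := leP 0 (ln (D x (p m0))); have := a0 m0; have := qa m0; nra.
  have lD : ln t0 <= ln (D x (p m)) by rewrite ler_ln ?posrE// far.
  by nra.
apply: le_trans (ler_sum _ (fun m _ => bnd m)) _.
rewrite big_split /= sumr_const card_ord (bigD1 m0)//= eqxx mul1r big1.
  by rewrite -mulr_natl; lra.
by move=> m /negPf ->; rewrite mul0r.
Qed.

Definition DU v F x : R := \int[@area R]_y (Bk v x y / D x y * F y).

(** By [Bk_bound] the kernel has only half of the singularity of [1 / D]; the
    length of the field at [x] is kept, to compensate for the singularities of
    the density. *)
Lemma Bk_sing v x y eta : 0 <= eta -> D x y <> 0 ->
  `|Bk v x y / (eta + D x y)| <= Num.sqrt (1 - sdot v x ^+ 2) * Num.sqrt 2 * D x y `^ (- 2^-1).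
Proof.
move=> e0 /eqP D0; have Dp : 0 < D x y by rewrite lt_neqAle D_ge0 andbT eq_sym.
have h := Bk_bound v x y.
have ed : 0 < eta + D x y by rewrite ltr_wpDl.
rewrite normrM normfV (gtr0_norm ed).
apply: (@le_trans _ _ (`|Bk v x y| / D x y)).
  by rewrite ler_wpM2l// lef_pV2 ?posrE// lerDr.
rewrite ler_pdivrMr// (le_trans h)// -!mulrA ler_wpM2l ?sqrtr_ge0// ler_wpM2l ?sqrtr_ge0//.
by rewrite mulrC powR_mull// -powR12_sqrt ?D_ge0// (_ : 1 - 2^-1 = 2^-1) ?lexx//; lra.
Qed.

Lemma measurable_DU v F : itg (@area R) F -> measurable_fun setT (DU v F).
Proof.
move=> iF; have mF := itg_measurable iF; have h : 0 < (2^-1 : R) < 1 by lra.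
have ih : itg (@area R \x @area R)%E (fun z => Bk v z.1 z.2 / D z.1 z.2 * F z.2).
  apply: itg_le (itgZ (Num.sqrt 2) (itg_norm (itg_riesz_prod h iF))).
    apply: measurable_funM; first by meas.
    exact: (measurableT_comp mF measurable_snd).
  move=> [x y] /=; rewrite !normrM mulrA ler_wpM2r// (ger0_norm (powR_ge0 _ _)) -normrM.
  have [->|/eqP D0] := eqVneq (D x y) 0.
    by rewrite invr0 mulr0 normr0 mulr_ge0 ?sqrtr_ge0 ?powR_ge0.
  have := Bk_sing v (lexx 0) D0; rewrite add0r => /le_trans; apply.
  by rewrite ler_wpM2r ?powR_ge0// ler_piMl ?sqrtr_ge0// sqrt_sdot2_le1.
exact: itg_measurable (Rint_prod12 ih).1.
Qed.

Section estimates.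
Variables (v w : sphere R) (Phi Phi' : R -> R) (B : R).
Hypotheses (dPhi : forall u, drv Phi u (Phi' u)) (cPhi' : continuous Phi').
Hypothesis PhiB : forall x m, `|Phi (D x w)| * Num.sqrt (1 - sdot v x ^+ 2) <= B * Num.sqrt (D x (p m)).

Let phi x := Phi (D x w).
Let sv x := Num.sqrt (1 - sdot v x ^+ 2).

Let cPhi : continuous Phi. Proof. by move=> u; exact: drv_continuous (dPhi u). Qed.

Let mphi : measurable_fun setT phi.
Proof. by apply: (measurableT_comp (continuous_measurable_fun cPhi)); meas. Qed.

Let mphi' : measurable_fun setT (fun x => Phi' (D x w)).
Proof. by apply: (measurableT_comp (continuous_measurable_fun cPhi')); meas. Qed.

Let sv0 x : 0 <= sv x. Proof. exact: sqrtr_ge0. Qed.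

Let Mx x := expR (C + \sum_(m < 3) a m * ln (D x (p m)) - 2 * pot f x + 3 * \int[@area R]_y g y).

Let DUh_le n F x : itg (@area R) F -> (forall y, 0 <= F y) ->
  itg (@area R) (fun y => D x y `^ (- 2^-1) * F y) ->
  `|DUh n v F x| <= sv x * Num.sqrt 2 * riesz 2^-1 F x.
Proof.
move=> iF F0 iH; apply: (le_trans (normr_Rint (itg_DUh n v x iF))).
rewrite /riesz -RintZ//; apply: le_Rint_ae.
- exact: itg_norm (itg_DUh n v x iF).
- exact: itgZ.
- apply: ae_mono (ae_D_neq x 0) => y D0; rewrite normrM (ger0_norm (F0 y)) mulrA ler_wpM2r//.
  by apply: Bk_sing => //; rewrite ltW// etan_gt0.
Qed.

Let DUh_cvg F x : itg (@area R) F -> (forall y, 0 <= F y) ->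
  itg (@area R) (fun y => D x y `^ (- 2^-1) * F y) ->
  itg (@area R) (fun y => Bk v x y / D x y * F y) /\
  DUh n v F x @[n --> \oo] --> DU v F x.
Proof.
move=> iF F0 iH; have mF := itg_measurable iF.
apply: (@Rint_dct _ _ _ (@area R) (fun n y => Bk v x y / (etan R n + D x y) * F y) _
  (fun y => sv x * Num.sqrt 2 * (D x y `^ (- 2^-1) * F y))).
- by move=> n; meas.
- by meas.
- apply: ae_mono (ae_D_neq x 0) => y /eqP D0; apply: cvgM; last exact: cvg_cst.
  apply: cvgM; first exact: cvg_cst.
  apply: cvgV => //; rewrite -[X in _ --> X]add0r.
  by apply: cvgD; [exact: cvg_etan|exact: cvg_cst].
- exact: itgZ.
- apply: ae_mono (ae_D_neq x 0) => y D0 n; rewrite normrM (ger0_norm (F0 y)) mulrA ler_wpM2r//.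
  by apply: Bk_sing => //; rewrite ltW// etan_gt0.
Qed.

(* Everything that holds at almost every point. *)
Let good q H x := [/\ forall m, D x (p m) <> 0,
  itg (@area R) (fun y => lb (D x y) * f y) /\ itg (@area R) (fun y => lb (D x y) * g y) &
  forall s F, s \in [:: 2^-1; (1 - q) / 2; 2^-1 + (1 - q) / 2; (1 + q) / 2] ->
   [\/ F = f, F = g | F = H] -> itg (@area R) (fun y => D x y `^ (- s) * F y)].

Let ae_conj (P1 P2 : sphere R -> Prop) : {ae @area R, forall x, P1 x} -> {ae @area R, forall x, P2 x} ->
  {ae @area R, forall x, P1 x /\ P2 x}.
Proof. exact: ae_mono2. Qed.

Let good_ae q H : 2^-1 <= q -> q < 1 -> itg (@area R) H -> {ae @area R, forall x, good q H x}.
Proof.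
move=> q0 q1 iH.
have N1 : {ae @area R, forall x m, D x (p m) <> 0}.
  by apply: ae_forall3 => m; apply: ae_mono (ae_D_neq (p m) 0) => x; rewrite DC.
have N2 := ae_conj (itg_lb_ae itf) (itg_lb_ae itgg).
have K s : 0 < s < 1 -> {ae @area R, forall x, forall F, [\/ F = f, F = g | F = H] ->
    itg (@area R) (fun y => D x y `^ (- s) * F y)}.
  move=> s01; have h := ae_conj (ae_conj (itg_riesz_ae s01 itf) (itg_riesz_ae s01 itgg)) (itg_riesz_ae s01 iH).
  by apply: ae_mono h => x [[h1 h2] h3] F [] ->.
have K1 : 0 < (2^-1 : R) < 1 by lra.
have K2 : 0 < (1 - q) / 2 < 1 by lra.
have K3 : 0 < 2^-1 + (1 - q) / 2 < 1 by lra.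
have K4 : 0 < (1 + q) / 2 < 1 by lra.
have h := ae_conj (ae_conj (K _ K1) (K _ K2)) (ae_conj (K _ K3) (K _ K4)).
apply: ae_mono2 (ae_conj N1 N2) h => x [n1 n2] [[k1 k2] [k3 k4]]; split => // s F.
by rewrite !inE => /or4P[] /eqP ->; [exact: k1|exact: k2|exact: k3|exact: k4].
Qed.

Let T1 q H x := \sum_(m < 3) (D x (p m) `^ (- ((1 + q) / 2)) * \int[@area R]_y H y + riesz ((1 + q) / 2) H x).

Let T2 q H F x := \sum_(m < 3) (\int[@area R]_y H y *
     (D x (p m) `^ (- ((1 + q) / 2)) * \int[@area R]_y F y + riesz ((1 + q) / 2) F x)
  + \int[@area R]_y F y *
     (D x (p m) `^ (- ((1 + q) / 2)) * \int[@area R]_y H y + riesz ((1 + q) / 2) H x)).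

Let itg_sum3 (F : 'I_3 -> sphere R -> R) : (forall m, itg (@area R) (F m)) ->
  itg (@area R) (fun x => \sum_(m < 3) F m x).
Proof.
move=> h; elim: (index_enum 'I_3) => [|m s IH].
  by under eq_fun do rewrite big_nil; exact: itg_cst.
by under eq_fun do rewrite big_cons; exact: itgD.
Qed.

Let itg_T1 q H : 2^-1 <= q -> q < 1 -> itg (@area R) H -> itg (@area R) (T1 q H).
Proof.
move=> q0 q1 iH; have K4 : 0 < (1 + q) / 2 < 1 by lra.
apply: itg_sum3 => m; apply: itgD; last exact: itg_riesz.
under eq_fun do rewrite mulrC DC; apply: itgZ; exact: (area_D_pow (p m) K4).1.
Qed.

Let itg_T2 q H F : 2^-1 <= q -> q < 1 -> itg (@area R) H -> itg (@area R) F -> itg (@area R) (T2 q H F).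
Proof.
move=> q0 q1 iH iF; have K4 : 0 < (1 + q) / 2 < 1 by lra.
have iP m c : itg (@area R) (fun x => D x (p m) `^ (- ((1 + q) / 2)) * c).
  by under eq_fun do rewrite mulrC DC; apply: itgZ; exact: (area_D_pow (p m) K4).1.
by apply: itg_sum3 => m; apply: itgD; apply: itgZ; apply: itgD => //; exact: itg_riesz.
Qed.

(** The density is at most [D^(-q)], with [q < 1], times a Riesz potential of
    small order. The derivatives of the potentials add a singularity of order
    [1/2], compensated at the vortices by the hypothesis on [Phi]. The orders
    add up to less than one, so that the products are integrable. *)
Lemma majorants : exists q H c, [/\ 2^-1 <= q, q < 1, itg (@area R) H, (0 <= c) /\ (forall y, 0 <= H y) &
  {ae @area R, forall x, [/\ good q H x, Mx x <= c * T1 q H x,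
    Mx x * (`|phi x| * sv x) * riesz 2^-1 f x <= c * T2 q H f x &
    Mx x * (`|phi x| * sv x) * riesz 2^-1 g x <= c * T2 q H g x]}].
Proof.
have [q [q0 q1 qa]] := exponent_gap; have q00 : 0 <= q by lra.
have d0 : 0 < (1 - q) / 4 by lra.
have d1 : 2 * ((1 - q) / 4) < 1 by lra.
have [C0 [H [C00 iH H0 hE]]] := exp_pot_le itf f0 d0 d1.
have [c [cge0 hc]] := vortex_factor q00 q1 qa.
pose c1 := expR (C + 3 * \int[@area R]_y g y) * c * C0.
have c10 : 0 <= c1 by rewrite !mulr_ge0 ?expR_ge0.
have B0 : 0 <= B.
  have := PhiB (p ord0) ord_max; have : 0 < Num.sqrt (D (p ord0) (p ord_max)).
    by rewrite sqrtr_gt0 D_gt0//; exact: pp.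
  move=> h1 h2; rewrite -(pmulr_lge0 _ h1); apply: le_trans h2.
  by rewrite mulr_ge0 ?sqrtr_ge0.
exists q, H, (c1 * (1 + B)); split => //; first by split => //; rewrite mulr_ge0// addr_ge0.
apply: ae_mono2 (good_ae q0 q1 iH) hE => x [n1 n2 n3] hEx.
have [m0 hm0] := hc x n1.
have dq : 2 * ((1 - q) / 4) = (1 - q) / 2 by lra.
rewrite dq in hEx.
have Dp : 0 < D x (p m0) by rewrite lt_neqAle D_ge0 andbT eq_sym; apply/eqP.
have M1 : Mx x <= c1 * (D x (p m0) `^ (- q) * riesz ((1 - q) / 2) H x).
  have -> : Mx x = expR (C + 3 * \int[@area R]_y g y) *
     (expR (\sum_(m < 3) a m * ln (D x (p m))) * expR (- 2 * pot f x)).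
    by rewrite -!expRD; congr expR; ring.
  rewrite /c1 -!mulrA ler_wpM2l ?expR_ge0//.
  rewrite [leRHS](_ : _ = (c * D x (p m0) `^ (- q)) * (C0 * riesz ((1 - q) / 2) H x)); last by ring.
  by apply: ler_pM; rewrite ?expR_ge0.
have rH s : 0 <= riesz s H x by exact: riesz_ge0.
have k1 : 0 < (1 - q) / 2 by lra.
have k2 : 2^-1 + (1 - q) / 2 < 1 by lra.
have k3 : q + (1 - q) / 2 < 1 by lra.
have k4 : 0 <= q - 2^-1 by lra.
have k5 : 0 < 2^-1 + (1 - q) / 2 by lra.
have k6 : (1 + q) / 2 < 1 by lra.
have k7 : 0 < (2^-1 : R) by lra.
have n3H s := fun h => n3 s H h (Or33 _ _ erefl).
have j1 : (1 - q) / 2 \in [:: 2^-1; (1 - q) / 2; 2^-1 + (1 - q) / 2; (1 + q) / 2] by rewrite !inE eqxx !orbT.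
have j2 : 2^-1 + (1 - q) / 2 \in [:: 2^-1; (1 - q) / 2; 2^-1 + (1 - q) / 2; (1 + q) / 2] by rewrite !inE eqxx !orbT.
have j3 : (1 + q) / 2 \in [:: 2^-1; (1 - q) / 2; 2^-1 + (1 - q) / 2; (1 + q) / 2] by rewrite !inE eqxx !orbT.
have j4 : 2^-1 \in [:: 2^-1; (1 - q) / 2; 2^-1 + (1 - q) / 2; (1 + q) / 2] by rewrite !inE eqxx.
have rm : D x (p m0) `^ (- q) * riesz ((1 - q) / 2) H x <=
    D x (p m0) `^ (- ((1 + q) / 2)) * \int[@area R]_y H y + riesz ((1 + q) / 2) H x.
  have e : q + (1 - q) / 2 = (1 + q) / 2 by field.
  have := @riesz_mix R (D x (p m0)) q ((1 - q) / 2) H x Dp q00; rewrite e; apply => //.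
    exact: n3H j1.
  exact: n3H j3.
have IH0 : 0 <= \int[@area R]_y H y by exact: Rint_ge0.
have t1m m : 0 <= D x (p m) `^ (- ((1 + q) / 2)) * \int[@area R]_y H y + riesz ((1 + q) / 2) H x.
  by rewrite addr_ge0// mulr_ge0 ?powR_ge0.
have main F : (forall y, 0 <= F y) -> itg (@area R) F -> [\/ F = f, F = g | F = H] ->
    Mx x * (`|phi x| * sv x) * riesz 2^-1 F x <= c1 * (1 + B) * T2 q H F x.
  move=> F0 iF FE; have rF s : 0 <= riesz s F x by exact: riesz_ge0.
  have IF0 : 0 <= \int[@area R]_y F y by exact: Rint_ge0.
  have tm m (X Y : sphere R -> R) : (forall y, 0 <= X y) -> (forall y, 0 <= Y y) -> 0 <= \int[@area R]_y X y *
      (D x (p m) `^ (- ((1 + q) / 2)) * \int[@area R]_y Y y + riesz ((1 + q) / 2) Y x).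
    move=> X0 Y0; have i1 : 0 <= \int[@area R]_y X y by exact: Rint_ge0.
    have i2 : 0 <= \int[@area R]_y Y y by exact: Rint_ge0.
    have r1 : 0 <= riesz ((1 + q) / 2) Y x by exact: riesz_ge0.
    by rewrite mulr_ge0// addr_ge0// mulr_ge0 ?powR_ge0.
  apply: (@le_trans _ _ (c1 * (1 + B) * (D x (p m0) `^ (- (q - 2^-1)) * (riesz 2^-1 F x * riesz ((1 - q) / 2) H x)))).
    have h1 := PhiB x m0; rewrite -/(phi x) -/(sv x) in h1.
    have -> : c1 * (1 + B) * (D x (p m0) `^ (- (q - 2^-1)) * (riesz 2^-1 F x * riesz ((1 - q) / 2) H x))
       = (c1 * (D x (p m0) `^ (- q) * riesz ((1 - q) / 2) H x)) * ((1 + B) * Num.sqrt (D x (p m0))) * riesz 2^-1 F x.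
      have -> : D x (p m0) `^ (- (q - 2^-1)) = D x (p m0) `^ (- q) * Num.sqrt (D x (p m0)).
        rewrite -powR12_sqrt ?D_ge0// -powRD ?(gt_eqF Dp) ?implybT//.
        by congr powR; ring.
      by ring.
    rewrite ler_wpM2r//; apply: ler_pM => //; first exact: expR_ge0.
      by rewrite mulr_ge0.
    by rewrite (le_trans h1)// ler_wpM2r ?sqrtr_ge0// lerDr.
  rewrite ler_wpM2l ?mulr_ge0 ?addr_ge0//.
  have m2 : riesz 2^-1 F x * riesz ((1 - q) / 2) H x <=
      riesz (2^-1 + (1 - q) / 2) F x * \int[@area R]_y H y + \int[@area R]_y F y * riesz (2^-1 + (1 - q) / 2) H x.
    exact: (riesz_mix2 k7 k1 k2 iF iH F0 H0 (n3 _ _ j4 FE) (n3H _ j1) (n3 _ _ j2 FE) (n3H _ j2)).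
  apply: le_trans (ler_wpM2l (powR_ge0 _ _) m2) _.
  have e : (q - 2^-1) + (2^-1 + (1 - q) / 2) = (1 + q) / 2 by field.
  have mixF (X : sphere R -> R) : (forall y, 0 <= X y) -> itg (@area R) X -> [\/ X = f, X = g | X = H] ->
     D x (p m0) `^ (- (q - 2^-1)) * riesz (2^-1 + (1 - q) / 2) X x <=
     D x (p m0) `^ (- ((1 + q) / 2)) * \int[@area R]_y X y + riesz ((1 + q) / 2) X x.
    move=> X0 iX XE.
    have := @riesz_mix R (D x (p m0)) (q - 2^-1) (2^-1 + (1 - q) / 2) X x Dp; rewrite e; apply => //.
      exact: n3 j2 XE.
    exact: n3 j3 XE.
  rewrite /T2 (bigD1 m0) //; apply: ler_wpDr.
    by apply: sumr_ge0 => m _; apply: addr_ge0; apply: tm.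
  rewrite mulrDr; apply: lerD.
    by rewrite mulrA mulrC; exact: (ler_wpM2l IH0 (mixF F F0 iF FE)).
  by rewrite mulrCA; exact: (ler_wpM2l IF0 (mixF H H0 iH (Or33 _ _ erefl))).
split => //.
- apply: (le_trans M1); rewrite -[leRHS]mulrA; apply: ler_wpM2l => //.
  have T10 : 0 <= T1 q H x by apply: sumr_ge0 => m _; exact: t1m.
  apply: (@le_trans _ _ (T1 q H x)); last by rewrite ler_peMl// lerDl.
  apply: (le_trans rm); rewrite /T1 (bigD1 m0) // lerDl; apply: sumr_ge0 => m _; exact: t1m.
- by apply: main => //; exact: Or31.
- by apply: main => //; exact: Or32.
Qed.


Let bnd (h : R -> R) : continuous h -> exists K, 0 <= K /\ forall x, `|h (D x w)| <= K.
Proof.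
move=> ch; have [M [_ HM]] : bounded_set [set h x | x in `[0, 2]%classic].
  apply: compact_bounded; apply: continuous_compact; last exact: segment_compact.
  exact: continuous_subspaceT.
have H u : 0 <= u <= 2 -> `|h u| <= M + 1.
  move=> u02; apply: (HM (M + 1)); first by rewrite ltrDl.
  by exists u => //=; rewrite in_itv.
exists (M + 1); split; first by apply: le_trans (normr_ge0 (h 0)) (H 0 _); rewrite lexx /=.
by move=> x; apply: H; rewrite D_ge0 D_le2.
Qed.

(* The terms of the integrand that do not involve the potentials. *)
Let loc eta x := 2 * sdot v x * phi x + Phi' (D x w) * Bk v x w
  + phi x * \sum_(m < 3) a m * (Bk v x (p m) / (eta + D x (p m))).

Let loc_bound : exists K, 0 <= K /\ forall eta x, 0 <= eta -> (forall m, D x (p m) <> 0) -> `|loc eta x| <= K.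
Proof.
have [K1 [K10 hK1]] := bnd cPhi; have [K2 [K20 hK2]] := bnd cPhi'.
exists (2 * 1 * K1 + K2 * 2 + \sum_(m < 3) `|a m| * (`|B| * Num.sqrt 2)); split.
  by rewrite !addr_ge0 ?mulr_ge0 ?sumr_ge0// => m _; rewrite !mulr_ge0 ?sqrtr_ge0.
move=> eta x e0 Dx; rewrite /loc; apply: nbD; first apply: nbD.
- by apply: nbM; [apply: nbM; [rewrite ger0_norm|exact: norm_sdot]|exact: hK1].
- by apply: nbM; [exact: hK2|exact: Bk_le2].
- rewrite mulr_sumr; apply: le_trans (ler_norm_sum _ _ _) _; apply: ler_sum => m _.
  rewrite mulrCA normrM ler_wpM2l// normrM.
  have Dp : 0 < D x (p m) by rewrite lt_neqAle D_ge0 andbT eq_sym; apply/eqP.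
  apply: le_trans (ler_wpM2l (normr_ge0 _) (Bk_sing v e0 (Dx m))) _.
  rewrite !mulrA; apply: (@le_trans _ _ (`|B| * Num.sqrt (D x (p m)) * Num.sqrt 2 * D x (p m) `^ (- 2^-1))).
    rewrite ler_wpM2r ?powR_ge0// ler_wpM2r ?sqrtr_ge0//; apply: (le_trans (PhiB x m)).
    by rewrite ler_wpM2r ?sqrtr_ge0// ler_norm.
  have e : Num.sqrt (D x (p m)) * D x (p m) `^ (- 2^-1) = 1.
    by rewrite -powR12_sqrt ?D_ge0// -powRD ?(gt_eqF Dp) ?implybT// subrr powRr0.
  by rewrite [leLHS](_ : _ = `|B| * Num.sqrt 2 * (Num.sqrt (D x (p m)) * D x (p m) `^ (- 2^-1))); [rewrite e mulr1|ring].
Qed.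

Let mloc eta : measurable_fun setT (loc eta).
Proof.
apply: measurable_funD; first by meas.
by apply: measurable_funM => //; apply: measurable_sum => m; meas.
Qed.

Let Uh_cvg F x : itg (@area R) F -> itg (@area R) (fun y => lb (D x y) * F y) ->
  Uh n F x @[n --> \oo] --> pot F x.
Proof. by move=> iF ix; exact: (Lk_pot ix (itg_measurable iF)).1. Qed.

Let Lk_le3 n x y : Lk (etan R n) x y <= 3.
Proof.
have e0 := etan_gt0 R n; have e1 := etan_le1 R n; have d2 := D_le2 x y.
have := ln_sublinear (etaD_gt0 e0 x y); rewrite /Lk; lra.
Qed.

Let itg_lnD F x : itg (@area R) F -> itg (@area R) (fun y => lb (D x y) * F y) ->
  itg (@area R) (fun y => ln (D x y) * F y).
Proof.
move=> iF ix; have mF := itg_measurable iF; apply: itg_le (itg_norm ix) => [|y]; first by meas.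
rewrite !normrM ler_wpM2r// (ger0_norm (lb_ge0 _)); apply: norm_ln_lb.
by rewrite D_ge0 (le_trans (D_le2 _ _))//; lra.
Qed.

(* The regularised densities are dominated, because the logarithms of the
   singular factors only increase with the regularisation. *)
Let Wh_le q H x n : good q H x -> expR (Wh n a p C f g x) <= Mx x.
Proof.
move=> [Dx [ixf ixg] _]; rewrite ler_expR /Wh.
have e0 := etan_gt0 R n.
have h3 : Uh n g x <= 3 * \int[@area R]_y g y.
  rewrite -RintZ//; apply: le_Rint; [exact: itg_Lk|exact: itgZ|].
  by move=> y; rewrite ler_wpM2r.
have lnLk y : D x y <> 0 -> ln (D x y) <= Lk (etan R n) x y.
  move=> /eqP D0; have Dp : 0 < D x y by rewrite lt_neqAle D_ge0 andbT eq_sym.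
  by rewrite /Lk ler_ln ?posrE ?(addr_gt0 e0 Dp)// lerDr ltW.
have h2 : pot f x <= Uh n f x.
  apply: le_Rint_ae; [exact: itg_lnD|exact: itg_Lk|].
  by apply: ae_mono (ae_D_neq x 0) => y /lnLk h; rewrite ler_wpM2r.
have h1 : \sum_(m < 3) a m * Lk (etan R n) x (p m) <= \sum_(m < 3) a m * ln (D x (p m)).
  by apply: ler_sum => m _; have /andP[_ am] := a0 m; rewrite ler_wnM2l// lnLk.
by lra.
Qed.

Let f_le q H x : good q H x -> f x <= Mx x.
Proof.
move=> [Dx [ixf ixg] _]; rewrite fE ler_expR /vort.
have h3 : pot g x <= 3 * \int[@area R]_y g y.
  rewrite -RintZ//; apply: le_Rint; [exact: itg_lnD|exact: itgZ|].
  move=> y; rewrite ler_wpM2r//; have d2 := D_le2 x y; have := D_ge0 x y.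
  rewrite le_eqVlt => /orP[/eqP <-|d0]; first by rewrite ln0.
  by have := ln_sublinear d0; lra.
by lra.
Qed.

Let Wh_cvg q H x : good q H x -> expR (Wh n a p C f g x) @[n --> \oo] --> f x.
Proof.
move=> [Dx [ixf ixg] _]; rewrite fE.
apply: (continuous_cvg _ (@continuous_expR R _)).
apply: cvgD; last exact: Uh_cvg.
apply: cvgB; last by apply: cvgM; [exact: cvg_cst|exact: Uh_cvg].
apply: cvgD; first exact: cvg_cst.
elim: (index_enum 'I_3) => [|m s IH].
  by under eq_fun do rewrite big_nil; rewrite big_nil; exact: cvg_cst.
under eq_fun do rewrite big_cons; rewrite big_cons; apply: cvgD => //.
by apply: cvgM; [exact: cvg_cst|exact: cvg_Lk].
Qed.

Let loc_cvg x : (forall m, D x (p m) <> 0) -> loc (etan R n) x @[n --> \oo] --> loc 0 x.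
Proof.
move=> Dx; apply: cvgD; first exact: cvg_cst.
apply: cvgM; first exact: cvg_cst.
elim: (index_enum 'I_3) => [|m s IH].
  by under eq_fun do rewrite big_nil; rewrite big_nil; exact: cvg_cst.
under eq_fun do rewrite big_cons; rewrite big_cons; apply: cvgD => //.
apply: cvgM; first exact: cvg_cst.
apply: cvgM; first exact: cvg_cst.
apply: cvgV; first by rewrite add0r; apply/eqP.
by apply: cvgD; [exact: cvg_etan|exact: cvg_cst].
Qed.

(** The limit of the regularised identities by dominated convergence. The
    equation says that the density [f] is in equilibrium under the conformal
    field attached to [v], weighted by a function of the distance to [w] which
    controls the singularities at the vortices. *)
Theorem virial :
  let K F (z : sphere R * sphere R) := phi z.1 * f z.1 * (Bk v z.1 z.2 / D z.1 z.2) * F z.2 in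
  [/\ itg (@area R \x @area R)%E (K f), itg (@area R \x @area R)%E (K g) &
  \int[@area R]_x (f x * (2 * sdot v x * Phi (D x w) + Phi' (D x w) * Bk v x w
     + Phi (D x w) * \sum_(m < 3) a m * (Bk v x (p m) / D x (p m))))
  = 2 * \int[(@area R \x @area R)%E]_z K f z - \int[(@area R \x @area R)%E]_z K g z].
Proof.
move=> K; have [q [H [c [q0 q1 iH [c0 H0] hae]]]] := majorants.
have [L [L0 hL]] := loc_bound.
have mf := itg_measurable itf.
have iT F : itg (@area R) F -> itg (@area R) (T2 q H F) by exact: itg_T2.
have j4 : 2^-1 \in [:: 2^-1; (1 - q) / 2; 2^-1 + (1 - q) / 2; (1 + q) / 2] by rewrite !inE eqxx.
have s2 : 0 <= Num.sqrt 2 :> R by exact: sqrtr_ge0.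
have iK F : itg (@area R) F -> (forall y, 0 <= F y) -> [\/ F = f, F = g | F = H] ->
    {ae @area R, forall x, Mx x * (`|phi x| * sv x) * riesz 2^-1 F x <= c * T2 q H F x} ->
    [/\ itg (@area R \x @area R)%E (K F), itg (@area R) (fun x => phi x * f x * DU v F x) &
    \int[(@area R \x @area R)%E]_z K F z = \int[@area R]_x (phi x * f x * DU v F x)].
  move=> iF F0 FE hF; have mF := itg_measurable iF.
  have iKF : itg (@area R \x @area R)%E (K F).
    apply: (itg_prod_ae (b := fun x => Num.sqrt 2 * (c * T2 q H F x))).
    - have h1 := measurableT_comp mphi (@measurable_fst _ _ (sphere R) (sphere R)).
      have h2 := measurableT_comp mf (@measurable_fst _ _ (sphere R) (sphere R)).
      have h3 := measurableT_comp mF (@measurable_snd _ _ (sphere R) (sphere R)).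
      by rewrite /K; apply: measurable_funM => //; apply: measurable_funM; [exact: measurable_funM|meas].
    - by apply: itgZ; apply: itgZ; exact: iT.
    - apply: ae_mono2 hae hF => x [gx _ _ _] hx.
      have [Dx _ n3] := gx; have iR := n3 _ _ j4 FE.
      have [iB _] := DUh_cvg iF F0 iR.
      have iKx : itg (@area R) (fun y => K F (x, y)).
        by under eq_fun do rewrite /K /= -mulrA; exact: itgZ.
      split => //; apply: (@le_trans _ _ (\int[@area R]_y (Num.sqrt 2 * (f x * (`|phi x| * sv x)) * (D x y `^ (- 2^-1) * F y)))).
        apply: le_Rint_ae; [exact: itg_norm|exact: itgZ|].
        apply: ae_mono (ae_D_neq x 0) => y D0; rewrite /K /= !normrM (ger0_norm (F0 y)) (ger0_norm (f0 x)).
        rewrite [leRHS]mulrA ler_wpM2r//.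
        have := Bk_sing v (lexx 0) D0; rewrite add0r normrM => h.
        rewrite [leRHS](_ : _ = `|phi x| * f x * (sv x * Num.sqrt 2 * D x y `^ (- 2^-1))); last by ring.
        by rewrite ler_wpM2l// mulr_ge0.
      rewrite RintZ// -mulrA ler_wpM2l//; apply: le_trans hx.
      rewrite -/(riesz _ _ _) ler_wpM2r ?riesz_ge0// ler_wpM2r ?mulr_ge0//.
      exact: f_le gx.
  have e12 : {ae @area R, forall x, \int[@area R]_y K F (x, y) = phi x * f x * DU v F x}.
    apply: ae_mono hae => x [gx _ _ _]; have [Dx _ n3] := gx; have iR := n3 _ _ j4 FE.
    have [iB _] := DUh_cvg iF F0 iR.
    by rewrite -RintZ//; apply: eq_Rint => y; rewrite /K /=; ring.
  have m2 : measurable_fun setT (fun x => phi x * f x * DU v F x).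
    by have := measurable_DU v iF => h; apply: measurable_funM => //; exact: measurable_funM.
  split => //; first exact: itg_ae m2 e12 (Rint_prod12 iKF).1.
  rewrite (Rint_prod12 iKF).2; apply: ae_eq_Rint => //.
  exact: itg_measurable (Rint_prod12 iKF).1.
have mDUf := measurable_DU v itf; have mDUg := measurable_DU v itgg.
have [iKf iDf ->] := iK f itf f0 (Or31 _ _ erefl) (ae_mono (fun x h => let: And4 _ _ h _ := h in h) hae).
have [iKg iDg ->] := iK g itgg g0 (Or32 _ _ erefl) (ae_mono (fun x h => let: And4 _ _ _ h := h in h) hae).
split => //.
have iloc : itg (@area R) (fun x => f x * loc 0 x).
  apply: (@itg_le_ae _ _ _ _ (fun x => L * f x)); last exact: itgZ.
    exact: measurable_funM.
  by apply: ae_mono hae => x [[Dx _ _] _ _ _]; rewrite normrM (ger0_norm (f0 x)) mulrC ler_wpM2r// hL.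
have -> : \int[@area R]_x (f x * (2 * sdot v x * Phi (D x w) + Phi' (D x w) * Bk v x w
     + Phi (D x w) * \sum_(m < 3) a m * (Bk v x (p m) / D x (p m)))) = \int[@area R]_x (f x * loc 0 x).
  apply: eq_Rint => x; congr (_ * (_ + _ * _)); apply: eq_bigr => m _; by rewrite add0r.
pose Hn n x := expR (Wh n a p C f g x) * (2 * sdot v x * Phi (D x w)
    + Phi' (D x w) * Bk v x w + Phi (D x w) * DWh n a p f g v x).
pose Hl x := f x * (loc 0 x + phi x * (- 2 * DU v f x + DU v g x)).
have [_ lim] : itg (@area R) Hl /\ \int[@area R]_x Hn n x @[n --> \oo] --> \int[@area R]_x Hl x.
  apply: (@Rint_dct _ _ _ (@area R) Hn Hl (fun x => L * (c * T1 q H x) + Num.sqrt 2 * (2 * (c * T2 q H f x) + c * T2 q H g x))).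
  - move=> n; have h1 := measurable_Wh n a p C itf itgg; have h2 := measurable_DWh n a p itf itgg v.
    by rewrite /Hn -/phi; apply: measurable_funM; [exact: measurableT_comp|meas].
  - apply: measurable_funM => //; apply: measurable_funD => //; apply: measurable_funM => //.
    by apply: measurable_funD => //; exact: measurable_funM.
  - apply: ae_mono hae => x [gx _ _ _]; have [Dx _ n3] := gx.
    have [_ cf] := DUh_cvg itf f0 (n3 _ _ j4 (Or31 _ _ erefl)).
    have [_ cg] := DUh_cvg itgg g0 (n3 _ _ j4 (Or32 _ _ erefl)).
    have -> : Hn ^~ x = fun n => expR (Wh n a p C f g x) * (loc (etan R n) x + phi x * (- 2 * DUh n v f x + DUh n v g x)).
      by apply/funext => n; rewrite /Hn /loc /DWh /phi; ring.
    apply: cvgM; first exact: Wh_cvg gx.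
    apply: cvgD; first exact: loc_cvg.
    apply: cvgM; first exact: cvg_cst.
    by apply: cvgD => //; apply: cvgM => //; exact: cvg_cst.
  - apply: itgD; first by apply: itgZ; apply: itgZ; exact: itg_T1.
    by apply: itgZ; apply: itgD; [apply: itgZ|]; apply: itgZ; exact: iT.
  - apply: ae_mono hae => x [gx hT1 hTf hTg] n; have [Dx _ n3] := gx.
    have df := DUh_le n itf f0 (n3 _ _ j4 (Or31 _ _ erefl)).
    have dg := DUh_le n itgg g0 (n3 _ _ j4 (Or32 _ _ erefl)).
    have -> : Hn n x = expR (Wh n a p C f g x) * loc (etan R n) x
        + (expR (Wh n a p C f g x) * phi x) * (- 2 * DUh n v f x + DUh n v g x).
      by rewrite /Hn /loc /DWh /phi; ring.
    have hW := Wh_le n gx; have M0 : 0 <= Mx x by exact: expR_ge0.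
    have hl := hL (etan R n) x (ltW (etan_gt0 R n)) Dx.
    apply: (le_trans (ler_normD _ _)); apply: lerD.
      rewrite normrM (ger0_norm (expR_ge0 _)) mulrC; apply: ler_pM; rewrite ?expR_ge0//.
      exact: le_trans hW hT1.
    rewrite normrM normrM (ger0_norm (expR_ge0 _)).
    apply: (@le_trans _ _ (Mx x * `|phi x| * (2 * (sv x * Num.sqrt 2 * riesz 2^-1 f x) + sv x * Num.sqrt 2 * riesz 2^-1 g x))).
      apply: ler_pM; rewrite ?mulr_ge0 ?expR_ge0//; first exact: ler_wpM2r.
      by apply: nbD => //; apply: nbM => //; rewrite normrN ger0_norm.
    rewrite [leLHS](_ : _ = Num.sqrt 2 * (2 * (Mx x * (`|phi x| * sv x) * riesz 2^-1 f x) + Mx x * (`|phi x| * sv x) * riesz 2^-1 g x)); last by ring.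
    by rewrite ler_wpM2l// lerD// ler_wpM2l.
have Hn0 n : \int[@area R]_x Hn n x = 0 by exact: reg_virial.
have E0 : \int[@area R]_x Hl x = 0.
  move: lim; under eq_fun do rewrite Hn0.
  by move=> lim0; rewrite -(cvg_lim _ lim0)//; exact: lim_cst.
have i2 := itgB (itgZ 2 iDf) iDg.
have : \int[@area R]_x Hl x = \int[@area R]_x (f x * loc 0 x)
   - (2 * \int[@area R]_x (phi x * f x * DU v f x) - \int[@area R]_x (phi x * f x * DU v g x)).
  rewrite -(RintZ _ iDf) -(RintB (itgZ 2 iDf) iDg) -(RintB iloc i2).
  by apply: eq_Rint => x; rewrite /Hl; ring.
by rewrite E0 => /esym/eqP; rewrite subr_eq0 => /eqP.
Qed.

End estimates.
End virial.

(** * Radial weights and the layer-cake formula *)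

Section antiderivative.
Variable R : realType.

(** As [om] has compact support, its primitive on a segment extends to the line.
    *)
Lemma antiderivative (om : R -> R) (b : R) : continuous om -> (forall s, s <= -1 -> om s = 0) ->
  (forall s, b <= s -> om s = 0) -> exists A : R -> R, forall u, drv A u (om u).
Proof.
move=> co oml omr.
have io : (@lebesgue_measure R).-integrable setT (EFin \o om).
  have fi : (@lebesgue_measure R).-integrable `[-1, b] (EFin \o om).
    apply: continuous_compact_integrable; first exact: segment_compact.
    exact: continuous_subspaceT.
  have fi2 : (@lebesgue_measure R).-integrable setT ((EFin \o om) \_ `[-1, b]%classic).
    by apply: (proj1 (@integrable_mkcond _ _ R (@lebesgue_measure R) `[-1, b]%classic (EFin \o om) _)).
  move: fi2; congr (integrable _ _ _); apply/funext => s; rewrite patchE /=; case: ifPn => //.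
  rewrite notin_setE /= in_itv /= => /negP; rewrite negb_and -!ltNge => /orP[h|h].
    by rewrite oml// ltW.
  by rewrite omr// ltW.
exists (fun x => \int[@lebesgue_measure R]_(t in `]-oo, x]) om t) => u.
have iu : (@lebesgue_measure R).-integrable `]-oo, (u + 1)] (EFin \o om) by apply: integrableS io.
have u1 : u < u + 1 by rewrite ltrDl.
have [d1 d2] := @continuous_FTC1 R om -oo%O u (u + 1) u1 iu (ltNyr u) (co u).
by apply: DeriveDef; [exact: d1|rewrite -derive1E; exact: d2].
Qed.

End antiderivative.

Section radial_weight.
Variables (R : realType) (G : R -> R) (t1 T : R).
Hypotheses (cG : continuous G) (G01 : forall s, 0 <= G s <= 1) (GT : forall s, T <= s -> G s = 0).
Hypotheses (t10 : 0 < t1) (T0 : 0 < T).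

(** The logarithmic weight [G s / s], made bounded below [t1]; its values at
    negative arguments only matter for its continuity. *)
Definition wt (s : R) : R := G s * Num.max 0 (Num.min 1 (1 + s)) / Num.max s t1.

Lemma wt_cts : continuous wt.
Proof.
rewrite /wt; apply: ctsM; first by cts.
by apply: ctsV; [move=> s; rewrite gt_eqF// lt_max t10 orbT|cts].
Qed.

Lemma wtE s : 0 <= s -> wt s = G s / Num.max s t1.
Proof. by move=> s0; rewrite /wt min_l ?lerDl// max_r ?mulr1. Qed.

Lemma wt_ge0 s : 0 <= wt s.
Proof.
have /andP[g0 _] := G01 s.
by rewrite /wt divr_ge0 ?mulr_ge0 ?le_max ?lexx// (ltW t10) orbT.
Qed.

Lemma wt_bound s : `|wt s| <= t1^-1.
Proof.
rewrite ger0_norm ?wt_ge0// -[leRHS]mul1r; have /andP[g0 g1] := G01 s.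
apply: ler_pM.
- by rewrite mulr_ge0// le_max lexx.
- by rewrite invr_ge0 le_max (ltW t10) orbT.
- by rewrite mulr_ile1// ?le_max ?lexx// ge_max ler01 ge_min lexx.
- by rewrite lef_pV2 ?posrE ?lt_max ?t10 ?orbT// le_max lexx orbT.
Qed.

Lemma wt_le s : 0 < s -> wt s <= s^-1.
Proof.
move=> s0; rewrite wtE ?(ltW s0)// -[leRHS]mul1r; have /andP[g0 g1] := G01 s.
apply: ler_pM => //; first by rewrite invr_ge0 le_max (ltW s0).
by rewrite lef_pV2 ?posrE ?lt_max ?s0// le_max lexx.
Qed.

Lemma wt_supp s : T <= s -> wt s = 0. Proof. by move=> /GT h; rewrite /wt h !mul0r. Qed.

(** A primitive of [- wt], the weight to be put in the virial identity. Its
    growth at the origin is at most logarithmic. *)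
Lemma radial_weight : exists Phi : R -> R, [/\ forall u, drv Phi u (- wt u),
  forall s, 0 <= s <= 2 -> Phi s = \int[seg 0 2]_z (wt z * (s <= z)%R%:R),
  forall s t, s <= t -> Phi t <= Phi s,
  forall s t, 0 < s -> s <= t -> Phi s - Phi t <= ln t - ln s &
  T <= 2 -> forall s, T <= s -> Phi s = 0].
Proof.
have [A dA] : exists A : R -> R, forall u, drv A u (wt u).
  apply: (@antiderivative _ _ T) wt_cts _ wt_supp => s s1.
  by rewrite /wt (_ : Num.max _ _ = 0) ?mulr0 ?mul0r// max_l// ge_min -lerBrDl sub0r s1 orbT.
have I s t : s <= t -> \int[seg s t]_z wt z = A t - A s.
  by move=> st; exact: FTC_seg st dA wt_cts.
have mw : measurable_fun setT wt by apply: continuous_measurable_fun; exact: wt_cts.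
have mono s t : s <= t -> A s <= A t.
  by move=> st; rewrite -subr_ge0 -I//; apply: Rint_ge0 => z; exact: wt_ge0.
exists (fun u => A 2 - A u); split.
- by move=> u; have h := dA u; apply: drv_eq; [dv|rewrite add0r].
- move=> s /andP[s0 s2]; rewrite -I// /Rintegral seg_sub//; last by move=> z; exact: wt_ge0.
  congr fine; apply: eq_integral => z _; rewrite indicE; congr (_ * _%:R)%:E.
  by congr nat_of_bool; apply/idP/idP; rewrite inE /= in_itv /= andbT.
- by move=> s t st; have := mono _ _ st; lra.
- move=> s t s0 st; rewrite (_ : _ - _ = A t - A s); last by ring.
  have mi : measurable_fun setT (fun z : R => z^-1) by meas.
  have [||ii <-] := @FTC_loc R s t (fun z => z^-1) (@ln R) st mi.
  + move=> x /andP[sx _]; have x0 := lt_le_trans s0 sx.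
    by apply: drv_eq; [apply: (drv_ln (f := fun y => y)); [exact: x0|exact: drv_id]|rewrite mulr1].
  + move=> x /andP[sx _]; have x0 := lt_le_trans s0 sx.
    exact: drv_continuous (drvV (lt0r_neq0 x0) (drv_id x)).
  rewrite -I//; apply: le_Rint_ae => //.
    by apply: itg_seg_cont; exact: wt_cts.
  by apply: ae_mono (ae_seg s t) => z /andP[sz _]; apply: wt_le; exact: lt_le_trans s0 sz.
- move=> T2 s Ts; suff : \int[seg T (Num.max s 2)]_z wt z = 0 /\ \int[seg T 2]_z wt z = 0.
    have TM : T <= Num.max s 2 by rewrite le_max Ts.
    rewrite !I// => -[e1 e2].
    have h1 := mono _ _ Ts; have h2 := mono s (Num.max s 2); rewrite le_max lexx in h2.
    by have := h2 isT; lra.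
  have z0 b : \int[seg T b]_z wt z = 0.
    rewrite (eq_Rint_seg (g := fun=> 0))//; first by rewrite Rint_eq0.
    by move=> z /andP[Tz _]; exact: wt_supp.
  by split.
Qed.

End radial_weight.

Section layer_cake.
Variables (R : realType) (q : sphere R).
Implicit Types (f : sphere R -> R).

Definition mass f t : R := \int[@area R]_x ((D x q <= t)%R%:R * f x).

Lemma norm_ind (b : bool) : `|b%:R| <= 1 :> R.
Proof. by case: b; rewrite ?normr1 ?normr0. Qed.

Lemma measurable_ind d (X : measurableType d) (a b : X -> R) :
  measurable_fun setT a -> measurable_fun setT b ->
  measurable_fun setT (fun z => (a z <= b z)%R%:R : R).
Proof.
move=> ma mb; have mS : measurable [set z | (a z <= b z)%R].
  by rewrite -[X in measurable X]setTI; exact: measurable_fun_le.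
have -> : (fun z => (a z <= b z)%R%:R) = \1_[set z | (a z <= b z)%R] :> (X -> R).
  by apply/funext => z; rewrite indicE; congr (nat_of_bool _)%:R; apply/idP/idP; rewrite inE.
exact: measurable_indic.
Qed.

Lemma itg_layer f (be : R -> R) M : itg (@area R) f -> measurable_fun setT be ->
  (forall z, `|be z| <= M) ->
  itg (@area R \x seg 0 2)%E (fun w => (D w.1 q <= w.2)%R%:R * f w.1 * be w.2).
Proof.
move=> iF mb bM; have mf := itg_measurable iF.
have mk : measurable_fun setT (fun w : sphere R * R => (D w.1 q <= w.2)%R%:R * f w.1 * be w.2).
  apply: measurable_funM; last exact: (measurableT_comp mb measurable_snd).
  apply: measurable_funM; last exact: (measurableT_comp mf measurable_fst).
  by apply: measurable_ind => //; meas.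
have M0 : 0 <= M by rewrite (le_trans _ (bM 0)).
apply: (itg_prod_ae (b := fun x => `|f x| * M * 2)) => //.
  by under eq_fun do rewrite -mulrA mulrC; apply: itgZ; exact: itg_norm.
apply: ae_all => x.
have mx : measurable_fun setT (fun z => (D x q <= z)%R%:R * f x * be z).
  exact: (measurableT_comp mk (@measurable_pair1 _ _ _ _ x)).
have bx z : `|(D x q <= z)%R%:R * f x * be z| <= `|f x| * M.
  by rewrite !normrM; apply: ler_pM => //; rewrite ler_piMl// norm_ind.
have ix : itg (seg 0 2) (fun z => (D x q <= z)%R%:R * f x * be z).
  by apply: (@itg_bounded _ _ _ _ _ (`|f x| * M)).
split; first exact: ix.
apply: (@le_trans _ _ (\int[seg 0 2]_z (`|f x| * M))).
  by apply: le_Rint => //; [exact: itg_norm ix|exact: itg_cst].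
by rewrite Rint_cst [X in fine X](seg_setT _)//= subr0.
Qed.

(** Fubini. *)
Lemma layer_cake f (be : R -> R) M : itg (@area R) f -> measurable_fun setT be ->
  (forall z, `|be z| <= M) ->
  \int[@area R]_x (f x * \int[seg 0 2]_z (be z * (D x q <= z)%R%:R)) = \int[seg 0 2]_z (be z * mass f z).
Proof.
move=> iF mb bM; have ih := itg_layer iF mb bM.
transitivity (\int[@area R]_x \int[seg 0 2]_z ((D x q <= z)%R%:R * f x * be z)).
  apply: eq_Rint => x; rewrite -RintZ.
    by apply: eq_Rint => z; ring.
  apply: (@itg_bounded _ _ _ _ _ M).
    by apply: measurable_funM => //; apply: measurable_ind.
  by move=> z; rewrite -[leRHS]mulr1; apply: nbM => //; exact: norm_ind.
rewrite (Rint_swap ih); apply: eq_Rint => z; rewrite mulrC /mass [RHS]mulrC -RintZ.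
  by apply: eq_Rint => x; rewrite mulrC.
apply: (itgMb (C := 1) iF); first by apply: measurable_ind; meas.
by move=> x; exact: norm_ind.
Qed.

Lemma measurable_mass f : itg (@area R) f -> measurable_fun setT (mass f).
Proof.
move=> iF; have ih := @itg_layer f (fun=> 1) 1 iF (@measurable_cst _ _ _ _ _ _).
have {}ih := ih (fun _ => norm_ind true).
have := itg_measurable (Rint_prod21 ih).1.
by under eq_fun do under eq_Rint do rewrite mulr1.
Qed.

Lemma itg_ind f t : itg (@area R) f -> itg (@area R) (fun x => (D x q <= t)%R%:R * f x).
Proof.
move=> iF; apply: (itgMb (C := 1) iF); first by apply: measurable_ind; meas.
by move=> x; exact: norm_ind.
Qed.

Lemma mass_ge0 f t : (forall x, 0 <= f x) -> 0 <= mass f t.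
Proof. by move=> f0; apply: Rint_ge0 => x; rewrite mulr_ge0. Qed.

Lemma mass_mono f s t : itg (@area R) f -> (forall x, 0 <= f x) -> s <= t -> mass f s <= mass f t.
Proof.
move=> iF f0 st; apply: le_Rint; [exact: itg_ind|exact: itg_ind|move=> x].
rewrite ler_wpM2r// ler_nat; have [h|//] := boolP (D x q <= s).
by rewrite (le_trans h st).
Qed.

Lemma mass_le f t : itg (@area R) f -> (forall x, 0 <= f x) -> mass f t <= \int[@area R]_x f x.
Proof.
move=> iF f0; apply: le_Rint => //; first exact: itg_ind.
by move=> x; rewrite ler_piMl//; case: (_ <= t)%R.
Qed.

End layer_cake.

(** * The local Pohozaev identity *)

Section product_swap.
Context (R : realType).

Lemma Rint_prod_swap (h : sphere R * sphere R -> R) : itg (@area R \x @area R)%E h ->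
  itg (@area R \x @area R)%E (fun z => h (z.2, z.1)) /\
  \int[(@area R \x @area R)%E]_z h (z.2, z.1) = \int[(@area R \x @area R)%E]_z h z.
Proof.
move=> ih; have mh := itg_measurable ih.
have ms : measurable_fun setT (fun z : sphere R * sphere R => h (z.2, z.1)).
  by apply: (measurableT_comp mh); apply: measurable_fun_pair.
have ihs : itg (@area R \x @area R)%E (fun z => h (z.2, z.1)).
  apply/integrable12ltyP; first exact/measurable_EFinP.
  have mE : measurable_fun setT (EFin \o h) by exact/measurable_EFinP.
  exact: (integrable21ltyP (@area R) (@area R) mE).1 ih.
by split => //; rewrite (Rint_prod12 ihs).2 (Rint_prod21 ih).2.
Qed.

Lemma itg_tensor (f g : sphere R -> R) : itg (@area R) f -> itg (@area R) g ->
  itg (@area R \x @area R)%E (fun z => f z.1 * g z.2) /\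
  \int[(@area R \x @area R)%E]_z (f z.1 * g z.2) = \int[@area R]_x f x * \int[@area R]_x g x.
Proof.
move=> iF iG; have mf := itg_measurable iF; have mg := itg_measurable iG.
have ih : itg (@area R \x @area R)%E (fun z => f z.1 * g z.2).
  apply: (itg_prod_ae (b := fun x => \int[@area R]_y `|g y| * `|f x|)).
  - by apply: measurable_funM; [exact: (measurableT_comp mf measurable_fst)|exact: (measurableT_comp mg measurable_snd)].
  - by apply: itgZ; exact: itg_norm.
  - apply: ae_all => x.
    have ix : itg (@area R) (fun y => f x * g y) by exact: itgZ.
    split; first exact: ix.
    rewrite mulrC -RintZ; last exact: itg_norm.
    by under eq_Rint do rewrite normrM.
split => //; rewrite (Rint_prod12 ih).2 mulrC -RintZ//.
by apply: eq_Rint => x /=; rewrite [RHS]mulrC; exact: RintZ.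
Qed.

End product_swap.

Section elementary.
Variable R : realType.

Lemma ln_sqrt (u : R) : 0 < u -> ln u = 2 * ln (Num.sqrt u).
Proof.
move=> u0; rewrite -[in LHS](sqr_sqrtr (ltW u0)) lnXn ?sqrtr_gt0//.
by rewrite mulr2n mulrDl mul1r.
Qed.

Lemma ln_le_sub1 (z : R) : 0 < z -> ln z <= z - 1.
Proof.
move=> z0; have h := @le_ln1Dx R (z - 1); rewrite (_ : 1 + (z - 1) = z) in h; last by ring.
by apply: h; lra.
Qed.

Lemma sqrt_ln_le (s t : R) : 0 < s -> s <= t -> Num.sqrt s * (ln t - ln s) <= 2 * Num.sqrt t.
Proof.
move=> s0 st; have t0 := lt_le_trans s0 st.
have q0 : 0 < Num.sqrt s by rewrite sqrtr_gt0.
have q1 : 0 < Num.sqrt t by rewrite sqrtr_gt0.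
rewrite (ln_sqrt s0) (ln_sqrt t0) -mulrBr -ln_div ?posrE//.
have h := ln_le_sub1 (divr_gt0 q1 q0).
rewrite mulrCA ler_wpM2l// (le_trans (ler_wpM2l (ltW q0) h))//.
by rewrite mulrBr mulr1 mulrC divfK ?gt_eqF// gerBl ltW.
Qed.

(** The difference of the logarithms is controlled by [d], even when [t] is
    close to [s]: this is what makes the error in the two-point function
    bounded. *)
Lemma sqrt_ln_gap (s t d : R) : 0 < s -> s < t -> Num.sqrt t <= Num.sqrt s + d ->
  Num.sqrt s * (ln t - ln s) <= 2 * d.
Proof.
move=> s0 st hd; have t0 := lt_trans s0 st.
have q0 : 0 < Num.sqrt s by rewrite sqrtr_gt0.
have q1 : 0 < Num.sqrt t by rewrite sqrtr_gt0.
rewrite (ln_sqrt s0) (ln_sqrt t0) -mulrBr -ln_div ?posrE//.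
have h := ln_le_sub1 (divr_gt0 q1 q0).
rewrite mulrCA ler_wpM2l// (le_trans (ler_wpM2l (ltW q0) h))//.
by rewrite mulrBr mulr1 mulrC divfK ?gt_eqF//; lra.
Qed.

End elementary.

Section weighted_identity.
Variables (R : realType) (q : sphere R) (p : 'I_3 -> sphere R) (T : R).
Implicit Types (x y : sphere R).
Hypotheses (T0 : 0 < T) (T1 : T <= 1) (Tq : forall m, p m <> q -> 4 * T <= D q (p m)).
Variables (Phi w : R -> R).
Hypotheses (dPhi : forall u, drv Phi u (- w u)) (cw : continuous w) (w0 : forall s, 0 <= w s)
  (Pmono : forall s t, s <= t -> Phi t <= Phi s)
  (Pln : forall s t, 0 < s -> s <= t -> Phi s - Phi t <= ln t - ln s)
  (Psupp : forall s, T <= s -> Phi s = 0) (wle : forall s, 0 < s -> w s <= s^-1).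

Let P0 s : 0 <= Phi s.
Proof.
have h : Phi (Num.max s T) = 0 by apply: Psupp; rewrite le_max lexx orbT.
by rewrite -h; apply: Pmono; rewrite le_max lexx.
Qed.

Let Pu s : 0 < s -> s * Phi s <= 2.
Proof.
move=> s0; have [sT|Ts] := leP s T; last by rewrite Psupp ?mulr0// ltW.
have h := Pln s0 sT; rewrite (Psupp (lexx T)) subr0 in h.
have h2 := sqrt_ln_le s0 sT; have q1 : Num.sqrt s <= 1 by rewrite -sqrtr1 ler_sqrt// (le_trans sT).
have q2 : Num.sqrt T <= 1 by rewrite -sqrtr1 ler_sqrt.
have q0 := sqrtr_ge0 s; rewrite -{1}(sqr_sqrtr (ltW s0)) expr2 -mulrA.
have h3 : Num.sqrt s * Phi s <= 2 by apply: le_trans (ler_wpM2l q0 h) _; lra.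
have h4 : 0 <= Num.sqrt s * Phi s by rewrite mulr_ge0.
by apply: le_trans h3; rewrite ler_piMl.
Qed.

Let Dpm x m : D x q < T -> p m <> q -> T <= D x (p m).
Proof.
by move=> xT /Tq h; have := D_quasi q x (p m); rewrite (DC q x); lra.
Qed.

Let Pfar x m : x <> q -> p m <> q -> `|Phi (D x q) * (Bk q x (p m) / D x (p m))| <= 4.
Proof.
move=> xq pq; have [Ts|xT] := leP T (D x q).
  by rewrite Psupp// mul0r normr0.
have hT := Dpm xT pq; have s0 : 0 < D x q by exact: D_gt0.
have d0 : 0 < D x (p m) by exact: lt_le_trans hT.
have hB := Bk_bound2 q x (p m); rewrite (DC q x) in hB.
have hP := Pln s0 (ltW xT); rewrite (Psupp (lexx T)) subr0 in hP.
have h2 := sqrt_ln_le s0 (ltW xT).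
have q0 : 0 <= Num.sqrt (D x q) by exact: sqrtr_ge0.
have hs : Num.sqrt T <= Num.sqrt (D x (p m)) by rewrite ler_sqrt// ltW.
rewrite normrM (ger0_norm (P0 _)) normrM normfV (gtr0_norm d0) mulrA ler_pdivrMr//.
apply: (le_trans (ler_wpM2l (P0 _) hB)).
have e := sqr_sqrtr (ltW d0); set z := Num.sqrt (D x (p m)) in hs e hB *.
have z0 : 0 < z by rewrite sqrtr_gt0.
rewrite -e [leLHS](_ : _ = 2 * (Num.sqrt (D x q) * Phi (D x q)) * z); last by ring.
rewrite expr2 [leRHS]mulrA ler_wpM2r ?(ltW z0)//.
have : Num.sqrt (D x q) * Phi (D x q) <= 2 * z.
  apply: (le_trans (ler_wpM2l q0 hP)); apply: (le_trans h2); by rewrite ler_wpM2l.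
by lra.
Qed.

(* The two-point function: symmetrised, it only sees the outer point. *)
Let Ptwo x y : x <> q -> y <> q -> x <> y ->
  `|(Phi (D x q) * Bk q x y + Phi (D y q) * Bk q y x) / D x y - 2 * Phi (Num.max (D x q) (D y q))| <= 8.
Proof.
wlog xy : x y / D x q <= D y q.
  move=> H xq yq nxy; case/orP: (le_total (D x q) (D y q)) => h; first exact: H.
  have nyx : y <> x by move=> e; apply: nxy.
  have := H y x h yq xq nyx; by rewrite (DC y x) maxC [X in X / _]addrC.
move=> xq yq nxy; have s0 : 0 < D x q by exact: D_gt0.
have t0 : 0 < D y q by exact: D_gt0.
have d0 : 0 < D x y by exact: D_gt0.
rewrite max_r//.
have E : (Phi (D x q) * Bk q x y + Phi (D y q) * Bk q y x) / D x y - 2 * Phi (D y q) =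
   - ((D x q + D y q) * Phi (D y q)) + (Phi (D x q) - Phi (D y q)) * (Bk q x y / D x y).
  have h := Bk_sym q x y.
  have -> : Bk q y x = (sdot q x + sdot q y) * D x y - Bk q x y by rewrite -h; ring.
  rewrite !(DC _ q) [D q x]/D [D q y]/D; field; exact: lt0r_neq0.
rewrite E (_ : 8 = 4 + 4 :> R); last by lra.
apply: nbD.
  have := Pu t0; have := P0 (D y q) => h1 h2; have st := addr_ge0 (ltW s0) (ltW t0).
  rewrite normrN ger0_norm; last exact: mulr_ge0.
  have h3 : D x q * Phi (D y q) <= D y q * Phi (D y q) by rewrite ler_wpM2r.
  rewrite mulrDl (le_trans (lerD (le_trans h3 h2) h2))//; lra.
have [e|ne] := eqVneq (D x q) (D y q); first by rewrite e subrr mul0r normr0.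
have lt : D x q < D y q by rewrite lt_neqAle ne.
have hB := Bk_bound2 q x y; rewrite (DC q x) in hB.
have hP := Pln s0 xy; have hP0 : 0 <= Phi (D x q) - Phi (D y q) by rewrite subr_ge0 Pmono.
have tri := D_triangle y x q; rewrite (DC y x) addrC in tri.
have h2 := sqrt_ln_gap s0 lt tri.
have q0 : 0 <= Num.sqrt (D x q) by exact: sqrtr_ge0.
rewrite normrM (ger0_norm hP0) normrM normfV (gtr0_norm d0) mulrA ler_pdivrMr//.
apply: (le_trans (ler_wpM2l hP0 hB)).
have e := sqr_sqrtr (ltW d0); set z := Num.sqrt (D x y) in h2 e hB *.
have z0 : 0 < z by rewrite sqrtr_gt0.
rewrite -e [leLHS](_ : _ = 2 * (Num.sqrt (D x q) * (Phi (D x q) - Phi (D y q))) * z); last by ring.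
rewrite expr2 [leRHS]mulrA ler_wpM2r ?(ltW z0)//.
have : Num.sqrt (D x q) * (Phi (D x q) - Phi (D y q)) <= 2 * z.
  by apply: le_trans h2; rewrite ler_wpM2l.
by lra.
Qed.

Definition alq (a : 'I_3 -> R) : R := \sum_(m < 3) (p m == q)%:R * a m.

Let cPhi : continuous Phi. Proof. by move=> u; exact: drv_continuous (dPhi u). Qed.

Let Pbnd : exists M, 0 <= M /\ forall x, Phi (D x q) <= M.
Proof. by exists (Phi 0); split => // x; apply: Pmono; exact: D_ge0. Qed.

Let mP : measurable_fun setT (fun x => Phi (D x q)).
Proof. by apply: (measurableT_comp (continuous_measurable_fun cPhi)); meas. Qed.

Section one_density.
Variables (a : 'I_3 -> R) (C : R) (f g : sphere R -> R).
Hypotheses (a0 : forall m, -1 < a m <= 0) (pp : forall m m', m != m' -> p m <> p m').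
Hypotheses (itf : itg (@area R) f) (itgg : itg (@area R) g) (g0 : forall x, 0 <= g x).
Hypothesis fE : forall x, f x = expR (vort a p C f g x).
Hypothesis f1 : \int[@area R]_x f x <= 1.

Let f0 x : 0 <= f x. Proof. by rewrite fE expR_ge0. Qed.

Definition Kq (F : sphere R -> R) (z : sphere R * sphere R) : R :=
  Phi (D z.1 q) * f z.1 * (Bk q z.1 z.2 / D z.1 z.2) * F z.2.

Lemma itg_Phi : itg (@area R) (fun x => f x * Phi (D x q)).
Proof.
have [M [M0 hM]] := Pbnd; under eq_fun do rewrite mulrC.
by apply: (itgMb (C := M)) => // x; rewrite ger0_norm.
Qed.

(** In the virial identity with pole and centre at [q], the main terms are [2 *
    (1 + alq)] times the weighted mass and the interactions; the vortices other
    than [q] are outside of the support of the weight. *)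
Lemma weighted_one : [/\ itg (@area R \x @area R)%E (Kq f), itg (@area R \x @area R)%E (Kq g) &
  `|2 * (1 + alq a) * \int[@area R]_x (f x * Phi (D x q))
    - (2 * \int[(@area R \x @area R)%E]_z Kq f z - \int[(@area R \x @area R)%E]_z Kq g z)| <= 20].
Proof.
have [M [M0 hM]] := Pbnd.
have PB x m : `|Phi (D x q)| * Num.sqrt (1 - sdot q x ^+ 2) <= (M * Num.sqrt 2) * Num.sqrt (D x (p m)).
  rewrite ger0_norm//; have [Ts|xT] := leP T (D x q).
    by rewrite Psupp// mul0r mulr_ge0 ?sqrtr_ge0// mulr_ge0 ?sqrtr_ge0.
  rewrite -mulrA; apply: ler_pM; rewrite ?sqrtr_ge0//.
  apply: (le_trans (sqrt_sdot2_le q x)); rewrite ler_wpM2l ?sqrtr_ge0// DC.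
  have [<-//|/eqP pq] := eqVneq (p m) q.
  by rewrite ler_sqrt ?D_ge0// (le_trans (ltW xT))// Dpm.
have cw' : continuous (fun u => - w u) by cts.
have [i1 i2 E] := virial a0 pp itf itgg g0 fE dPhi cw' PB.
split => //; rewrite -E -RintZ; last exact: itg_Phi.
have bE : {ae @area R, forall x, `|2 * (1 + alq a) * (f x * Phi (D x q)) -
    f x * (2 * sdot q x * Phi (D x q) + - w (D x q) * Bk q x q
      + Phi (D x q) * \sum_(m < 3) a m * (Bk q x (p m) / D x (p m)))| <= 20 * f x}.
  apply: ae_mono (ae_neq q) => x xq; have s0 : 0 < D x q by exact: D_gt0.
  have -> : 2 * (1 + alq a) * (f x * Phi (D x q)) -
    f x * (2 * sdot q x * Phi (D x q) + - w (D x q) * Bk q x q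
      + Phi (D x q) * \sum_(m < 3) a m * (Bk q x (p m) / D x (p m)))
    = (2 * (D x q * Phi (D x q)) + w (D x q) * D x q * (2 - D x q) +
       \sum_(m < 3) a m * (Phi (D x q) * ((p m == q)%:R * 2 - Bk q x (p m) / D x (p m)))) * f x.
    rewrite Bk_self (DC q x).
    have -> : \sum_(m < 3) a m * (Phi (D x q) * ((p m == q)%:R * 2 - Bk q x (p m) / D x (p m)))
       = 2 * alq a * Phi (D x q) - Phi (D x q) * \sum_(m < 3) a m * (Bk q x (p m) / D x (p m)).
      rewrite /alq mulr_sumr mulr_suml [Phi _ * _]mulr_sumr -sumrB; apply: eq_bigr => m _; ring.
    have -> : sdot q x = 1 - D x q by rewrite /D sdotC; ring.
    ring.
  rewrite normrM (ger0_norm (f0 x)) ler_wpM2r//.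
  have pu := Pu s0; have p0 := P0 (D x q); have d2 := D_le2 x q.
  have wD : 0 <= w (D x q) * D x q <= 1.
    rewrite mulr_ge0 ?(ltW s0)//= -(mulVf (lt0r_neq0 s0)) ler_wpM2r ?(ltW s0)//; exact: wle.
  have bm m : `|a m * (Phi (D x q) * ((p m == q)%:R * 2 - Bk q x (p m) / D x (p m)))| <= 4.
    have am : `|a m| <= 1 by have := a0 m; rewrite ler_norml; lra.
    rewrite normrM -[leRHS]mul1r; apply: ler_pM => //.
    have [->|/eqP pq] := eqVneq (p m) q; rewrite /= ?mul1r ?mul0r.
      rewrite Bk_self (DC q x) (_ : _ * _ = D x q * Phi (D x q)); first by rewrite ger0_norm ?mulr_ge0 ?(ltW s0)//; lra.
      by field; exact: lt0r_neq0.
    by rewrite sub0r mulrN normrN; exact: Pfar.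
  rewrite (_ : 20 = 2 * 2 + 1 * 2 + 3 * 4 + 2 :> R); last by lra.
  apply: (@le_trans _ _ (2 * 2 + 1 * 2 + 3 * 4)); last by rewrite lerDl.
  apply: nbD; first apply: nbD.
  - by apply: nbM; rewrite ger0_norm// mulr_ge0 ?(ltW s0).
  - apply: nbM; first by rewrite ger0_norm; lra.
    by rewrite ger0_norm; lra.
  - apply: le_trans (ler_norm_sum _ _ _) _; apply: (@le_trans _ _ (\sum_(m < 3) 4)); first exact: ler_sum.
    by rewrite sumr_const card_ord; lra.
have iv : itg (@area R) (fun x => f x * (2 * sdot q x * Phi (D x q) + - w (D x q) * Bk q x q
      + Phi (D x q) * \sum_(m < 3) a m * (Bk q x (p m) / D x (p m)))).
  have iP := itgZ (2 * (1 + alq a)) itg_Phi.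
  apply: (@itg_le_ae _ _ _ _ (fun x => `|2 * (1 + alq a) * (f x * Phi (D x q))| + 20 * f x)).
  - have mf := itg_measurable itf.
    have mw : measurable_fun setT (fun x => w (D x q)).
      by apply: (measurableT_comp (continuous_measurable_fun cw)); meas.
    apply: measurable_funM => //; apply: measurable_funD; first by meas.
    by apply: measurable_funM => //; apply: measurable_sum => m; meas.
  - apply: ae_mono bE => x h; rewrite -[X in `|X|](subKr (2 * (1 + alq a) * (f x * Phi (D x q)))).
    by apply: (le_trans (ler_normB _ _)); rewrite lerD2l.
  - by apply: itgD; [exact: itg_norm|exact: itgZ].
have iP := itgZ (2 * (1 + alq a)) itg_Phi.
rewrite -RintB//; have iD := itgB iP iv.
apply: le_trans (normr_Rint iD) _; apply: (@le_trans _ _ (\int[@area R]_x (20 * f x))).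
  by apply: le_Rint_ae => //; [exact: itg_norm|exact: itgZ].
by rewrite RintZ// -[leRHS]mulr1 ler_wpM2l.
Qed.

End one_density.


Lemma le_Rint_prod_ae (h k : sphere R * sphere R -> R) :
  itg (@area R \x @area R)%E h -> itg (@area R \x @area R)%E k ->
  {ae @area R, forall x, {ae @area R, forall y, h (x, y) <= k (x, y)}} ->
  \int[(@area R \x @area R)%E]_z h z <= \int[(@area R \x @area R)%E]_z k z.
Proof.
move=> ih ik hk; have [i1 ->] := Rint_prod12 ih; have [i2 ->] := Rint_prod12 ik.
apply: le_Rint_ae => //.
have s1 := ae_integrable1 ih; have s2 := ae_integrable1 ik.
have s12 := ae_mono2 (fun x => @conj _ _) s1 s2.
by apply: ae_mono2 hk s12 => x hx [j1 j2]; exact: le_Rint_ae.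
Qed.

Definition maxpot (f g : sphere R -> R) (z : sphere R * sphere R) : R :=
  f z.1 * g z.2 * Phi (Num.max (D z.1 q) (D z.2 q)).

Lemma itg_maxpot f g : itg (@area R) f -> itg (@area R) g -> itg (@area R \x @area R)%E (maxpot f g).
Proof.
move=> iF iG; have [ifg _] := itg_tensor iF iG; have [M [M0 hM]] := Pbnd.
have mm : measurable_fun setT (fun z : sphere R * sphere R => Phi (Num.max (D z.1 q) (D z.2 q))).
  apply: (measurableT_comp (continuous_measurable_fun cPhi)); apply: measurable_maxr; meas.
rewrite /maxpot; under eq_fun do rewrite mulrC.
apply: (itgMb (C := M)) => // z; rewrite ger0_norm//.
by apply: (le_trans _ (hM z.1)); apply: Pmono; rewrite le_max lexx.
Qed.

(** Integration of [Ptwo]. *)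
Lemma symmetrised f g : itg (@area R) f -> itg (@area R) g -> (forall x, 0 <= f x) -> (forall x, 0 <= g x) ->
  \int[@area R]_x f x <= 1 -> \int[@area R]_x g x <= 1 ->
  itg (@area R \x @area R)%E (Kq f g) -> itg (@area R \x @area R)%E (Kq g f) ->
  `|\int[(@area R \x @area R)%E]_z Kq f g z + \int[(@area R \x @area R)%E]_z Kq g f z
    - 2 * \int[(@area R \x @area R)%E]_z maxpot f g z| <= 8.
Proof.
move=> iF iG f0 g0 f1 g1 i1 i2; have [i3 e3] := Rint_prod_swap i2.
have [ifg efg] := itg_tensor iF iG; have im := itg_maxpot iF iG.
rewrite -e3 -RintD// -RintZ// -RintB//; [|exact: itgD|exact: itgZ].
have iD := itgB (itgD i1 i3) (itgZ 2 im).
apply: (le_trans (normr_Rint iD)).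
apply: (@le_trans _ _ (\int[(@area R \x @area R)%E]_z (8 * (f z.1 * g z.2)))).
  apply: le_Rint_prod_ae; [exact: itg_norm iD|exact: itgZ|].
  apply: ae_mono (ae_neq q) => x xq; have h := ae_mono2 (fun x => @conj _ _) (ae_neq q) (ae_neq x).
  apply: ae_mono h => y [yq yx] /=.
  have := Ptwo xq yq (not_eq_sym yx); rewrite /Kq /maxpot /= (DC y x).
  set b1 := Bk q x y; set b2 := Bk q y x; set F1 := Phi (D x q); set F2 := Phi (D y q); set F3 := Phi _.
  rewrite [X in _ -> `|X| <= _](_ : _ = (f x * g y) * ((F1 * b1 + F2 * b2) / D x y - 2 * F3)); last by ring.
  by move=> h8; rewrite normrM ger0_norm ?mulr_ge0// mulrC ler_wpM2r// mulr_ge0.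
have f2 : 0 <= \int[@area R]_x f x by exact: Rint_ge0.
have g2 : 0 <= \int[@area R]_x g x by exact: Rint_ge0.
by rewrite RintZ// efg -[leRHS]mulr1 ler_wpM2l// mulr_ile1.
Qed.

(** In the sum of the two identities the mixed interactions come in pairs that
    can be symmetrised. *)
Lemma weighted_pair a1 a2 C1 C2 f1 f2 :
  (forall m, -1 < a1 m <= 0) -> (forall m, -1 < a2 m <= 0) -> (forall m m', m != m' -> p m <> p m') ->
  itg (@area R) f1 -> itg (@area R) f2 -> \int[@area R]_x f1 x <= 1 -> \int[@area R]_x f2 x <= 1 ->
  (forall x, f1 x = expR (vort a1 p C1 f1 f2 x)) -> (forall x, f2 x = expR (vort a2 p C2 f2 f1 x)) ->
  `|(1 + alq a1) * \int[@area R]_x (f1 x * Phi (D x q)) + (1 + alq a2) * \int[@area R]_x (f2 x * Phi (D x q))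
    - (\int[(@area R \x @area R)%E]_z maxpot f1 f1 z + \int[(@area R \x @area R)%E]_z maxpot f2 f2 z
        - \int[(@area R \x @area R)%E]_z maxpot f1 f2 z)| <= 32.
Proof.
move=> a10 a20 pp i1 i2 l1 l2 E1 E2.
have p1 x : 0 <= f1 x by rewrite E1 expR_ge0.
have p2 x : 0 <= f2 x by rewrite E2 expR_ge0.
have [k11 k12 h1] := weighted_one a10 pp i1 i2 p2 E1 l1.
have [k22 k21 h2] := weighted_one a20 pp i2 i1 p1 E2 l2.
have s11 := symmetrised i1 i1 p1 p1 l1 l1 k11 k11.
have s22 := symmetrised i2 i2 p2 p2 l2 l2 k22 k22.
have s12 := symmetrised i1 i2 p1 p2 l1 l2 k12 k21.
move: h1 h2 s11 s22 s12; rewrite !ler_norml.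
move: (\int[_]_x (f1 x * _)) (\int[_]_x (f2 x * _)) (\int[_]_z maxpot f1 f1 z) (\int[_]_z maxpot f2 f2 z)
  (\int[_]_z maxpot f1 f2 z) (\int[_]_z Kq f1 f1 z) (\int[_]_z Kq f1 f2 z) (\int[_]_z Kq f2 f1 z) (\int[_]_z Kq f2 f2 z)
  (alq a1) (alq a2) => J1 J2 M1 M2 M3 K1 K2 K3 K4 b1 b2 /andP[? ?] /andP[? ?] /andP[? ?] /andP[? ?] /andP[? ?].
apply/andP; split; lra.
Qed.

End weighted_identity.

Section subsegment.
Variable R : realType.

Lemma measurable_ind2 (s t : R) : measurable_fun setT (fun z : R => ((s <= z) && (z <= t))%R%:R : R).
Proof.
have -> : (fun z => ((s <= z) && (z <= t))%R%:R : R) = (fun z => (s <= z)%R%:R * (z <= t)%R%:R).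
  by apply/funext => z; rewrite -natrM mulnb.
by apply: measurable_funM; exact: measurable_ind.
Qed.

Lemma Rint_subseg (a b s t M : R) (h : R -> R) : a <= s -> t <= b -> measurable_fun setT h ->
  (forall z, `|h z| <= M) ->
  \int[seg s t]_z h z = \int[seg a b]_z (((s <= z) && (z <= t))%R%:R * h z).
Proof.
move=> as_ tb mh hM.
have mi : measurable_fun setT (fun z => ((s <= z) && (z <= t))%R%:R * h z).
  by apply: measurable_funM => //; exact: measurable_ind2.
rewrite !Rint_seg; first last.
- exact: (@itg_bounded _ _ _ _ _ M).
- apply: (@itg_bounded _ _ _ _ _ M) => // z; rewrite normrM -[leRHS]mul1r; apply: ler_pM => //.
  exact: norm_ind.
rewrite Rintegral_mkcond [RHS]Rintegral_mkcond; apply: eq_Rint => z; rewrite !patchE.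
have mem c d : (z \in `[c, d]%classic) = (c <= z <= d) by apply/idP/idP; rewrite inE /= in_itv.
rewrite !mem; case: (leP s z) => sz; rewrite /= ?mul0r ?if_same//.
case: (leP z t) => zt; rewrite /= ?mul0r ?if_same// mul1r.
by rewrite (le_trans as_ sz) (le_trans zt tb).
Qed.

Lemma Rint_subseg_cst (a b s t c : R) : a <= s -> s <= t -> t <= b ->
  \int[seg a b]_z (((s <= z) && (z <= t))%R%:R * c) = c * (t - s).
Proof.
move=> as_ st tb; rewrite -(Rint_subseg (h := fun=> c) (M := `|c|) as_ tb)//.
by rewrite Rint_cst [X in fine X](seg_setT st).
Qed.

Lemma itg_subseg_cst (a b s t c : R) : itg (seg a b) (fun z => ((s <= z) && (z <= t))%R%:R * c).
Proof.
apply: (@itg_bounded _ _ _ _ _ `|c|).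
  by apply: measurable_funM => //; exact: measurable_ind2.
by move=> z; rewrite -[leRHS]mul1r normrM ler_wpM2r// norm_ind.
Qed.

End subsegment.

Section pohozaev.
Variables (R : realType) (q : sphere R) (p : 'I_3 -> sphere R) (t1 t0 : R) (g : R -> R).
Hypotheses (t10 : 0 < t1) (t1t0 : t1 <= t0) (t04 : t0 <= 4^-1).
Hypotheses (cg : continuous g) (g01 : forall s, 0 <= g s <= 1).
Hypothesis sep : forall m, p m <> q -> 8 * t0 <= D q (p m).

Let t00 : 0 < t0. Proof. exact: lt_le_trans t10 t1t0. Qed.

Let t0h : 2 * t0 <= 1. Proof. by rewrite mulrC -ler_pdivlMr// mul1r (le_trans t04)// lef_pV2 ?posrE// ler_nat. Qed.

(** The quadratic form of the local masses whose zero set contains the possible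
    blow-up masses at [q]. *)
Definition pohozaev_form (b1 b2 n1 n2 : R) : R := b1 * n1 + b2 * n2 - n1 ^+ 2 - n2 ^+ 2 + n1 * n2.

Let G s := g s * Num.max 0 (Num.min 1 (2 - s / t0)).

Let cG : continuous G. Proof. by rewrite /G; cts. Qed.

Let rb s : 0 <= Num.max 0 (Num.min 1 (2 - s / t0)) <= 1.
Proof. by rewrite le_max lexx /= ge_max ler01 ge_min lexx. Qed.

Let G01 s : 0 <= G s <= 1.
Proof.
have /andP[a b] := g01 s; have /andP[c d] := rb s.
by rewrite /G mulr_ge0//= mulr_ile1.
Qed.

Let GT s : 2 * t0 <= s -> G s = 0.
Proof.
move=> h; rewrite /G max_l ?mulr0// ge_min; apply/orP; right.
by rewrite subr_le0 ler_pdivlMr.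
Qed.

Let GE s : s <= t0 -> G s = g s.
Proof.
move=> h; have h2 : s / t0 <= 1 by rewrite ler_pdivrMr// mul1r.
by rewrite /G min_l ?max_r ?mulr1//; lra.
Qed.

Variables (a1 a2 : 'I_3 -> R) (C1 C2 : R) (f1 f2 : sphere R -> R).
Hypotheses (a10 : forall m, -1 < a1 m <= 0) (a20 : forall m, -1 < a2 m <= 0).
Hypotheses (pp : forall m m', m != m' -> p m <> p m').
Hypotheses (i1 : itg (@area R) f1) (i2 : itg (@area R) f2).
Hypotheses (l1 : \int[@area R]_x f1 x <= 1) (l2 : \int[@area R]_x f2 x <= 1).
Hypotheses (E1 : forall x, f1 x = expR (vort a1 p C1 f1 f2 x)) (E2 : forall x, f2 x = expR (vort a2 p C2 f2 f1 x)).

Let p1 x : 0 <= f1 x. Proof. by rewrite E1 expR_ge0. Qed.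
Let p2 x : 0 <= f2 x. Proof. by rewrite E2 expR_ge0. Qed.

Definition pohozaev_at s : R :=
  pohozaev_form (1 + alq q p a1) (1 + alq q p a2) (mass q f1 s) (mass q f2 s).

Let alq01 a : (forall m, -1 < a m <= 0) -> 0 <= 1 + alq q p a <= 1.
Proof.
move=> a0; rewrite /alq; have [/existsP[m0 /eqP e]|/existsPn h] := boolP [exists m, p m == q].
  rewrite (bigD1 m0)//= e eqxx mul1r big1 ?addr0; first by have := a0 m0; lra.
  by move=> m mm0; case: eqP; rewrite ?mul0r// => em; case: (pp mm0); rewrite em.
by rewrite big1 ?addr0 ?lexx ?ler01// => m _; rewrite (negPf (h m)) mul0r.
Qed.

Lemma pohozaev_at_bound s : `|pohozaev_at s| <= 3.
Proof.
have /andP[? ?] := alq01 a10; have /andP[? ?] := alq01 a20.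
have n10 := mass_ge0 q s p1; have n11 := le_trans (mass_le q s i1 p1) l1.
have n20 := mass_ge0 q s p2; have n21 := le_trans (mass_le q s i2 p2) l2.
rewrite /pohozaev_at /pohozaev_form; move: (mass q f1 s) (mass q f2 s) n10 n11 n20 n21 => n m *.
have h1 : 0 <= (1 + alq q p a1) * n <= 1 by rewrite mulr_ge0// mulr_ile1.
have h2 : 0 <= (1 + alq q p a2) * m <= 1 by rewrite mulr_ge0// mulr_ile1.
have h3 : 0 <= n * m <= 1 by rewrite mulr_ge0// mulr_ile1.
have h4 : 0 <= n ^+ 2 <= 1 by rewrite sqr_ge0 exprn_ile1.
have h5 : 0 <= m ^+ 2 <= 1 by rewrite sqr_ge0 exprn_ile1.
by rewrite ler_norml; lra.
Qed.

Lemma measurable_pohozaev_at : measurable_fun setT pohozaev_at.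
Proof.
have m1 := measurable_mass q i1; have m2 := measurable_mass q i2.
by rewrite /pohozaev_at /pohozaev_form; meas.
Qed.

(** By the layer-cake formula the weighted masses and interactions are integrals
    of [n_i] and of [n_i n_j] against the same measure. *)
Lemma pohozaev_weighted : `|\int[seg 0 2]_z (wt G t1 z * pohozaev_at z)| <= 32.
Proof.
have T0 : 0 < 2 * t0 by rewrite mulr_gt0.
have T1 := t0h.
have T2 : 2 * t0 <= 2 by rewrite (le_trans T1)// ler1n.
have Tq m : p m <> q -> 4 * (2 * t0) <= D q (p m) by move=> /sep; rewrite mulrA -natrM.
have [Phi [dPhi PE Pmono Pln Psupp]] := radial_weight cG G01 GT t10.
have cw := wt_cts cG t10; have w0 := wt_ge0 G01 t10; have wb := wt_bound G01 t10.
have mw : measurable_fun setT (wt G t1) by exact: continuous_measurable_fun.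
have w1 s : 0 < s -> wt G t1 s <= s^-1 by move=> s0; apply: wt_le.
have cw' : continuous (wt G t1) := cw.
have h : `|(1 + alq q p a1) * \int[@area R]_x (f1 x * Phi (D x q)) + (1 + alq q p a2) * \int[@area R]_x (f2 x * Phi (D x q))
    - (\int[(@area R \x @area R)%E]_z maxpot q Phi f1 f1 z + \int[(@area R \x @area R)%E]_z maxpot q Phi f2 f2 z
        - \int[(@area R \x @area R)%E]_z maxpot q Phi f1 f2 z)| <= 32.
  by apply: (@weighted_pair R q p _ T0 T1 Tq Phi (wt G t1) dPhi cw' w0 Pmono Pln (Psupp T2) w1 a1 a2 C1 C2).
have D02 x : 0 <= D x q <= 2 by rewrite D_ge0 D_le2.
have J f : itg (@area R) f -> \int[@area R]_x (f x * Phi (D x q)) = \int[seg 0 2]_z (wt G t1 z * mass q f z).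
  move=> iF; rewrite -(layer_cake q iF mw wb).
  by apply: eq_Rint => x; rewrite PE.
have mb f : itg (@area R) f -> (forall x, 0 <= f x) -> \int[@area R]_x f x <= 1 -> forall z, `|mass q f z| <= 1.
  move=> iF f0 fl z; rewrite ger0_norm ?mass_ge0//; exact: le_trans (mass_le q z iF f0) fl.
have M f h' : itg (@area R) f -> itg (@area R) h' -> (forall x, 0 <= f x) -> (forall x, 0 <= h' x) ->
   \int[@area R]_x h' x <= 1 ->
   \int[(@area R \x @area R)%E]_z maxpot q Phi f h' z = \int[seg 0 2]_z (wt G t1 z * mass q h' z * mass q f z).
  move=> iF iH f0 h0 hl.
  have im : itg (@area R \x @area R)%E (maxpot q Phi f h').
    by apply: (@itg_maxpot R q (2 * t0) Phi (wt G t1)) => //; exact: Psupp.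
  rewrite (Rint_prod12 im).2.
  have mm : measurable_fun setT (fun z => wt G t1 z * mass q h' z).
    by apply: measurable_funM => //; exact: measurable_mass.
  rewrite -(@layer_cake _ _ f (fun z => wt G t1 z * mass q h' z) t1^-1 iF mm); last first.
    by move=> z; rewrite -[leRHS]mulr1; apply: nbM => //; exact: mb.
  apply: eq_Rint => x; rewrite /maxpot /=.
  have mx : measurable_fun setT (fun z => wt G t1 z * (D x q <= z)%R%:R).
    by apply: measurable_funM => //; exact: measurable_ind.
  have bx z : `|wt G t1 z * (D x q <= z)%R%:R| <= t1^-1.
    by rewrite -[leRHS]mulr1; apply: nbM => //; exact: norm_ind.
  have EP y : Phi (Num.max (D x q) (D y q)) = \int[seg 0 2]_z (wt G t1 z * (D x q <= z)%R%:R * (D y q <= z)%R%:R).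
    rewrite PE; last by rewrite le_max D_ge0 ge_max !D_le2.
    by apply: eq_Rint => z; rewrite ge_max -mulrA -natrM mulnb.
  have P0 u : 0 <= Phi u.
    by have := Pmono u (Num.max u (2 * t0)); rewrite le_max lexx (Psupp T2 (Num.max _ _)) ?le_max ?lexx ?orbT//; apply.
  have iP : itg (@area R) (fun y => h' y * Phi (Num.max (D x q) (D y q))).
    under eq_fun do rewrite mulrC; apply: (itgMb (C := Phi 0)) => //.
      apply: (measurableT_comp (continuous_measurable_fun (fun u => drv_continuous (dPhi u)))).
      by apply: measurable_maxr => //; meas.
    by move=> y; rewrite ger0_norm// Pmono// le_max D_ge0.
  transitivity (f x * \int[@area R]_y (h' y * \int[seg 0 2]_z (wt G t1 z * (D x q <= z)%R%:R * (D y q <= z)%R%:R))).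
    transitivity (f x * \int[@area R]_y (h' y * Phi (Num.max (D x q) (D y q)))).
      by rewrite -RintZ//; apply: eq_Rint => y; rewrite mulrA.
    by congr (_ * _); apply: eq_Rint => y; rewrite EP.
  rewrite (layer_cake q iH mx bx); congr (_ * _); apply: eq_Rint => z; ring.
move: h; rewrite (J f1 i1) (J f2 i2) (M f1 f1)// (M f2 f2)// (M f1 f2)//.
have iw f : itg (@area R) f -> (forall x, 0 <= f x) -> \int[@area R]_x f x <= 1 -> itg (seg 0 2) (fun z => wt G t1 z * mass q f z).
  move=> iF f0 fl; apply: (@itg_bounded _ _ _ _ _ t1^-1).
    by apply: measurable_funM => //; exact: measurable_mass.
  by move=> z; rewrite -[leRHS]mulr1; apply: nbM => //; exact: mb.
have iww f h' : itg (@area R) f -> itg (@area R) h' -> (forall x, 0 <= f x) -> (forall x, 0 <= h' x) ->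
    \int[@area R]_x f x <= 1 -> \int[@area R]_x h' x <= 1 -> itg (seg 0 2) (fun z => wt G t1 z * mass q h' z * mass q f z).
  move=> iF iH f0 h0 fl hl; apply: (@itg_bounded _ _ _ _ _ t1^-1).
    by apply: measurable_funM; [apply: measurable_funM => //|]; exact: measurable_mass.
  move=> z; rewrite -[leRHS]mulr1 -[X in _ <= X * _]mulr1; apply: nbM; [apply: nbM => //|]; exact: mb.
have j1 := iw f1 i1 p1 l1; have j2 := iw f2 i2 p2 l2.
have j11 := iww f1 f1 i1 i1 p1 p1 l1 l1; have j22 := iww f2 f2 i2 i2 p2 p2 l2 l2.
have j12 := iww f1 f2 i1 i2 p1 p2 l1 l2.
congr (`|_| <= _).
rewrite -(RintZ _ j1) -(RintZ _ j2) -(RintD (itgZ _ j1) (itgZ _ j2)) -(RintD j11 j22) -(RintB (itgD j11 j22) j12).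
rewrite -(RintB (itgD (itgZ _ j1) (itgZ _ j2)) (itgB (itgD j11 j22) j12)).
by apply: eq_Rint => z; rewrite /pohozaev_at /pohozaev_form; ring.
Qed.

(** The form is small on average over the logarithmic scales: an estimate with
    an absolute constant. The continuous weight of [pohozaev_weighted] differs
    from [g s / s] outside of the segment from [t1] to [t0] only, where its mass
    is bounded. *)
Theorem local_pohozaev : `|\int[seg t1 t0]_s (g s / s * pohozaev_at s)| <= 40.
Proof.
have [m3 mP] := (pohozaev_at_bound, measurable_pohozaev_at).
have cw := wt_cts cG t10; have wb := wt_bound G01 t10.
have mw : measurable_fun setT (wt G t1) by exact: continuous_measurable_fun.
have T1 := t0h; have t1n : t1^-1 >= 0 by rewrite invr_ge0 ltW.
have i0 : itg (seg 0 2) (fun z => wt G t1 z * pohozaev_at z).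
  apply: (@itg_bounded _ _ _ _ _ (t1^-1 * 3)); first exact: measurable_funM.
  by move=> z; apply: nbM.
have bw z : `|wt G t1 z * pohozaev_at z| <= t1^-1 * 3 by apply: nbM.
pose k z := ((t1 <= z) && (z <= t0))%R%:R * (wt G t1 z * pohozaev_at z).
have -> : \int[seg t1 t0]_s (g s / s * pohozaev_at s) = \int[seg 0 2]_z k z.
  rewrite -(Rint_subseg (M := t1^-1 * 3)) ?(ltW t10)//; [|by rewrite (le_trans _ (le_trans T1 _))// ?ler1n// ler_peMl ?ler1n// ltW|exact: measurable_funM].
  have mg := continuous_measurable_fun cg.
  apply: eq_Rint_seg; [meas|exact: measurable_funM|].
  move=> s /andP[s1 s2]; rewrite wtE ?(le_trans (ltW t10))// GE// max_l//.
have mk : measurable_fun setT k.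
  by apply: measurable_funM; [exact: measurable_ind2|exact: measurable_funM].
have ik : itg (seg 0 2) k.
  apply: (@itg_bounded _ _ _ _ _ (t1^-1 * 3)) => // z.
  by rewrite /k -[leRHS]mul1r; apply: nbM => //; exact: norm_ind.
rewrite -[\int[seg 0 2]_z k z](subKr (\int[seg 0 2]_z (wt G t1 z * pohozaev_at z))).
rewrite (_ : 40 = 32 + 8 :> R); last by lra.
apply: nbD; first exact: pohozaev_weighted.
rewrite normrN -RintB//; have iD := itgB i0 ik.
apply: (le_trans (normr_Rint iD)).
have T2 : 2 * t0 <= 2 by rewrite (le_trans T1)// ler1n.
have tt : t0 <= 2 * t0 by rewrite ler_peMl ?ler1n// ltW.
pose e z := ((0 <= z) && (z <= t1))%R%:R * (t1^-1 * 3) + ((t0 <= z) && (z <= 2 * t0))%R%:R * (t0^-1 * 3).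
have ie := itgD (itg_subseg_cst 0 2 0 t1 (t1^-1 * 3)) (itg_subseg_cst 0 2 t0 (2 * t0) (t0^-1 * 3)).
apply: (@le_trans _ _ (\int[seg 0 2]_z e z)).
  apply: le_Rint_ae; [exact: itg_norm iD|exact: ie|].
  apply: ae_mono (ae_seg 0 2) => z /andP[z0 z2]; rewrite /k /e z0 /=.
  have p3 : 0 <= t0^-1 * 3 by rewrite mulr_ge0// invr_ge0 ltW.
  have p4 : 0 <= t1^-1 * 3 by rewrite mulr_ge0.
  have [zt1|t1z] := leP z t1.
    rewrite mul1r -[leLHS]addr0; apply: lerD; last by rewrite mulr_ge0.
    case: (_ && _); rewrite ?mul1r ?subrr ?normr0// mul0r subr0//.
  rewrite mul0r add0r (ltW t1z) /=; have [zt0|t0z] := leP z t0.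
    by rewrite mul1r subrr normr0 mulr_ge0.
  rewrite mul0r subr0 (ltW t0z) /=; have [zT|Tz] := leP z (2 * t0).
    rewrite mul1r; apply: nbM => //; have zp := lt_trans t00 t0z.
    rewrite ger0_norm ?wt_ge0//; apply: le_trans (_ : z^-1 <= _).
      by apply: wt_le.
    by rewrite lef_pV2 ?posrE// ltW.
  by rewrite mul0r (wt_supp t1 GT) ?mul0r ?normr0// ltW.
rewrite RintD; [|exact: itg_subseg_cst|exact: itg_subseg_cst].
rewrite !Rint_subseg_cst ?(ltW t10) ?(ltW t00)//; last first.
  by rewrite (le_trans t1t0)// (le_trans tt).
rewrite subr0 [X in _ + X](_ : _ = 3); last by field; exact: lt0r_neq0.
by rewrite mulrAC mulVf ?mul1r ?lt0r_neq0//; lra.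
Qed.

End pohozaev.

(** * Comparison of a density with its scale function *)

Section scale.
Variable R : realType.
Implicit Types (x y q : sphere R) (F : sphere R -> R).

(** The logarithmic singularity below the scale [t]. *)
Definition lp (t u : R) : R := Num.max 0 (ln t - ln u).

Lemma lp_ge0 t u : 0 <= lp t u. Proof. by rewrite le_max lexx. Qed.

Lemma lkE (t u : R) : 0 < u -> u < t -> lk t u = expR (lp t u / 2).
Proof.
move=> u0 ut; have t0 := lt_trans u0 ut.
rewrite /lk ut mul1r /powR !gt_eqF// -expRD; congr expR; rewrite /lp max_r; first by field.
by rewrite subr_ge0 ler_ln ?posrE// ltW.
Qed.

Lemma lp_out (t u : R) : 0 < t -> t <= u -> lp t u = 0.
Proof. by move=> t0 tu; rewrite /lp max_l// subr_le0 ler_ln ?posrE// (lt_le_trans t0). Qed.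

Lemma lp_le_lk (t u : R) : 0 < t -> 0 < u -> lp t u <= 2 * lk t u.
Proof.
move=> t0 u0; have [tu|ut] := leP t u; first by rewrite lp_out// mulr_ge0 ?lk_ge0.
by rewrite lkE//; have := expR_ge1Dx (lp t u / 2); have := lp_ge0 t u; lra.
Qed.

(** The logarithm as it is seen from the distance [eta] to [q]. *)
Definition lmx q (eta : R) y : R := ln (Num.max eta (D q y)).

Variable (q : sphere R) (eta : R).
Hypothesis eta0 : 0 < eta.

Let mx0 y : 0 < Num.max eta (D q y). Proof. by rewrite lt_max eta0. Qed.

Lemma norm_lmx y : `|lmx q eta y| <= `|ln eta| + 1.
Proof.
have h1 : ln eta <= lmx q eta y by rewrite /lmx ler_ln ?posrE// le_max lexx.
have h2 : lmx q eta y <= `|ln eta| + 1.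
  rewrite /lmx; have [h|h] := leP eta (D q y); last by rewrite (le_trans (ler_norm _))// lerDl.
  have h0 := lt_le_trans eta0 h; have := ln_le_sub1 h0; have := D_le2 q y; have := normr_ge0 (ln eta); lra.
have h3 : - `|ln eta| <= ln eta by rewrite lerNl -normrN ler_norm.
by rewrite ler_norml h2 andbT; lra.
Qed.

Lemma measurable_lmx : measurable_fun setT (lmx q eta).
Proof.
by apply: (measurableT_comp (@measurable_ln R)); apply: measurable_maxr => //; meas.
Qed.

Lemma itg_lmx F : itg (@area R) F -> itg (@area R) (fun y => lmx q eta y * F y).
Proof. by move=> iF; apply: (itgMb (C := `|ln eta| + 1)) => //; [exact: measurable_lmx|exact: norm_lmx]. Qed.

Let ae_D0 x : {ae @area R, forall y, 0 < D x y}.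
Proof. by apply: ae_mono (ae_D_neq x 0) => y /eqP h; rewrite lt_neqAle eq_sym h D_ge0. Qed.

Lemma lnD_le_lmx x y (K : R) : 0 < D x y -> 0 < K -> D x y <= K * Num.max eta (D q y) ->
  ln (D x y) <= lmx q eta y + ln K.
Proof.
move=> d0 K0 h; rewrite /lmx -lnM ?posrE// ler_ln ?posrE// ?mulr_gt0//.
by rewrite mulrC.
Qed.

Lemma pot_le_lmx F x (K : R) : itg (@area R) F -> (forall y, 0 <= F y) -> \int[@area R]_y F y <= 1 ->
  1 <= K -> (forall y, D x y <= K * Num.max eta (D q y)) ->
  itg (@area R) (fun y => ln (D x y) * F y) ->
  pot F x <= \int[@area R]_y (lmx q eta y * F y) + ln K.
Proof.
move=> iF F0 F1 K1 h ix; have K0 : 0 < K by exact: lt_le_trans ltr01 K1.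
apply: (@le_trans _ _ (\int[@area R]_y (lmx q eta y * F y + ln K * F y))).
  apply: le_Rint_ae => //; first by apply: itgD; [exact: itg_lmx|exact: itgZ].
  by apply: ae_mono (ae_D0 x) => y d0; rewrite -mulrDl ler_wpM2r// lnD_le_lmx.
rewrite RintD; [|exact: itg_lmx|exact: itgZ].
by rewrite lerD2l RintZ// ler_piMr// ln_ge0.
Qed.

(** The potential is only bounded below up to its own singularity at [x], which
    is kept as an error term and averaged later. *)
Lemma pot_ge_lmx F x (K t : R) : itg (@area R) F -> (forall y, 0 <= F y) -> \int[@area R]_y F y <= 1 ->
  1 <= K -> 0 < t -> (forall y, Num.max eta (D q y) <= K * Num.max t (D x y)) ->
  itg (@area R) (fun y => ln (D x y) * F y) ->
  itg (@area R) (fun y => lp t (D x y) * F y) /\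
  \int[@area R]_y (lmx q eta y * F y) - ln K - \int[@area R]_y (lp t (D x y) * F y) <= pot F x.
Proof.
move=> iF F0 F1 K1 t0 h ix; have K0 : 0 < K by exact: lt_le_trans ltr01 K1.
have mF := itg_measurable iF.
have il : itg (@area R) (fun y => lp t (D x y) * F y).
  apply: (@itg_le _ _ _ _ (fun y => `|ln t| * F y + `|ln (D x y) * F y|)).
  - by apply: measurable_funM => //; apply: measurable_maxr => //; meas.
  - move=> y; rewrite normrM (ger0_norm (lp_ge0 _ _)) normrM (ger0_norm (F0 y)) -mulrDl ler_wpM2r//.
    rewrite /lp ge_max addr_ge0//= (le_trans (ler_norm _))//.
    by rewrite (le_trans (ler_normB _ _)).
  - by apply: itgD; [exact: itgZ|exact: itg_norm].
split => //; rewrite -addrA -opprD lerBlDr addrCA addrC.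
apply: (@le_trans _ _ (\int[@area R]_y (ln (D x y) * F y + lp t (D x y) * F y + ln K * F y))).
  apply: le_Rint_ae; [exact: itg_lmx|by apply: itgD; [exact: itgD|exact: itgZ]|].
  apply: ae_mono (ae_D0 x) => y d0; rewrite -!mulrDl ler_wpM2r//.
  have h2 : ln (Num.max t (D x y)) <= ln (D x y) + lp t (D x y).
    rewrite /lp; have [td|dt] := leP t (D x y); first by rewrite lerDl le_max lexx.
    by rewrite addrC -lerBlDr le_max lexx orbT.
  apply: (@le_trans _ _ (ln (Num.max t (D x y)) + ln K)); last by rewrite lerD2r.
  have m0 : 0 < Num.max t (D x y) by rewrite lt_max t0.
  by rewrite -lnM ?posrE// /lmx ler_ln ?posrE ?mulr_gt0// mulrC.
rewrite RintD; [|exact: itgD|exact: itgZ]; rewrite RintD// RintZ//.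
by rewrite lerD2l ler_piMr// ln_ge0.
Qed.

Variables (p : 'I_3 -> sphere R) (a : 'I_3 -> R) (C : R) (f g : sphere R -> R).
Hypotheses (a0 : forall m, -1 < a m <= 0) (itf : itg (@area R) f) (itgg : itg (@area R) g).
Hypotheses (g0 : forall x, 0 <= g x) (f1 : \int[@area R]_x f x <= 1) (g1 : \int[@area R]_x g x <= 1).
Hypothesis fE : forall x, f x = expR (vort a p C f g x).

Let f0 x : 0 <= f x. Proof. by rewrite fE expR_ge0. Qed.

(** The exponent of the density [f] at distance [eta] from [q], up to a
    bounded error. *)
Definition scale_exp : R := C + \sum_(m < 3) a m * lmx q eta (p m)
  - 2 * \int[@area R]_y (lmx q eta y * f y) + \int[@area R]_y (lmx q eta y * g y).

Definition regular_at x := [/\ forall m, 0 < D x (p m),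
  itg (@area R) (fun y => ln (D x y) * f y) & itg (@area R) (fun y => ln (D x y) * g y)].

Lemma ae_regular : {ae @area R, forall x, regular_at x}.
Proof.
have N1 : {ae @area R, forall x m, 0 < D x (p m)}.
  apply: ae_forall3 => m; apply: ae_mono (ae_D_neq (p m) 0) => x /eqP h.
  by rewrite lt_neqAle eq_sym (DC x) h D_ge0.
have N2 := ae_mono2 (fun x => @conj _ _) (ae_itg_pot itf) (ae_itg_pot itgg).
by apply: ae_mono2 N1 N2 => x n1 [n2 n3]; split.
Qed.

(** As the mass of [f] near [x] is at most [1/4], Jensen's inequality replaces
    the exponential of the singular part of the potential by an integrable
    function. *)
Lemma density_le x (K t : R) : regular_at x -> 1 <= K -> 0 < t ->
  (forall y, D x y <= K * Num.max eta (D q y)) ->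
  (forall y, Num.max eta (D q y) <= K * Num.max t (D x y)) ->
  (forall m, Num.max eta (D q (p m)) <= K * D x (p m)) ->
  mass x f t <= 4^-1 -> itg (@area R) (fun y => lk t (D x y) * f y) ->
  f x <= expR (scale_exp + 6 * ln K) * (1 + 4 * \int[@area R]_y (lk t (D x y) * f y)).
Proof.
move=> [Dx if_ ig_] K1 t0 h1 h2 h3 m4 ilk; have K0 : 0 < K by exact: lt_le_trans ltr01 K1.
have mf := itg_measurable itf.
have [il hf] := pot_ge_lmx itf f0 f1 K1 t0 h2 if_.
have hg := pot_le_lmx itgg g0 g1 K1 h1 ig_.
have hm m : a m * ln (D x (p m)) <= a m * lmx q eta (p m) + ln K.
  have /andP[am1 am0] := a0 m; have lK := ln_ge0 K1.
  have : lmx q eta (p m) - ln K <= ln (D x (p m)).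
    by rewrite lerBlDr -lnM ?posrE// ler_ln ?posrE ?mulr_gt0// mulrC.
  by nra.
have hs : \sum_(m < 3) a m * ln (D x (p m)) <= \sum_(m < 3) a m * lmx q eta (p m) + 3 * ln K.
  apply: le_trans (ler_sum _ (fun m _ => hm m)) _.
  by rewrite big_split /= sumr_const card_ord mulr_natl.
have hE : vort a p C f g x <= scale_exp + 6 * ln K + 2 * \int[@area R]_y (lp t (D x y) * f y).
  by rewrite /vort /scale_exp; lra.
rewrite fE; apply: (@le_trans _ _ (expR (scale_exp + 6 * ln K) * expR (2 * \int[@area R]_y (lp t (D x y) * f y)))).
  by rewrite -expRD ler_expR.
rewrite ler_wpM2l ?expR_ge0//.
pose b y : R := (D x y < t)%R%:R.
have mb : measurable_fun setT b.
  have -> : b = fun y => 1 - (t <= D x y)%R%:R.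
    by apply/funext => y; rewrite /b ltNge; case: (t <= _)%R; rewrite ?subrr ?subr0.
  by apply: measurable_funB => //; apply: measurable_ind; meas.
have nb y : `|b y| <= 1 by exact: norm_ind.
have iw : itg (@area R) (fun y => 4 * (b y * f y)) by apply: itgZ; apply: (itgMb (C := 1)).
have w0 y : 0 <= 4 * (b y * f y) by rewrite !mulr_ge0.
have w1 : \int[@area R]_y (4 * (b y * f y)) <= 1.
  rewrite RintZ; last by apply: (itgMb (C := 1)).
  have : \int[@area R]_y (b y * f y) <= mass x f t.
    apply: le_Rint; [by apply: (itgMb (C := 1))|exact: itg_ind|move=> y].
    by rewrite ler_wpM2r// ler_nat DC; case: ltgtP.
  by lra.
have e1 : {ae @area R, forall y, 2 * (lp t (D x y) * f y) = lp t (D x y) / 2 * (4 * (b y * f y))}.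
  apply: ae_mono (ae_D0 x) => y d0; rewrite /b; have [dt|td] := ltP (D x y) t; first by rewrite mul1r; field.
  by rewrite lp_out// !mul0r mulr0.
have e2 : {ae @area R, forall y, 4 * (lk t (D x y) * f y) = expR (lp t (D x y) / 2) * (4 * (b y * f y))}.
  apply: ae_mono (ae_D0 x) => y d0; rewrite /b; have [dt|td] := ltP (D x y) t.
    by rewrite lkE// mul1r; ring.
  by rewrite /lk ltNge td /= !mul0r !mulr0.
have ml : measurable_fun setT (fun y => lp t (D x y)).
  by apply: measurable_maxr => //; meas.
have m1 : measurable_fun setT (fun y => lp t (D x y) / 2 * (4 * (b y * f y))) by meas.
have m2 : measurable_fun setT (fun y => expR (lp t (D x y) / 2) * (4 * (b y * f y))) by meas.
have i1 := itg_ae m1 e1 (itgZ 2 il).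
have i2 := itg_ae m2 e2 (itgZ 4 ilk).
have := jensen_exp iw w0 w1 i1 i2.
rewrite -(ae_eq_Rint (itg_measurable (itgZ 2 il)) m1 e1) -(ae_eq_Rint (itg_measurable (itgZ 4 ilk)) m2 e2).
have z0 := Rint_ge0 (@area R) w0; move: z0.
rewrite (RintZ 2 il) (RintZ 4 ilk) => z0 /le_trans; apply; by rewrite lerD2r gerBl.
Qed.

Lemma itg_lkF t F : 0 < t -> itg (@area R) F -> {ae @area R, forall x, itg (@area R) (fun y => lk t (D x y) * F y)}.
Proof.
move=> t0 iF; have := itg_ker_prod (measurable_lk t) (lk_ge0 t) (fun x => area_D_lk x t0) iF.
by move=> /ae_integrable1.
Qed.

(** Here only the singularity of the potential of [g] matters, and [exp (- z) >=
    1 - z]. *)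
Lemma density_ge x (t : R) : regular_at x -> 0 < t -> t <= eta -> eta <= D x q <= 2 * eta ->
  itg (@area R) (fun y => lk t (D x y) * g y) ->
  expR (scale_exp - (5 * ln 6 + ln (6 * (eta / t)))) * (1 - 2 * \int[@area R]_y (lk t (D x y) * g y)) <= f x.
Proof.
move=> [Dx if_ ig_] t0 te /andP[ex xe] ilk.
have K1 : 1 <= 6 * (eta / t).
  by have : 1 <= eta / t; [rewrite ler_pdivlMr// mul1r|lra].
have K0 : 0 < 6 * (eta / t) by exact: lt_le_trans ltr01 K1.
have c1 y : D x y <= 6 * Num.max eta (D q y).
  have := D_quasi x q y; have : eta <= Num.max eta (D q y) by rewrite le_max lexx.
  have : D q y <= Num.max eta (D q y) by rewrite le_max lexx orbT.
  by move: (Num.max _ _) => M *; lra.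
have c2 y : Num.max eta (D q y) <= 6 * (eta / t) * Num.max t (D x y).
  have et : eta = eta / t * t by rewrite divfK ?gt_eqF.
  have k1 : 1 <= eta / t by rewrite ler_pdivlMr// mul1r.
  set M := Num.max t (D x y); have M1 : t <= M by rewrite le_max lexx.
  have M2 : D x y <= M by rewrite le_max lexx orbT.
  have h1 : eta <= eta / t * M by rewrite {1}et ler_wpM2l// (le_trans _ k1).
  have M0 := lt_le_trans t0 M1.
  have h2 : M <= eta / t * M by rewrite ler_peMl// ltW.
  have := D_quasi q x y; rewrite (DC q x) ge_max => h3.
  by apply/andP; split; nra.
have [il hg] := pot_ge_lmx itgg g0 g1 K1 t0 c2 ig_.
have hf := pot_le_lmx itf f0 f1 (ler1n R 6) c1 if_.
have l6 : 0 <= ln (6 : R) by rewrite ln_ge0// ler1n.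
have hm m : a m * lmx q eta (p m) - ln 6 <= a m * ln (D x (p m)).
  have /andP[am1 am0] := a0 m.
  have := lnD_le_lmx (Dx m) (ltr0n R 6) (c1 (p m)).
  by nra.
have hs : \sum_(m < 3) a m * lmx q eta (p m) - 3 * ln 6 <= \sum_(m < 3) a m * ln (D x (p m)).
  rewrite lerBlDr; have : \sum_(m < 3) (a m * lmx q eta (p m) - ln 6) <= \sum_(m < 3) a m * ln (D x (p m)).
    by apply: ler_sum => m _; exact: hm.
  by rewrite big_split /= sumr_const card_ord mulNrn mulr_natl lerBlDr.
have hl : \int[@area R]_y (lp t (D x y) * g y) <= 2 * \int[@area R]_y (lk t (D x y) * g y).
  rewrite -RintZ//; apply: le_Rint_ae => //; first exact: itgZ.
  by apply: ae_mono (ae_D0 x) => y d0; rewrite mulrA ler_wpM2r// lp_le_lk.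
have hE : scale_exp - (5 * ln 6 + ln (6 * (eta / t))) + - (2 * \int[@area R]_y (lk t (D x y) * g y)) <= vort a p C f g x.
  by rewrite /vort /scale_exp; lra.
rewrite fE; apply: le_trans (_ : expR (scale_exp - (5 * ln 6 + ln (6 * (eta / t)))) * expR (- (2 * \int[@area R]_y (lk t (D x y) * g y))) <= _).
  rewrite ler_wpM2l ?expR_ge0//; exact: expR_ge1Dx.
by rewrite -expRD ler_expR.
Qed.

End scale.

(** * Masses of annuli *)

Section annuli.
Variable R : realType.
Implicit Types (x y q : sphere R).

Lemma Rint_inv (s t : R) : 0 < s -> s <= t ->
  itg (seg s t) (fun z => z^-1) /\ \int[seg s t]_z z^-1 = ln t - ln s.
Proof.
move=> s0 st; have mi : measurable_fun setT (fun z : R => z^-1) by meas.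
apply: (@FTC_loc R s t (fun z => z^-1) (@ln R) st mi).
- move=> x /andP[sx _]; have x0 := lt_le_trans s0 sx.
  exact: is_derive1_ln.
- move=> x /andP[sx _]; have x0 := lt_le_trans s0 sx.
  exact: drv_continuous (drvV (lt0r_neq0 x0) (drv_id x)).
Qed.

(** Circles are negligible. *)
Lemma mass_cts q (f : sphere R -> R) : itg (@area R) f -> (forall x, 0 <= f x) -> continuous (mass q f).
Proof.
move=> iF f0; have mf := itg_measurable iF; move=> t; apply/cvgrPdist_le => e e0.
have md : measurable_fun setT (fun x : sphere R => D x q) by meas.
pose u n : R := t + etan R n; pose v n : R := t - etan R n.
have en0 n := etan_gt0 R n.
have ut : u n @[n --> \oo] --> t by rewrite -[X in _ --> X]addr0; apply: cvgD; [exact: cvg_cst|exact: cvg_etan].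
have vt : v n @[n --> \oo] --> t by rewrite -[X in _ --> X]subr0; apply: cvgB; [exact: cvg_cst|exact: cvg_etan].
have lim w : w n @[n --> \oo] --> t -> mass q f (w n) @[n --> \oo] --> mass q f t.
  move=> wt; have [|||||_] := @Rint_dct _ _ _ (@area R) (fun n x => (D x q <= w n)%R%:R * f x)
    (fun x => (D x q <= t)%R%:R * f x) (fun x => `|f x|); last by [].
  - by move=> n; apply: measurable_funM => //; exact: measurable_ind.
  - by apply: measurable_funM => //; exact: measurable_ind.
  - apply: ae_mono (ae_D_neq q t) => x; rewrite (DC q) => /eqP xt.
    apply: cvgM; last exact: cvg_cst; apply: cvg_near_cst.
    have [lt|gt|ee] := ltgtP (D x q) t; last by rewrite ee eqxx in xt.
      by near=> n; rewrite ltW//; near: n; exact: (cvgr_gt t wt).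
    by near=> n; have h : w n < D x q by [near: n; exact: (cvgr_lt t wt)]; rewrite leNgt h.
  - exact: itg_norm.
  - by apply: ae_all => x n; rewrite normrM ler_piMl// norm_ind.
have [N] : exists n, mass q f (u n) <= mass q f t + e /\ mass q f t - e <= mass q f (v n).
  have h1 : \forall n \near \oo, mass q f (u n) <= mass q f t + e by apply: (cvgr_le _ (lim _ ut)); rewrite ltrDl.
  have h2 : \forall n \near \oo, mass q f t - e <= mass q f (v n) by apply: (cvgr_ge _ (lim _ vt)); rewrite ltrBlDr ltrDl.
  have [N _ h] : \forall n \near \oo, mass q f (u n) <= mass q f t + e /\ mass q f t - e <= mass q f (v n).
    by apply: filterS2 h1 h2.
  by exists N; apply: h => /=.
move=> [hu hv]; near=> s.
have : `|t - s| <= etan R N by near: s; apply: cvgr_dist_le => //; exact: en0.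
rewrite ler_distl => /andP[h1 h2].
have m1 : mass q f s <= mass q f (u N) by apply: mass_mono => //; rewrite /u; lra.
have m2 : mass q f (v N) <= mass q f s by apply: mass_mono => //; rewrite /v; lra.
by rewrite ler_distl; lra.
Unshelve. all: by end_near. Qed.

Definition ann q (eta : R) x : R := ((eta < D x q) && (D x q <= 2 * eta))%R%:R.

Lemma annE q eta x : 0 <= eta -> ann q eta x = (D x q <= 2 * eta)%R%:R - (D x q <= eta)%R%:R.
Proof.
move=> e0; rewrite /ann ltNge; have [h|h] := leP (D x q) eta; last by rewrite subr0.
by rewrite (le_trans h) ?subrr// ler_peMl// ler1n.
Qed.

Lemma measurable_ann q eta : 0 <= eta -> measurable_fun setT (ann q eta).
Proof.
move=> e0; have -> : ann q eta = fun x => (D x q <= 2 * eta)%R%:R - (D x q <= eta)%R%:R.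
  by apply/funext => x; exact: annE.
by apply: measurable_funB; apply: measurable_ind => //; meas.
Qed.

Lemma Rint_ann q eta (f : sphere R -> R) : 0 <= eta -> itg (@area R) f ->
  itg (@area R) (fun x => ann q eta x * f x) /\
  \int[@area R]_x (ann q eta x * f x) = mass q f (2 * eta) - mass q f eta.
Proof.
move=> e0 iF; split.
  by apply: (itgMb (C := 1)) => //; [exact: measurable_ann|move=> x; exact: norm_ind].
rewrite -RintB; [|exact: itg_ind|exact: itg_ind].
by apply: eq_Rint => x; rewrite annE// mulrBl.
Qed.

Lemma area_ball_le q (t : R) : 0 < t -> \int[@area R]_x ((D x q <= t)%R%:R : R) <= 64 * pi * t.
Proof.
move=> t0; have t2 : 0 < 2 * t by rewrite mulr_gt0.
have [ik hk] := area_D_lk q t2; rewrite (_ : 64 * pi * t = 32 * pi * (2 * t)); last by ring.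
apply: le_trans hk; apply: le_Rint_ae => //.
  have mi : measurable_fun setT (fun x : sphere R => (D x q <= t)%R%:R : R) by apply: measurable_ind; meas.
  by apply: (@itg_bounded _ _ _ _ _ 1) => // x; exact: norm_ind.
apply: ae_mono (ae_D_neq q 0) => x /eqP d0; have d : 0 < D q x by rewrite lt_neqAle eq_sym d0 D_ge0.
rewrite (DC x q); have [h|h] := leP (D q x) t; last by rewrite lk_ge0.
rewrite lkE//; last by rewrite (le_lt_trans h)// ltr_pMl// ltr1n.
by rewrite -expR0 ler_expR divr_ge0 ?lp_ge0.
Qed.

Lemma area_ann_ge q (eta : R) : 0 < eta -> eta <= 1 -> pi * eta <= \int[@area R]_x ann q eta x.
Proof.
move=> e0 e1.
pose om u : R := Num.max 0 (Num.min 1 (4 * (u - eta) / eta)) * Num.max 0 (Num.min 1 (4 * (2 * eta - u) / eta)).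
have r01 (z : R) : 0 <= Num.max 0 (Num.min 1 z) <= 1.
  by rewrite le_max lexx /= ge_max ler01 ge_min lexx.
have com : continuous om.
  have -> : om = fun u => Num.max 0 (Num.min 1 (4 * eta^-1 * (u - eta))) * Num.max 0 (Num.min 1 (4 * eta^-1 * (2 * eta - u))).
    by apply/funext => u; rewrite /om; congr (Num.max 0 (Num.min 1 _) * Num.max 0 (Num.min 1 _)); ring.
  by cts.
have om01 u : 0 <= om u <= 1.
  have /andP[a b] := r01 (4 * (u - eta) / eta); have /andP[c d] := r01 (4 * (2 * eta - u) / eta).
  by rewrite /om mulr_ge0//= mulr_ile1.
have oml u : u <= eta -> om u = 0.
  move=> h; rewrite /om (_ : Num.max 0 (Num.min 1 (4 * (u - eta) / eta)) = 0) ?mul0r// max_l// ge_min.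
  by rewrite pmulr_lle0 ?invr_gt0// pmulr_rle0// subr_le0 h orbT.
have omr u : 2 * eta <= u -> om u = 0.
  move=> h; rewrite /om (_ : Num.max 0 (Num.min 1 (4 * (2 * eta - u) / eta)) = 0) ?mulr0// max_l// ge_min.
  by rewrite pmulr_lle0 ?invr_gt0// pmulr_rle0// subr_le0 h orbT.
have om1 u : 5 / 4 * eta <= u <= 7 / 4 * eta -> om u = 1.
  move=> /andP[h1 h2]; rewrite /om !min_l ?max_r ?mulr1//.
    by rewrite ler_pdivlMr// mul1r; lra.
  by rewrite ler_pdivlMr// mul1r; lra.
have oml1 s : s <= -1 -> om s = 0 by move=> h; apply: oml; lra.
have [A dA] := antiderivative com oml1 omr.
have I1 : \int[@area R]_x om (D q x) = 2 * pi * \int[seg 0 2]_z om z.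
  by rewrite (Rint_D q com (fun u _ => dA u)) (FTC_seg (ler0n R 2) dA com).
apply: (@le_trans _ _ (\int[@area R]_x om (D q x))).
  have -> : pi * eta = 2 * pi * (eta / 2) by field.
  rewrite I1; apply: ler_wpM2l; first by rewrite mulr_ge0 ?pi_ge0.
  have -> : eta / 2 = \int[seg 0 2]_z (((5 / 4 * eta <= z) && (z <= 7 / 4 * eta))%R%:R * 1).
    by rewrite Rint_subseg_cst; [field|lra|lra|lra].
  apply: le_Rint; [exact: itg_subseg_cst|exact: itg_seg_cont|move=> z].
  have /andP[z0 _] := om01 z; rewrite mulr1; case E : (_ && _) => //.
  by rewrite om1.
apply: le_Rint.
- apply: (@itg_bounded _ _ _ _ _ 1); last by move=> x; have /andP[? ?] := om01 (D q x); rewrite ger0_norm.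
  by apply: (measurableT_comp (continuous_measurable_fun com)); meas.
- apply: (@itg_bounded _ _ _ _ _ 1); first exact: measurable_ann (ltW e0).
  by move=> x; exact: norm_ind.
- move=> x; rewrite /ann (DC x q); have [h|h] := leP (D q x) eta; first by rewrite oml.
  have [h2|h2] := leP (D q x) (2 * eta); last by rewrite omr// ltW.
  by have /andP[] := om01 (D q x).
Qed.

Variables (p : 'I_3 -> sphere R) (a : 'I_3 -> R) (C : R) (f g : sphere R -> R).
Hypotheses (a0 : forall m, -1 < a m <= 0) (itf : itg (@area R) f) (itgg : itg (@area R) g).
Hypotheses (g0 : forall x, 0 <= g x) (f1 : \int[@area R]_x f x <= 1) (g1 : \int[@area R]_x g x <= 1).
Hypothesis fE : forall x, f x = expR (vort a p C f g x).

Let f0 x : 0 <= f x. Proof. by rewrite fE expR_ge0. Qed.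

Let prod_lk t F : 0 < t -> itg (@area R) F ->
  itg (@area R \x @area R)%E (fun z => lk t (D z.1 z.2) * F z.2).
Proof. by move=> t0 iF; exact: itg_ker_prod (measurable_lk t) (lk_ge0 t) (fun x => area_D_lk x t0) iF. Qed.

Let Rint_lkF t F : 0 < t -> itg (@area R) F -> (forall y, 0 <= F y) -> \int[@area R]_y F y <= 1 ->
  itg (@area R) (fun x => \int[@area R]_y (lk t (D x y) * F y)) /\
  \int[@area R]_x \int[@area R]_y (lk t (D x y) * F y) <= 32 * pi * t.
Proof.
move=> t0 iF F0 F1; have ip := prod_lk t0 iF; have [i1 e1] := Rint_prod12 ip.
have [i2 e2] := Rint_prod21 ip; split; first exact: i1.
rewrite /= in e1 e2 i2; rewrite -e1 e2.
apply: (@le_trans _ _ (\int[@area R]_y (32 * pi * t * F y))).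
  apply: le_Rint => //; first exact: itgZ.
  move=> y; have [ik hk] := area_D_lk y t0; under eq_Rint do rewrite mulrC DC.
  by rewrite RintZ// mulrC ler_wpM2r.
by rewrite RintZ// ler_piMr// !mulr_ge0 ?pi_ge0// ltW.
Qed.

(** The inner radius [t = eta / 128] of [annulus_mass_ge] is small enough for
    the singular part to have less than half of the area of the annulus. *)
Definition ann_cst : R := expR (- (5 * ln 6 + ln (6 * 128))).

Lemma ann_cst_gt0 : 0 < ann_cst. Proof. exact: expR_gt0. Qed.

(** Integration of [density_ge] over the annulus between the radii [eta] and [2
    * eta]. *)
Lemma annulus_mass_ge q eta : 0 < eta -> eta <= 1 ->
  ann_cst * (eta * expR (scale_exp q eta p a C f g)) <= mass q f (2 * eta) - mass q f eta.
Proof.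
move=> e0 e1; have [_ <-] := Rint_ann q (ltW e0) itf; have [ia _] := Rint_ann q (ltW e0) itf.
pose t := eta / 128; have t0 : 0 < t by rewrite divr_gt0.
have te : t <= eta by rewrite ler_pdivrMr// ler_peMr ?ler1n// ltW.
have et : eta / t = 128 by rewrite /t; field; exact: lt0r_neq0.
have [ik hk] := Rint_lkF t0 itgg g0 g1.
set W := scale_exp _ _ _ _ _ _ _.
have ie1 : itg (@area R) (ann q eta).
  apply: (@itg_bounded _ _ _ _ _ 1); first exact: measurable_ann (ltW e0).
  by move=> x; exact: norm_ind.
have ie : itg (@area R) (fun x => expR (W - (5 * ln 6 + ln (6 * 128))) *
   (ann q eta x - 2 * \int[@area R]_y (lk t (D x y) * g y))).
  by apply: itgZ; apply: itgB => //; exact: itgZ.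
apply: le_trans (_ : \int[@area R]_x (expR (W - (5 * ln 6 + ln (6 * 128))) *
   (ann q eta x - 2 * \int[@area R]_y (lk t (D x y) * g y))) <= _); last first.
  apply: le_Rint_ae => //.
  have h := ae_mono2 (fun x => @conj _ _) (ae_regular p itf itgg) (itg_lkF t0 itgg).
  apply: ae_mono h => x [gx ix]; rewrite {1}/ann /ann; case E : (_ && _); last first.
    rewrite mul0r mulr_ge0_le0 ?expR_ge0// sub0r oppr_le0 mulr_ge0//.
    by apply: Rint_ge0 => y; rewrite mulr_ge0 ?lk_ge0.
  have [h1 h2] := andP E; rewrite mul1r.
  have := density_ge e0 a0 itf itgg g0 f1 g1 fE gx t0 te _ ix; rewrite et.
  by apply; rewrite (ltW h1) h2.
rewrite RintZ; last by apply: itgB => //; exact: itgZ.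
rewrite RintB// ?RintZ//; last exact: itgZ.
rewrite expRD -/ann_cst [X in _ <= X * _]mulrC -mulrA.
rewrite ler_wpM2l ?(ltW ann_cst_gt0)// [leLHS]mulrC ler_wpM2l ?expR_ge0//.
have := area_ann_ge q e0 e1; have := pi_ge2 R; move: hk; rewrite /t.
move: (\int[_]_x \int[_]_y _) (\int[_]_x ann _ _ _) => I J; generalize (@pi R) => k hI k2 hJ.
by have : 2 * eta <= k * eta by [rewrite ler_wpM2r// ltW]; lra.
Qed.

(** Integration of [density_le]: wherever the geometry is that of the scale
    [eta] and the density is spread at the scale [t], its mass is at most what
    the scale function predicts. *)
Lemma region_mass_le q eta (K t : R) (b : sphere R -> bool) : 0 < eta -> 1 <= K -> 0 < t ->
  measurable_fun setT (fun x => (b x)%:R : R) ->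
  (forall x, b x -> [/\ forall y, D x y <= K * Num.max eta (D q y),
     forall y, Num.max eta (D q y) <= K * Num.max t (D x y),
     forall m, Num.max eta (D q (p m)) <= K * D x (p m) & mass x f t <= 4^-1]) ->
  \int[@area R]_x ((b x)%:R * f x) <=
    expR (scale_exp q eta p a C f g + 6 * ln K) * (\int[@area R]_x (b x)%:R + 128 * pi * t).
Proof.
move=> e0 K1 t0 mb hb; have [ik hk] := Rint_lkF t0 itf f0 f1.
set W := scale_exp _ _ _ _ _ _ _.
have ib : itg (@area R) (fun x => (b x)%:R * f x).
  by apply: (itgMb (C := 1)) => // x; exact: norm_ind.
have ib1 : itg (@area R) (fun x => (b x)%:R : R).
  by apply: (@itg_bounded _ _ _ _ _ 1) => // x; exact: norm_ind.
apply: le_trans (_ : \int[@area R]_x (expR (W + 6 * ln K) *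
   ((b x)%:R + 4 * \int[@area R]_y (lk t (D x y) * f y))) <= _).
  apply: le_Rint_ae => //; first by apply: itgZ; apply: itgD => //; exact: itgZ.
  have h := ae_mono2 (fun x => @conj _ _) (ae_regular p itf itgg) (itg_lkF t0 itf).
  apply: ae_mono h => x [gx ix]; have [bx|_] := boolP (b x); last first.
    rewrite mul0r mulr_ge0 ?expR_ge0// add0r mulr_ge0//.
    by apply: Rint_ge0 => y; rewrite mulr_ge0 ?lk_ge0.
  have [c1 c2 c3 c4] := hb x bx; rewrite mul1r.
  exact: (density_le e0 a0 itf itgg g0 f1 g1 fE gx K1 t0 c1 c2 c3 c4 ix).
rewrite RintZ; last by apply: itgD => //; exact: itgZ.
rewrite ler_wpM2l ?expR_ge0// RintD ?RintZ//; last exact: itgZ.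
by rewrite lerD2l; lra.
Qed.

End annuli.

(** * Pairs of densities near a point *)

Section toda_pairs.
Variables (R : realType) (p : 'I_3 -> sphere R).
Implicit Types (x y q : sphere R) (f g : sphere R -> R).

(** The masses are kept at distance [gam] from [1]: the constants below depend
    on the densities through [gam] only. *)
Record toda_pair (a1 a2 : 'I_3 -> R) (C1 C2 : R) f1 f2 (gam : R) : Prop := TodaPair {
  tp_a1 : forall m, -1 < a1 m <= 0 ;
  tp_a2 : forall m, -1 < a2 m <= 0 ;
  tp_pp : forall m m', m != m' -> p m <> p m' ;
  tp_i1 : itg (@area R) f1 ;
  tp_i2 : itg (@area R) f2 ;
  tp_gam : 0 < gam ;
  tp_l1 : \int[@area R]_x f1 x <= 1 - gam ;
  tp_l2 : \int[@area R]_x f2 x <= 1 - gam ;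
  tp_E1 : forall x, f1 x = expR (vort a1 p C1 f1 f2 x) ;
  tp_E2 : forall x, f2 x = expR (vort a2 p C2 f2 f1 x) }.

Lemma toda_pairC a1 a2 C1 C2 f1 f2 gam : toda_pair a1 a2 C1 C2 f1 f2 gam -> toda_pair a2 a1 C2 C1 f2 f1 gam.
Proof. by case=> *; split. Qed.

Section one_pair.
Variables (a1 a2 : 'I_3 -> R) (C1 C2 : R) (f1 f2 : sphere R -> R) (gam : R).
Hypothesis tp : toda_pair a1 a2 C1 C2 f1 f2 gam.

Let i1 := tp_i1 tp.
Let i2 := tp_i2 tp.

Lemma tp_f1 x : 0 <= f1 x. Proof. by rewrite (tp_E1 tp) expR_ge0. Qed.
Lemma tp_f2 x : 0 <= f2 x. Proof. by rewrite (tp_E2 tp) expR_ge0. Qed.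

Lemma tp_m1 : \int[@area R]_x f1 x <= 1. Proof. by have := tp_l1 tp; have := tp_gam tp; lra. Qed.
Lemma tp_m2 : \int[@area R]_x f2 x <= 1. Proof. by have := tp_l2 tp; have := tp_gam tp; lra. Qed.

Lemma mass1_bound q s : 0 <= mass q f1 s <= 1 - gam.
Proof. by rewrite mass_ge0 ?(le_trans (mass_le q s i1 tp_f1) (tp_l1 tp))//; exact: tp_f1. Qed.

Lemma mass2_bound q s : 0 <= mass q f2 s <= 1 - gam.
Proof. by rewrite mass_ge0 ?(le_trans (mass_le q s i2 tp_f2) (tp_l2 tp))//; exact: tp_f2. Qed.

Local Notation Pq q := (pohozaev_at q p a1 a2 f1 f2).

(** [g] may depend on the masses, which are continuous functions of the scale.
    *)
Lemma pohozaev_pair q t1 t0 (g : R -> R) : 0 < t1 -> t1 <= t0 -> t0 <= 4^-1 -> continuous g ->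
  (forall s, 0 <= g s <= 1) -> (forall m, p m <> q -> 8 * t0 <= D q (p m)) ->
  `|\int[seg t1 t0]_s (g s / s * Pq q s)| <= 40.
Proof.
move=> h1 h2 h3 h4 h5 h6.
exact: (@local_pohozaev R q p t1 t0 g h1 h2 h3 h4 h5 h6 a1 a2 C1 C2 f1 f2 (tp_a1 tp) (tp_a2 tp)
  (tp_pp tp) i1 i2 tp_m1 tp_m2 (tp_E1 tp) (tp_E2 tp)).
Qed.

Lemma itg_seg_inv (t1 t0 M : R) (h : R -> R) : 0 < t1 -> measurable_fun setT h ->
  (forall s, `|h s| <= M) -> itg (seg t1 t0) (fun s => h s / s).
Proof.
move=> t10 mh hM; have M0 : 0 <= M := le_trans (normr_ge0 _) (hM 0).
apply: (@itg_le_ae _ _ _ _ (fun=> M / t1)); [by meas| |exact: itg_cst].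
apply: ae_mono (ae_seg t1 t0) => s /andP[h1 _]; have s0 := lt_le_trans t10 h1.
by rewrite normrM ler_pM// normfV (gtr0_norm s0) lef_pV2 ?posrE.
Qed.

Lemma itg_pohozaev q (t1 t0 : R) (g : R -> R) : 0 < t1 -> measurable_fun setT g -> (forall s, 0 <= g s <= 1) ->
  itg (seg t1 t0) (fun s => g s / s * Pq q s).
Proof.
move=> t10 mg g01; under eq_fun do rewrite mulrAC.
apply: (@itg_seg_inv _ _ 3) => //.
  apply: measurable_funM => //; exact: measurable_pohozaev_at.
move=> s; have /andP[h0 h1] := g01 s; rewrite -[leRHS]mul1r; apply: nbM; first by rewrite ger0_norm.
exact: (@pohozaev_at_bound R q p a1 a2 C1 C2 f1 f2 (tp_a1 tp) (tp_a2 tp) (tp_pp tp) i1 i2 tp_m1 tp_m2 (tp_E1 tp) (tp_E2 tp)).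
Qed.

Lemma Rint_div_inv (c t1 t0 : R) : 0 < t1 -> t1 <= t0 -> itg (seg t1 t0) (fun s => c / s) /\
  \int[seg t1 t0]_s (c / s) = c * (ln t0 - ln t1).
Proof. by move=> h1 h2; have [iv <-] := Rint_inv h1 h2; split; [exact: itgZ|exact: RintZ]. Qed.

Lemma pohozaev_le q t1 t0 (c : R) : 0 < t1 -> t1 <= t0 -> t0 <= 4^-1 ->
  (forall m, p m <> q -> 8 * t0 <= D q (p m)) ->
  (forall s, t1 <= s <= t0 -> c <= Pq q s) -> c * (ln t0 - ln t1) <= 40.
Proof.
move=> h1 h2 h3 h6 hc.
have := @pohozaev_pair q t1 t0 (fun=> 1) h1 h2 h3 (@cts_cst R 1) (fun _ => _) h6.
have -> : (0 <= 1 :> R) && (1 <= 1 :> R) by rewrite ler01 lexx.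
move=> /(_ (fun=> isT)); rewrite ler_norml => /andP[_]; apply: le_trans.
have [iv <-] := Rint_div_inv c h1 h2.
have ip := @itg_pohozaev q t1 t0 (fun=> 1) h1 (@measurable_cst _ _ _ _ _ _).
apply: le_Rint_ae => //; first by apply: ip => s; rewrite ler01 lexx.
apply: ae_mono (ae_seg t1 t0) => s hs; have /andP[s1 _] := hs; have s0 := lt_le_trans h1 s1.
by rewrite mulrC mul1r ler_wpM2l ?invr_ge0 ?(ltW s0)// hc.
Qed.

(** The ratio of scales that makes [pohozaev_le] contradictory for a mass above
    [1/4]. *)
Definition spread : R := expR (- (160 / gam)).

Lemma spread_gt0 : 0 < spread. Proof. exact: expR_gt0. Qed.

Lemma spread_le1 : spread <= 1.
Proof. by rewrite -expR0 ler_expR lerNl oppr0 divr_ge0// ltW// (tp_gam tp). Qed.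

Lemma alq_far q a : (forall m, p m <> q) -> alq q p a = 0.
Proof. by move=> h; rewrite /alq big1// => m _; case: eqP => [/h|_]; rewrite ?mul0r. Qed.

(** Away from the vortices the form is at least [gam] times the mass of [f1], as
    [n - n^2 >= gam * n] and [m - m^2 >= 0]. *)
Lemma local_mass_small x (t0 : R) : 0 < t0 -> t0 <= 4^-1 -> (forall m, 8 * t0 <= D x (p m)) ->
  mass x f1 (t0 * spread) <= 4^-1.
Proof.
move=> t00 t04 far; have s0 := spread_gt0; have s1 := spread_le1; have g0 := tp_gam tp.
have t10 : 0 < t0 * spread by rewrite mulr_gt0.
have t1t : t0 * spread <= t0 by rewrite ler_piMr// ltW.
have px m : p m <> x by move=> e; have := far m; rewrite e Dxx; lra.
have h : forall s, t0 * spread <= s <= t0 -> gam * mass x f1 (t0 * spread) <= Pq x s.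
  move=> s /andP[hs _]; have /andP[n0 n1] := mass1_bound x s; have /andP[m0 m1] := mass2_bound x s.
  have mm := mass_mono x i1 tp_f1 hs.
  rewrite /pohozaev_at /pohozaev_form !alq_far// addr0 !mul1r.
  move: (mass x f1 s) (mass x f2 s) n0 n1 m0 m1 mm => n m n0 n1 m0 m1 mm.
  have k1 : gam * mass x f1 (t0 * spread) <= gam * n by rewrite ler_wpM2l// ltW.
  have k2 : gam * n <= n * (1 - n) by rewrite mulrC ler_wpM2l//; lra.
  have k3 : 0 <= m * (1 - m) by rewrite mulr_ge0//; lra.
  have k4 : 0 <= n * m by rewrite mulr_ge0.
  lra.
have := pohozaev_le t10 t1t t04 (fun m _ => far m) h.
rewrite lnM ?posrE// expRK opprD opprK addrA subrr add0r mulrC mulrA divfK ?gt_eqF//; lra.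
Qed.


Definition annK : R := 34 / spread.

Definition ann_sup : R := expR (6 * ln annK) * (144 * pi).

Lemma ann_sup_gt0 : 0 < ann_sup. Proof. by rewrite mulr_gt0 ?expR_gt0// mulr_gt0 ?pi_gt0. Qed.

(** The points of an annulus are far from the vortices relative to their
    distance to [q], so that [local_mass_small] applies at each of them. *)
Lemma annulus_mass_le q eta : 0 < eta -> eta <= 4^-1 -> (forall m, p m <> q -> 8 * eta <= D q (p m)) ->
  mass q f1 (2 * eta) - mass q f1 eta <= ann_sup * (eta * expR (scale_exp q eta p a1 C1 f1 f2)).
Proof.
move=> e0 e4 far; have s0 := spread_gt0; have s1 := spread_le1.
have [_ <-] := Rint_ann q (ltW e0) i1.
pose t := eta / 8 * spread; have t0 : 0 < t by rewrite mulr_gt0// divr_gt0.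
have K34 : 34 <= annK by rewrite ler_pdivlMr// ler_piMr.
have K1 : 1 <= annK by apply: le_trans K34; rewrite ler1n.
have eK : eta * 4 <= (annK - 2) * t.
  have : 32 / spread <= annK - 2.
    rewrite lerBrDr /annK; have : 2 <= 2 / spread by rewrite ler_pdivlMr// ler_piMr.
    by rewrite (_ : 34 / spread = 32 / spread + 2 / spread); [lra|field; exact: lt0r_neq0].
  move=> /(ler_wpM2r (ltW t0)); apply: le_trans.
  rewrite /t (_ : 32 / spread * _ = eta * 4)//; field; exact: lt0r_neq0.
have := @region_mass_le R p a1 C1 f1 f2 (tp_a1 tp) i1 i2 tp_f2 tp_m1 tp_m2 (tp_E1 tp) q eta annK t
  (fun x => (eta < D x q) && (D x q <= 2 * eta)) e0 K1 t0 (measurable_ann q (ltW e0)).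
set W := scale_exp _ _ _ _ _ _ _; move=> /(_ _)/le_trans; apply.
  move=> x /andP[/ltW xe ex].
  have Dpm m : eta <= D x (p m).
    have [->//|/eqP pq] := eqVneq (p m) q.
    by have := far m pq; have := D_quasi q x (p m); rewrite (DC q x); lra.
  split.
  - move=> y; have := D_quasi x q y; have h2 : eta <= Num.max eta (D q y) by rewrite le_max lexx.
    have h1 : D q y <= Num.max eta (D q y) by rewrite le_max lexx orbT.
    move: (Num.max _ _) h1 h2 => M h1 h2 h3; apply: (@le_trans _ _ (6 * M)); [lra|rewrite ler_wpM2r//; lra].
  - move=> y; have := D_quasi q x y; rewrite (DC q x).
    have h2 : t <= Num.max t (D x y) by rewrite le_max lexx.
    have h1 : D x y <= Num.max t (D x y) by rewrite le_max lexx orbT.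
    move: (Num.max t _) h1 h2 => M h1 h2 h3.
    have k : (annK - 2) * t <= (annK - 2) * M by rewrite ler_wpM2l//; lra.
    have M0 : 0 < M by exact: lt_le_trans t0 h2.
    by rewrite ge_max; apply/andP; split; lra.
  - move=> m; have h := Dpm m; have := D_quasi q x (p m); rewrite (DC q x) => h3.
    have d0 : 0 < D x (p m) by exact: lt_le_trans e0 h.
    rewrite ge_max; apply/andP; split; apply: (@le_trans _ _ (6 * D x (p m))); rewrite ?ler_wpM2r ?(ltW d0)//; lra.
  - have e8 : eta / 8 <= 4^-1 by apply: le_trans e4; rewrite ler_pdivrMr// ler_peMr ?ler1n// ltW.
    apply: local_mass_small => //; first by rewrite divr_gt0.
    by move=> m; rewrite mulrC divfK.
rewrite expRD /ann_sup -mulrA [leRHS](_ : _ = expR W * (expR (6 * ln annK) * (144 * pi * eta))); last by ring.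
rewrite ler_wpM2l ?expR_ge0// ler_wpM2l ?expR_ge0//.
have ha : \int[@area R]_x ((eta < D x q) && (D x q <= 2 * eta))%R%:R <= 64 * pi * (2 * eta).
  have e2 : 0 < 2 * eta by rewrite mulr_gt0.
  apply: le_trans (area_ball_le q e2); apply: le_Rint.
  - apply: (@itg_bounded _ _ _ _ _ 1); [exact: measurable_ann (ltW e0)|by move=> x; exact: norm_ind].
  - apply: (@itg_bounded _ _ _ _ _ 1); last by move=> x; exact: norm_ind.
    by apply: measurable_ind; meas.
  - by move=> x; rewrite ler_nat; case: (_ < _)%R.
have ht : 128 * pi * t <= 16 * pi * eta.
  rewrite (_ : 16 * pi * eta = 128 * pi * (eta / 8)); last by field.
  by rewrite ler_wpM2l ?mulr_ge0 ?pi_ge0// /t ler_piMr// divr_ge0// ltW.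
by apply: le_trans (lerD ha ht) _; rewrite le_eqVlt; apply/orP; left; apply/eqP; ring.
Qed.

Definition log_mass q f (eta t0 : R) : R := \int[seg eta t0]_z (mass q f z / z).

(** Layer-cake formula for the difference of the two truncated logarithms. *)
Lemma lmx_shift q f (eta t0 : R) : itg (@area R) f -> (forall x, 0 <= f x) -> 0 < eta -> eta <= t0 -> t0 <= 2 ->
  \int[@area R]_y (lmx q t0 y * f y) - \int[@area R]_y (lmx q eta y * f y) = log_mass q f eta t0.
Proof.
move=> iF F0 e0 et t2; have t0' := lt_le_trans e0 et.
rewrite -RintB; [|exact: itg_lmx|exact: itg_lmx].
pose be z : R := ((eta <= z) && (z <= t0))%R%:R * (Num.max z eta)^-1.
have mx z : 0 < Num.max z eta by rewrite lt_max e0 orbT.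
have mmax : measurable_fun setT (fun z : R => (Num.max z eta)^-1).
  have m1 : measurable_fun setT (fun z : R => Num.max z eta) by exact: measurable_maxr.
  by meas.
have bmax z : `|(Num.max z eta)^-1| <= eta^-1.
  by rewrite ger0_norm ?invr_ge0 ?(ltW (mx z))// lef_pV2 ?posrE// le_max lexx orbT.
have mbe : measurable_fun setT be by apply: measurable_funM => //; exact: measurable_ind2.
have bbe z : `|be z| <= eta^-1.
  by rewrite -[leRHS]mul1r; apply: nbM => //; exact: norm_ind.
have mm := measurable_mass q iF.
have bm z : `|mass q f z| <= \int[@area R]_x f x by rewrite ger0_norm ?mass_ge0// mass_le.
transitivity (\int[seg 0 2]_z (be z * mass q f z)).
  rewrite -(layer_cake q iF mbe bbe); apply: eq_Rint => x; rewrite -mulrBl mulrC; congr (_ * _).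
  transitivity (\int[seg eta t0]_z ((D x q <= z)%R%:R * (Num.max z eta)^-1)).
    have mi : measurable_fun setT (fun z => (D x q <= z)%R%:R * (Num.max z eta)^-1).
      by apply: measurable_funM => //; exact: measurable_ind.
    have [xt|tx] := leP (D x q) t0; last first.
      rewrite (eq_Rint_seg (g := fun=> 0)) ?Rint_eq0//.
        by rewrite /lmx (DC q x) !max_r ?subrr ?(ltW tx)// (le_trans et)// ltW.
      by move=> z /andP[_ zt]; rewrite leNgt (le_lt_trans zt tx) /= mul0r.
    have st : Num.max eta (D x q) <= t0 by rewrite ge_max et.
    have s0 : 0 < Num.max eta (D x q) by rewrite lt_max e0.
    have es : eta <= Num.max eta (D x q) by rewrite le_max lexx.
    rewrite /lmx (DC q x) max_l//; have [_ <-] := Rint_inv s0 st.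
    transitivity (\int[seg (Num.max eta (D x q)) t0]_z (Num.max z eta)^-1).
      apply: eq_Rint_seg => //; first exact: measurable_invr.
      by move=> z /andP[sz _]; rewrite max_l// (le_trans es).
    rewrite (Rint_subseg es (lexx t0) mmax bmax); apply: eq_Rint_seg => //.
      by apply: measurable_funM => //; exact: measurable_ind2.
    by move=> z /andP[ez zt]; rewrite zt andbT ge_max ez.
  rewrite (Rint_subseg (a := 0) (b := 2) (M := eta^-1)) ?(ltW e0)//.
  - by apply: eq_Rint => z; rewrite /be; ring.
  - by apply: measurable_funM => //; exact: measurable_ind.
  - by move=> z; rewrite -[leRHS]mul1r; apply: nbM => //; exact: norm_ind.
rewrite /log_mass.
transitivity (\int[seg 0 2]_z (((eta <= z) && (z <= t0))%R%:R * (mass q f z * (Num.max z eta)^-1))).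
  by apply: eq_Rint => z; rewrite /be; ring.
rewrite -(Rint_subseg (a := 0) (b := 2) (M := \int[@area R]_x f x * eta^-1)) ?(ltW e0)//.
- apply: eq_Rint_seg; [exact: measurable_funM|by meas|].
  by move=> z /andP[ez _]; rewrite max_l.
- exact: measurable_funM.
- by move=> z; apply: nbM.
Qed.

Lemma scale_exp_shift q eta t0 : 0 < eta -> eta <= t0 -> t0 <= 2 -> (forall m, p m <> q -> t0 <= D q (p m)) ->
  scale_exp q eta p a1 C1 f1 f2 = scale_exp q t0 p a1 C1 f1 f2 - alq q p a1 * (ln t0 - ln eta)
    + 2 * log_mass q f1 eta t0 - log_mass q f2 eta t0.
Proof.
move=> e0 et t2 far; rewrite /scale_exp -(lmx_shift q i1 tp_f1 e0 et t2) -(lmx_shift q i2 tp_f2 e0 et t2).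
have -> : \sum_(m < 3) a1 m * lmx q eta (p m) =
    \sum_(m < 3) a1 m * lmx q t0 (p m) - alq q p a1 * (ln t0 - ln eta).
  rewrite /alq mulr_suml -sumrB; apply: eq_bigr => m _.
  have [->|/eqP pq] := eqVneq (p m) q; rewrite /lmx /= ?mul1r ?mul0r.
    rewrite Dxx !max_l ?(ltW e0)//; last by rewrite (le_trans (ltW e0)).
    by ring.
  by rewrite !max_r ?subr0 ?far//; rewrite (le_trans et)// far.
ring.
Qed.

End one_pair.
End toda_pairs.

(** * The first density does not concentrate at the third vortex *)

Section third_vortex.
Variable R : realType.

(** Summation over dyadic annuli, the masses of the small balls tending to zero.
    *)
Lemma dyadic_le (m w : R -> R) (t0 : R) : continuous m -> m 0 = 0 -> (forall t, 0 < t -> 0 <= w t) ->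
  (forall t, 0 < t -> t <= t0 -> m (2 * t) - m t <= w (2 * t) - w t) ->
  forall t, 0 < t -> t <= t0 -> m t <= w t.
Proof.
move=> cm m0 w0 h t tp tt.
have pos n : 0 < t / 2 ^+ n by rewrite divr_gt0// exprn_gt0.
have step n : m t - w t <= m (t / 2 ^+ n) - w (t / 2 ^+ n).
  elim: n => [|n IH]; first by rewrite expr0 divr1.
  have e : t / 2 ^+ n = 2 * (t / 2 ^+ n.+1) by rewrite exprS; field; rewrite expf_neq0.
  have le : t / 2 ^+ n.+1 <= t0.
    by apply: le_trans tt; rewrite ler_pdivrMr ?exprn_gt0// ler_peMr ?exprn_ege1 ?ler1n// ltW.
  by have := h _ (pos n.+1) le; rewrite -e; lra.
have lim : m (t / 2 ^+ n) @[n --> \oo] --> (0 : R).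
  rewrite -m0; apply: continuous_cvg; first exact: cm.
  have -> : (fun n : nat => t / 2 ^+ n) = geometric t 2^-1.
    by apply/funext => n; rewrite /geometric /= exprVn.
  by apply: cvg_geometric; rewrite ger0_norm// invf_lt1 ?ltr1n.
have : m t - w t <= 0.
  rewrite -(cvg_lim _ lim)//; apply: limr_ge; first by apply/cvg_ex; exists 0.
  by near=> n; apply: (le_trans (step n)); rewrite gerBl w0.
lra.
Unshelve. all: by end_near. Qed.

Lemma double_sub_le (a b c : R) : a <= c -> 0 <= b -> 2 * a - b <= 2 * c.
Proof. lra. Qed.

Lemma mass0 (q : sphere R) (f : sphere R -> R) : itg (@area R) f -> mass q f 0 = 0.
Proof.
move=> iF; have mf := itg_measurable iF; rewrite /mass (ae_eq_Rint (g := fun=> 0)) ?Rint_eq0//.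
  by apply: measurable_funM => //; apply: measurable_ind; meas.
apply: ae_mono (ae_D_neq q 0) => x; rewrite (DC q x) => /eqP d0.
by rewrite le_eqVlt (negPf d0) ltNge D_ge0 mul0r.
Qed.

Definition excess_cst (gam : R) : R := 320 / gam ^+ 3.
Definition decay_cst (gam : R) : R :=
  ann_sup gam * expR (excess_cst gam) / ann_cst R / (expR (gam / 2 * ln 2) - 1).
Definition log_cst (gam : R) : R := decay_cst gam / (gam / 2).
Definition mass_cst (gam : R) : R := ann_sup gam * expR (2 * log_cst gam) / ann_cst R.

Lemma decay_cst_gt0 gam : 0 < gam -> 0 < decay_cst gam.
Proof.
move=> g0; apply: divr_gt0; last first.
  by rewrite subr_gt0 expR_gt1; apply: mulr_gt0; [exact: divr_gt0|rewrite ln_gt0// ltr1n].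
by apply: divr_gt0; [apply: mulr_gt0; [exact: ann_sup_gt0|exact: expR_gt0]|exact: ann_cst_gt0].
Qed.

Lemma log_cst_gt0 gam : 0 < gam -> 0 < log_cst gam.
Proof. by move=> g0; apply: divr_gt0; [exact: decay_cst_gt0|exact: divr_gt0]. Qed.

Lemma mass_cst_gt0 gam : 0 < mass_cst gam.
Proof.
by apply: divr_gt0; [apply: mulr_gt0; [exact: ann_sup_gt0|exact: expR_gt0]|exact: ann_cst_gt0].
Qed.

(** When [n - m <= gam / 2] the inequality is trivial; otherwise the form is at
    least [gam * n], and the factor [8 / gam ^+ 3] makes the last term at least
    [2]. *)
Lemma excess_form (gam eps n m : R) : 0 < gam -> 0 <= eps -> 0 <= n <= 1 - gam -> 0 <= m <= 1 - gam ->
  2 * n - m <= 1 - gam / 2 + 8 / gam ^+ 3 * (Num.max 0 (n - m) * pohozaev_form (1 + 0) eps n m).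
Proof.
move=> g0 eps0 /andP[n0 n1] /andP[m0 m1]; rewrite /pohozaev_form.
have [nm|mn] := leP (n - m) 0.
  by rewrite mul0r mulr0; lra.
have hp : gam * n <= (1 + 0) * n + eps * m - n ^+ 2 - m ^+ 2 + n * m.
  have k1 : 0 <= n * (1 - gam - n) by rewrite mulr_ge0//; lra.
  have k2 : 0 <= m * (n - m) by rewrite mulr_ge0//; lra.
  have k3 : 0 <= eps * m by rewrite mulr_ge0// ltW.
  by nra.
have h2 : 8 / gam ^+ 2 * ((n - m) * n) <= 8 / gam ^+ 3 * ((n - m) * ((1 + 0) * n + eps * m - n ^+ 2 - m ^+ 2 + n * m)).
  rewrite [leLHS](_ : _ = 8 / gam ^+ 3 * ((n - m) * (gam * n))); last by field; exact: lt0r_neq0.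
  by rewrite ler_wpM2l ?divr_ge0 ?exprn_ge0 ?(ltW g0)// ler_wpM2l// ltW.
apply: le_trans (_ : (1 - gam / 2) + 8 / gam ^+ 2 * ((n - m) * n) <= _); last by rewrite lerD2l.
have p0 : 0 <= 8 / gam ^+ 2 * ((n - m) * n) by rewrite mulr_ge0 ?divr_ge0 ?exprn_ge0 ?(ltW g0)// mulr_ge0// ltW.
have [d|d] := leP (n - m) (gam / 2); first by lra.
have q4 : gam ^+ 2 / 4 <= (n - m) * n.
  have : gam / 2 <= n by lra.
  by move=> d2; have := ler_pM (ltW (divr_gt0 g0 (ltr0n R 2))) (ltW (divr_gt0 g0 (ltr0n R 2))) (ltW d) d2; lra.
have : 2 <= 8 / gam ^+ 2 * ((n - m) * n).
  have -> : 2 = 8 / gam ^+ 2 * (gam ^+ 2 / 4) :> R by field; exact: lt0r_neq0.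
  by rewrite ler_wpM2l// divr_ge0// exprn_ge0// ltW.
by lra.
Qed.

Variables (p : 'I_3 -> sphere R) (a1 a2 : 'I_3 -> R) (C1 C2 : R) (f1 f2 : sphere R -> R) (gam : R).
Hypothesis tp : toda_pair p a1 a2 C1 C2 f1 f2 gam.
Variables (q : sphere R) (t0 eps : R).
Hypotheses (t00 : 0 < t0) (t04 : t0 <= 4^-1) (far : forall m, p m <> q -> 8 * t0 <= D q (p m)).
Hypotheses (q1 : alq q p a1 = 0) (q2 : 1 + alq q p a2 = eps) (eps0 : 0 < eps).

Let i1 : itg (@area R) f1. Proof. exact: tp_i1 tp. Qed.
Let i2 : itg (@area R) f2. Proof. exact: tp_i2 tp. Qed.
Let g0 : 0 < gam. Proof. exact: tp_gam tp. Qed.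
Let N1 := mass q f1.
Let N2 := mass q f2.

Let t02 : t0 <= 2. Proof. by apply: le_trans t04 _; apply: (@le_trans _ _ 1); rewrite ?invf_le1 ?ler1n. Qed.

Let mN1 : measurable_fun setT N1. Proof. exact: measurable_mass. Qed.
Let mN2 : measurable_fun setT N2. Proof. exact: measurable_mass. Qed.
Let f10 := tp_f1 tp.
Let f20 := tp_f2 tp.

Let nb1 s : `|N1 s| <= 1.
Proof. by have /andP[h1 h2] := mass1_bound tp q s; rewrite ger0_norm// (le_trans h2)// gerBl ltW. Qed.
Let nb2 s : `|N2 s| <= 1.
Proof. by have /andP[h1 h2] := mass2_bound tp q s; rewrite ger0_norm// (le_trans h2)// gerBl ltW. Qed.

(** Integration of [excess_form] against [dt / t]: the weight [max 0 (n - m)] is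
    admissible in the Pohozaev estimate. *)
Lemma excess_le eta : 0 < eta -> eta <= t0 ->
  2 * log_mass q f1 eta t0 - log_mass q f2 eta t0 <= (1 - gam / 2) * (ln t0 - ln eta) + excess_cst gam.
Proof.
move=> e0 et; pose g s := Num.max 0 (N1 s - N2 s).
have c1 : continuous N1 by exact: mass_cts.
have c2 : continuous N2 by exact: mass_cts.
have cg : continuous g by exact: (cts_max (@cts_cst R 0) (ctsD c1 (ctsN c2))).
have g01 s : 0 <= g s <= 1.
  rewrite /g le_max lexx /= ge_max ler01 /=.
  have /andP[n20 _] := mass2_bound tp q s.
  by apply: le_trans (_ : N1 s <= 1); [rewrite gerBl|exact: le_trans (ler_norm _) (nb1 s)].
have := pohozaev_pair tp e0 et t04 cg g01 far.
have ip := itg_pohozaev tp q t0 e0 (continuous_measurable_fun cg) g01.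
rewrite ler_norml => /andP[_ hP].
have iL1 : itg (seg eta t0) (fun z => N1 z / z) by exact: itg_seg_inv e0 mN1 nb1.
have iL2 : itg (seg eta t0) (fun z => N2 z / z) by exact: itg_seg_inv e0 mN2 nb2.
have [iv Ev] := Rint_div_inv (1 - gam / 2) e0 et.
rewrite /log_mass -/N1 -/N2 -(RintZ _ iL1) -(RintB (itgZ _ iL1) iL2) -Ev.
set P := pohozaev_at _ _ _ _ _ _ in ip hP *.
apply: (@le_trans _ _ (\int[seg eta t0]_s ((1 - gam / 2) / s + 8 / gam ^+ 3 * (g s / s * P s)))).
  apply: le_Rint_ae; [exact: itgB (itgZ _ iL1) iL2|by apply: itgD => //; exact: itgZ|].
  apply: ae_mono (ae_seg eta t0) => s /andP[es _]; have s0 := lt_le_trans e0 es.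
  rewrite mulrA -mulrBl [X in _ <= _ + X](_ : _ = (8 / gam ^+ 3 * (g s * P s)) / s); last by ring.
  rewrite -mulrDl ler_wpM2r ?invr_ge0 ?(ltW s0)//.
  have b1 : 0 <= N1 s <= 1 - gam by exact: (mass1_bound tp q s).
  have b2 : 0 <= N2 s <= 1 - gam by exact: (mass2_bound tp q s).
  rewrite /P /pohozaev_at q1 q2 /g -/N1 -/N2.
  move: (N1 s) (N2 s) b1 b2 => n m /andP[n0 n1] /andP[m0 m1].
  by apply: excess_form => //; rewrite ?n0 ?m0//; exact: ltW.
rewrite (RintD iv (itgZ _ ip)) (RintZ _ ip) lerD2l /excess_cst.
have -> : 320 / gam ^+ 3 = 8 / gam ^+ 3 * 40 by ring.
by rewrite ler_wpM2l// divr_ge0// exprn_ge0// ltW.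
Qed.

Let W1 eta := scale_exp q eta p a1 C1 f1 f2.

Let W1_top : expR (W1 t0) <= (ann_cst R * t0)^-1.
Proof.
have c0 := ann_cst_gt0 R; have t01 : t0 <= 1 by apply: le_trans t04 _; rewrite invf_le1 ?ler1n.
have := annulus_mass_ge (tp_a1 tp) i1 i2 f20 (tp_m1 tp) (tp_m2 tp) (tp_E1 tp) q t00 t01.
have /andP[h1 _] := mass1_bound tp q t0; have /andP[_ h2] := mass1_bound tp q (2 * t0).
have ct : 0 < ann_cst R * t0 by rewrite mulr_gt0.
rewrite mulrA -ler_pdivlMl// => h; apply: (le_trans h); rewrite ler_piMr ?invr_ge0 ?(ltW ct)//.
apply: le_trans (_ : mass q f1 (2 * t0) <= 1); first by rewrite gerBl.
by apply: (le_trans h2); rewrite gerBl ltW.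
Qed.

Let far1 t : t <= t0 -> forall m, p m <> q -> 8 * t <= D q (p m).
Proof. by move=> tt m /far; lra. Qed.

Let W1_shift eta : 0 < eta -> eta <= t0 ->
  W1 eta = W1 t0 + 2 * log_mass q f1 eta t0 - log_mass q f2 eta t0.
Proof.
move=> e0 et; rewrite /W1 (scale_exp_shift tp e0 et t02); first by rewrite q1 mul0r subr0.
by move=> m /far; lra.
Qed.

Let log_mass_ge0 f eta : (forall x, 0 <= f x) -> 0 < eta -> eta <= t0 -> itg (@area R) f ->
   (forall s, `|mass q f s| <= 1) -> 0 <= log_mass q f eta t0.
Proof.
move=> f0 e0 et iF fb; rewrite /log_mass; have mm := measurable_mass q iF.
rewrite -(@Rint_eq0 _ _ _ (seg eta t0) (fun=> 0))//; apply: le_Rint_ae; [exact: itg_cst|exact: itg_seg_inv e0 mm fb|].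
apply: ae_mono (ae_seg eta t0) => z /andP[ez _]; rewrite divr_ge0 ?mass_ge0//.
exact: le_trans (ltW e0) ez.
Qed.

(** By [excess_le] the masses of the annuli decay like a power of the radius.
    The constant does not depend on [eps]. *)
Lemma mass_decay t : 0 < t -> t <= t0 -> N1 t <= decay_cst gam * expR (gam / 2 * (ln t - ln t0)).
Proof.
apply: (dyadic_le (m := N1) (w := fun t => decay_cst gam * expR (gam / 2 * (ln t - ln t0)))).
- exact: mass_cts.
- exact: mass0.
- by move=> s _; rewrite mulr_ge0 ?expR_ge0// ltW// decay_cst_gt0.
move=> {}t tpos tt; have t4 : t <= 4^-1 by exact: le_trans tt t04.
apply: (le_trans (annulus_mass_le tp tpos t4 (far1 tt))).
have e1 : expR (W1 t) <= (ann_cst R * t0)^-1 * expR ((1 - gam / 2) * (ln t0 - ln t) + excess_cst gam).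
  rewrite (W1_shift tpos tt) -addrA expRD; apply: ler_pM; rewrite ?expR_ge0//.
  by rewrite ler_expR; exact: excess_le.
apply: le_trans (ler_wpM2l (ltW (ann_sup_gt0 gam)) (ler_wpM2l (ltW tpos) e1)) _.
rewrite lnM ?posrE// /decay_cst; set b := gam / 2; set E := expR (b * ln 2).
have -> : b * (ln 2 + ln t - ln t0) = b * ln 2 + b * (ln t - ln t0) by ring.
rewrite [expR (b * ln 2 + _)]expRD -/E [expR (_ + excess_cst _)]expRD.
have E1 : 0 < E - 1 by rewrite subr_gt0 expR_gt1 mulr_gt0 ?divr_gt0// ln_gt0// ltr1n.
have c0 := ann_cst_gt0 R.
have -> : expR ((1 - b) * (ln t0 - ln t)) = t0 / t * expR (b * (ln t - ln t0)).
  rewrite -[X in X / _](lnK t00) -[X in _ / X](lnK tpos) -expRN -!expRD; congr expR; ring.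
move: (expR (b * _)) (expR (excess_cst _)) => X Y.
rewrite le_eqVlt; apply/orP; left; apply/eqP; field.
by rewrite !lt0r_neq0.
Qed.

Lemma log_mass1_le eta : 0 < eta -> eta <= t0 -> log_mass q f1 eta t0 <= log_cst gam.
Proof.
move=> e0 et; pose b := gam / 2; have b0 : 0 < b by rewrite divr_gt0.
pose F z := log_cst gam * expR (b * (ln z - ln t0)).
pose h z := decay_cst gam * expR (b * (ln z - ln t0)) / z.
have mh : measurable_fun setT h by rewrite /h; meas.
have [||ih eh] := @FTC_loc R eta t0 h F et mh.
- move=> z /andP[ez _]; have z0 := lt_le_trans e0 ez.
  apply: drv_eq; first by rewrite /F; dv.
  by rewrite /h /log_cst -/b; field; rewrite !lt0r_neq0.
- move=> z /andP[ez _]; have z0 := lt_le_trans e0 ez.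
  have d : drv h z (decay_cst gam * (expR (b * (ln z - ln t0)) * (b / z)) / z - decay_cst gam * expR (b * (ln z - ln t0)) / z ^+ 2).
    have zn := lt0r_neq0 z0; apply: drv_eq; first by rewrite /h; dv.
    by field; rewrite zn (lt0r_neq0 t00).
  exact: drv_continuous d.
apply: (@le_trans _ _ (\int[seg eta t0]_z h z)).
  apply: le_Rint_ae => //; first exact: itg_seg_inv e0 mN1 nb1.
  apply: ae_mono (ae_seg eta t0) => z /andP[ez zt]; have z0 := lt_le_trans e0 ez.
  by rewrite ler_wpM2r ?invr_ge0 ?(ltW z0)//; exact: mass_decay.
by rewrite eh /F subrr mulr0 expR0 mulr1 gerBl mulr_ge0 ?expR_ge0 ?(ltW (log_cst_gt0 g0)).
Qed.

(** A bootstrap: by [mass_decay] the logarithmic moment of [f1] is bounded, so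
    that [f1] behaves like a bounded function, in the mean. *)
Theorem inner_mass t : 0 < t -> t <= t0 -> N1 t <= mass_cst gam * (t / t0).
Proof.
apply: (dyadic_le (m := N1) (w := fun t => mass_cst gam * (t / t0))).
- exact: mass_cts.
- exact: mass0.
- by move=> s s0; apply: mulr_ge0; [exact: ltW (mass_cst_gt0 _)|rewrite divr_ge0// ltW].
move=> {}t tpos tt; have t4 : t <= 4^-1 by exact: le_trans tt t04.
apply: (le_trans (annulus_mass_le tp tpos t4 (far1 tt))).
have e1 : expR (W1 t) <= (ann_cst R * t0)^-1 * expR (2 * log_cst gam).
  rewrite (W1_shift tpos tt) -addrA expRD; apply: ler_pM; rewrite ?expR_ge0 ?W1_top// ler_expR.
  exact: double_sub_le (log_mass1_le tpos tt) (log_mass_ge0 f20 tpos tt i2 nb2).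
apply: le_trans (ler_wpM2l (ltW (ann_sup_gt0 gam)) (ler_wpM2l (ltW tpos) e1)) _.
have c0 := ann_cst_gt0 R.
rewrite /mass_cst le_eqVlt; apply/orP; left; apply/eqP; field.
by rewrite !lt0r_neq0.
Qed.

End third_vortex.

(** * The second density is small away from the first two vortices *)

Section second_density.
Variable R : realType.

Definition top_cst (gam : R) : R := 2 * expR (log_cst gam + 1) / ann_cst R.

Definition far_cst (gam t0 th : R) : R :=
  top_cst gam / t0 * (expR (6 * ln (2 / (th / 8 * spread gam))) * (132 * pi)).

Lemma top_cst_gt0 gam : 0 < top_cst gam.
Proof. by apply: divr_gt0; [apply: mulr_gt0 => //; exact: expR_gt0|exact: ann_cst_gt0]. Qed.

Lemma measurable_far (p : 'I_3 -> sphere R) th :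
  measurable_fun setT (fun x => [forall m, th <= D x (p m)]%:R : R).
Proof.
have -> : (fun x => [forall m, th <= D x (p m)]%:R : R) = fun x => \prod_(m < 3) (th <= D x (p m))%R%:R.
  apply/funext => x; rewrite -natr_prod; congr _%:R; apply/esym.
  have [/forallP h|] := boolP [forall m, th <= D x (p m)]; first by rewrite big1// => m _; rewrite h.
  by rewrite negb_forall => /existsP[m /negPf h]; rewrite (bigD1 m)//= h mul0n.
under eq_fun do rewrite !big_ord_recr big_ord0 /=.
have mi m : measurable_fun setT (fun x => (th <= D x (p m))%R%:R : R) by apply: measurable_ind; meas.
by apply: measurable_funM => //; apply: measurable_funM => //; apply: measurable_funM.
Qed.

(** Up to contributions of the order of [n] and of [ep], the form is [- m ^+ 2].
    *)
Lemma third_form (n m k ga ep : R) : 0 < ga -> 0 < ep -> 0 <= n <= 1 - ga -> 0 <= m <= 1 - ga -> k <= m ^+ 2 ->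
  pohozaev_form (1 + 0) ep n m <= 2 * n + (ep - k).
Proof.
move=> gp e0 /andP[n0 n1] /andP[m0 m1] h; rewrite /pohozaev_form.
have k1 : n * m <= n by rewrite ler_piMr//; lra.
have k2 : ep * m <= ep by rewrite ler_piMr ?(ltW e0)//; lra.
have k3 := sqr_ge0 n.
by lra.
Qed.

Lemma third_comb (I A k L n e : R) : -40 <= I -> A <= k -> I <= 2 * A + (e - n) * L ->
  n * L <= 40 + 2 * k + e * L.
Proof. by move=> h1 h2 h3; lra. Qed.

Variables (p : 'I_3 -> sphere R) (a1 a2 : 'I_3 -> R) (C1 C2 : R) (f1 f2 : sphere R -> R) (gam : R).
Hypothesis tp : toda_pair p a1 a2 C1 C2 f1 f2 gam.
Variables (q : sphere R) (t0 eps : R).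
Hypotheses (t00 : 0 < t0) (t04 : t0 <= 4^-1) (far : forall m, p m <> q -> 8 * t0 <= D q (p m)).
Hypotheses (q1 : alq q p a1 = 0) (q2 : 1 + alq q p a2 = eps) (eps0 : 0 < eps) (eps1 : eps <= 1).

Let i1 : itg (@area R) f1. Proof. exact: tp_i1 tp. Qed.
Let i2 : itg (@area R) f2. Proof. exact: tp_i2 tp. Qed.
Let g0 : 0 < gam. Proof. exact: tp_gam tp. Qed.
Let N1 := mass q f1.
Let N2 := mass q f2.
Let tp' := toda_pairC tp.

Let t01 : t0 <= 1. Proof. by apply: le_trans t04 _; rewrite invf_le1 ?ler1n. Qed.
Let t02 : t0 <= 2. Proof. by apply: (le_trans t01); rewrite ler1n. Qed.

Let mN1 : measurable_fun setT N1. Proof. exact: measurable_mass. Qed.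
Let mN2 : measurable_fun setT N2. Proof. exact: measurable_mass. Qed.

Let nb1 s : `|N1 s| <= 1.
Proof. by have /andP[h1 h2] := mass1_bound tp q s; rewrite ger0_norm// (le_trans h2)// gerBl ltW. Qed.
Let nb2 s : `|N2 s| <= 1.
Proof. by have /andP[h1 h2] := mass2_bound tp q s; rewrite ger0_norm// (le_trans h2)// gerBl ltW. Qed.

Let W2 eta := scale_exp q eta p a2 C2 f2 f1.

Let W2_ge eta : 0 < eta -> eta <= t0 ->
  W2 t0 + (1 - eps) * (ln t0 - ln eta) - log_cst gam <= W2 eta.
Proof.
move=> e0 et; have h1 := log_mass1_le tp t00 t04 far q1 q2 eps0 e0 et.
have h2 : 0 <= log_mass q f2 eta t0.
  rewrite /log_mass -(@Rint_eq0 _ _ _ (seg eta t0) (fun=> 0))//.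
  apply: le_Rint_ae; [exact: itg_cst|exact: itg_seg_inv e0 mN2 nb2|].
  apply: ae_mono (ae_seg eta t0) => z /andP[ez _]; rewrite divr_ge0 ?mass_ge0//; first exact: tp_f2 tp.
  exact: le_trans (ltW e0) ez.
have hq : alq q p a2 = eps - 1 by rewrite -q2; ring.
have ft m : p m <> q -> t0 <= D q (p m).
  by move=> /far; apply: le_trans; rewrite ler_peMl ?ler1n// ltW.
rewrite /W2 (scale_exp_shift tp' e0 et t02 ft) hq.
move: h1 h2; move: (log_mass q f1 _ _) (log_mass q f2 _ _) (log_cst _) (scale_exp _ _ _ _ _ _ _) (ln t0) (ln eta) eps.
by move=> A1 A2 k W x y e h1 h2; lra.
Qed.

(** At the scales between [exp (- 1 / eps)] and [1], relative to [t0], the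
    masses of the dyadic annuli around [q] are bounded below by a same multiple
    of [t0 * expR (W2 t0)]. There are about [1 / eps] of them, of total mass at
    most [1]. *)
Lemma top_small : t0 * expR (W2 t0) <= top_cst gam * eps.
Proof.
pose c := ann_cst R * (expR (- (log_cst gam + 1)) * (t0 * expR (W2 t0))).
have pos n : 0 < t0 / 2 ^+ n by rewrite divr_gt0// exprn_gt0.
have c0 : 0 <= c by rewrite !mulr_ge0 ?expR_ge0 ?(ltW (ann_cst_gt0 R)) ?(ltW t00).
have step n : n%:R * eps <= 1 -> n%:R * c <= N2 t0 - N2 (t0 / 2 ^+ n).
  elim: n => [|n IH] ne; first by rewrite mul0r expr0 divr1 subrr.
  have ne' : n%:R * eps <= 1 by apply: le_trans ne; apply: (ler_wpM2r (ltW eps0)); rewrite ler_nat.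
  have e : t0 / 2 ^+ n = 2 * (t0 / 2 ^+ n.+1) by rewrite exprS; field; rewrite expf_neq0.
  have := IH ne'; set eta := t0 / 2 ^+ n.+1 in e *; have ep : 0 < eta by exact: pos.
  have et : eta <= t0 by rewrite ler_pdivrMr ?exprn_gt0// ler_peMr ?exprn_ege1 ?ler1n// ltW.
  have h := annulus_mass_ge (tp_a2 tp) i2 i1 (tp_f1 tp) (tp_m2 tp) (tp_m1 tp) (tp_E2 tp) q ep (le_trans et t01).
  have hc : c <= N2 (2 * eta) - N2 eta.
    apply: le_trans h; rewrite /c ler_wpM2l ?(ltW (ann_cst_gt0 R))//.
    have hl : ln t0 - ln eta <= n.+1%:R.
      rewrite /eta ln_div ?posrE ?exprn_gt0// lnXn// opprB addrC subrK -[leLHS]mulr_natl ler_piMr//.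
      by have := ln_le_sub1 (ltr0n R 2); lra.
    have hl0 : 0 <= ln t0 - ln eta by rewrite subr_ge0 ler_ln ?posrE.
    have hw := W2_ge ep et; rewrite -/(W2 eta).
    rewrite -{1}(lnK t00) -{1}(lnK ep) -!expRD ler_expR.
    have : eps * (ln t0 - ln eta) <= 1.
      by apply: le_trans ne; rewrite mulrC; exact: (ler_wpM2r (ltW eps0)) hl.
    by move: hw; move: (W2 t0) (W2 eta) (ln t0) (ln eta) (log_cst _) => *; lra.
  by rewrite -[n.+1%:R]natr1 [X in _ -> X <= _]mulrDl mul1r e => h3; move: h3 hc; move: (N2 t0) (N2 _) (N2 _) (n%:R * c) => *; lra.
pose n := Num.truncn eps^-1.
have /andP[n1 n2] : n%:R <= eps^-1 < n.+1%:R by apply: truncn_itv; rewrite invr_ge0 ltW.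
have ne : n%:R * eps <= 1 by rewrite -ler_pdivlMr// mul1r.
have n0 : 1 <= n%:R :> R.
  rewrite ler1n lt0n; apply/eqP => n0; move: n2; rewrite n0 ltNge => /negP; apply.
  by rewrite invf_ge1.
have hn : n%:R * c <= 1.
  apply: (le_trans (step n ne)); have /andP[h _] := mass2_bound tp q (t0 / 2 ^+ n).
  by apply: le_trans (_ : N2 t0 <= 1); [rewrite gerBl|exact: le_trans (ler_norm _) (nb2 _)].
have hc : c <= 2 * eps.
  have k1 : 1 <= 2 * (n%:R * eps).
    have : 1 < n.+1%:R * eps by rewrite -ltr_pdivrMr// mul1r.
    by rewrite -[n.+1%:R]natr1 mulrDl mul1r; have := ler_wpM2r (ltW eps0) n0; rewrite mul1r; lra.
  have k2 : 0 < n%:R :> R by exact: lt_le_trans n0.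
  rewrite -(ler_pM2l k2); apply: (le_trans hn); apply: (le_trans k1); rewrite le_eqVlt; apply/orP; left.
  by apply/eqP; ring.
have e1 := expR_gt0 (log_cst gam + 1); have a0 := ann_cst_gt0 R.
have -> : t0 * expR (W2 t0) = expR (log_cst gam + 1) / ann_cst R * c.
  by rewrite /c expRN; field; rewrite !lt0r_neq0.
rewrite /top_cst [leRHS](_ : _ = expR (log_cst gam + 1) / ann_cst R * (2 * eps)); last by ring.
by rewrite ler_wpM2l// ltW// divr_gt0.
Qed.

(** Away from the vortices, [f2] is controlled by its scale function at the top
    scale [t0]. *)
Lemma far_mass_small th : 0 < th -> th <= t0 ->
  \int[@area R]_x ([forall m, th <= D x (p m)]%:R * f2 x) <= far_cst gam t0 th * eps.
Proof.
move=> th0 tht; pose t := th / 8 * spread gam; have s0 := spread_gt0 gam; have s1 := spread_le1 tp.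
have th8 : 0 < th / 8 by rewrite divr_gt0.
have tp0 : 0 < t by rewrite mulr_gt0.
have t8 : th / 8 <= th by rewrite ler_pdivrMr// ler_peMr ?ler1n// ltW.
have tth : t <= th by apply: le_trans t8; rewrite ler_piMr// ltW.
have Kt u : t <= u -> 2 <= 2 / t * u by move=> tu; rewrite mulrAC ler_pdivlMr// ler_wpM2l.
have K1 : 1 <= 2 / t.
  by rewrite ler_pdivlMr// mul1r (le_trans tth)// (le_trans tht).
have mb := measurable_far p th.
have D2 x y := D_le2 (R := R) x y.
have := @region_mass_le R p a2 C2 f2 f1 (tp_a2 tp) i2 i1 (tp_f1 tp) (tp_m2 tp) (tp_m1 tp) (tp_E2 tp) q t0 (2 / t) t
  (fun x => [forall m, th <= D x (p m)]) t00 K1 tp0 mb.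
move=> /(_ _)/le_trans; apply.
  move=> x /forallP hx; split.
  - move=> y; apply: le_trans (D2 _ _) (Kt _ _); rewrite le_max (le_trans tth)//.
  - move=> y; apply: le_trans (_ : 2 <= _); first by rewrite ge_max t02 D2.
    by apply: Kt; rewrite le_max lexx.
  - move=> m; apply: le_trans (_ : 2 <= _); first by rewrite ge_max t02 D2.
    by apply: Kt; exact: le_trans tth (hx m).
  - have h4 : th / 8 <= 4^-1 by apply: le_trans t8 (le_trans tht t04).
    apply: (local_mass_small tp' th8 h4) => m; by rewrite mulrC divfK.
rewrite expRD -/(W2 t0) /far_cst -/t.
have hw : expR (W2 t0) <= top_cst gam / t0 * eps.
  by rewrite mulrAC ler_pdivlMr// mulrC top_small.
rewrite [leRHS](_ : _ = top_cst gam / t0 * eps * expR (6 * ln (2 / t)) * (132 * pi)); last by ring.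
have ib : itg (@area R) (fun x => [forall m, th <= D x (p m)]%:R : R).
  by apply: (@itg_bounded _ _ _ _ _ 1) => // x; exact: norm_ind.
apply: ler_pM; rewrite ?mulr_ge0 ?expR_ge0//.
- by apply: addr_ge0; [apply: Rint_ge0 => x|rewrite !mulr_ge0 ?pi_ge0// ltW].
- by rewrite ler_wpM2r ?expR_ge0.
have -> : 132 * pi = 1 * (4 * pi) + 128 * pi * 1 :> R by ring.
apply: lerD.
  rewrite -Rint_area_cst; apply: le_Rint => //; first exact: itg_cst.
  by move=> x; rewrite -[leRHS]/(1%:R) ler_nat leq_b1.
by rewrite ler_wpM2l ?mulr_ge0 ?pi_ge0// (le_trans tth)// (le_trans tht).
Qed.

(** By [third_form] the square of the mass of [f2], nondecreasing in the scale,
    has a bounded logarithmic integral, up to the contributions of [f1] and of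
    [eps]. *)
Lemma third_mass_small t1 : 0 < t1 -> t1 <= t0 ->
  N2 t1 ^+ 2 * (ln t0 - ln t1) <= 40 + 2 * log_cst gam + eps * (ln t0 - ln t1).
Proof.
move=> t10 t1t; have g1 : forall s : R, 0 <= (fun=> 1 : R) s <= 1 by move=> s; rewrite ler01 lexx.
have := pohozaev_pair tp t10 t1t t04 (@cts_cst R 1) g1 far.
have ip := itg_pohozaev tp q t0 t10 (@measurable_cst _ _ _ _ _ _) g1.
rewrite ler_norml => /andP[hP _].
have iL1 : itg (seg t1 t0) (fun z => N1 z / z) by exact: itg_seg_inv t10 mN1 nb1.
have [iv Ev] := Rint_div_inv (eps - N2 t1 ^+ 2) t10 t1t.
have hA := log_mass1_le tp t00 t04 far q1 q2 eps0 t10 t1t.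
have : \int[seg t1 t0]_s (1 / s * pohozaev_at q p a1 a2 f1 f2 s) <=
    \int[seg t1 t0]_s (2 * (N1 s / s) + (eps - N2 t1 ^+ 2) / s).
  apply: le_Rint_ae => //; first by apply: itgD => //; exact: itgZ.
  apply: ae_mono (ae_seg t1 t0) => s /andP[es _]; have s0 := lt_le_trans t10 es.
  rewrite mulrA -mulrDl mulrC mul1r ler_wpM2r ?invr_ge0 ?(ltW s0)//.
  have b1 : 0 <= N1 s <= 1 - gam by exact: (mass1_bound tp q s).
  have b2 : 0 <= N2 s <= 1 - gam by exact: (mass2_bound tp q s).
  have b3 : 0 <= N2 t1 by have /andP[] := mass2_bound tp q t1.
  have b4 : N2 t1 <= N2 s by apply: mass_mono => //; exact: tp_f2 tp.
  have b5 : N2 t1 ^+ 2 <= N2 s ^+ 2 by rewrite ler_sqr ?nnegrE// (le_trans b3).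
  rewrite /pohozaev_at q1 q2 -/N1 -/N2.
  exact: third_form g0 eps0 b1 b2 b5.
rewrite (RintD (itgZ _ iL1) iv) (RintZ _ iL1) Ev -/(log_mass q f1 t1 t0).
exact: third_comb hP hA.
Qed.

End second_density.

(** * Concentration of the second density *)

Section concentration.
Variable R : realType.

Lemma alq_vortex (p : 'I_3 -> sphere R) (a : 'I_3 -> R) m : (forall m m', m != m' -> p m <> p m') ->
  alq (p m) p a = a m.
Proof.
move=> pp; rewrite /alq (bigD1 m)//= eqxx mul1r big1 ?addr0// => k km.
by case: eqP; rewrite ?mul0r// => e; case: (pp _ _ km).
Qed.

(** If both [n] and [n'] are large, both stay away from [be], and the forms give
    [A + n < m] and [B + n' < m'], against [r1 < A + B]. *)
Lemma two_masses (sig A B be r1 r2 m n m' n' : R) : 0 < sig -> 2 * sig < be -> 0 < A -> 0 < B ->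
  0 <= m -> 0 <= n <= 1 -> 0 <= m' -> 0 <= n' <= 1 ->
  pohozaev_form A be m n <= sig -> pohozaev_form B be m' n' <= sig ->
  m + m' <= r1 -> n + n' <= r2 -> r2 <= n + n' + 2 * sig -> be < r2 < be + sig -> r1 < A + B ->
  n * n' <= 2 * sig.
Proof.
rewrite /pohozaev_form => s0 sbe A0 B0 m0 /andP[n0 n1] m'0 /andP[n'0 n'1] P1 P2 mm nn rn /andP[be2 r2be] rAB.
rewrite leNgt; apply/negP => h.
have hn : sig < n * (be - n).
  have : n * (n' - sig) <= n * (be - n) by rewrite ler_wpM2l//; lra.
  have k : n * sig <= sig by rewrite ler_piMl// ltW.
  by lra.
have hn' : sig < n' * (be - n').
  have : n' * (n - sig) <= n' * (be - n') by rewrite ler_wpM2l//; lra.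
  have k : n' * sig <= sig by rewrite ler_piMl// ltW.
  by lra.
have k1 : A + n < m.
  rewrite ltNge; apply/negP => k; have k' : 0 <= m * (A + n - m) by rewrite mulr_ge0//; lra.
  by lra.
have k2 : B + n' < m'.
  rewrite ltNge; apply/negP => k; have k' : 0 <= m' * (B + n' - m') by rewrite mulr_ge0//; lra.
  by lra.
lra.
Qed.

Lemma one_mass (sig be tau r2 n n' : R) : 0 < sig -> 4 * sig <= be -> sig * (2 + 8 / be) <= tau ->
  0 <= n -> 0 <= n' -> n * n' <= 2 * sig -> be < r2 -> r2 <= n + n' + 2 * sig ->
  be - tau <= n \/ be - tau <= n'.
Proof.
move=> s0 sbe st n0 n'0 nn be2 rn; have b0 : 0 < be by lra.
have key u v : 0 <= u -> 0 <= v -> u * v <= 2 * sig -> be / 4 <= u -> v <= 8 * sig / be.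
  move=> u0 v0 uv bu; have : be / 4 * v <= 2 * sig by apply: le_trans uv; rewrite ler_wpM2r.
  by rewrite ler_pdivlMr//; lra.
have e : sig * (2 + 8 / be) = 2 * sig + 8 * sig / be by ring.
have [h|h] := leP (be / 4) n.
  by left; have := key n n' n0 n'0 nn h; lra.
right; have h' : be / 4 <= n' by lra.
by have := key n' n n'0 n0; rewrite mulrC => /(_ nn h'); lra.
Qed.

(** Each of the first two vortices has a scale at which the Pohozaev form is at
    most [sig]; the masses at these two scales account for all of [f2] but [2 *
    sig]. *)
Theorem concentration (p : 'I_3 -> sphere R) (A B be r1 gam tau : R) : (forall m m', m != m' -> p m <> p m') ->
  0 < A -> 0 < B -> 0 < be -> 0 < gam -> 0 < tau -> r1 < A + B ->
  exists2 ep0, 0 < ep0 & forall eps r2 C1 C2 f1 f2, 0 < eps < ep0 ->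
    toda_pair p (triple (A - 1) (B - 1) 0) (triple (be - 1) (be - 1) (eps - 1)) C1 C2 f1 f2 gam ->
    \int[@area R]_x f1 x = r1 -> \int[@area R]_x f2 x = r2 -> be < r2 < be + eps ->
    be - tau <= mass (p ord0) f2 tau \/ be - tau <= mass (p (inord 1)) f2 tau.
Proof.
move=> pp A0 B0 be0 g0 tau0 rAB; have [t' [t'0 t'1 sep']] := separation pp.
pose t0 := Num.min (t' / 4) tau.
have t00 : 0 < t0 by rewrite lt_min tau0 divr_gt0.
have t04 : t0 <= 4^-1 by rewrite ge_min ler_pdivrMr// mulVf// t'1.
have t0tau : t0 <= tau by rewrite ge_min lexx orbT.
have sep m m' : m != m' -> 8 * t0 <= D (p m) (p m').
  have k : t0 <= t' / 4 by rewrite ge_min lexx.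
  by move=> /sep' h; lra.
clearbody t0.
pose sig := Num.min (be / 4) (tau / (2 + 8 / be)).
have b8 : 0 < 2 + 8 / be by rewrite addr_gt0// divr_gt0.
have sig0 : 0 < sig by rewrite lt_min !divr_gt0.
have sigb : 4 * sig <= be by rewrite mulrC -ler_pdivlMr// ge_min lexx.
have sigt : sig * (2 + 8 / be) <= tau by rewrite -ler_pdivlMr// ge_min lexx orbT.
clearbody sig.
pose L := Num.max (41 / sig) ((40 + 2 * log_cst gam) / (sig ^+ 2 / 2)).
have k40 : 0 < 40 + 2 * log_cst gam by rewrite addr_gt0// mulr_gt0// log_cst_gt0.
have sig2 : 0 < sig ^+ 2 / 2 by rewrite divr_gt0// exprn_gt0.
have L1 : 40 < sig * L.
  apply: (@lt_le_trans _ _ 41); first by rewrite ltr_nat.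
  by rewrite mulrC -ler_pdivrMr// le_max lexx.
have L2 : 40 + 2 * log_cst gam <= sig ^+ 2 / 2 * L.
  by rewrite [leRHS]mulrC -ler_pdivrMr// le_max lexx orbT.
have L0 : 0 < L by rewrite -(pmulr_rgt0 _ sig0); apply: lt_trans L1.
clearbody L.
pose t1 := t0 * expR (- L).
have t10 : 0 < t1 by rewrite mulr_gt0 ?expR_gt0.
have lnt1 : ln t0 - ln t1 = L by rewrite /t1 lnM ?posrE ?expR_gt0// expRK; ring.
have t1t : t1 <= t0.
  by rewrite /t1 ler_piMr ?(ltW t00)// -expR0 ler_expR lerNl oppr0 ltW.
clearbody t1.
have fc0 : 0 < far_cst gam t0 t1.
  apply: mulr_gt0; first by apply: divr_gt0 => //; exact: top_cst_gt0.
  by apply: mulr_gt0; [exact: expR_gt0|rewrite mulr_gt0 ?pi_gt0].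
exists (Num.min (Num.min 1 sig) (Num.min (sig ^+ 2 / 2) (sig / far_cst gam t0 t1))).
  by rewrite !lt_min ltr01 sig0 sig2 divr_gt0.
move=> eps r2 C1 C2 f1 f2 /andP[eps0]; rewrite !lt_min => /andP[/andP[/ltW eps1 epss] /andP[/ltW epss2 /ltW epsf]].
move=> tp I1 I2 /andP[r2b r2e].
have i1 := tp_i1 tp; have i2 := tp_i2 tp; have f10 := tp_f1 tp; have f20 := tp_f2 tp.
have far m k : p k <> p m -> 8 * t0 <= D (p m) (p k).
  by move=> pk; apply: sep; apply/eqP => e; apply: pk; rewrite e.
set P := fun q => pohozaev_at q p (triple (A - 1) (B - 1) 0) (triple (be - 1) (be - 1) (eps - 1)) f1 f2.
have low m : exists s, t1 <= s <= t0 /\ P (p m) s <= sig.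
  apply: contrapT => /forallNP h.
  have hc s : t1 <= s <= t0 -> sig <= P (p m) s.
    by move=> hs; rewrite leNgt; apply/negP => k; apply: (h s); split => //; exact: ltW.
  by have := pohozaev_le tp t10 t1t t04 (far m) hc; rewrite lnt1 leNgt L1.
have [s [/andP[s1 s2] Ps]] := low ord0; have [s' [/andP[s1' s2'] Ps']] := low (inord 1).
rewrite /P /pohozaev_at !alq_vortex// {1 2}/triple /= in Ps.
rewrite /P /pohozaev_at !alq_vortex// {1 2}/triple inordK//= in Ps'.
have e1 : 1 + (A - 1) = A by ring.
have e2 : 1 + (B - 1) = B by ring.
have e3 : 1 + (be - 1) = be by ring.
rewrite e1 e3 in Ps; rewrite e2 e3 in Ps'.
have p01 : p ord0 <> p (inord 1) by apply: pp; rewrite -val_eqE /= inordK.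
have disj f : itg (@area R) f -> (forall x, 0 <= f x) ->
    mass (p ord0) f s + mass (p (inord 1)) f s' <= \int[@area R]_x f x.
  move=> iF f0; rewrite -RintD; [|exact: itg_ind|exact: itg_ind].
  apply: le_Rint => //; first by apply: itgD; exact: itg_ind.
  move=> x; have [h|h] := leP (D x (p ord0)) s; last first.
    by rewrite mul0r add0r ler_piMl// -[leRHS]/(1%:R) ler_nat leq_b1.
  have h2 : 8 * t0 <= D (p ord0) (p (inord 1)) by apply: far; exact: nesym.
  have h3 := D_quasi (p ord0) x (p (inord 1)); rewrite (DC (p ord0) x) in h3.
  have h4 : s' < D x (p (inord 1)).
    by clear -h h2 h3 s2 s2' t00; lra.
  by rewrite (lt_geF h4) mul0r addr0 mul1r.
have cover : r2 <= mass (p ord0) f2 s + mass (p (inord 1)) f2 s' + 2 * sig.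
  have h3 : mass (p ord_max) f2 t1 <= sig.
    have q1 : alq (p ord_max) p (triple (A - 1) (B - 1) 0) = 0 by rewrite alq_vortex.
    have q2 : 1 + alq (p ord_max) p (triple (be - 1) (be - 1) (eps - 1)) = eps.
      by rewrite alq_vortex// /triple /=; ring.
    have := third_mass_small tp t00 t04 (far ord_max) q1 q2 eps0 t10 t1t; rewrite lnt1 => h.
    have h4 : mass (p ord_max) f2 t1 ^+ 2 * L <= sig ^+ 2 * L.
      apply: (le_trans h); have : eps * L <= sig ^+ 2 / 2 * L by rewrite ler_wpM2r// ltW.
      have : sig ^+ 2 * L = sig ^+ 2 / 2 * L + sig ^+ 2 / 2 * L by field.
      lra.
    rewrite (ler_pM2r L0) in h4.
    by rewrite -(ler_sqr (x := mass (p ord_max) f2 t1)) ?nnegrE ?mass_ge0// ltW.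
  have h4 : \int[@area R]_x ([forall m, t1 <= D x (p m)]%:R * f2 x) <= sig.
    have q1 : alq (p ord_max) p (triple (A - 1) (B - 1) 0) = 0 by rewrite alq_vortex.
    have q2 : 1 + alq (p ord_max) p (triple (be - 1) (be - 1) (eps - 1)) = eps.
      by rewrite alq_vortex// /triple /=; ring.
    apply: (le_trans (far_mass_small tp t00 t04 (far ord_max) q1 q2 eps0 eps1 t10 t1t)).
    by rewrite mulrC -ler_pdivlMr.
  rewrite -I2; apply: (@le_trans _ _ (mass (p ord0) f2 s + mass (p (inord 1)) f2 s' + mass (p ord_max) f2 t1
    + \int[@area R]_x ([forall m, t1 <= D x (p m)]%:R * f2 x))); last first.
    by rewrite -!addrA !lerD2l; clear -h3 h4; lra.
  have i3 : itg (@area R) (fun x => [forall m, t1 <= D x (p m)]%:R * f2 x).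
    by apply: (itgMb (C := 1)) => //; [exact: measurable_far|move=> x; exact: norm_ind].
  rewrite -RintD; [|exact: itg_ind|exact: itg_ind].
  rewrite -RintD; [|by apply: itgD; exact: itg_ind|exact: itg_ind].
  rewrite -RintD//; last by apply: itgD; [apply: itgD|]; exact: itg_ind.
  apply: le_Rint => //; first by apply: itgD => //; apply: itgD; [apply: itgD|]; exact: itg_ind.
  move=> x; rewrite -!mulrDl ler_peMl//.
  have [hx|hx] := leP (D x (p ord0)) s; first by rewrite -!addrA lerDl !addr_ge0.
  have [hx'|hx'] := leP (D x (p (inord 1))) s'; first by rewrite addrAC -!addrA addrCA lerDl !addr_ge0.
  have [hx3|hx3] := leP (D x (p ord_max)) t1; first by rewrite !add0r lerDl.
  have -> : [forall m, t1 <= D x (p m)].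
    apply/forallP => m; have := ltn_ord m; case: m => [[|[|[|//]]] hm] _.
    - by rewrite (_ : Ordinal hm = ord0); [exact: le_trans s1 (ltW hx)|exact: val_inj].
    - by rewrite (_ : Ordinal hm = inord 1); [exact: le_trans s1' (ltW hx')|apply: val_inj; rewrite /= inordK].
    - by rewrite (_ : Ordinal hm = ord_max); [exact: ltW|exact: val_inj].
  by rewrite !add0r.
have d1 := disj f1 i1 f10; have d2 := disj f2 i2 f20; rewrite I1 in d1; rewrite I2 in d2.
have nb q z : 0 <= mass q f2 z <= 1.
  by have /andP[u0 u1] := mass2_bound tp q z; rewrite u0 (le_trans u1)// gerBl ltW.
have nn : mass (p ord0) f2 s * mass (p (inord 1)) f2 s' <= 2 * sig.
  apply: (two_masses (A := A) (B := B) (be := be) (r1 := r1) (r2 := r2) (m := mass (p ord0) f1 s) (m' := mass (p (inord 1)) f1 s')) => //.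
  - by apply: lt_le_trans sigb; rewrite ltr_pM2r// ltr_nat.
  - exact: mass_ge0.
  - exact: mass_ge0.
  - by rewrite r2b (lt_trans r2e)// ltrD2l.
have [h|h] := one_mass sig0 sigb sigt (mass_ge0 (p ord0) s f20) (mass_ge0 (p (inord 1)) s' f20) nn r2b cover.
  by left; apply: (le_trans h); apply: mass_mono => //; exact: le_trans s2 t0tau.
by right; apply: (le_trans h); apply: mass_mono => //; exact: le_trans s2' t0tau.
Qed.

End concentration.

(** * The global balance *)

Section cutoff.
Variable R : realType.
Implicit Types (x y q v w : sphere R).

Lemma drv_max_sqr (u : R) : drv (fun z => Num.max 0 z ^+ 2) u (2 * Num.max 0 u).
Proof.
have [u0|u0|->] := ltgtP u 0.
- rewrite mulr0; have h0 : drv (fun=> 0) u 0 := drv_cst 0 u. refine (near_eq_is_derive _ h0).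
  near=> z; rewrite max_l ?expr0n//.
  by rewrite ltW//; near: z; exact: lt_nbhsl.
- have h0 : drv (fun z : R => z * z) u (2 * u) by apply: drv_eq (drvM (drv_id u) (drv_id u)) _; rewrite mulr1 mulr_natl mulr2n.
  refine (near_eq_is_derive _ h0).
  near=> z; rewrite max_r ?expr2//.
  by rewrite ltW//; near: z; exact: lt_nbhsr.
- rewrite mulr0.
  have lim : h^-1 *: ((fun z : R => Num.max 0 z ^+ 2) (h + 0) - Num.max 0 0 ^+ 2) @[h --> 0^'] --> (0 : R).
    apply/cvgrPdist_le => e e0; near=> h; rewrite sub0r normrN addr0 maxxx expr0n subr0.
    have h0 : h != 0 by near: h; exact: nbhs_dnbhs_neq.
    have he : `|h| <= e by near: h; apply: cvgr0_norm_le => //; apply: cvg_within.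
    apply: le_trans he; rewrite /= normrM normfV ler_pdivrMl ?normr_gt0// ger0_norm ?sqr_ge0//.
    rewrite -expr2 real_normK ?num_real//; have [hh|hh] := leP 0 h; first by [].
    by rewrite expr0n sqr_ge0.
  apply: DeriveDef; first by apply/cvg_ex; exists 0; move: lim; under eq_fun do rewrite -[X in X + 0](mulr1); exact.
  rewrite /derive; apply: cvg_lim => //; move: lim; under eq_fun do rewrite -[X in X + 0](mulr1); exact.
Unshelve. all: by end_near. Qed.

Variable S : R.
Hypotheses (S0 : 0 < S) (S1 : S <= 1).

Let T := S ^+ 2.
Let T0 : 0 < T. Proof. exact: exprn_gt0. Qed.
Let T1 : T <= 1. Proof. by apply: exprn_ile1 => //; exact: ltW. Qed.

(** The weight [cutoff = 1 - bump] of the virial identity vanishes at the origin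
    only, to the first order, and is constant beyond [S ^+ 2]. *)
Definition bump (u : R) : R := Num.max 0 (1 - u / T) ^+ 2.
Definition cutoff (u : R) : R := 1 - bump u.
Definition cutoff' (u : R) : R := 2 / T * Num.max 0 (1 - u / T).

Lemma drv_cutoff u : drv cutoff u (cutoff' u).
Proof.
have h0 : drv (fun z : R => 1 - z / T) u (- T^-1).
  by apply: drv_eq; [dv; exact: lt0r_neq0|field; exact: lt0r_neq0].
have h := drv_comp (f := fun z => Num.max 0 z ^+ 2) (g := fun z => 1 - z / T) (drv_max_sqr (1 - u / T)) h0.
have h2 : drv (fun z => 1 - Num.max 0 (1 - z / T) ^+ 2) u (0 + - (2 * Num.max 0 (1 - u / T) * - T^-1)).
  exact: drvD (drv_cst 1 u) (drvN h).
by apply: drv_eq h2 _; rewrite /cutoff'; ring.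
Qed.

Lemma cts_cutoff' : continuous cutoff'.
Proof.
have -> : cutoff' = fun u => 2 / T * Num.max 0 (1 - T^-1 * u).
  by apply/funext => u; rewrite /cutoff' (mulrC u).
by cts.
Qed.

Let mx01 u : 0 <= u -> 0 <= Num.max 0 (1 - u / T) <= 1.
Proof. by move=> u0; rewrite le_max lexx /= ge_max ler01 gerBl divr_ge0// ltW. Qed.

Lemma bump01 u : 0 <= u -> 0 <= bump u <= 1.
Proof. by move=> /mx01 /andP[h0 h1]; rewrite /bump exprn_ge0//= exprn_ile1. Qed.

Lemma cutoff01 u : 0 <= u -> 0 <= cutoff u <= 1.
Proof. by move=> /bump01; rewrite /cutoff => /andP[? ?]; rewrite subr_ge0 gerBl; apply/andP. Qed.

Lemma bump_far u : T < u -> bump u = 0.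
Proof.
move=> Tu; rewrite /bump max_l ?expr0n// subr_le0 ler_pdivlMr// mul1r; exact: ltW.
Qed.

Lemma bump_ind u : 0 <= u -> bump u <= (u <= T)%R%:R.
Proof. by move=> u0; have [h|h] := leP u T; [have /andP[] := bump01 u0|rewrite bump_far]. Qed.

Lemma cutoff_lin u : 0 <= u -> cutoff u <= 2 / T * u.
Proof.
move=> u0; have h : 1 - u / T <= Num.max 0 (1 - u / T) by rewrite le_max lexx orbT.
have /andP[h0 h1] := mx01 u0; rewrite /cutoff /bump.
rewrite [leRHS](_ : _ = 2 * (u / T)); last by ring.
have key (M k : R) : 1 - k <= M -> 0 <= M -> M <= 1 -> 1 - M ^+ 2 <= 2 * k by move=> *; nra.
exact: key.
Qed.

Lemma cutoff'_bound u : 0 <= u -> 0 <= cutoff' u <= 2 / T * (u <= T)%R%:R.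
Proof.
move=> u0; have /andP[h0 h1] := mx01 u0; have T2 : 0 <= 2 / T by rewrite divr_ge0// ltW.
rewrite /cutoff' mulr_ge0//= ler_wpM2l//; have [//|h] := leP u T.
by rewrite max_l// subr_le0 ler_pdivlMr// mul1r ltW.
Qed.

(** In the chordal distance [sqrt D], the cutoff is Lipschitz with constant of
    order [1 / S]: this compensates for the singularity of the interaction
    kernel, which is of order [1 / sqrt D]. *)
Lemma bump_lip s t d : 0 <= s -> s <= t -> Num.sqrt t <= Num.sqrt s + d ->
  `|bump s - bump t| <= 4 / S * d.
Proof.
move=> s0 st hd; have t0 := le_trans s0 st.
have d0 : 0 <= d by have := ler_wsqrtr st; lra.
have /andP[a0 a1] := mx01 s0; have /andP[b0 b1] := mx01 t0.
have ab : Num.max 0 (1 - t / T) <= Num.max 0 (1 - s / T).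
  rewrite ge_max a0 /= le_max; apply/orP; right.
  by rewrite lerD2l lerN2 ler_wpM2r// invr_ge0 ltW.
have key : Num.max 0 (1 - s / T) - Num.max 0 (1 - t / T) <= 2 / S * d.
  have S20 : 0 <= 2 / S * d by rewrite mulr_ge0// divr_ge0// ltW.
  have [sT|Ts] := leP s T; last first.
    by rewrite !max_l ?subrr// subr_le0 ler_pdivlMr// mul1r ?(le_trans (ltW Ts))// ltW.
  have qs := sqrtr_ge0 s; have qs2 := sqr_sqrtr s0; have qt := sqrtr_ge0 t; have qt2 := sqr_sqrtr t0.
  have sS : Num.sqrt s <= S by rewrite -(ler_sqr (x := Num.sqrt s)) ?nnegrE ?(ltW S0)// qs2.
  have m1 : Num.max 0 (1 - s / T) = 1 - s / T by rewrite max_r// subr_ge0 ler_pdivrMr// mul1r.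
  have [tS|St] := leP (Num.sqrt t) S.
    have tT : t <= T by rewrite -qt2 /T ler_sqr ?nnegrE// ltW.
    rewrite m1 max_r ?subr_ge0 ?ler_pdivrMr ?mul1r//.
    have -> : 1 - s / T - (1 - t / T) = (Num.sqrt t ^+ 2 - Num.sqrt s ^+ 2) / T by rewrite qs2 qt2; ring.
    rewrite subr_sqr ler_pdivrMr// (_ : 2 / S * d * T = d * (2 * S)); last by rewrite /T; field; exact: lt0r_neq0.
    by apply: ler_pM; [rewrite subr_ge0 ler_wsqrtr|exact: addr_ge0|rewrite lerBlDl|rewrite mulr_natl mulr2n; exact: lerD].
  have h1 : 1 - s / T = (S ^+ 2 - Num.sqrt s ^+ 2) / T by rewrite qs2 /T; field; exact: lt0r_neq0.
  rewrite m1; apply: (@le_trans _ _ (1 - s / T)); first by rewrite gerBl.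
  rewrite h1 subr_sqr ler_pdivrMr// (_ : 2 / S * d * T = d * (2 * S)); last by rewrite /T; field; exact: lt0r_neq0.
  have k1 : 0 <= S - Num.sqrt s by rewrite subr_ge0.
  have k2 : 0 <= S + Num.sqrt s by rewrite addr_ge0// ltW.
  apply: ler_pM => //; first by rewrite lerBlDl (le_trans (ltW St)).
  by rewrite mulr_natl mulr2n lerD2l.
rewrite /bump; move: a0 a1 b0 b1 ab key; move: (Num.max 0 (1 - s / T)) (Num.max 0 (1 - t / T)) => A B a0 a1 b0 b1 ab key.
have AB0 : 0 <= A - B by rewrite subr_ge0.
rewrite subr_sqr (ger0_norm (mulr_ge0 AB0 (addr_ge0 a0 b0))).
apply: le_trans (_ : 2 / S * d * 2 <= _); last by rewrite le_eqVlt; apply/orP; left; apply/eqP; ring.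
by apply: ler_pM => //; [exact: addr_ge0|lra].
Qed.

Definition near w x : R := (D x w <= T)%R%:R.

Lemma bump_lip_D x y w : `|bump (D x w) - bump (D y w)| <= 4 / S * Num.sqrt (D x y).
Proof.
wlog xy : x y / D x w <= D y w.
  move=> H; case/orP: (le_total (D x w) (D y w)) => h; first exact: H.
  by rewrite distrC (DC x y); exact: H.
apply: bump_lip => //; first exact: D_ge0.
by have := D_triangle y x w; rewrite (DC y x) addrC.
Qed.

(** Up to the neighbourhood of [w], the symmetrised kernel is the height, by
    [Bk_sym]. *)
Lemma sym_kernel v w x y : x <> y ->
  `|(cutoff (D x w) * Bk v x y + cutoff (D y w) * Bk v y x) / D x y - (sdot v x + sdot v y)|
     <= (2 + 6 / S) * (near w x + near w y).
Proof.
move=> xy; have d0 := D_gt0 xy; have dn := lt0r_neq0 d0.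
have -> : (cutoff (D x w) * Bk v x y + cutoff (D y w) * Bk v y x) / D x y - (sdot v x + sdot v y) =
   - (bump (D x w) * (sdot v x + sdot v y) + (bump (D y w) - bump (D x w)) * (Bk v y x / D x y)).
  have e : sdot v x + sdot v y = (Bk v x y + Bk v y x) / D x y by rewrite Bk_sym mulfK.
  by rewrite e /cutoff; field.
rewrite normrN; have S60 : 0 <= 6 / S by rewrite divr_ge0// ltW.
have K0 : 0 <= 2 + 6 / S by rewrite addr_ge0.
have hb : `|bump (D x w) * (sdot v x + sdot v y) + (bump (D y w) - bump (D x w)) * (Bk v y x / D x y)| <= 2 + 6 / S.
  apply: nbD.
    have /andP[p0 p1] := bump01 (D_ge0 x w).
    rewrite -[leRHS]mul1r; apply: nbM; first by rewrite ger0_norm.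
    by rewrite (_ : 2 = 1 + 1 :> R); [apply: nbD; exact: norm_sdot|lra].
  rewrite normrM normrM normfV (gtr0_norm d0) mulrA ler_pdivrMr//.
  have h1 := bump_lip_D y x w; have h2 := Bk_bound v y x.
  have h3 : `|Bk v y x| <= Num.sqrt 2 * Num.sqrt (D x y).
    by rewrite (DC x y) (le_trans h2)// ler_piMl ?mulr_ge0 ?sqrtr_ge0 ?sqrt_sdot2_le1.
  apply: (le_trans (ler_pM (normr_ge0 _) (normr_ge0 _) h1 h3)); rewrite (DC y x).
  have q2 := sqr_sqrtr (ltW d0); move: q2; set z := Num.sqrt (D x y) => q2.
  rewrite -q2 (_ : 4 / S * z * (Num.sqrt 2 * z) = (4 * Num.sqrt 2) / S * z ^+ 2); last by ring.
  rewrite ler_wpM2r ?sqr_ge0// ler_wpM2r ?invr_ge0 ?(ltW S0)//.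
  have s2 : Num.sqrt 2 <= 3 / 2 :> R.
    by rewrite -(ler_sqr (x := Num.sqrt 2)) ?nnegrE ?sqrtr_ge0 ?divr_ge0// sqr_sqrtr//; lra.
  lra.
rewrite /near; have [hx|hx] := leP (D x w) T.
  by apply: (le_trans hb); rewrite ler_peMr// lerDl.
have [hy|hy] := leP (D y w) T; first by rewrite add0r mulr1.
by rewrite !bump_far// subrr !mul0r addr0 normr0 mulr0.
Qed.

End cutoff.

(** * The balance along an axis *)

Section balance.
Variable R : realType.
Implicit Types (x y v w : sphere R).
Variables (p : 'I_3 -> sphere R) (S : R).
Hypotheses (S0 : 0 < S) (S1 : S <= 1) (pp : forall m m', m != m' -> p m <> p m').
Hypothesis anti : pt (p (inord 1)) = - pt (p ord0).

Local Notation v := (p ord0).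
Local Notation w := (p ord_max).

Lemma sdot_anti x : sdot (p (inord 1)) x = - sdot v x.
Proof.
rewrite /sdot /dot anti -sumrN; apply: eq_bigr => i _; by rewrite mxE mulNr.
Qed.

Let T0 : 0 < S ^+ 2. Proof. exact: exprn_gt0. Qed.

(** The hypothesis of the virial identity: the field vanishes at the first two
    vortices, which are its poles, and the cutoff at the third. *)
Lemma cutoff_sing x m : `|cutoff S (D x w)| * Num.sqrt (1 - sdot v x ^+ 2)
  <= (Num.sqrt 2 + 2 / S ^+ 2 * Num.sqrt 2) * Num.sqrt (D x (p m)).
Proof.
have D0 := D_ge0 x w; have /andP[c0 c1] := cutoff01 S0 D0.
have q2 := sqrtr_ge0 (2 : R); have T2 : 0 <= 2 / S ^+ 2 by rewrite divr_ge0// ltW.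
have T3 : 0 <= 2 / S ^+ 2 * Num.sqrt 2 by exact: mulr_ge0.
rewrite (ger0_norm c0).
have side z : sdot z x ^+ 2 = sdot v x ^+ 2 -> cutoff S (D x w) * Num.sqrt (1 - sdot v x ^+ 2)
    <= (Num.sqrt 2 + 2 / S ^+ 2 * Num.sqrt 2) * Num.sqrt (D x z).
  move=> <-; apply: (@le_trans _ _ (Num.sqrt (1 - sdot z x ^+ 2))).
    by rewrite ler_piMl ?sqrtr_ge0.
  apply: (le_trans (sqrt_sdot2_le z x)); rewrite (DC z x) ler_wpM2r ?sqrtr_ge0// lerDl//.
case: m => [[|[|[|//]]] hm].
- by rewrite (_ : Ordinal hm = ord0); [exact: side|exact: val_inj].
- rewrite (_ : Ordinal hm = inord 1); last by apply: val_inj; rewrite /= inordK.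
  by apply: side; rewrite sdot_anti sqrrN.
- rewrite (_ : Ordinal hm = ord_max); last exact: val_inj.
  apply: (@le_trans _ _ (cutoff S (D x w))); first by rewrite ler_piMr ?sqrt_sdot2_le1.
  apply: (le_trans (cutoff_lin S0 D0)).
  rewrite -{1}(sqr_sqrtr D0) expr2 mulrA ler_wpM2r ?sqrtr_ge0//.
  apply: (@le_trans _ _ (2 / S ^+ 2 * Num.sqrt 2)); last by rewrite lerDr.
  by rewrite ler_wpM2l// ler_wsqrtr// D_le2.
Qed.

Definition height (f : sphere R -> R) : R := \int[@area R]_x (sdot v x * f x).

Definition kcut (f g : sphere R -> R) (z : sphere R * sphere R) : R :=
  cutoff S (D z.1 w) * f z.1 * (Bk v z.1 z.2 / D z.1 z.2) * g z.2.

Let ms : measurable_fun setT (fun x => sdot v x).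
Proof.
have -> : (fun x => sdot v x) = fun x => 1 - D v x by apply/funext => x; rewrite /D; ring.
meas.
Qed.

Let itg_s f : itg (@area R) f -> itg (@area R) (fun x => sdot v x * f x).
Proof. by move=> iF; apply: (itgMb (C := 1)) => // x; exact: norm_sdot. Qed.

(** The symmetrised kernel is, up to the neighbourhood of [w], a sum of two
    functions of one variable, so that its double integral factorises. *)
Lemma kernel_height f g : itg (@area R) f -> itg (@area R) g -> (forall x, 0 <= f x) -> (forall x, 0 <= g x) ->
  itg (@area R \x @area R)%E (kcut f g) -> itg (@area R \x @area R)%E (kcut g f) ->
  `|\int[(@area R \x @area R)%E]_z kcut f g z + \int[(@area R \x @area R)%E]_z kcut g f z
    - (height f * \int[@area R]_x g x + \int[@area R]_x f x * height g)|
  <= (2 + 6 / S) * (mass w f (S ^+ 2) * \int[@area R]_x g x + \int[@area R]_x f x * mass w g (S ^+ 2)).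
Proof.
move=> iF iG f0 g0 k1 k2; have [k3 e3] := Rint_prod_swap k2.
have [t1 e1] := itg_tensor (itg_s iF) iG; have [t2 e2] := itg_tensor iF (itg_s iG).
have [t4 e4] := itg_tensor (itg_ind w (S ^+ 2) iF) iG; have [t5 e5] := itg_tensor iF (itg_ind w (S ^+ 2) iG).
rewrite -e3 -(RintD k1 k3) -e1 -e2 -(RintD t1 t2) -(RintB (itgD k1 k3) (itgD t1 t2)).
have iD := itgB (itgD k1 k3) (itgD t1 t2); have i6 := itgZ (2 + 6 / S) (itgD t4 t5).
apply: (le_trans (normr_Rint iD)); rewrite -e4 -e5 -(RintD t4 t5) -(RintZ _ (itgD t4 t5)).
apply: le_Rint_prod_ae; [exact: itg_norm iD|exact: i6|].
apply: ae_all => x; apply: ae_mono (ae_neq x) => y yx /=.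
have := sym_kernel S0 v w (not_eq_sym yx); rewrite /kcut /near /= (DC y x).
move=> h; rewrite [X in `|X|](_ : _ = (f x * g y) * ((cutoff S (D x w) * Bk v x y + cutoff S (D y w) * Bk v y x) / D x y - (sdot v x + sdot v y))); last by ring.
rewrite normrM ger0_norm ?mulr_ge0// [leRHS](_ : _ = (f x * g y) * ((2 + 6 / S) * ((D x w <= S ^+ 2)%R%:R + (D y w <= S ^+ 2)%R%:R))); last by ring.
by rewrite ler_wpM2l// mulr_ge0.
Qed.

(** The contribution of the vortex at [w], after cutoff. *)
Definition wsing x : R := cutoff S (D x w) * (Bk v x w / D x w).

Lemma wsing_le x : `|wsing x| <= 2 / S ^+ 2 * `|Bk v x w|.
Proof.
have D0 := D_ge0 x w; have /andP[c0 c1] := cutoff01 S0 D0; have T2 : 0 <= 2 / S ^+ 2 by rewrite divr_ge0// ltW.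
rewrite /wsing; have [->|Dn] := eqVneq (D x w) 0; first by rewrite invr0 !mulr0 normr0 mulr_ge0.
have Dp : 0 < D x w by rewrite lt_neqAle eq_sym Dn.
rewrite normrM normrM (ger0_norm c0) normfV (gtr0_norm Dp) mulrA ler_pdivrMr// mulrAC.
by rewrite ler_wpM2r//; exact: cutoff_lin.
Qed.

Lemma wsing_bound x : `|wsing x| <= 4 / S ^+ 2.
Proof.
apply: (le_trans (wsing_le x)); rewrite (_ : 4 / S ^+ 2 = 2 / S ^+ 2 * 2); last by ring.
by rewrite ler_wpM2l ?Bk_le2// divr_ge0// ltW.
Qed.

Let ccut : continuous (cutoff S).
Proof. by move=> u; exact: drv_continuous (drv_cutoff S0 u). Qed.

Let mcut : measurable_fun setT (fun x => cutoff S (D x w)).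
Proof. by apply: (measurableT_comp (continuous_measurable_fun ccut)); meas. Qed.

Let mcut' : measurable_fun setT (fun x => cutoff' S (D x w)).
Proof. by apply: (measurableT_comp (continuous_measurable_fun (@cts_cutoff' _ S))); meas. Qed.

Lemma measurable_wsing : measurable_fun setT wsing.
Proof. by apply: measurable_funM => //; meas. Qed.

(** The field vanishes at [v], so that a density concentrated at [v] hardly
    feels the vortex at [w]. *)
Lemma Rint_wsing f tau : itg (@area R) f -> (forall x, 0 <= f x) -> 0 < tau ->
  itg (@area R) (fun x => `|wsing x| * f x) /\
  \int[@area R]_x (`|wsing x| * f x) <= 8 / S ^+ 2 * Num.sqrt tau * \int[@area R]_x f x
    + 4 / S ^+ 2 * (\int[@area R]_x f x - mass v f tau).
Proof.
move=> iF f0 tau0; have mw := measurable_wsing; have q0 := sqrtr_ge0 tau.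
have iw : itg (@area R) (fun x => `|wsing x| * f x).
  apply: (itgMb (C := 4 / S ^+ 2)) => //; first exact: measurableT_comp.
  by move=> x; rewrite normr_id; exact: wsing_bound.
have ii := itg_ind v tau iF; split => //.
rewrite /mass -(RintB iF ii) -(RintZ _ iF) -(RintZ _ (itgB iF ii)) -(RintD (itgZ _ iF) (itgZ _ (itgB iF ii))).
apply: le_Rint => //; first exact: itgD (itgZ _ iF) (itgZ _ (itgB iF ii)).
move=> x; have [h|h] := leP (D x v) tau; last first.
  rewrite mul0r subr0 -mulrDl ler_wpM2r// (le_trans (wsing_bound x))// lerDr mulr_ge0// divr_ge0//.
  exact: ltW.
rewrite mul1r subrr mulr0 addr0 ler_wpM2r//; apply: (le_trans (wsing_le x)).
rewrite (_ : 8 / S ^+ 2 * Num.sqrt tau = 2 / S ^+ 2 * (4 * Num.sqrt tau)); last by ring.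
rewrite ler_wpM2l ?divr_ge0 ?(ltW T0)//; apply: (le_trans (Bk_bound2 v x w)).
have h1 : Num.sqrt (D v x) <= Num.sqrt tau by rewrite ler_wsqrtr// DC.
have h2 : Num.sqrt (D x w) <= 2.
  by rewrite -(ler_sqr (x := Num.sqrt (D x w))) ?nnegrE ?sqrtr_ge0// sqr_sqrtr ?D_ge0//; have := D_le2 x w; lra.
rewrite (_ : 4 * Num.sqrt tau = 2 * Num.sqrt tau * 2); last by ring.
by apply: ler_pM; rewrite ?mulr_ge0 ?sqrtr_ge0// ler_wpM2l.
Qed.

Definition vterm (a : 'I_3 -> R) (f : sphere R -> R) x : R :=
  f x * (2 * sdot v x * cutoff S (D x w) + cutoff' S (D x w) * Bk v x w
     + cutoff S (D x w) * \sum_(m < 3) a m * (Bk v x (p m) / D x (p m))).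

(** At the poles of the field the kernel is not singular: the vortices there act
    with the strengths [1 + sdot v x] and [- (1 - sdot v x)]. *)
Lemma vortex_terms a f : (forall m, -1 < a m <= 0) -> itg (@area R) f -> (forall x, 0 <= f x) ->
  `|\int[@area R]_x vterm a f x - ((2 + a ord0 + a (inord 1)) * height f
     + (a ord0 - a (inord 1)) * \int[@area R]_x f x)|
  <= (6 + 3 / S) * mass w f (S ^+ 2) + `|a ord_max| * \int[@area R]_x (`|wsing x| * f x).
Proof.
move=> a0 iF f0; have mf := itg_measurable iF.
have [iw _] := Rint_wsing iF f0 ltr01; have is_ := itg_s iF; have ii := itg_ind w (S ^+ 2) iF.
pose l0 x := (2 + a ord0 + a (inord 1)) * (sdot v x * f x) + (a ord0 - a (inord 1)) * f x.
have il0 : itg (@area R) l0 by apply: itgD; exact: itgZ.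
pose er x := (6 + 3 / S) * ((D x w <= S ^+ 2)%R%:R * f x) + `|a ord_max| * (`|wsing x| * f x).
have ier : itg (@area R) er by apply: itgD; exact: itgZ.
have bE : {ae @area R, forall x, `|vterm a f x - l0 x| <= er x}.
  have h := ae_mono2 (fun x => @conj _ _) (ae_D_neq v 0) (ae_D_neq (p (inord 1)) 0).
  apply: ae_mono h => x [xv x1].
  have sv : D x v = 1 - sdot v x by rewrite DC.
  have s1 : D x (p (inord 1)) = 1 + sdot v x by rewrite DC /D sdot_anti opprK.
  have v0 : 1 - sdot v x != 0 by rewrite -sv DC; apply/eqP.
  have v1 : 1 + sdot v x != 0 by rewrite -s1 DC; apply/eqP.
  have B0 : Bk v x v / D x v = 1 + sdot v x.
    by rewrite Bk_self sv (DC v x) sv; field.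
  have B1 : Bk v x (p (inord 1)) / D x (p (inord 1)) = - (1 - sdot v x).
    rewrite s1 /Bk (sdotC v) (sdotC x) !sdot_anti sdot1; field.
    exact: v1.
  have E : vterm a f x - l0 x = f x * (- (bump S (D x w) * (2 * sdot v x + a ord0 * (1 + sdot v x) + a (inord 1) * - (1 - sdot v x)))
      + cutoff' S (D x w) * Bk v x w + a ord_max * wsing x).
    rewrite /vterm /l0 /wsing 3!big_ord_recr big_ord0 /= add0r.
    rewrite (_ : widen_ord _ (widen_ord _ ord_max) = ord0); last exact: val_inj.
    rewrite (_ : widen_ord _ ord_max = inord 1); last by apply: val_inj; rewrite /= inordK.
    rewrite B0 B1; have -> : bump S (D x w) = 1 - cutoff S (D x w) by rewrite /cutoff; ring.
    ring.
  rewrite E normrM (ger0_norm (f0 x)) /er [leRHS](_ : _ = f x * ((6 + 3 / S) * (D x w <= S ^+ 2)%R%:R + `|a ord_max| * `|wsing x|)); last by ring.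
  rewrite ler_wpM2l//; apply: nbD; last by rewrite normrM.
  have D0 := D_ge0 x w; have bi := bump_ind S0 D0; have /andP[b0 b1] := bump01 S0 D0.
  have sN := norm_sdot v x.
  have na m : `|a m| <= 1 by have := a0 m; rewrite ler_norml; lra.
  rewrite [leRHS]mulrDl; apply: nbD.
    rewrite normrN mulrC; apply: nbM; last by rewrite ger0_norm.
    rewrite (_ : 6 = 2 * 1 + 1 * (1 + 1) + 1 * (1 + 1) :> R); last by lra.
    apply: nbD; first apply: nbD.
    - by apply: nbM => //; rewrite ger0_norm.
    - by apply: nbM => //; apply: nbD => //; rewrite normr1.
    - by apply: nbM => //; rewrite normrN; apply: nbD; rewrite ?normrN// normr1.
  have /andP[k0 k1] := cutoff'_bound S0 D0.
  have [hw|hw] := leP (D x w) (S ^+ 2); last first.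
    rewrite mulr0; move: k1; rewrite (lt_geF hw) mulr0 => k1.
    by rewrite (_ : cutoff' S (D x w) = 0) ?mul0r ?normr0//; apply/eqP; rewrite eq_le k1.
  rewrite mulr1; move: k1; rewrite hw mulr1 => k1.
  have hB := Bk_bound v x w.
  have hB2 : `|Bk v x w| <= 3 / 2 * S.
    apply: (le_trans hB); apply: (@le_trans _ _ (1 * (3 / 2 * S))); last by rewrite mul1r.
    apply: ler_pM; rewrite ?mulr_ge0 ?sqrtr_ge0 ?sqrt_sdot2_le1//.
    apply: ler_pM; rewrite ?sqrtr_ge0//.
      by rewrite -(ler_sqr (x := Num.sqrt 2)) ?nnegrE ?sqrtr_ge0 ?divr_ge0// sqr_sqrtr//; lra.
    by rewrite -(ler_sqr (x := Num.sqrt (D x w))) ?nnegrE ?sqrtr_ge0 ?(ltW S0)// sqr_sqrtr.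
  rewrite (_ : 3 / S = 2 / S ^+ 2 * (3 / 2 * S)); last by field; exact: lt0r_neq0.
  by apply: nbM => //; rewrite ger0_norm.
have iv : itg (@area R) (vterm a f).
  apply: (@itg_le_ae _ _ _ _ (fun x => `|l0 x| + er x)).
  - apply: measurable_funM => //; apply: measurable_funD.
      by apply: measurable_funD; apply: measurable_funM => //; meas.
    by apply: measurable_funM => //; apply: measurable_sum => m; meas.
  - apply: ae_mono bE => x h; rewrite -[X in `|X|](subrK (l0 x)) addrC.
    by apply: (le_trans (ler_normD _ _)); rewrite lerD2l.
  - by apply: itgD => //; exact: itg_norm.
rewrite /height -(RintZ _ is_) -(RintZ _ iF) -(RintD (itgZ _ is_) (itgZ _ iF)) -(RintB iv il0).
have iD := itgB iv il0; apply: (le_trans (normr_Rint iD)).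
rewrite /mass -(RintZ _ ii) -(RintZ _ iw) -(RintD (itgZ _ ii) (itgZ _ iw)).
by apply: le_Rint_ae => //; exact: itg_norm.
Qed.

End balance.

(** * The contradiction *)

Section no_concentration.
Variable R : realType.

(** With [R2], [M2] close to [be], the balance is the sum of two nonnegative
    terms, [(A + be - R1) * (R1 + M1)] and [(R1 - B) * (R1 - M1)], whose
    coefficients are at least [de]. *)
Lemma balance_arith (A B be R1 R2 M1 M2 de k k' e : R) :
  `|(A + B) * M1 + (A - B) * R1 + 2 * be * M2 - 2 * (M1 * R1) - 2 * (M2 * R2) + (M1 * R2 + R1 * M2)| <= e ->
  0 < R1 <= 1 -> 0 <= R2 <= 1 -> `|M1| <= R1 -> `|M2| <= R2 -> 0 <= R2 - M2 <= k -> be < R2 < be + k' ->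
  de <= A + be - R1 -> de <= R1 - B -> 2 * de * R1 <= e + 4 * k' + k.
Proof.
rewrite !ler_norml => /andP[_ h1] /andP[R10 R11] /andP[R20 R21] /andP[m1 m1'] /andP[m2 m2'] /andP[k0 kk] /andP[b1 b2] d1 d2.
have main : 2 * de * R1 <= (A + B - 2 * R1 + be) * M1 + (A - B + be) * R1.
  have -> : (A + B - 2 * R1 + be) * M1 + (A - B + be) * R1 = (A + be - R1) * (R1 + M1) + (R1 - B) * (R1 - M1) by ring.
  have k1 : de * (R1 + M1) <= (A + be - R1) * (R1 + M1) by rewrite ler_wpM2r//; lra.
  have k2 : de * (R1 - M1) <= (R1 - B) * (R1 - M1) by rewrite ler_wpM2r//; lra.
  by lra.
have e1 : (A + B) * M1 + (A - B) * R1 + 2 * be * M2 - 2 * (M1 * R1) - 2 * (M2 * R2) + (M1 * R2 + R1 * M2) =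
  (A + B - 2 * R1 + be) * M1 + (A - B + be) * R1 + (- (2 * ((R2 - be) * M2)) + (R2 - be) * M1 - R1 * (be - M2)) by ring.
have p0 : 0 <= R2 - be by lra.
have j1 : (R2 - be) * M2 <= k'.
  by apply: le_trans (_ : (R2 - be) * 1 <= _); [rewrite ler_wpM2l//; lra|lra].
have j2 : - k' <= (R2 - be) * M1.
  by apply: le_trans (_ : (R2 - be) * -1 <= _); [lra|rewrite ler_wpM2l//; lra].
have j3 : R1 * (be - M2) <= k + k'.
  have [h|h] := leP 0 (be - M2); first by apply: (@le_trans _ _ (1 * (be - M2))); [rewrite ler_wpM2r|lra].
  by apply: (@le_trans _ _ 0); [rewrite mulr_ge0_le0 ?ltW|lra].
by lra.
Qed.

Lemma balance_sum (A B be eps H R1 R2 M1 M2 n1 n2 I11 I12 I21 I22 c : R) :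
  `|I11 + I11 - (M1 * R1 + R1 * M1)| <= (2 + c) * (n1 * R1 + R1 * n1) ->
  `|I22 + I22 - (M2 * R2 + R2 * M2)| <= (2 + c) * (n2 * R2 + R2 * n2) ->
  `|I12 + I21 - (M1 * R2 + R1 * M2)| <= (2 + c) * (n1 * R2 + R1 * n2) ->
  `|2 * I11 - I12 - ((2 + (A - 1) + (B - 1)) * M1 + (A - 1 - (B - 1)) * R1)| <= (6 + c / 2) * n1 ->
  `|2 * I22 - I21 - ((2 + (be - 1) + (be - 1)) * M2 + (be - 1 - (be - 1)) * R2)| <= (6 + c / 2) * n2 + `|eps - 1| * H ->
  `|eps - 1| <= 1 -> 0 <= H -> R1 <= 1 -> R2 <= 1 -> 0 <= R1 -> 0 <= R2 -> 0 <= n1 -> 0 <= n2 -> 0 <= c ->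
  `|(A + B) * M1 + (A - B) * R1 + 2 * be * M2 - 2 * (M1 * R1) - 2 * (M2 * R2) + (M1 * R2 + R1 * M2)|
   <= (12 + c * (7 / 2)) * (n1 + n2) + H.
Proof.
move=> h11 h22 h12 v1 v2 ne H0 R11 R21 R10 R20 n10 n20 c0.
have hH : `|eps - 1| * H <= H by rewrite ler_piMl.
have c2 : 0 <= 2 + c by lra.
have pr (n r : R) : 0 <= n -> r <= 1 -> n * r <= n by move=> ? ?; rewrite ler_piMr.
have q1 : (2 + c) * (n1 * R1 + R1 * n1) <= (2 + c) * (2 * n1).
  by rewrite ler_wpM2l//; have := pr _ _ n10 R11; lra.
have q2 : (2 + c) * (n2 * R2 + R2 * n2) <= (2 + c) * (2 * n2).
  by rewrite ler_wpM2l//; have := pr _ _ n20 R21; lra.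
have q3 : (2 + c) * (n1 * R2 + R1 * n2) <= (2 + c) * (n1 + n2).
  by rewrite ler_wpM2l//; have := pr _ _ n10 R21; have := pr _ _ n20 R11; lra.
move: h11 h22 h12 v1 v2; rewrite !ler_norml => /andP[? ?] /andP[? ?] /andP[? ?] /andP[? ?] /andP[? ?].
apply/andP; split; lra.
Qed.

Lemma final_arith (S k X : R) : 0 < S -> S * (33 * k + 50) <= X -> 0 < X ->
  ~ 2 * X <= 33 * k * S + 16 * S + 4 * S + 5 * S.
Proof. by move=> S0 h X0 h2; lra. Qed.

Variables (p : 'I_3 -> sphere R).
Hypotheses (pp : forall m m', m != m' -> p m <> p m') (anti : pt (p (inord 1)) = - pt (p ord0)).

Local Notation v := (p ord0).
Local Notation w := (p ord_max).

(** The sum of the two virial identities for the axis, the interactions being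
    symmetrised by [kernel_height]. *)
Lemma balance (S A B be eps gam C1 C2 : R) (f1 f2 : sphere R -> R) : 0 < S -> S <= 1 ->
  toda_pair p (triple (A - 1) (B - 1) 0) (triple (be - 1) (be - 1) (eps - 1)) C1 C2 f1 f2 gam ->
  `|(A + B) * height p f1 + (A - B) * \int[@area R]_x f1 x + 2 * be * height p f2
    - 2 * (height p f1 * \int[@area R]_x f1 x) - 2 * (height p f2 * \int[@area R]_x f2 x)
    + (height p f1 * \int[@area R]_x f2 x + \int[@area R]_x f1 x * height p f2)|
  <= (12 + 21 / S) * (mass w f1 (S ^+ 2) + mass w f2 (S ^+ 2))
     + \int[@area R]_x (`|wsing p S x| * f2 x).
Proof.
move=> S0 S1 tp; have i1 := tp_i1 tp; have i2 := tp_i2 tp; have f10 := tp_f1 tp; have f20 := tp_f2 tp.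
have a10 := tp_a1 tp; have a20 := tp_a2 tp.
have cc' : continuous (cutoff' S) by exact: cts_cutoff'.
have [k11 k12 E1] := virial a10 pp i1 i2 f20 (tp_E1 tp) (drv_cutoff S0) cc' (cutoff_sing S0 anti).
have [k22 k21 E2] := virial a20 pp i2 i1 f10 (tp_E2 tp) (drv_cutoff S0) cc' (cutoff_sing S0 anti).
have h11 := kernel_height S0 i1 i1 f10 f10 k11 k11.
have h22 := kernel_height S0 i2 i2 f20 f20 k22 k22.
have h12 := kernel_height S0 i1 i2 f10 f20 k12 k21.
have v1 := vortex_terms S0 anti a10 i1 f10; have v2 := vortex_terms S0 anti a20 i2 f20.
have T1 : \int[@area R]_x vterm p S (triple (A - 1) (B - 1) 0) f1 x =
   2 * \int[(@area R \x @area R)%E]_z kcut p S f1 f1 z - \int[(@area R \x @area R)%E]_z kcut p S f1 f2 z := E1.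
have T2 : \int[@area R]_x vterm p S (triple (be - 1) (be - 1) (eps - 1)) f2 x =
   2 * \int[(@area R \x @area R)%E]_z kcut p S f2 f2 z - \int[(@area R \x @area R)%E]_z kcut p S f2 f1 z := E2.
rewrite {}T1 in v1; rewrite {}T2 in v2.
have e0 (a b c : R) : triple a b c (ord0 : 'I_3) = a by [].
have e1 (a b c : R) : triple a b c (inord 1 : 'I_3) = b by rewrite /triple inordK.
have e2 (a b c : R) : triple a b c (ord_max : 'I_3) = c by [].
rewrite !e0 !e1 !e2 normr0 mul0r addr0 in v1; rewrite !e0 !e1 !e2 in v2.
have ne : `|eps - 1| <= 1 by have := a20 ord_max; rewrite e2 ler_norml; lra.
have H0 : 0 <= \int[@area R]_x (`|wsing p S x| * f2 x) by apply: Rint_ge0 => x; rewrite mulr_ge0.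
have R11 := tp_m1 tp; have R21 := tp_m2 tp.
have R10 : 0 <= \int[@area R]_x f1 x by exact: Rint_ge0.
have R20 : 0 <= \int[@area R]_x f2 x by exact: Rint_ge0.
have n1 := mass_ge0 w (S ^+ 2) f10; have n2 := mass_ge0 w (S ^+ 2) f20.
have c0 : 0 <= 6 / S by rewrite divr_ge0// ltW.
have c3 : 3 / S = 6 / S / 2 by field; exact: lt0r_neq0.
have c21 : 21 / S = 6 / S * (7 / 2) by field; exact: lt0r_neq0.
rewrite c3 in v1 v2; rewrite c21.
move: h11 h22 h12 v1 v2 ne H0 R11 R21 R10 R20 n1 n2 c0.
move: (\int[_]_x (`|_| * _)) (\int[_]_x f1 x) (\int[_]_x f2 x) (height p f1) (height p f2) (mass w f1 _) (mass w f2 _)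
  (\int[_]_z kcut p S f1 f1 z) (\int[_]_z kcut p S f1 f2 z) (\int[_]_z kcut p S f2 f1 z) (\int[_]_z kcut p S f2 f2 z)
  (6 / S) => H R1 R2 M1 M2 n1 n2 I11 I12 I21 I22 c.
exact: balance_sum.
Qed.

(** A density concentrated at [v] has a height close to its mass. *)
Lemma height_le (f : sphere R -> R) tau : itg (@area R) f -> (forall x, 0 <= f x) -> 0 < tau ->
  `|height p f| <= \int[@area R]_x f x /\
  0 <= \int[@area R]_x f x - height p f <= tau * \int[@area R]_x f x + 2 * (\int[@area R]_x f x - mass v f tau).
Proof.
move=> iF f0 tau0; have ii := itg_ind v tau iF.
have is_ : itg (@area R) (fun x => sdot v x * f x).
  apply: (itgMb (C := 1)) => // [|x]; last exact: norm_sdot.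
  by meas.
split.
  apply: (le_trans (normr_Rint is_)); apply: le_Rint => //; first exact: itg_norm.
  by move=> x; rewrite normrM (ger0_norm (f0 x)) ler_piMl// norm_sdot.
rewrite /height /mass -(RintB iF ii) -(RintZ _ (itgB iF ii)) -(RintB iF is_) -(RintZ _ iF).
rewrite -(RintD (itgZ _ iF) (itgZ _ (itgB iF ii))); apply/andP; split.
  by apply: Rint_ge0 => x; rewrite subr_ge0 ler_piMl// sdot_le1.
apply: le_Rint; [exact: itgB|exact: itgD (itgZ _ iF) (itgZ _ (itgB iF ii))|move=> x].
have e : f x - sdot v x * f x = D x v * f x by rewrite DC /D; ring.
rewrite e; have [h|h] := leP (D x v) tau.
  by rewrite mul1r subrr mulr0 addr0 ler_wpM2r.
rewrite mul0r subr0 -mulrDl ler_wpM2r// (le_trans (D_le2 _ _))// lerDr ltW//.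
Qed.

(** The errors in the balance come from the neighbourhood of [w], of size [S ^+
    2], in which [f1] has a mass of order [S ^+ 2] by [inner_mass]; as the
    kernel is of order [1 / S] there, its effect is of order [S]. The
    concentration of [f2] at the scale [S ^+ 8] makes the other errors smaller.
    *)
Theorem no_concentration (A B be r1 gam : R) : 0 < gam -> 0 < r1 -> 0 < be -> B < r1 -> r1 < A + be ->
  exists2 tau, 0 < tau & forall eps r2 C1 C2 f1 f2, 0 < eps <= tau ->
    toda_pair p (triple (A - 1) (B - 1) 0) (triple (be - 1) (be - 1) (eps - 1)) C1 C2 f1 f2 gam ->
    \int[@area R]_x f1 x = r1 -> \int[@area R]_x f2 x = r2 -> be < r2 < be + eps ->
    ~ be - tau <= mass v f2 tau.
Proof.
move=> g0 r10 be0 Br rA; have [t' [t'0 t'1 sep']] := separation pp.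
pose t0 := t' / 4; have t00 : 0 < t0 by rewrite divr_gt0.
have t04 : t0 <= 4^-1 by rewrite ler_pdivrMr// mulVf.
have sep m m' : m != m' -> 8 * t0 <= D (p m) (p m').
  by move=> /sep' h; rewrite /t0; have := D_ge0 (p m) (p m'); lra.
clearbody t0.
pose de := Num.min (A + be - r1) (r1 - B).
have de0 : 0 < de by rewrite lt_min !subr_gt0 rA.
have d1 : de <= A + be - r1 by rewrite ge_min lexx.
have d2 : de <= r1 - B by rewrite ge_min lexx orbT.
clearbody de.
pose M := 33 * (mass_cst gam / t0 + 2) + 50.
have mc : 0 < mass_cst gam / t0 by apply: divr_gt0 => //; exact: mass_cst_gt0.
have M0 : 0 < M by rewrite /M; lra.
pose S := Num.min (Num.min 1 t0) (de * r1 / M).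
have S0 : 0 < S by rewrite !lt_min ltr01 t00 divr_gt0// mulr_gt0.
have S1 : S <= 1 by rewrite !ge_min lexx.
have St : S <= t0 by rewrite !ge_min lexx orbT.
have SM : S * M <= de * r1 by rewrite -ler_pdivlMr// !ge_min lexx orbT.
clearbody S.
have T0 : 0 < S ^+ 2 by exact: exprn_gt0.
have Tt : S ^+ 2 <= t0 by apply: le_trans St; rewrite expr2 ler_piMl// ltW.
have tau0 : 0 < S ^+ 8 by exact: exprn_gt0.
have tauT : S ^+ 8 <= S ^+ 2 by rewrite ler_wiXn2l ?(ltW S0).
have TS : S ^+ 2 <= S by rewrite expr2 ler_piMl// ltW.
exists (S ^+ 8) => //; set tau := S ^+ 8 in tau0 tauT *.
move=> eps r2 C1 C2 f1 f2 /andP[eps0 epst] tp I1 I2 /andP[r2b r2e] conc.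
have i1 := tp_i1 tp; have i2 := tp_i2 tp; have f10 := tp_f1 tp; have f20 := tp_f2 tp.
have far m k : p k <> p m -> 8 * t0 <= D (p m) (p k).
  by move=> pk; apply: sep; apply/eqP => e; apply: pk; rewrite e.
have q1 : alq w p (triple (A - 1) (B - 1) 0) = 0 by rewrite alq_vortex.
have q2 : 1 + alq w p (triple (be - 1) (be - 1) (eps - 1)) = eps.
  by rewrite alq_vortex// /triple /=; ring.
have n1 := inner_mass tp t00 t04 (far ord_max) q1 q2 eps0 T0 Tt.
have n2 : mass w f2 (S ^+ 2) <= r2 - mass v f2 tau.
  rewrite lerBrDr -I2 -RintD; [|exact: itg_ind|exact: itg_ind].
  apply: le_Rint => //; first by apply: itgD; exact: itg_ind.
  move=> x; have [h|h] := leP (D x w) (S ^+ 2); last first.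
    by rewrite mul0r add0r ler_piMl// -[leRHS]/(1%:R) ler_nat leq_b1.
  have vw : v <> w by apply: pp.
  have h2 := far _ _ vw; have h3 := D_quasi w x v; rewrite (DC w x) in h3.
  have h4 : tau < D x v by move: (D x v) (D x w) (D w v) h h2 h3 => *; lra.
  by rewrite (lt_geF h4) mul0r addr0 mul1r.
have n2' : mass w f2 (S ^+ 2) <= 2 * tau by clear -n2 conc r2e epst; lra.
have H := (Rint_wsing p S0 i2 f20 tau0).2; rewrite I2 in H.
have E := balance S0 S1 tp; rewrite I1 I2 in E.
have [hh1 _] := height_le i1 f10 tau0; rewrite I1 in hh1.
have [hh2 hk] := height_le i2 f20 tau0; rewrite I2 in hh2 hk.
have R11 := tp_m1 tp; have R21 := tp_m2 tp; rewrite I1 in R11; rewrite I2 in R21.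
have r20 : 0 <= r2 by clear -be0 r2b; lra.
have sq : Num.sqrt tau = S ^+ 4.
  by rewrite /tau (_ : S ^+ 8 = (S ^+ 4) ^+ 2) ?sqrtr_sqr ?ger0_norm ?exprn_ge0 ?(ltW S0)//; ring.
have hk' : 0 <= r2 - height p f2 <= 5 * S.
  have /andP[u0 u1] := hk; rewrite u0 /=; apply: (le_trans u1).
  have : tau * r2 <= tau by rewrite ler_piMr// ltW.
  by clear -tauT TS conc r2e epst; lra.
have H' : \int[@area R]_x (`|wsing p S x| * f2 x) <= 16 * S.
  apply: (le_trans H); rewrite sq.
  have -> : 16 * S = 8 * S + 8 * S by ring.
  apply: lerD.
    rewrite (_ : 8 / S ^+ 2 * S ^+ 4 = 8 * S ^+ 2); last by field; exact: lt0r_neq0.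
    apply: (@le_trans _ _ (8 * S ^+ 2)); last by rewrite ler_wpM2l.
    by rewrite ler_piMr// mulr_ge0// ltW.
  apply: (@le_trans _ _ (4 / S ^+ 2 * (2 * tau))).
    by rewrite ler_wpM2l ?divr_ge0 ?(ltW T0)//; clear -conc r2e epst; lra.
  rewrite /tau (_ : 4 / S ^+ 2 * (2 * S ^+ 8) = 8 * S ^+ 6); last by field; exact: lt0r_neq0.
  by rewrite ler_wpM2l// -[leRHS]expr1 ler_wiXn2l ?(ltW S0).
have N : (12 + 21 / S) * (mass w f1 (S ^+ 2) + mass w f2 (S ^+ 2)) <= 33 * (mass_cst gam / t0 + 2) * S.
  have c1 : 12 + 21 / S <= 33 / S.
    have : 1 <= 1 / S by rewrite ler_pdivlMr// mul1r.
    by rewrite (_ : 33 / S = 12 * (1 / S) + 21 / S) => [h|]; [rewrite lerD2r ler_peMr|field; exact: lt0r_neq0].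
  have c2 : mass w f1 (S ^+ 2) + mass w f2 (S ^+ 2) <= (mass_cst gam / t0 + 2) * S ^+ 2.
    rewrite mulrDl; apply: lerD; first by rewrite mulrAC -mulrA.
    by apply: (le_trans n2'); rewrite ler_wpM2l.
  apply: (@le_trans _ _ (33 / S * ((mass_cst gam / t0 + 2) * S ^+ 2))).
    apply: ler_pM => //; last by rewrite addr_ge0 ?mass_ge0.
    by rewrite addr_ge0// divr_ge0// ltW.
  by rewrite le_eqVlt; apply/orP; left; apply/eqP; field; rewrite !lt0r_neq0.
have Etot := le_trans E (lerD N H').
have b1 : 0 < r1 <= 1 by rewrite r10.
have b2 : 0 <= r2 <= 1 by rewrite r20.
have b3 : be < r2 < be + S.
  by rewrite r2b (lt_le_trans r2e)// lerD2l (le_trans epst)// (le_trans tauT).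
have := balance_arith Etot b1 b2 hh1 hh2 hk' b3 d1 d2.
have dr : 0 < de * r1 by rewrite mulr_gt0.
rewrite -(mulrA 2 de r1); exact: final_arith.
Qed.

End no_concentration.

Section assembly.
Variable R : realType.

Lemma rho_barP (a : 'I_3 -> R) (rho : R) : rho < rho_bar a ->
  rho / (4 * pi) < 1 /\ forall m m', m != m' -> rho / (4 * pi) < 2 + a m + a m'.
Proof.
have p4 : 0 < 4 * pi :> R by rewrite mulr_gt0 ?pi_gt0.
rewrite /rho_bar mulrC -ltr_pdivrMr// => h; split.
  apply: lt_le_trans h _; exact: bigmin_le_id.
move=> m m' mm'; apply: lt_le_trans h _.
exact: (@bigmin_le_cond _ _ _ 1 (m, m') (fun z : 'I_3 * 'I_3 => z.1 != z.2) (fun z => 2 + a z.1 + a z.2)).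
Qed.

Lemma triple0 (T : Type) (a b c : T) : triple a b c ord0 = a. Proof. by []. Qed.
Lemma triple1 (T : Type) (a b c : T) : triple a b c (inord 1) = b. Proof. by rewrite /triple inordK. Qed.
Lemma triple2 (T : Type) (a b c : T) : triple a b c ord_max = c. Proof. by []. Qed.

Lemma ord3P (P : 'I_3 -> Prop) : P ord0 -> P (inord 1) -> P ord_max -> forall m, P m.
Proof.
move=> h0 h1 h2 [[|[|[|//]]] hm].
- by rewrite (_ : Ordinal hm = ord0)//; exact: val_inj.
- by rewrite (_ : Ordinal hm = inord 1)//; apply: val_inj; rewrite /= inordK.
- by rewrite (_ : Ordinal hm = ord_max)//; exact: val_inj.
Qed.

Lemma sum3 (F : 'I_3 -> R) : \sum_(m < 3) F m = F ord0 + F (inord 1) + F ord_max.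
Proof.
rewrite !big_ord_recr big_ord0 /= add0r; congr (F _ + F _ + _); apply: val_inj => //=.
by rewrite inordK.
Qed.

Lemma triple_inj (p1 p2 p3 : sphere R) : p1 <> p2 -> p1 <> p3 -> p2 <> p3 ->
  forall m m' : 'I_3, m != m' -> triple p1 p2 p3 m <> triple p1 p2 p3 m'.
Proof.
move=> p12 p13 p23; apply: ord3P; apply: ord3P; rewrite ?eqxx ?triple0 ?triple1 ?triple2// => _ //; exact: nesym.
Qed.

Lemma vort_swap (a b c : R) (p1 p2 p3 : sphere R) C f g x :
  vort (triple b a c) (triple p2 p1 p3) C f g x = vort (triple a b c) (triple p1 p2 p3) C f g x.
Proof. by rewrite /vort !sum3 !triple0 !triple1 !triple2 [X in C + (X + _)]addrC. Qed.

Lemma toda_pair_swap (a b c a' b' c' C1 C2 gam : R) (p1 p2 p3 : sphere R) f1 f2 :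
  toda_pair (triple p1 p2 p3) (triple a b c) (triple a' b' c') C1 C2 f1 f2 gam ->
  toda_pair (triple p2 p1 p3) (triple b a c) (triple b' a' c') C1 C2 f1 f2 gam.
Proof.
case=> h1 h2 pp i1 i2 g0 l1 l2 E1 E2.
have n01 : (ord0 : 'I_3) != inord 1 by rewrite -val_eqE /= inordK.
have n12 : (inord 1 : 'I_3) != ord_max by rewrite -val_eqE /= inordK.
have p12 := pp _ _ n01; rewrite triple0 triple1 in p12.
have p13 := pp ord0 ord_max isT; rewrite triple0 triple2 in p13.
have p23 := pp _ _ n12; rewrite triple1 triple2 in p23.
split; last 2 first.
- by move=> x; rewrite vort_swap.
- by move=> x; rewrite vort_swap.
- by apply: ord3P; [have := h1 (inord 1)|have := h1 ord0|have := h1 ord_max]; rewrite ?triple0 ?triple1 ?triple2.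
- by apply: ord3P; [have := h2 (inord 1)|have := h2 ord0|have := h2 ord_max]; rewrite ?triple0 ?triple1 ?triple2.
- by apply: triple_inj => //; exact: nesym.
- exact: i1.
- exact: i2.
- exact: g0.
- exact: l1.
- exact: l2.
Qed.

(** The statement is symmetric in the first two vortices, so that
    [concentration] may be assumed to occur at either. *)
Theorem no_toda_pair (p1 p2 p3 : sphere R) (A B be r1 gam : R) : p1 <> p2 -> p1 <> p3 -> p2 <> p3 ->
  pt p2 = - pt p1 -> 0 < gam -> 0 < A -> 0 < B -> 0 < be -> 0 < r1 -> A < r1 -> B < r1 -> r1 < A + B ->
  r1 < A + be -> r1 < B + be ->
  exists2 e0, 0 < e0 & forall eps r2 C1 C2 f1 f2, 0 < eps < e0 ->
    \int[@area R]_x f1 x = r1 -> \int[@area R]_x f2 x = r2 -> be < r2 < be + eps ->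
    ~ toda_pair (triple p1 p2 p3) (triple (A - 1) (B - 1) 0) (triple (be - 1) (be - 1) (eps - 1)) C1 C2 f1 f2 gam.
Proof.
move=> p12 p13 p23 anti g0 A0 B0 be0 r10 Ar Br rAB rA rB.
pose p := triple p1 p2 p3; pose p' := triple p2 p1 p3.
have pp : forall m m', m != m' -> p m <> p m' by exact: triple_inj.
have pp' : forall m m', m != m' -> p' m <> p' m' by apply: triple_inj => //; exact: nesym.
have an : pt (p (inord 1)) = - pt (p ord0) by rewrite /p triple1 triple0.
have an' : pt (p' (inord 1)) = - pt (p' ord0) by rewrite /p' triple1 triple0 anti opprK.
have [t1 t10 H1] := no_concentration pp an g0 r10 be0 Br rA.
have [t2 t20 H2] := no_concentration pp' an' g0 r10 be0 Ar rB.
pose tau := Num.min t1 t2; have tau0 : 0 < tau by rewrite lt_min t10.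
have [e0 e00 H] := concentration pp A0 B0 be0 g0 tau0 rAB.
exists (Num.min e0 tau); first by rewrite lt_min e00.
move=> eps r2 C1 C2 f1 f2 /andP[eps0]; rewrite lt_min => /andP[epse /ltW epst] I1 I2 r2b tp.
have t1t : tau <= t1 by rewrite ge_min lexx.
have t2t : tau <= t2 by rewrite ge_min lexx orbT.
have i2 := tp_i2 tp; have f20 := tp_f2 tp.
have eps0e : 0 < eps < e0 by rewrite eps0.
have [h|h] := H eps r2 C1 C2 f1 f2 eps0e tp I1 I2 r2b.
- have e1 : 0 < eps <= t1 by rewrite eps0 (le_trans epst).
  apply: (H1 eps r2 C1 C2 f1 f2 e1 tp I1 I2 r2b).
  by apply: le_trans (le_trans h (mass_mono (p ord0) i2 f20 t1t)); rewrite lerD2l lerN2.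
- have e2 : 0 < eps <= t2 by rewrite eps0 (le_trans epst).
  apply: (H2 eps r2 C1 C2 f1 f2 e2 (toda_pair_swap tp) I1 I2 r2b).
  rewrite {1}/p' triple0; rewrite {1}/p triple1 in h.
  by apply: le_trans (le_trans h (mass_mono p2 i2 f20 t2t)); rewrite lerD2l lerN2.
Qed.

End assembly.

Theorem theorem1p6 (R : realType) (G : sphere R -> sphere R -> R)
    (hG : forall p, is_green p (G p))
    (p1 p2 p3 : sphere R)
    (p12 : p1 <> p2) (p13 : p1 <> p3) (p23 : p2 <> p3)
    (antipodal : pt p2 = - pt p1)
    (a11 a12 a13 a21 a22 rho1 : R)
    (ha11 : -1 < a11) (ha12 : -1 < a12) (ha13 : a13 = 0)
    (ha21 : -1 < a21) (ha22 : -1 < a22)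
    (rho1_gt0 : 0 < rho1)
    (hrho1_1 : 4 * pi * (1 + a11) < rho1 <
       Num.min (rho_bar (triple a11 a12 a13)) (4 * pi * (2 + a11 + a21)))
    (hrho1_2 : 4 * pi * (1 + a12) < rho1 <
       Num.min (rho_bar (triple a11 a12 a13)) (4 * pi * (2 + a12 + a22))) :
  exists a_star : R, -1 < a_star < 0 /\
    forall a23 rho2 : R,
      let a1 := triple a11 a12 a13 in
      let a2 := triple a21 a22 a23 in
      let p := triple p1 p2 p3 in
      -1 < a23 <= a_star ->
      (forall m : 'I_3, 4 * pi * (1 + a2 m) < rho2 <
         Num.min (rho_bar a2) (4 * pi * (2 + a1 m + a2 m))) ->
      ~ exists u1 u2 : sphere R -> R,
          toda_solution (h_tilde G p a1) (h_tilde G p a2) rho1 rho2 u1 u2.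
Proof.
have p4 : 0 < 4 * pi :> R by rewrite mulr_gt0 ?pi_gt0.
have n01 : (ord0 : 'I_3) != inord 1 by rewrite -val_eqE /= inordK.
have n12 : (inord 1 : 'I_3) != ord_max by rewrite -val_eqE /= inordK.
have scale (x rho : R) : 4 * pi * x < rho -> x < rho / (4 * pi) by rewrite ltr_pdivlMr// mulrC.
have scale' (x rho : R) : rho < 4 * pi * x -> rho / (4 * pi) < x by rewrite ltr_pdivrMr// mulrC.
move: hrho1_1 hrho1_2; rewrite !lt_min => /andP[/scale k1 /andP[/rho_barP[r11 rb] /scale' k2]] /andP[/scale k3 /andP[_ /scale' k4]].
have k5 := rb _ _ n01; rewrite triple0 triple1 in k5.
have r10 : 0 < rho1 / (4 * pi) by rewrite divr_gt0.
have [r1 r1E] : exists r1, rho1 / (4 * pi) = r1 by eexists.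
rewrite r1E in k1 k2 k3 k4 k5 r11 r10; clear rb.
have second (a23 rho2 : R) : (forall m : 'I_3, 4 * pi * (1 + triple a21 a22 a23 m) < rho2 <
         Num.min (rho_bar (triple a21 a22 a23)) (4 * pi * (2 + triple a11 a12 a13 m + triple a21 a22 a23 m))) ->
    [/\ 1 + a21 < rho2 / (4 * pi), 1 + a22 < rho2 / (4 * pi), rho2 / (4 * pi) < 1,
        rho2 / (4 * pi) < 1 + a21 + (1 + a23) & rho2 / (4 * pi) < 1 + a22 + (1 + a23)].
  move=> h; have := h ord0; have := h (inord 1); rewrite triple0 triple1 !lt_min.
  move=> /andP[/scale j1 /andP[/rho_barP[j2 jb] _]] /andP[/scale j3 _].
  have j4 := jb ord0 ord_max isT; have j5 := jb _ _ n12; rewrite triple0 triple2 in j4; rewrite triple1 triple2 in j5.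
  by split => //; lra.
have [e21|ne21] := eqVneq a21 a22; last first.
  pose d := Num.min (2^-1) `|a21 - a22|.
  have d0 : 0 < d by rewrite lt_min invr_gt0 ltr0n normr_gt0 subr_eq0 ne21.
  have d1 : d <= 2^-1 by rewrite ge_min lexx.
  have d2 : d <= `|a21 - a22| by rewrite ge_min lexx orbT.
  exists (d - 1); split; first by lra.
  move=> a23 rho2 a1 a2 p /andP[h1 h2] /second [j1 j2 j3 j4 j5] _.
  by move: d2; rewrite leNgt ltr_norml; case/negP; apply/andP; split; lra.
have [be1|be1] := leP 0 a21.
  exists (- 2^-1); split; first by lra.
  move=> a23 rho2 a1 a2 p _ /second [j1 _ j3 _ _] _.
  by have := lt_trans j1 j3; rewrite gtrDl ltNge be1.
pose gam := Num.min (1 - r1) (- a21 / 2).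
have g0 : 0 < gam by rewrite lt_min subr_gt0 r11 divr_gt0// oppr_gt0.
have g1 : gam <= 1 - r1 by rewrite ge_min lexx.
have g2 : gam <= - a21 / 2 by rewrite ge_min lexx orbT.
clearbody gam.
have A0 : 0 < 1 + a11 by lra.
have B0 : 0 < 1 + a12 by lra.
have be0 : 0 < 1 + a21 by lra.
have rAB : r1 < (1 + a11) + (1 + a12) by lra.
have rA : r1 < (1 + a11) + (1 + a21) by lra.
have rB : r1 < (1 + a12) + (1 + a21) by lra.
have [e0 e00 H] := no_toda_pair p12 p13 p23 antipodal g0 A0 B0 be0 r10 k1 k3 rAB rA rB.
pose d := Num.min (Num.min (2^-1) (- a21 / 2)) (e0 / 2).
have d0 : 0 < d by rewrite !lt_min invr_gt0 ltr0n !divr_gt0// oppr_gt0.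
have d1 : d <= 2^-1 by rewrite !ge_min lexx.
have d2 : d <= - a21 / 2 by rewrite !ge_min lexx orbT.
have d3 : d <= e0 / 2 by rewrite !ge_min lexx orbT.
clearbody d.
exists (d - 1); split; first by clear -d0 d1; lra.
move=> a23 rho2 a1 a2 p /andP[h1 h2] hh [u1 [u2 sol]].
have [j1 j2 j3 j4 j5] := second _ _ hh.
have rho20 : 0 < rho2.
  have /andP[+ _] := hh ord0; apply: lt_trans; rewrite mulr_gt0//= /a2 triple0; lra.
have [C1 [C2 [f1 [f2 [i1 i2 I1 I2 [E1 E2]]]]]] := toda_densities hG rho1_gt0 rho20 sol.
rewrite r1E in I1.
have re : 0 < 1 + a23 < e0 by clear -h1 h2 d3 e00; lra.
have rb2 : 1 + a21 < rho2 / (4 * pi) < 1 + a21 + (1 + a23) by rewrite j1.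
apply: (H (1 + a23) (rho2 / (4 * pi)) C1 C2 f1 f2 re I1 I2 rb2).
have s1 (z : R) : 1 + z - 1 = z by ring.
have -> : triple (1 + a11 - 1) (1 + a12 - 1) 0 = a1 by rewrite !s1 /a1 ha13.
have -> : triple (1 + a21 - 1) (1 + a21 - 1) (1 + a23 - 1) = a2 by rewrite !s1 /a2 -e21.
split => //.
- by apply: ord3P; rewrite /a1 ?triple0 ?triple1 ?triple2 ?ha13; clear -ha11 ha12 k1 k3 r11; lra.
- by apply: ord3P; rewrite /a2 ?triple0 ?triple1 ?triple2; clear -ha21 ha22 j1 j2 j3 h1 h2 d1; lra.
- exact: triple_inj.
- by rewrite I1; clear -g1; lra.
- by rewrite I2; clear -j4 h2 d2 g2; lra.
Qed.
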